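(* Let $\ell>0$, $B(x)=\operatorname{diag}(\beta_1(x),\dots,\beta_n(x))$ and $Q=(Q_{jk})\in L^1([0,\ell];\mathbb C^{n\times n})$, where the real-valued $\beta_k$ satisfy: $\beta_k,1/\beta_k\in L^\infty[0,\ell]$, each with constant nonzero sign; for some $n_-\in\{0,\dots,n\}$, $\beta_1\le\dots\le\beta_{n_-}<0<\beta_{n_-+1}\le\dots\le\beta_n$ on $[0,\ell]$; there is $\theta>0$ such that for each $k\le n-1$ either $\beta_k\equiv\beta_{k+1}$ or $\beta_k(x)+\theta<\beta_{k+1}(x)$ on $[0,\ell]$; and $Q_{jk}\equiv0$ whenever $\beta_j\equiv\beta_k$. Let the boundary conditions $Cy(0)+Dy(\ell)=0$ be regular and let $\Lambda_0=\{\lambda^0_m\}_{m\in\mathbb Z}$ be the sequence of eigenvalues (counting multiplicity) of $L_U(0)$, i.e. of zeros of $\Delta_0$. Then $L_U(Q)$ has discrete spectrum, and its sequence of eigenvalues $\Lambda=\{\lambda_m\}_{m\in\mathbb Z}$ (counting multiplicity), which is the sequence of zeros of $\Delta_Q$, can be ordered so that $$\lambda_m=\lambda_m^0+o(1)\quad\text{as }m\to\infty,\ m\in\mathbb Z.$$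
   Context: $\rho_k(x)=\int_0^x\beta_k$, $b_k=\rho_k(\ell)$. $\mathfrak H=\bigoplus_{k=1}^nL^2_{|\beta_k|}[0,\ell]$ with inner product $(f,g)_{\mathfrak H}=\int_0^\ell\langle|B(x)|f(x),g(x)\rangle dx$. For $C,D\in\mathbb C^{n\times n}$ with $\operatorname{rank}(C\ D)=n$, $L_U(Q)$ is the operator in $\mathfrak H$ given by $L_U(Q)y=-iB^{-1}(y'+Qy)$ on $\{y\in AC([0,\ell];\mathbb C^n):-iB^{-1}(y'+Qy)\in\mathfrak H,\ Cy(0)+Dy(\ell)=0\}$; $L_U(0)$ is the same with $Q=0$. $\Phi_Q(x,\lambda)$ is the fundamental matrix of $-iB^{-1}(y'+Qy)=\lambda y$ with $\Phi_Q(0,\lambda)=I_n$, $\Phi_0(x,\lambda)=\operatorname{diag}(e^{i\lambda\rho_k(x)})$, $\Delta_Q(\lambda)=\det(C+D\Phi_Q(\ell,\lambda))$, $\Delta_0(\lambda)=\det(C+D\Phi_0(\ell,\lambda))$. With $P_+=\operatorname{diag}(p_k^+)$, $p_k^+=1$ if $b_k>0$, $0$ if $b_k<0$, $P_-=I_n-P_+$, the boundary conditions are regular if $\det(CP_-+DP_+)\ne0\ne\det(CP_++DP_-)$. Eigenvalues are counted with algebraic multiplicity. *)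

(* Defs.v *)
From HB Require Import structures.
From mathcomp Require Import all_boot all_order all_algebra.
From mathcomp Require Import all_classical all_reals all_analysis.
From mathcomp.real_closed Require Import complex.
From Stdlib Require Import ClassicalEpsilon.

Set Implicit Arguments.
Unset Strict Implicit.
Unset Printing Implicit Defensive.
Import Order.TTheory GRing.Theory Num.Theory.
Local Open Scope ring_scope.
Local Open Scope classical_set_scope.
Local Open Scope complex_scope.

Definition cabs (R : realType) (z : R[i]) : R :=
  Num.sqrt (complex.Re z ^+ 2 + complex.Im z ^+ 2).

Definition cexp (R : realType) (z : R[i]) : R[i] :=
  (expR (complex.Re z) * cos (complex.Im z)) +i* (expR (complex.Re z) * sin (complex.Im z)).

Definition seg (R : realType) (l : R) : set R := `[0, l]%classic.

Definition ae_on (R : realType) (l : R) (P : R -> Prop) : Prop :=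
  {ae (@lebesgue_measure R), forall x, seg l x -> P x}.

Definition Linf (R : realType) (l : R) (f : R -> R) : Prop :=
  measurable_fun (seg l) f /\ exists M : R, ae_on l (fun x => `|f x| <= M).

Definition cintegrable (R : realType) (l : R) (f : R -> R[i]) : Prop :=
  (@lebesgue_measure R).-integrable (seg l) (fun x => (complex.Re (f x))%:E) /\
  (@lebesgue_measure R).-integrable (seg l) (fun x => (complex.Im (f x))%:E).

Definition cmeasurable (R : realType) (l : R) (f : R -> R[i]) : Prop :=
  measurable_fun (seg l) (fun x => complex.Re (f x)) /\
  measurable_fun (seg l) (fun x => complex.Im (f x)).

Definition cint (R : realType) (f : R -> R[i]) (a b : R) : R[i] :=
  (Rintegral (@lebesgue_measure R) `[a, b]%classic (fun x => complex.Re (f x)))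
  +i* (Rintegral (@lebesgue_measure R) `[a, b]%classic (fun x => complex.Im (f x))).

Definition mxint (R : realType) (p q : nat) (F : R -> 'M[R[i]]_(p, q)) (a b : R)
  : 'M[R[i]]_(p, q) := \matrix_(i, j) cint (fun x => F x i j) a b.

Definition mxintegrable (R : realType) (l : R) (p q : nat)
  (F : R -> 'M[R[i]]_(p, q)) : Prop :=
  forall i j, cintegrable l (fun x => F x i j).

Definition Bmx (R : realType) (n : nat) (beta : 'I_n -> R -> R) (x : R)
  : 'M[R[i]]_n := \matrix_(j, k) (if j == k then (beta j x)%:C else 0).

Definition bk (R : realType) (n : nat) (beta : 'I_n -> R -> R) (l : R)
  (k : 'I_n) : R := Rintegral (@lebesgue_measure R) `[0, l]%classic (beta k).

(* Phi is the (absolutely continuous) fundamental matrix of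
   -i B^{-1} (y' + Q y) = lambda y, Phi(0) = I_n, i.e.
   Phi' = (i lambda B - Q) Phi a.e., written in integrated form. *)
Definition is_fundamental (R : realType) (n : nat) (beta : 'I_n -> R -> R)
  (Q : R -> 'M[R[i]]_n) (l : R) (lam : R[i]) (Phi : R -> 'M[R[i]]_n) : Prop :=
  let A := fun t => ('i * lam) *: Bmx beta t - Q t in
  mxintegrable l (fun t => A t *m Phi t) /\
  forall x, seg l x -> Phi x = 1%:M + mxint (fun t => A t *m Phi t) 0 x.

Definition PhiQ (R : realType) (n : nat) (beta : 'I_n -> R -> R)
  (Q : R -> 'M[R[i]]_n) (l : R) (lam : R[i]) : R -> 'M[R[i]]_n :=
  epsilon (inhabits (fun _ => 1%:M)) (is_fundamental beta Q l lam).

Definition DeltaQ (R : realType) (n : nat) (beta : 'I_n -> R -> R)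
  (Q : R -> 'M[R[i]]_n) (l : R) (C D : 'M[R[i]]_n) (lam : R[i]) : R[i] :=
  \det (C + D *m PhiQ beta Q l lam l).

Definition Phi0l (R : realType) (n : nat) (beta : 'I_n -> R -> R) (l : R)
  (lam : R[i]) : 'M[R[i]]_n :=
  \matrix_(j, k) (if j == k then cexp ('i * lam * (bk beta l k)%:C) else 0).

Definition Delta0 (R : realType) (n : nat) (beta : 'I_n -> R -> R) (l : R)
  (C D : 'M[R[i]]_n) (lam : R[i]) : R[i] :=
  \det (C + D *m Phi0l beta l lam).

Definition Pplus (R : realType) (n : nat) (beta : 'I_n -> R -> R) (l : R)
  : 'M[R[i]]_n :=
  \matrix_(j, k) (if (j == k) && (0 < bk beta l k) then 1 else 0).

Definition regular_bc (R : realType) (n : nat) (beta : 'I_n -> R -> R) (l : R)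
  (C D : 'M[R[i]]_n) : Prop :=
  let Pp := Pplus beta l in
  let Pm := 1%:M - Pp in
  \det (C *m Pm + D *m Pp) != 0 /\ \det (C *m Pp + D *m Pm) != 0.

Definition ccont_at (R : realType) (g : R[i] -> R[i]) (z : R[i]) : Prop :=
  forall e : R, 0 < e -> exists d : R, 0 < d /\
    forall w, cabs (w - z) < d -> cabs (g w - g z) < e.

(* z is a zero of multiplicity k of F (k = 0 : F z <> 0) *)
Definition zero_mult (R : realType) (F : R[i] -> R[i]) (z : R[i]) (k : nat)
  : Prop :=
  exists g : R[i] -> R[i],
    (forall w, F w = (w - z) ^+ k * g w) /\ ccont_at g z /\ g z != 0.

Definition count_eq (R : realType) (lam : int -> R[i]) (z : R[i]) (k : nat)
  : Prop :=
  exists s : seq int, uniq s /\ size s = k /\ forall m, lam m = z <-> m \in s.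

Definition enum_zeros (R : realType) (F : R[i] -> R[i]) (lam : int -> R[i])
  : Prop :=
  forall z, exists k, zero_mult F z k /\ count_eq lam z k.

Definition vec (R : realType) (n : nat) := R -> 'cV[R[i]]_n.

Definition normH2 (R : realType) (n : nat) (beta : 'I_n -> R -> R) (l : R)
  (f : vec R n) : \bar R :=
  (\int[@lebesgue_measure R]_(x in seg l)
     (\sum_(k < n) `|beta k x| * (complex.Re (f x k 0) ^+ 2 + complex.Im (f x k 0) ^+ 2))%:E)%E.

Definition inH (R : realType) (n : nat) (beta : 'I_n -> R -> R) (l : R)
  (f : vec R n) : Prop :=
  (forall k, cmeasurable l (fun x => f x k 0)) /\ (normH2 beta l f < +oo)%E.

(* graph of L_U(Q): (y, f) with y in dom(L_U(Q)) and L_U(Q) y = f (a.e.).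
   y is absolutely continuous with y' = i B f - Q y a.e., i.e.
   -i B^{-1}(y' + Q y) = f, written in integrated form, and
   C y(0) + D y(l) = 0. *)
Definition LU (R : realType) (n : nat) (beta : 'I_n -> R -> R)
  (Q : R -> 'M[R[i]]_n) (l : R) (C D : 'M[R[i]]_n) (y f : vec R n) : Prop :=
  let g := fun t => 'i *: (Bmx beta t *m f t) - Q t *m y t in
  inH beta l f /\
  mxintegrable l g /\
  (forall x, seg l x -> y x = y 0 + mxint g 0 x) /\
  C *m y 0 + D *m y l = 0.

Fixpoint in_kerpow (R : realType) (n : nat) (beta : 'I_n -> R -> R)
  (Q : R -> 'M[R[i]]_n) (l : R) (C D : 'M[R[i]]_n) (mu : R[i]) (k : nat)
  (y : vec R n) : Prop :=
  match k with
  | 0%N => ae_on l (fun x => y x = 0)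
  | k'.+1 => exists f, LU beta Q l C D y f /\
       exists z, ae_on l (fun x => z x = f x - mu *: y x) /\
                 in_kerpow beta Q l C D mu k' z
  end.

Definition in_root (R : realType) (n : nat) (beta : 'I_n -> R -> R)
  (Q : R -> 'M[R[i]]_n) (l : R) (C D : 'M[R[i]]_n) (mu : R[i]) (y : vec R n)
  : Prop := exists k, in_kerpow beta Q l C D mu k y.

(* the root subspace at mu (as a subspace of H) has dimension d,
   i.e. the algebraic multiplicity of mu is d (d = 0 : not an eigenvalue) *)
Definition alg_mult (R : realType) (n : nat) (beta : 'I_n -> R -> R)
  (Q : R -> 'M[R[i]]_n) (l : R) (C D : 'M[R[i]]_n) (mu : R[i]) (d : nat)
  : Prop :=
  exists v : 'I_d -> vec R n,
    (forall i, in_root beta Q l C D mu (v i)) /\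
    (forall c : 'I_d -> R[i],
        ae_on l (fun x => \sum_(i < d) c i *: v i x = 0) -> forall i, c i = 0) /\
    (forall y, in_root beta Q l C D mu y ->
       exists c : 'I_d -> R[i], ae_on l (fun x => y x = \sum_(i < d) c i *: v i x)).

Definition resolvent_pt (R : realType) (n : nat) (beta : 'I_n -> R -> R)
  (Q : R -> 'M[R[i]]_n) (l : R) (C D : 'M[R[i]]_n) (mu : R[i]) : Prop :=
  (forall f, inH beta l f ->
     exists y, LU beta Q l C D y (fun x => f x + mu *: y x)) /\
  exists M : R, forall y g, LU beta Q l C D y g ->
     let h := (fun x => g x - mu *: y x) : vec R n in
     (normH2 beta l y <= M%:E * normH2 beta l h)%E.

Definition discrete_spectrum (R : realType) (n : nat) (beta : 'I_n -> R -> R)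
  (Q : R -> 'M[R[i]]_n) (l : R) (C D : 'M[R[i]]_n) : Prop :=
  forall mu : R[i], resolvent_pt beta Q l C D mu \/
    ((exists r : R, 0 < r /\ forall w, 0 < cabs (w - mu) < r ->
        resolvent_pt beta Q l C D w) /\
     exists d, (0 < d)%N /\ alg_mult beta Q l C D mu d).

Definition enum_eigen (R : realType) (n : nat) (beta : 'I_n -> R -> R)
  (Q : R -> 'M[R[i]]_n) (l : R) (C D : 'M[R[i]]_n) (lam : int -> R[i]) : Prop :=
  forall z, exists d, alg_mult beta Q l C D z d /\ count_eq lam z d.

(* Main.v *)
Require Import Defs.
From HB Require Import structures.
From mathcomp Require Import all_boot all_order all_algebra.
From mathcomp Require Import all_classical all_reals all_analysis measurable_realfun.
From mathcomp.real_closed Require Import complex.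
From mathcomp Require Import fingroup perm cyclic separable cyclotomic ring lra.
Import Order.TTheory GRing.Theory Num.Theory.
Set Implicit Arguments.
Unset Strict Implicit.
Unset Printing Implicit Defensive.
Local Open Scope ring_scope.
Local Open Scope complex_scope.

(** Entire functions are locally uniform limits of polynomials; division by zeros and Rouche's theorem are obtained for them from
    polynomials through averages over roots of unity.

    Every minor of the 2n x n matrix (I, Phi_Q) solves a scalar equation in a system with ordered phases, and an integration by
    parts against a step approximation of q / (theta_f - theta_g) shows that, in the upper half-plane, the minors of Phi_Q and
    Phi_0 differ by o(1) relative to the largest exponential.  Expanding Delta_Q and Delta_0 in minors gives
    Delta_Q - Delta_0 = o(exp(i lambda b_-)) for Im lambda >= 0, and beta -> -beta, lambda -> -lambda exchanges the half-planes.
    Regularity makes Delta_0 at least c |exp(i lambda b_-)| high up; in the remaining strip the translates of Delta_0 lie in the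
    compact family det(C + D diag(u_k exp(i lambda b_k))), |u_k| = 1, so Delta_0 is bounded below at fixed distance from its zeros
    and has boundedly many zeros per unit annulus.  Hence Delta_Q is close to Delta_0 away from the zeros of Delta_0.  Annuli
    bounded by circles that avoid the zeros contain equally many zeros of both functions; inside an annulus one clusters the zeros
    at a scale with no pairwise distance in (s/10, s] and applies Rouche on the clusters.

    For the multiplicities, the Taylor coefficients Phi_i of Phi_Q at mu satisfy Phi_i' = A Phi_i + i B Phi_(i-1), so that root
    vectors are the combinations sum_i Phi_i c_(k-1-i) where (c_j) solves the Toeplitz system of the power series
    C + D Phi_Q(l, mu + X) modulo X^k.  The dimension of this solution space is the order of the determinant, by induction on that
    order: a kernel vector of the constant term lets one factor diag(X, 1, ..., 1) out of the matrix. *)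

(** * Complex modulus and polynomial estimates *)

(** For Im lambda > 0 the entries of Phi_Q mix growing and decaying exponentials, so Duhamel's
    formula started at 0 has an unbounded kernel and gives no comparison of single entries at the
    right scale. Minors remove the mixture: subtracting the sum of the negative beta_k from the
    phase of a minor leaves a nonnegative phase, every propagator is bounded, and only initial value
    problems occur. Minors are coupled only when they differ in one row; their phases then differ by
    some beta_j - beta_k, and this is where the separation theta and the vanishing of Q_jk for equal
    beta's enter. Discs of one fixed radius cannot give o(1), since zeros of Delta_0 may be multiple
    or lie arbitrarily close together. As a ring holds at most K of them, at most K^2 distances
    occur, so a gap exists among finitely many scales fixed beforehand, and one threshold for
    |lambda| serves all rings. The analytic tools lose constants on purpose (a maximum principle
    with factor 2 on the half disc, Rouche with margin 1/4), which lets finite sums over roots of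
    unity replace contour integrals. *)

Section ComplexModulus.
Variable R : realType.
Implicit Types z w : R[i].

Lemma normCE z : `|z| = (cabs z)%:C. Proof. exact: normc_def. Qed.

Lemma cabs_ge0 z : 0 <= cabs z. Proof. exact: sqrtr_ge0. Qed.

Lemma cabsM z w : cabs (z * w) = cabs z * cabs w.
Proof. by apply: complexI; rewrite [RHS]rmorphM /= -!normCE normrM. Qed.

Lemma cabsD z w : cabs (z + w) <= cabs z + cabs w.
Proof. by rewrite -lecR [X in _ <= X]rmorphD /= -!normCE ler_normD. Qed.

Lemma cabsN z : cabs (- z) = cabs z.
Proof. by apply: complexI; rewrite -!normCE normrN. Qed.

Lemma cabs_real (x : R) : cabs x%:C = `|x|.
Proof. by rewrite /cabs /= expr0n /= addr0 sqrtr_sqr. Qed.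

Lemma cabs0 : cabs (0 : R[i]) = 0.
Proof. by rewrite (cabs_real 0) normr0. Qed.

Lemma cabs1 : cabs (1 : R[i]) = 1.
Proof. by rewrite (cabs_real 1) normr1. Qed.

Lemma cabs_nat n : cabs (n%:R : R[i]) = n%:R.
Proof. by rewrite -(rmorph_nat (real_complex R)) cabs_real normr_nat. Qed.

Lemma cabs_eq0 z : (cabs z == 0) = (z == 0).
Proof. by rewrite -(inj_eq (@complexI R)) -normCE normr_eq0. Qed.

Lemma cabs_gt0 z : (0 < cabs z) = (z != 0).
Proof. by rewrite lt_def cabs_ge0 cabs_eq0 andbT. Qed.

Lemma cabsX z n : cabs (z ^+ n) = cabs z ^+ n.
Proof. by elim: n => [|n IH]; rewrite ?expr0 ?cabs1// !exprS cabsM IH. Qed.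

Lemma cabsV z : cabs z^-1 = (cabs z)^-1.
Proof. by apply: complexI; rewrite fmorphV /= -!normCE normfV. Qed.

Lemma cabs_dist z w : cabs (z - w) = cabs (w - z).
Proof. by rewrite -cabsN opprB. Qed.

Lemma cabsB z w : cabs (z - w) <= cabs z + cabs w.
Proof. by rewrite -(cabsN w) cabsD. Qed.

Lemma cabs_sub z w : cabs z - cabs w <= cabs (z - w).
Proof. by rewrite lerBlDr -{1}(subrK w z) cabsD. Qed.

Lemma cabs_tri z w v : cabs (z - v) <= cabs (z - w) + cabs (w - v).
Proof. by rewrite (le_trans _ (cabsD _ _))// addrA subrK. Qed.

Lemma cabs_sum (I : Type) (s : seq I) (P : pred I) (F : I -> R[i]) :
  cabs (\sum_(i <- s | P i) F i) <= \sum_(i <- s | P i) cabs (F i).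
Proof.
elim/big_ind2 : _ => // [|x1 x2 y1 y2 h1 h2]; first by rewrite cabs0.
by rewrite (le_trans (cabsD _ _))// lerD.
Qed.

Lemma cabs_prod (I : Type) (s : seq I) (P : pred I) (F : I -> R[i]) :
  cabs (\prod_(i <- s | P i) F i) = \prod_(i <- s | P i) cabs (F i).
Proof. by apply: (big_morph (@cabs R) cabsM cabs1). Qed.

Lemma Re_le_cabs z : `|complex.Re z| <= cabs z.
Proof.
rewrite /cabs -[X in X <= _]ger0_norm// -sqrtr_sqr real_normK ?num_real//.
by rewrite ler_wsqrtr// lerDl sqr_ge0.
Qed.

Lemma Im_le_cabs z : `|complex.Im z| <= cabs z.
Proof.
rewrite /cabs -[X in X <= _]ger0_norm// -sqrtr_sqr real_normK ?num_real//.
by rewrite ler_wsqrtr// lerDr sqr_ge0.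
Qed.

Lemma cabs_le_ReIm z : cabs z <= `|complex.Re z| + `|complex.Im z|.
Proof.
case: z => a b /=; have -> : (a +i* b) = a%:C + 'i * b%:C :> R[i].
  by apply/eqP; rewrite eq_complex /= !(mulr0,mul0r,mul1r,addr0,add0r,subr0) !eqxx.
rewrite (le_trans (cabsD _ _))// cabsM !cabs_real /cabs /= expr0n expr1n add0r.
by rewrite sqrtr1 mul1r.
Qed.

Lemma geo_half_lt (K e : R) : 0 < e -> exists n : nat, K * 2^-1 ^+ n < e.
Proof.
move=> e0; have x0 : 0 <= `|K| / e by rewrite divr_ge0// ltW.
pose n := Num.Def.archi_bound (`|K| / e); have hn := archi_boundP x0; rewrite -/n in hn.
exists n; have h2 : n%:R <= 2 ^+ n :> R by rewrite -natrX ler_nat ltnW// ltn_expl.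
rewrite exprVn ltr_pdivrMr ?exprn_gt0// (le_lt_trans (ler_norm _))//.
by rewrite mulrC -ltr_pdivrMr//; apply: lt_le_trans h2.
Qed.

(** The usual way of passing to a limit below: approximation errors are arranged to be at most K
    2^-n, so exact identities and sharp bounds follow by letting n grow. *)
Lemma le0_of_geo (x K : R) (n0 : nat) :
  (forall n, (n0 <= n)%N -> x <= K * 2^-1 ^+ n) -> x <= 0.
Proof.
move=> h; rewrite leNgt; apply/negP => x0; have [n hn] := geo_half_lt `|K| x0.
have := h (n0 + n)%N (leq_addr _ _); apply/negP; rewrite -ltNge.
apply: le_lt_trans hn; apply: (@le_trans _ _ (`|K| * 2^-1 ^+ (n0 + n))).
  by rewrite ler_wpM2r ?exprn_ge0 ?ler_norm ?invr_ge0.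
by rewrite ler_wpM2l// exprD ler_piMl ?exprn_ge0 ?exprn_ile1 ?invr_ge0 ?invf_le1 ?ler1n.
Qed.

Lemma geo_sum_le (n : nat) : \sum_(k < n) (2^-1 : R) ^+ k <= 2.
Proof.
suff -> : \sum_(k < n) (2^-1 : R) ^+ k = 2 - 2 * 2^-1 ^+ n.
  by rewrite lerBlDr lerDl mulr_ge0 ?exprn_ge0 ?invr_ge0.
elim: n => [|n IH]; first by rewrite big_ord0 expr0 mulr1 subrr.
by rewrite big_ord_recr /= IH exprS; field.
Qed.

(** The intervals [u T - e T, u T + e T] pairwise meet, so the supremum of their left ends lies in
    all of them. *)
Lemma rlimit (u : nat -> R) (e : nat -> R) (T0 : nat) :
  (forall T S, (T0 <= T)%N -> (T <= S)%N -> `|u T - u S| <= e T) ->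
  exists l, forall T, (T0 <= T)%N -> `|u T - l| <= e T.
Proof.
move=> h; have e0 T : (T0 <= T)%N -> 0 <= e T by move=> hT; rewrite (le_trans _ (h T T hT _)).
have cross T S : (T0 <= T)%N -> (T0 <= S)%N -> u T - e T <= u S + e S.
  move=> hT hS; have [TS|/ltnW ST] := leqP T S.
    have := h _ _ hT TS; have := e0 _ hS; rewrite ler_norml => ? /andP[_ ?]; lra.
  have := h _ _ hS ST; have := e0 _ hT; rewrite ler_norml => ? /andP[? _]; lra.
pose A : set R := fun x => exists2 T, (T0 <= T)%N & x = u T - e T.
have A0 : A (u T0 - e T0) by exists T0.
exists (sup A) => T hT; rewrite ler_norml; apply/andP; split.
  suff : sup A <= u T + e T by lra.
  by apply: ge_sup; [exists (u T0 - e T0)|move=> x [S hS ->]; exact: cross].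
suff : u T - e T <= sup A by lra.
apply: ub_le_sup; last by exists T.
by exists (u T + e T) => x [S hS ->]; exact: cross.
Qed.

Lemma climit (u : nat -> R[i]) (e : nat -> R) (T0 : nat) :
  (forall T S, (T0 <= T)%N -> (T <= S)%N -> cabs (u T - u S) <= e T) ->
  exists l, forall T, (T0 <= T)%N -> cabs (u T - l) <= 2 * e T.
Proof.
move=> h.
have [|a ha] := @rlimit (fun T => complex.Re (u T)) e T0.
  move=> T S hT TS; apply: le_trans (h _ _ hT TS); apply: le_trans (Re_le_cabs _).
  by case: (u T) (u S) => ? ? [].
have [|b hb] := @rlimit (fun T => complex.Im (u T)) e T0.
  move=> T S hT TS; apply: le_trans (h _ _ hT TS); apply: le_trans (Im_le_cabs _).
  by case: (u T) (u S) => ? ? [].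
exists (a +i* b) => T hT; apply: le_trans (cabs_le_ReIm _) _.
move: (ha T hT) (hb T hT); case: (u T) => x y /= hx hy.
by rewrite mulr_natl mulr2n lerD.
Qed.

End ComplexModulus.

Section PolyEstimates.
Variable R : realType.
Local Notation C := R[i].

Lemma prim_root_complex (n : nat) : (0 < n)%N -> exists z : C, n.-primitive_root z.
Proof.
move=> n_gt0; pose p : {poly C} := 'X^n - 1.
have [r Dp] := closed_field_poly_normal p.
rewrite (monicP _) ?monicXnsubC // scale1r in Dp.
have rn1 : all n.-unity_root r by apply/allP => z; rewrite -root_prod_XsubC -Dp.
have sz_r : (n < (size r).+1)%N.
  by rewrite -(size_prod_XsubC r id) -Dp size_XnsubC.
have [|z] := hasP (has_prim_root n_gt0 rn1 _ sz_r); last by exists z.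
by rewrite -separable_prod_XsubC -Dp separable_Xn_sub_1 // pnatr_eq0 -lt0n.
Qed.

Lemma cabs_unity (z : C) n : (0 < n)%N -> z ^+ n = 1 -> cabs z = 1.
Proof.
move=> n0 zn; apply/eqP; rewrite -(pexpr_eq1 n0 (cabs_ge0 _)) -cabsX zn cabs1//.
Qed.

(* The k-th coefficient is the discrete Fourier coefficient over N-th roots of unity, N > deg P. *)
Lemma poly_coef_bound (P : {poly C}) (r M : R) k : 0 < r ->
  (forall w, cabs w = r -> cabs P.[w] <= M) -> cabs P`_k * r ^+ k <= M.
Proof.
move=> r0 hM; pose N := maxn (size P) k.+1.
have N0 : (0 < N)%N by rewrite /N leq_max orbT.
have kN : (k < N)%N by rewrite /N leq_max leqnn orbT.
have PN : (size P <= N)%N by rewrite /N leq_max leqnn.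
have [z pz] := prim_root_complex N0.
have z1 : cabs z = 1 by apply: (@cabs_unity _ N); rewrite ?prim_expr_order.
have z0 : z != 0 by rewrite -cabs_gt0 z1.
have key : \sum_(j < N) P.[r%:C * z ^+ j] * z ^- (j * k) = N%:R * (P`_k * r%:C ^+ k).
  under eq_bigr do rewrite (horner_coef_wide _ PN) mulr_suml.
  rewrite exchange_big /= (bigD1 (Ordinal kN)) //= [X in _ + X]big1 ?addr0.
    rewrite mulr_natl -[in RHS](card_ord N) -sumr_const; apply: eq_bigr => j _.
    by rewrite exprMn -exprM -!mulrA mulfV ?expf_neq0// mulr1.
  move=> i /eqP ik; pose x := z ^+ i / z ^+ k.
  have xN : x ^+ N = 1.
    rewrite /x expr_div_n -!exprM ![(_ * N)%N]mulnC !exprM (prim_expr_order pz).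
    by rewrite !expr1n invr1 mulr1.
  have x1 : x - 1 != 0.
    rewrite subr_eq0; apply/eqP => x1; apply: ik; apply: val_inj => /=; apply/eqP.
    have /eqP : z ^+ i = z ^+ k by rewrite -[LHS](divfK (expf_neq0 k z0)) -/x x1 mul1r.
    by rewrite (eq_prim_root_expr pz) !modn_small.
  rewrite (eq_bigr (fun j : 'I_N => P`_i * r%:C ^+ i * x ^+ j)).
    by rewrite -mulr_sumr -[X in _ * X](mulKf x1) -subrX1 xN subrr !mulr0.
  move=> j _; rewrite exprMn /x expr_div_n -!mulrA -!exprM.
  by rewrite ![(j * _)%N]mulnC.
have : cabs (N%:R * (P`_k * r%:C ^+ k)) <= N%:R * M.
  rewrite -key (le_trans (cabs_sum _ _ _))//.
  rewrite mulr_natl -[in X in _ <= X](card_ord N) -sumr_const; apply: ler_sum => j _.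
  rewrite cabsM cabsV !cabsX z1 expr1n invr1 mulr1 hM//.
  by rewrite cabsM cabsX z1 expr1n mulr1 cabs_real gtr0_norm.
by rewrite !cabsM cabsX cabs_nat cabs_real (gtr0_norm r0) ler_pM2l// ltr0n.
Qed.

(** A weak maximum principle: the coefficient bounds on the circle of radius r leave at most M 2^-i
    for the i-th term on the half disc, and the geometric series sums to at most 2. *)
Lemma poly_max (P : {poly C}) (r M : R) (w : C) : 0 < r ->
  (forall w, cabs w = r -> cabs P.[w] <= M) -> cabs w <= r / 2 -> cabs P.[w] <= 2 * M.
Proof.
move=> r0 hM hw; rewrite horner_coef (le_trans (cabs_sum _ _ _))//.
apply: (@le_trans _ _ (\sum_(i < size P) M * 2^-1 ^+ i)); last first.
  rewrite -mulr_sumr mulrC ler_wpM2r ?geo_sum_le//.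
  apply: le_trans (hM r%:C _); rewrite ?cabs_ge0// cabs_real gtr0_norm//.
apply: ler_sum => i _; rewrite cabsM cabsX.
apply: (@le_trans _ _ (cabs P`_i * (r / 2) ^+ i)).
  rewrite ler_wpM2l ?cabs_ge0//; apply: lerXn2r => //; rewrite nnegrE ?cabs_ge0//.
  by apply: le_trans hw; exact: cabs_ge0.
rewrite exprMn mulrA; apply: ler_wpM2r; rewrite ?exprn_ge0 ?invr_ge0//.
exact: poly_coef_bound.
Qed.

End PolyEstimates.

(** * Entire functions as limits of polynomials *)

(** This form is stable under sums, products and determinants, and it fits the Picard iterates,
    which are polynomials in lambda converging uniformly on discs; no power series in lambda has to
    be manipulated. *)
Definition entire (R : realType) (f : R[i] -> R[i]) : Prop :=
  forall r e : R, 0 < e -> exists P : {poly R[i]},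
    forall w, cabs w <= r -> cabs (P.[w] - f w) < e.

Section Entire.
Variable R : realType.
Local Notation C := R[i].
Implicit Types (f g : C -> C).

Lemma entire_ext f g : f =1 g -> entire f -> entire g.
Proof. by move=> fg hf r e e0; have [P hP] := hf r e e0; exists P => w; rewrite -fg; exact: hP. Qed.

Lemma entire_poly (P : {poly C}) : entire (horner P).
Proof. by move=> r e e0; exists P => w _; rewrite subrr cabs0. Qed.

Lemma entire_cst (c : C) : entire (fun _ => c).
Proof. by apply: entire_ext (entire_poly c%:P) => w; rewrite hornerC. Qed.

Lemma poly_bounded (P : {poly C}) r : exists2 M : R, 0 < M & forall w, cabs w <= r -> cabs P.[w] <= M.
Proof.
exists (1 + \sum_(i < size P) cabs P`_i * `|r| ^+ i).
  by rewrite ltr_pwDl// sumr_ge0// => i _; rewrite mulr_ge0 ?cabs_ge0 ?exprn_ge0.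
move=> w hw; rewrite horner_coef (le_trans (cabs_sum _ _ _))//.
apply: ler_wpDl => //; apply: ler_sum => i _; rewrite cabsM cabsX ler_wpM2l ?cabs_ge0//.
by apply: lerXn2r; rewrite ?nnegrE ?cabs_ge0//; apply: le_trans hw (ler_norm _).
Qed.

Lemma entire_bounded f r : entire f -> exists2 M : R, 0 < M & forall w, cabs w <= r -> cabs (f w) <= M.
Proof.
move=> hf; have [P hP] := hf r 1 ltr01; have [M M0 hM] := poly_bounded P r.
exists (M + 1); first by rewrite addr_gt0.
move=> w hw; have := hP w hw; have := hM w hw; have := cabs_sub (f w) P.[w].
rewrite cabs_dist; lra.
Qed.

Lemma entireD f g : entire f -> entire g -> entire (fun w => f w + g w).
Proof.
move=> hf hg r e e0; have e2 : 0 < e / 2 by rewrite divr_gt0.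
have [P hP] := hf r _ e2; have [Q hQ] := hg r _ e2; exists (P + Q) => w hw.
rewrite hornerD opprD addrACA (le_lt_trans (cabsD _ _))//.
by have := hP w hw; have := hQ w hw; lra.
Qed.

Lemma entireM f g : entire f -> entire g -> entire (fun w => f w * g w).
Proof.
move=> hf hg r e e0; have [M M0 hM] := entire_bounded r hf; have [N N0 hN] := entire_bounded r hg.
(* The bound 1 controls the product of the two errors by a single [e1]; the three terms then add up
   to at most e1 (M + N + 1) <= e / 2. *)
pose e1 := Num.min 1 (e / (2 * (M + N + 1))).
have D0 : 0 < 2 * (M + N + 1) by lra.
have e10 : 0 < e1 by rewrite lt_min ltr01 divr_gt0.
have e1e : e1 * (2 * (M + N + 1)) <= e by rewrite -ler_pdivlMr// ge_min lexx orbT.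
have e11 : e1 <= 1 by rewrite ge_min lexx.
have [P hP] := hf r _ e10; have [Q hQ] := hg r _ e10; exists (P * Q) => w hw.
have -> : (P * Q).[w] - f w * g w = (P.[w] - f w) * (Q.[w] - g w) + (P.[w] - f w) * g w + f w * (Q.[w] - g w).
  by rewrite hornerM; ring.
have a1 := hP w hw; have a2 := hQ w hw; have a3 := hM w hw; have a4 := hN w hw.
have b1 := cabs_ge0 (P.[w] - f w); have b2 := cabs_ge0 (Q.[w] - g w).
have b3 := cabs_ge0 (f w); have b4 := cabs_ge0 (g w).
apply: le_lt_trans (cabsD _ _) _; apply: le_lt_trans (lerD (cabsD _ _) (lexx _)) _; rewrite !cabsM.
have c1 : cabs (P.[w] - f w) * cabs (Q.[w] - g w) <= e1 * 1 by rewrite ler_pM//; lra.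
have c2 : cabs (P.[w] - f w) * cabs (g w) <= e1 * N by rewrite ler_pM//; lra.
have c3 : cabs (f w) * cabs (Q.[w] - g w) <= M * e1 by rewrite ler_pM//; lra.
nra.
Qed.

Lemma entireB f g : entire f -> entire g -> entire (fun w => f w - g w).
Proof.
move=> hf hg; apply: entire_ext (entireD hf (entireM (entire_cst (-1)) hg)) => w.
by rewrite mulN1r.
Qed.

Lemma entire_sum (I : Type) (s : seq I) (F : I -> C -> C) :
  (forall i, entire (F i)) -> entire (fun w => \sum_(i <- s) F i w).
Proof.
move=> hF; elim: s => [|i s IH].
  by apply: entire_ext (entire_cst 0) => w; rewrite big_nil.
by apply: entire_ext (entireD (hF i) IH) => w; rewrite big_cons.
Qed.

Lemma entire_prod (I : Type) (s : seq I) (F : I -> C -> C) :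
  (forall i, entire (F i)) -> entire (fun w => \prod_(i <- s) F i w).
Proof.
move=> hF; elim: s => [|i s IH].
  by apply: entire_ext (entire_cst 1) => w; rewrite big_nil.
by apply: entire_ext (entireM (hF i) IH) => w; rewrite big_cons.
Qed.

Lemma entire_det n (F : 'I_n -> 'I_n -> C -> C) :
  (forall i j, entire (F i j)) -> entire (fun w => \det (\matrix_(i, j) F i j w)).
Proof.
move=> hF; apply: (@entire_ext (fun w => \sum_(s : 'S_n) (-1) ^+ s * \prod_i F i (s i) w)).
  by move=> w; apply: eq_bigr => s _; congr (_ * _); apply: eq_bigr => i _; rewrite mxE.
apply: entire_sum => s; apply: entireM; first exact: entire_cst.
exact: entire_prod.
Qed.

Lemma entire_affine f (a b : C) : entire f -> entire (fun w => f (a * w + b)).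
Proof.
move=> hf r e e0; have [P hP] := hf (cabs a * `|r| + cabs b) e e0.
exists (P \Po (a *: 'X + b%:P)) => w hw.
rewrite horner_comp !hornerE; apply: hP; rewrite (le_trans (cabsD _ _))// lerD2r cabsM.
by rewrite ler_wpM2l ?cabs_ge0// (le_trans hw)// ler_norm.
Qed.

Lemma entire_max f (c : C) (r M : R) : entire f -> 0 < r ->
  (forall w, cabs (w - c) = r -> cabs (f w) <= M) ->
  forall w, cabs (w - c) <= r / 2 -> cabs (f w) <= 2 * M.
Proof.
move=> hf r0 hM w hw.
have hg : entire (fun w => f (w + c)).
  by apply: entire_ext (entire_affine 1 c hf) => z; rewrite mul1r.
rewrite leNgt; apply/negP => hlt; pose e := (cabs (f w) - 2 * M) / 4.
have e0 : 0 < e by rewrite /e; lra.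
have [P hP] := hg r e e0.
have h1 : forall v, cabs v = r -> cabs P.[v] <= M + e.
  move=> v hv; have := hP v; rewrite hv lexx => /(_ isT) h.
  have := hM (v + c); rewrite addrK hv => /(_ erefl) h2.
  by have := cabs_sub P.[v] (f (v + c)); lra.
have h2 := poly_max r0 h1 hw.
have h3 := hP (w - c); rewrite subrK in h3; have {}h3 : cabs (P.[w - c] - f w) < e by apply: h3; lra.
have := cabs_sub (f w) P.[w - c]; rewrite cabs_dist; move: h2 h3 e0 hlt; rewrite /e; lra.
Qed.

(** The polynomial quotients (P_T - P_T(b)) / (X - b) converge: on a large circle they differ little
    because |v - b| >= 1 there, and [poly_max] carries this to the half disc. *)
Lemma entire_div f (b : C) : entire f -> f b = 0 ->
  exists2 g, entire g & forall w, f w = (w - b) * g w.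
Proof.
(* Half of [rho T] exceeds T, so the discs of radius T exhaust the plane, while |v - b| >= 1 on the
   circle |v| = [rho T]. The constant 8 below is four approximation errors, doubled by
   [poly_max]. *)
move=> hf fb; pose rho (T : nat) : R := 2 * (T%:R + cabs b + 1).
have h0 (T : nat) : exists P : {poly C}, forall w, cabs w <= rho T -> cabs (P.[w] - f w) < 2^-1 ^+ T.
  by apply: hf; rewrite exprn_gt0.
have [P hP] := choice h0.
have h1 (T : nat) : exists Q : {poly C}, P T - (P T).[b]%:P = Q * ('X - b%:P).
  by apply/factor_theorem; rewrite rootE !hornerE subrr.
have [Q hQ] := choice h1.
have b0 := cabs_ge0 b.
have PQ T w : (P T).[w] - (P T).[b] = (w - b) * (Q T).[w].
  by have /(congr1 (horner^~ w)) := hQ T; rewrite !hornerE mulrC.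
have rhole T S : (T <= S)%N -> rho T <= rho S.
  by move=> TS; rewrite /rho ler_wpM2l// !lerD2r ler_nat.
have brho T : cabs b <= rho T by rewrite /rho; have := ler0n R T; lra.
have rho0 T : 0 < rho T by rewrite /rho; have := ler0n R T; lra.
have QQ T S w : (T <= S)%N -> cabs w <= rho T / 2 -> cabs ((Q T).[w] - (Q S).[w]) <= 8 * 2^-1 ^+ T.
  move=> TS hw; have -> : 8 * 2^-1 ^+ T = 2 * (4 * 2^-1 ^+ T) :> R by ring.
  have -> : (Q T).[w] - (Q S).[w] = (Q T - Q S).[w] by rewrite !hornerE.
  apply: poly_max hw => // v hv.
  have geoS : 2^-1 ^+ S <= 2^-1 ^+ T :> R.
    by rewrite -(subnK TS) exprD ler_piMl ?exprn_ge0// exprn_ile1// invf_le1// ler1n.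
  have k1 := hP T v; rewrite hv lexx in k1; have {}k1 := k1 isT.
  have k2 := hP S v; rewrite hv rhole// in k2; have {}k2 := k2 isT.
  have k3 := hP T b (brho T); have k4 := hP S b (brho S).
  have e1 : (v - b) * (Q T - Q S).[v] = ((P T).[v] - f v) - ((P S).[v] - f v) - (((P T).[b] - f b) - ((P S).[b] - f b)).
    by rewrite hornerD hornerN mulrBr -!PQ; ring.
  have : cabs ((v - b) * (Q T - Q S).[v]) <= 4 * 2^-1 ^+ T.
    rewrite e1; apply: le_trans (cabsB _ _) _.
    apply: le_trans (lerD (cabsB _ _) (cabsB _ _)) _; lra.
  rewrite cabsM; apply: le_trans; rewrite ler_peMl ?cabs_ge0//.
  have := cabs_sub v b; rewrite hv /rho; have := ler0n R T; lra.
have h2 w : exists l, forall T, cabs w <= T%:R -> cabs ((Q T).[w] - l) <= 16 * 2^-1 ^+ T.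
  pose T0 := Num.Def.archi_bound (cabs w); have hT0 := archi_boundP (cabs_ge0 w).
  have big T : cabs w <= T%:R -> cabs w <= rho T / 2 by rewrite /rho; lra.
  have [|l hl] := @climit R (fun T => (Q T).[w]) (fun T => 8 * 2^-1 ^+ T) T0; last first.
    exists l => T hT; have {hT} hT := big _ hT.
    (* [climit] speaks only of indices from [T0] on, but T may be smaller; comparing with a later S
       and letting S grow gives the bound for T itself. *)
    rewrite leNgt; apply/negP => hlt.
    have d0 : 0 < cabs ((Q T).[w] - l) - 8 * 2^-1 ^+ T.
      have : 0 <= 2^-1 ^+ T :> R by rewrite exprn_ge0.
      by lra.
    have : cabs ((Q T).[w] - l) - 8 * 2^-1 ^+ T <= 0.
      apply: (@le0_of_geo _ _ 16 (maxn T0 T)) => S; rewrite geq_max => /andP[S0 TS].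
      have := hl S S0; have := QQ T S w TS hT.
      have := cabs_tri (Q T).[w] (Q S).[w] l; lra.
    lra.
  move=> T S hT TS; apply: QQ => //; apply: big; apply/ltW.
  by rewrite (lt_le_trans hT0)// ler_nat.
have [g hg] := choice h2.
exists g.
  move=> r e e0; have [n hn] := geo_half_lt 16 e0.
  pose T := (n + Num.Def.archi_bound `|r|)%N.
  exists (Q T) => w hw; apply: (@le_lt_trans _ _ (16 * 2^-1 ^+ T)).
    apply: hg; apply: (le_trans hw); apply: (le_trans (ler_norm r)).
    by apply/ltW/(lt_le_trans (archi_boundP (normr_ge0 r))); rewrite ler_nat leq_addl.
  apply: le_lt_trans hn; rewrite ler_wpM2l// exprD ler_piMr ?exprn_ge0// exprn_ile1//.
  by rewrite invf_le1// ler1n.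
move=> w; apply/eqP; rewrite -subr_eq0 -cabs_eq0 eq_le cabs_ge0 andbT.
apply: (@le0_of_geo _ _ (2 + 16 * cabs (w - b)) (Num.Def.archi_bound (cabs w))) => T hT.
have hw : cabs w <= T%:R.
  by apply/ltW/(lt_le_trans (archi_boundP (cabs_ge0 w))); rewrite ler_nat.
have k1 : cabs ((P T).[w] - f w) < 2^-1 ^+ T.
  by apply: hP; rewrite /rho; have := cabs_ge0 w; lra.
have k2 := hP T b (brho T).
have -> : f w - (w - b) * g w = (w - b) * ((Q T).[w] - g w) - ((P T).[w] - f w) + ((P T).[b] - f b).
  by rewrite fb mulrBr -PQ; ring.
apply: le_trans (cabsD _ _) _; apply: le_trans (lerD (cabsB _ _) (lexx _)) _; rewrite cabsM.
have : cabs (w - b) * cabs ((Q T).[w] - g w) <= cabs (w - b) * (16 * 2^-1 ^+ T).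
  by rewrite ler_wpM2l ?cabs_ge0// hg.
lra.
Qed.

(** Division by w - z yields f w - f z = (w - z) g w with g bounded near z, hence a local Lipschitz
    bound. *)
Lemma entire_cont f z : entire f -> ccont_at f z.
Proof.
move=> hf e e0; have [g hg fg] := @entire_div (fun w => f w - f z) z (entireB hf (entire_cst _)) (subrr _).
have [M M0 hM] := entire_bounded (cabs z + 1) hg.
exists (Num.min 1 (e / M)); split; first by rewrite lt_min ltr01 divr_gt0.
move=> w; rewrite lt_min => /andP[w1 we].
rewrite fg cabsM; apply: (@le_lt_trans _ _ (cabs (w - z) * M)).
  rewrite ler_wpM2l ?cabs_ge0// hM//; have := cabs_sub w z; lra.
by rewrite -ltr_pdivlMr.
Qed.

Definition prodX (s : seq C) (w : C) : C := \prod_(b <- s) (w - b).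

Lemma prodX_horner s w : prodX s w = (\prod_(b <- s) ('X - b%:P)).[w].
Proof. by rewrite horner_prod; apply: eq_bigr => b _; rewrite !hornerE. Qed.

Lemma entire_prodX s : entire (prodX s).
Proof. by apply: entire_ext (entire_poly _) => w; rewrite prodX_horner. Qed.

Lemma prodX_eq0 s w : (prodX s w == 0) = (w \in s).
Proof. by rewrite prodX_horner -/(root _ _) root_prod_XsubC. Qed.

Lemma prodX_cons b s w : prodX (b :: s) w = (w - b) * prodX s w.
Proof. by rewrite /prodX big_cons. Qed.

(* Jensen-type bound: every zero near c forces a factor 1/3 through the maximum principle. *)
Lemma entire_zeros_bound f g s (c : C) (rho M : R) : entire g -> 0 < rho ->
  (forall w, f w = prodX s w * g w) -> {in s, forall b, cabs (b - c) <= rho} ->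
  (forall w, cabs (w - c) = 4 * rho -> cabs (f w) <= M) ->
  cabs (f c) <= 2 * M * 2^-1 ^+ size s.
Proof.
move=> hg rho0 fE hs hM.
have low (s' : seq C) w : {in s', forall b, cabs (b - c) <= rho} ->
    cabs (w - c) = 4 * rho -> (3 * rho) ^+ size s' <= cabs (prodX s' w).
  move=> hs' hw; elim: s' hs' => [|b s' IH] hs'; first by rewrite /prodX big_nil cabs1.
  rewrite prodX_cons cabsM /= exprS ler_pM ?exprn_ge0//; try lra.
    have := cabs_tri w b c; have := hs' b (mem_head _ _); lra.
  by apply: IH => x xs; apply: hs'; rewrite in_cons xs orbT.
have up (s' : seq C) : {in s', forall b, cabs (b - c) <= rho} -> cabs (prodX s' c) <= rho ^+ size s'.
  elim: s' => [|b s' IH] hs'; first by rewrite /prodX big_nil cabs1.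
  rewrite prodX_cons cabsM /= exprS ler_pM ?cabs_ge0//.
    by rewrite cabs_dist hs' ?mem_head.
  by apply: IH => x xs; apply: hs'; rewrite in_cons xs orbT.
have r30 : 0 < (3 * rho) ^+ size s by rewrite exprn_gt0//; lra.
have hgM w : cabs (w - c) = 4 * rho -> cabs (g w) <= M / (3 * rho) ^+ size s.
  move=> hw; rewrite ler_pdivlMr// mulrC; apply: le_trans (hM w hw).
  by rewrite fE cabsM ler_wpM2r ?cabs_ge0// low.
have gc : cabs (g c) <= 2 * (M / (3 * rho) ^+ size s).
  have rr : 0 < 4 * rho by lra.
  by apply: (entire_max hg rr hgM); rewrite subrr cabs0; lra.
have M0 : 0 <= M.
  have := hM (c + (4 * rho)%:C); rewrite addrC addKr cabs_real gtr0_norm; last by lra.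
  by move=> /(_ erefl); apply: le_trans; exact: cabs_ge0.
rewrite fE cabsM; apply: (@le_trans _ _ (rho ^+ size s * (2 * (M / (3 * rho) ^+ size s)))).
  by rewrite ler_pM ?cabs_ge0// up.
rewrite exprMn; have -> : rho ^+ size s * (2 * (M / (3 ^+ size s * rho ^+ size s))) = 2 * M * 3^-1 ^+ size s.
  rewrite exprVn; have x0 : rho ^+ size s != 0 by rewrite expf_neq0 ?lt0r_neq0.
  have y0 : 3 ^+ size s != 0 :> R by rewrite expf_neq0.
  by move: (rho ^+ size s) (3 ^+ size s) x0 y0 => x y x0 y0; field; rewrite x0 y0.
rewrite ler_wpM2l//; first by rewrite mulr_ge0.
by apply: lerXn2r; rewrite ?nnegrE ?invr_ge0// lef_pV2 ?posrE// ler_nat.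
Qed.

(** Zeros in the disc are divided out one by one. The process stops because n of them, with 2 M 2^-n
    < |f z0|, would contradict [entire_zeros_bound] at z0; the induction is on the number of zeros
    still allowed. *)
Lemma entire_factor f (r : R) z0 : entire f -> f z0 != 0 -> exists s g,
  [/\ entire g, forall w, f w = prodX s w * g w, {in s, forall b, cabs b <= r}
   & forall w, cabs w <= r -> g w != 0].
Proof.
move=> hf fz0; pose rho := `|r| + cabs z0 + 1.
have rho0 : 0 < rho by rewrite /rho; have := normr_ge0 r; have := cabs_ge0 z0; lra.
have [M M0 hM] := entire_bounded (cabs z0 + 4 * rho) hf.
have hM' w : cabs (w - z0) = 4 * rho -> cabs (f w) <= M.
  by move=> hw; apply: hM; have := cabs_sub w z0; lra.
have fz : 0 < cabs (f z0) by rewrite cabs_gt0.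
have [n hn] := geo_half_lt (2 * M) fz.
have bound s g : entire g -> (forall w, f w = prodX s w * g w) ->
    {in s, forall b, cabs b <= r} -> (size s < n)%N.
  move=> hg fE hs; rewrite ltnNge; apply/negP => ns.
  have : cabs (f z0) <= 2 * M * 2^-1 ^+ size s.
    apply: (entire_zeros_bound hg rho0 fE _ hM') => b /hs hb.
    have := cabsB b z0; have := ler_norm r; rewrite /rho; lra.
  apply/negP; rewrite -ltNge; apply: le_lt_trans hn; rewrite ler_wpM2l//; first by lra.
  by rewrite -(subnK ns) exprD ler_piMl ?exprn_ge0// exprn_ile1// invf_le1// ler1n.
suff : forall k s g, (n - size s <= k)%N -> entire g -> (forall w, f w = prodX s w * g w) ->
    {in s, forall b, cabs b <= r} -> exists s g,
  [/\ entire g, forall w, f w = prodX s w * g w, {in s, forall b, cabs b <= r}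
   & forall w, cabs w <= r -> g w != 0].
  move/(_ n [::] f); apply; rewrite ?subn0//.
  by move=> w; rewrite /prodX big_nil mul1r.
elim=> [|k IH] s g hk hg fE hs.
  by have := bound s g hg fE hs; rewrite -subn_gt0; case: (n - size s)%N hk.
have [[b hb gb]|hno] := pselect (exists2 b, cabs b <= r & g b = 0).
  have [h hh gE] := entire_div hg gb.
  apply: (IH (b :: s) h) => //.
  - by rewrite /= subnS; case: (n - size s)%N hk.
  - by move=> w; rewrite prodX_cons fE gE; ring.
  - by move=> x; rewrite in_cons => /orP[/eqP->|/hs].
exists s, g; split => // w hw; apply/eqP => gw; apply: hno; by exists w.
Qed.

End Entire.

Lemma prodX_split (R : realType) (p : pred R[i]) (s : seq R[i]) w :
  prodX s w = prodX [seq z <- s | p z] w * prodX [seq z <- s | ~~ p z] w.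
Proof. by rewrite /prodX !big_filter (bigID p). Qed.

(** * Rouche's theorem *)

Section ContinuousTime.
Import numFieldNormedType.Exports.
Local Open Scope classical_set_scope.

(** Compactness as a local-to-global principle: constants m valid near each point give one constant
    for the whole box. It serves [disc_cover], [unif_cont] and [unimodular_dichotomy]; monotonicity
    in m turns the claim into a property of the filter of right neighbourhoods of 0. *)
Lemma box_cover (R : realType) (n : nat) (B : R) (Pr : 'rV[R]_n -> R -> Prop) :
  (forall v m m', m' <= m -> Pr v m -> Pr v m') ->
  (forall v : 'rV[R]_n, (forall i, `|v 0 i| <= B) -> exists2 d : R, 0 < d &
     exists2 m : R, 0 < m & forall v' : 'rV[R]_n, (forall i, `|v' 0 i - v 0 i| < d) ->
       (forall i, `|v' 0 i| <= B) -> Pr v' m) ->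
  exists2 m : R, 0 < m & forall v : 'rV[R]_n, (forall i, `|v 0 i| <= B) -> Pr v m.
Proof.
move=> mono loc.
pose K := [set v : 'rV[R]_n | forall i, `[- B, B]%classic (v ord0 i)].
have KP v : K v <-> (forall i, `|v 0 i| <= B).
  by split=> h i; have := h i; rewrite /= in_itv /= ler_norml.
have cK : compact K by apply: (@rV_compact R n (fun=> `[- B, B]%classic)) => i; exact: segment_compact.
have H : forall x, K x -> \forall x' \near x & i \near (0 : R)^'+, K x' -> Pr x' i.
  move=> v /KP/loc[d d0 [m m0 hm]].
  exists ([set v' : 'rV[R]_n | forall i, `|v' 0 i - v 0 i| < d], [set i | i <= m]) => /=.
    split.
      apply/nbhs_ballP; exists d => //= v' [d0' hv'] i.
      by have := hv' ord0 i; rewrite /ball /= distrC.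
    by near=> i; near: i; exact: nbhs_right_le.
  move=> [v' i] /= [h1 h2] /KP h3; apply: mono h2 _; exact: hm.
have h := proj1 (compact_near_coveringP K) cK R (0 : R)^'+ (fun m v => K v -> Pr v m) _ H.
have [m [m0 hm]] : exists m : R, 0 < m /\ K `<=` (fun v => K v -> Pr v m).
  near (0:R)^'+ => m; exists m; split; first by near: m; exact: nbhs_right_gt.
  by near: m; exact: h.
by exists m => // v /KP hv; exact: hm.
Unshelve. all: by end_near.
Qed.

Section Rouche.
Variable R : realType.
Local Notation C := R[i].

Lemma disc_cover (Pr : C -> R -> Prop) (r : R) :
  (forall w m m', m' <= m -> Pr w m -> Pr w m') ->
  (forall w0, cabs w0 <= r -> exists2 d : R, 0 < d & exists2 m : R, 0 < m &
     forall w, cabs (w - w0) < d -> cabs w <= r -> Pr w m) ->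
  exists2 m : R, 0 < m & forall w, cabs w <= r -> Pr w m.
Proof.
move=> mono loc; pose W (v : 'rV[R]_2) : C := v 0 0 +i* v 0 1.
have dW (v v' : 'rV[R]_2) (d : R) : (forall i, `|v' 0 i - v 0 i| < d / 2) -> cabs (W v' - W v) < d.
  move=> h; apply: le_lt_trans (cabs_le_ReIm _) _ => /=.
  by have := h 0; have := h 1; lra.
have [||m m0 hm] := @box_cover R 2 r (fun v m => cabs (W v) <= r -> Pr (W v) m).
- by move=> v m m' mm h /h; exact: mono.
- move=> v _; have [/loc[d d0 [m m0 hm]]|hr] := leP (cabs (W v)) r.
    exists (d / 2); first by rewrite divr_gt0.
    by exists m => // v' hv' _; apply: hm; exact: dW.
  (* A point of the square outside the disc has a neighbourhood outside it, where the claim is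
     vacuous. *)
  exists ((cabs (W v) - r) / 2); first by lra.
  exists 1 => // v' /dW hv' _ h; have := cabs_sub (W v) (W v'); rewrite cabs_dist; lra.
exists m => // w hw; pose v : 'rV[R]_2 := \row_i (if i == 0 then complex.Re w else complex.Im w).
have Wv : W v = w by rewrite /W !mxE /=; case: (w).
rewrite -Wv; apply: hm; rewrite ?Wv// => i; rewrite mxE.
by case: ifP => _; apply: le_trans hw; [exact: Re_le_cabs|exact: Im_le_cabs].
Qed.

Lemma entire_min (g : C -> C) (r : R) : entire g -> (forall w, cabs w <= r -> g w != 0) ->
  exists2 m : R, 0 < m & forall w, cabs w <= r -> m <= cabs (g w).
Proof.
move=> hg nz; apply: disc_cover; first by move=> w m m'; exact: le_trans.
move=> w0 h0; have g0 : 0 < cabs (g w0) by rewrite cabs_gt0 nz.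
have g2 : 0 < cabs (g w0) / 2 by lra.
have [d [d0 hd]] := entire_cont w0 hg g2.
exists d => //; exists (cabs (g w0) / 2) => // w hw _.
by have := hd w hw; have := cabs_sub (g w0) (g w); rewrite cabs_dist; lra.
Qed.

Lemma dlog_prodX (s : seq C) w : w \notin s ->
  (\prod_(z <- s) ('X - z%:P))^`().[w] = prodX s w * \sum_(z <- s) (w - z)^-1.
Proof.
elim: s => [|b s IH] /=; first by rewrite !big_nil derivC horner0 mulr0.
rewrite in_cons negb_or => /andP[wb ws]; rewrite !big_cons derivM hornerD !hornerM IH//.
rewrite prodX_cons -prodX_horner derivXsubC !hornerE.
have wb0 : w - b != 0 by rewrite subr_eq0.
by rewrite /=; field.
Qed.

(** The points are the roots of X^N - r^N. Since w / (w - z) = 1 - z / (z - w), the sum reduces to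
    the logarithmic derivative of this polynomial at z. *)
Lemma circle_points (r : R) (N : nat) : 0 < r -> (0 < N)%N -> exists ws : seq C,
  [/\ size ws = N, {in ws, forall w, cabs w = r} &
   forall z, z ^+ N != r%:C ^+ N ->
     \sum_(w <- ws) w / (w - z) = N%:R * (r%:C ^+ N / (r%:C ^+ N - z ^+ N))].
Proof.
move=> r0 N0; have [ws Dp] := closed_field_poly_normal ('X^N - (r%:C ^+ N)%:P).
rewrite (monicP _) ?monicXnsubC // scale1r in Dp.
have sz : size ws = N by apply: succn_inj; rewrite -(size_prod_XsubC ws id) -Dp size_XnsubC.
have hor z : z ^+ N - r%:C ^+ N = prodX ws z by rewrite prodX_horner -Dp !hornerE.
exists ws; split => // [w wws|z hz].
  have /eqP : w ^+ N - r%:C ^+ N = 0 by apply/eqP; rewrite hor prodX_eq0.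
  rewrite subr_eq0 => /eqP/(congr1 (@cabs R)); rewrite !cabsX cabs_real gtr0_norm// => h.
  by apply/eqP; rewrite -(eqrXn2 N0 (cabs_ge0 _) (ltW r0)); apply/eqP.
have zws : z \notin ws by rewrite -prodX_eq0 -hor subr_eq0.
have := dlog_prodX zws; rewrite -Dp -hor derivB derivC subr0 derivXn !hornerMn !hornerE.
set S := \sum_(_ <- _) _ => hS.
have zr : z ^+ N - r%:C ^+ N != 0 by rewrite subr_eq0.
have -> : \sum_(w <- ws) w / (w - z) = \sum_(w <- ws) (1 - z * (z - w)^-1).
  apply: eq_big_seq => w wws; have zw : z - w != 0.
    by rewrite subr_eq0; apply: contra zws => /eqP->.
  have wz : w - z != 0 by rewrite -opprB oppr_eq0.
  by field; rewrite zw wz.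
rewrite big_split /= sumrN -mulr_sumr -/S big_const_seq count_predT sz iter_addr_0.
have -> : S = N%:R * z ^+ N.-1 / (z ^+ N - r%:C ^+ N).
  by rewrite mulr_natl hS mulrAC mulfV ?mul1r.
have zN : z * z ^+ N.-1 = z ^+ N by rewrite -exprS prednK.
have rz : r%:C ^+ N - z ^+ N != 0 by rewrite -opprB oppr_eq0.
have -> : z * (N%:R * z ^+ N.-1 / (z ^+ N - r%:C ^+ N)) = N%:R * (z ^+ N / (z ^+ N - r%:C ^+ N)).
  by rewrite -zN; field; rewrite zN.
by field; rewrite zr rz.
Qed.

(** With q = |z| / r inside the circle and q = r / |z| outside it, each kernel value differs from 1,
    respectively 0, by at most q^N / (1 - q^N). *)
Lemma kernel_limit (r : R) (s : seq C) (e : R) : 0 < r -> 0 < e ->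
  {in s, forall z, cabs z != r} -> exists N0, forall N, (N0 <= N)%N ->
  {in s, forall z, z ^+ N != r%:C ^+ N} /\
  cabs (\sum_(z <- s) (r%:C ^+ N / (r%:C ^+ N - z ^+ N)) - (count (fun z => cabs z < r) s)%:R) <= e.
Proof.
move=> r0; elim: s e => [|b s IH] e e0 hs.
  by exists 0%N => N _; split => //; rewrite big_nil /= subrr cabs0 ltW.
have e2 : 0 < e / 2 by lra.
have [|N1 h1] := IH _ e2.
  by move=> z zs; apply: hs; rewrite in_cons zs orbT.
have br := hs b (mem_head _ _).
have rC : cabs r%:C = r by rewrite cabs_real gtr0_norm.
have rn0 N : r%:C ^+ N != 0 by rewrite expf_neq0// -cabs_gt0 rC.
suff [N2 h2] : exists N2, forall N, (N2 <= N)%N -> b ^+ N != r%:C ^+ N /\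
    cabs (r%:C ^+ N / (r%:C ^+ N - b ^+ N) - (cabs b < r)%R%:R) <= e / 2.
  exists (maxn N1 N2) => N; rewrite geq_max => /andP[n1 n2].
  have [a1 a2] := h1 N n1; have [a3 a4] := h2 N n2; split.
    by move=> z; rewrite in_cons => /orP[/eqP->|/a1].
  rewrite big_cons /= natrD opprD addrACA; apply: le_trans (cabsD _ _) _; lra.
have small (q : R) : 0 <= q -> q < 1 -> exists N2, forall N, (N2 <= N)%N ->
    q ^+ N < 1 /\ q ^+ N <= (e / 2) * (1 - q ^+ N).
  move=> q0 q1; pose d := Num.min 1 (e / 2) / 2.
  have d0 : 0 < d by rewrite divr_gt0// lt_min ltr01.
  have /cvgrPdist_lt/(_ d d0)[N2 _ hN] : (fun n => q ^+ n) @ \oo --> (0 : R).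
    by apply: cvg_expr; rewrite ger0_norm.
  exists N2 => N /hN /=; rewrite sub0r normrN ger0_norm ?exprn_ge0// => hq.
  have dl : d <= 1/2 by rewrite /d ler_pM2r ?invr_gt0// ge_min lexx.
  have de : d <= e / 4 by rewrite (_ : e / 4 = e / 2 / 2); [rewrite /d ler_pM2r ?invr_gt0// ge_min lexx orbT|field].
  split; first by lra.
  have : (e / 2) * (1 / 2) <= (e / 2) * (1 - q ^+ N) by rewrite ler_wpM2l//; lra.
  lra.
have [bl|bg|be] := ltgtP (cabs b) r; last by rewrite be eqxx in br.
- have [||N2 hN] := small (cabs b / r); first by rewrite divr_ge0 ?cabs_ge0 ?ltW.
    by rewrite ltr_pdivrMr ?mul1r.
  exists N2 => N /hN[q1 q2].
  have lo : (1 - (cabs b / r) ^+ N) * r ^+ N <= cabs (r%:C ^+ N - b ^+ N).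
    have := cabs_sub (r%:C ^+ N) (b ^+ N); rewrite !cabsX rC expr_div_n mulrBl divfK ?mul1r//.
    by rewrite expf_neq0// gt_eqF.
  have pos : 0 < (1 - (cabs b / r) ^+ N) * r ^+ N by rewrite mulr_gt0 ?exprn_gt0// subr_gt0.
  have nz : r%:C ^+ N - b ^+ N != 0 by rewrite -cabs_gt0 (lt_le_trans pos).
  split; first by rewrite eq_sym -subr_eq0.
  have -> : r%:C ^+ N / (r%:C ^+ N - b ^+ N) - true%:R = b ^+ N / (r%:C ^+ N - b ^+ N).
    by rewrite (_ : (nat_of_bool true)%:R = 1 :> C)//; field.
  rewrite cabsM cabsV ler_pdivrMr ?(lt_le_trans pos)//.
  apply: le_trans (_ : e / 2 * ((1 - (cabs b / r) ^+ N) * r ^+ N) <= _); last first.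
    by rewrite ler_wpM2l// ltW.
  rewrite mulrA -ler_pdivrMr ?exprn_gt0//.
  by rewrite cabsX -expr_div_n.
- have b0 : 0 < cabs b by apply: lt_trans bg.
  have [||N2 hN] := small (r / cabs b); first by rewrite divr_ge0 ?cabs_ge0 ?ltW.
    by rewrite ltr_pdivrMr ?mul1r.
  exists N2 => N /hN[q1 q2].
  have lo : (1 - (r / cabs b) ^+ N) * cabs b ^+ N <= cabs (r%:C ^+ N - b ^+ N).
    rewrite cabs_dist; have := cabs_sub (b ^+ N) (r%:C ^+ N); rewrite !cabsX rC expr_div_n mulrBl divfK ?mul1r//.
    by rewrite expf_neq0// gt_eqF.
  have pos : 0 < (1 - (r / cabs b) ^+ N) * cabs b ^+ N by rewrite mulr_gt0 ?exprn_gt0// subr_gt0.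
  have nz : r%:C ^+ N - b ^+ N != 0 by rewrite -cabs_gt0 (lt_le_trans pos).
  split; first by rewrite eq_sym -subr_eq0.
  rewrite subr0 cabsM cabsV ler_pdivrMr ?(lt_le_trans pos)//.
  apply: le_trans (_ : e / 2 * ((1 - (r / cabs b) ^+ N) * cabs b ^+ N) <= _); last first.
    by rewrite ler_wpM2l// ltW.
  rewrite mulrA -ler_pdivrMr ?exprn_gt0//.
  by rewrite cabsX rC -expr_div_n.
Qed.

End Rouche.
Section RoucheTheorem.
Variable R : realType.
Local Notation C := R[i].

Lemma natC_dist_lt1 (m n : nat) : cabs (m%:R - n%:R : C) < 1 -> m = n.
Proof.
wlog mn : m n / (m <= n)%N.
  move=> H; have [/H//|/ltnW/H h] := leqP m n; rewrite cabs_dist => /h->//.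
rewrite cabs_dist -natrB// cabs_nat -[1]/(1%:R) ltr_nat ltnS leqn0 subn_eq0 => nm.
by apply/eqP; rewrite eqn_leq mn.
Qed.

(* r^N / (r^N - z^N) is the average of w / (w - z) over N equidistributed points of the circle
   and tends to the indicator of |z| < r, which replaces the argument principle. *)
Lemma count_roots_close (P1 P2 : {poly C}) (a1 a2 : C) (s1 s2 : seq C) (r : R) : 0 < r ->
  a1 != 0 -> a2 != 0 ->
  P1 = a1 *: \prod_(z <- s1) ('X - z%:P) -> P2 = a2 *: \prod_(z <- s2) ('X - z%:P) ->
  {in s1, forall z, cabs z != r} -> {in s2, forall z, cabs z != r} ->
  (forall w, cabs w = r -> cabs (w * (P1^`().[w] / P1.[w] - P2^`().[w] / P2.[w])) <= 1/4) ->
  count (fun z => cabs z < r) s1 = count (fun z => cabs z < r) s2.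
Proof.
(* Two kernel errors of 1/4 and the assumed 1/4 between the averages add up to less than 1, so the
   integer counts coincide. *)
move=> r0 a10 a20 E1 E2 n1 n2 hK.
have e4 : 0 < 1 / 4 :> R by lra.
have [N1 k1] := kernel_limit r0 e4 n1; have [N2 k2] := kernel_limit r0 e4 n2.
pose N := (maxn N1 N2).+1.
have [|u1 v1] := k1 N; first by rewrite /N leqW// leq_maxl.
have [|u2 v2] := k2 N; first by rewrite /N leqW// leq_maxr.
have [ws [sz hws hT]] := circle_points r0 (ltn0Sn _ : 0 < N)%N.
have dl a s (P : {poly C}) w : a != 0 -> P = a *: \prod_(z <- s) ('X - z%:P) ->
    {in s, forall z, cabs z != r} -> cabs w = r -> w * (P^`().[w] / P.[w]) = \sum_(z <- s) w / (w - z).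
  move=> a0 -> hs hw; have ws' : w \notin s.
    by apply/negP => /hs; rewrite hw eqxx.
  rewrite derivZ !hornerZ dlog_prodX// -prodX_horner -mulr_sumr.
  have p0 : prodX s w != 0 by rewrite prodX_eq0.
  by field; rewrite a0 p0.
have S a s (P : {poly C}) : a != 0 -> P = a *: \prod_(z <- s) ('X - z%:P) ->
    {in s, forall z, cabs z != r} -> {in s, forall z, z ^+ N != r%:C ^+ N} ->
    \sum_(w <- ws) w * (P^`().[w] / P.[w]) = N%:R * \sum_(z <- s) (r%:C ^+ N / (r%:C ^+ N - z ^+ N)).
  move=> a0 PE hs hz; rewrite (eq_big_seq (fun w => \sum_(z <- s) w / (w - z))); last first.
    by move=> w /hws hw; exact: (dl _ _ _ _ a0 PE hs hw).
  rewrite exchange_big /= mulr_sumr; apply: eq_big_seq => z zs.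
  by rewrite hT// hz.
have h1 := S _ _ _ a10 E1 n1 u1; have h2 := S _ _ _ a20 E2 n2 u2.
set A1 := \sum_(z <- s1) _ in v1 h1; set A2 := \sum_(z <- s2) _ in v2 h2.
have : cabs (N%:R * (A1 - A2)) <= N%:R * (1 / 4).
  rewrite mulrBr -h1 -h2 -sumrB; apply: le_trans (cabs_sum _ _ _) _.
  apply: (@le_trans _ _ (\sum_(w <- ws) (1 / 4))); last first.
    by rewrite big_const_seq count_predT sz iter_addr_0 mulr_natl.
  by rewrite big_seq [X in _ <= X]big_seq; apply: ler_sum => w /hws hw; rewrite -mulrBr hK.
rewrite cabsM cabs_nat ler_pM2l ?ltr0n// => hA.
apply: natC_dist_lt1.
set c1 := (count _ s1)%:R in v1 *; set c2 := (count _ s2)%:R in v2 *.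
have -> : c1 - c2 = (A1 - A2) - (A1 - c1) + (A2 - c2) by ring.
apply: le_lt_trans (cabsD _ _) _; apply: le_lt_trans (lerD (cabsB _ _) (lexx _)) _; lra.
Qed.

Lemma circle_lower_bound (s : seq C) (r : R) : {in s, forall z, cabs z != r} ->
  exists2 m : R, 0 < m & forall w, cabs w = r -> m <= cabs (prodX s w).
Proof.
move=> hs; exists (\prod_(z <- s) `|r - cabs z|).
  rewrite big_seq; apply: prodr_gt0 => z zs; rewrite normr_gt0 subr_eq0 eq_sym; exact: hs.
move=> w hw; rewrite /prodX cabs_prod; apply: ler_prod => z _; rewrite normr_ge0 /=.
have := cabs_sub w z; have := cabs_sub z w; rewrite (cabs_dist z w) hw ler_norml; lra.
Qed.

(** Homotopy in finitely many steps: along P + t (Q - P) the modulus on the circle stays above |P| /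
    2, and each step is short enough for [count_roots_close]. *)
Lemma poly_rouche (P Q : {poly C}) (a b : C) (sP sQ : seq C) (r : R) : 0 < r ->
  P = a *: \prod_(z <- sP) ('X - z%:P) -> Q = b *: \prod_(z <- sQ) ('X - z%:P) ->
  (forall w, cabs w = r -> P.[w] != 0 /\ cabs (P.[w] - Q.[w]) <= cabs P.[w] / 2) ->
  count (fun z => cabs z < r) sP = count (fun z => cabs z < r) sQ.
Proof.
move=> r0 PE QE h; pose D := Q - P; pose Pt (t : R) := P + t%:C *: D.
have onc (t : R) w : 0 <= t <= 1 -> cabs w = r -> cabs P.[w] / 2 <= cabs (Pt t).[w].
  move=> t01 hw; have [_ h2] := h w hw.
  have : cabs (t%:C * (P.[w] - Q.[w])) <= cabs P.[w] / 2.
    rewrite cabsM cabs_real ger0_norm; last by case/andP: t01.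
    by apply: le_trans h2; rewrite ler_piMl ?cabs_ge0//; case/andP: t01.
  have -> : (Pt t).[w] = P.[w] - t%:C * (P.[w] - Q.[w]) by rewrite /Pt /D !hornerE; ring.
  have := cabs_sub P.[w] (t%:C * (P.[w] - Q.[w])); lra.
have rC : cabs r%:C = r by rewrite cabs_real gtr0_norm.
have fac (F : {poly C}) (c : C) s : F = c *: \prod_(z <- s) ('X - z%:P) ->
    (forall w, cabs w = r -> F.[w] != 0) -> c != 0 /\ {in s, forall z, cabs z != r}.
  move=> -> hF; split; first by have := hF _ rC; rewrite hornerZ mulf_eq0 negb_or => /andP[].
  move=> z zs; apply/eqP => /hF; rewrite hornerZ -prodX_horner mulf_eq0 negb_or.
  by rewrite prodX_eq0 zs andbF.
have Pnz w : cabs w = r -> P.[w] != 0 by move=> /h[].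
have [a0 sP0] := fac _ _ _ PE Pnz.
have [m0 m0p hm0] := circle_lower_bound sP0.
pose m := cabs a * m0; have mp : 0 < m by rewrite mulr_gt0// cabs_gt0.
have hm w : cabs w = r -> m <= cabs P.[w].
  by move=> hw; rewrite PE hornerZ cabsM -prodX_horner ler_wpM2l ?cabs_ge0// hm0.
have [M M0 hM] := poly_bounded (D^`() * P - P^`() * D) r.
have Ptnz t : 0 <= t <= 1 -> forall w, cabs w = r -> (Pt t).[w] != 0.
  move=> t01 w hw; rewrite -cabs_gt0; apply: lt_le_trans (onc t w t01 hw).
  by rewrite divr_gt0// cabs_gt0 Pnz.
(* Logarithmic derivatives at parameters t and u differ by (t - u) (D' P - P' D) over a product of
   modulus at least m^2 / 4; multiplied by |w| = r, with |t - u| <= 1 / n, this is at most 4 r M /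
   (n m^2) <= 1/4. *)
pose n := (Num.Def.archi_bound (16 * r * M / m ^+ 2)).+1.
have K0 : 0 <= 16 * r * M / m ^+ 2.
  by apply: divr_ge0; [rewrite !mulr_ge0// ltW|rewrite exprn_ge0// ltW].
have hn : 16 * r * M / m ^+ 2 < n%:R.
  by apply: (lt_le_trans (archi_boundP K0)); rewrite ler_nat.
have n0 : 0 < n%:R :> R by rewrite ltr0n.
have lst0 (i : nat) : exists s : seq C, Pt (i%:R / n%:R) = lead_coef (Pt (i%:R / n%:R)) *: \prod_(z <- s) ('X - z%:P).
  by have [s hs] := closed_field_poly_normal (Pt (i%:R / n%:R)); exists s.
have [lst hlst] := choice lst0.
have alg (x x' d d' t u v : C) : x + t * d != 0 -> x + u * d != 0 ->
    v * ((x' + t * d') / (x + t * d) - (x' + u * d') / (x + u * d)) =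
    v * ((t - u) * (d' * x - x' * d)) / ((x + t * d) * (x + u * d)).
  by move=> h1 h2; field; rewrite h1 h2.
(* Equal parameters are allowed: this identifies the counts of two factorisations of one polynomial,
   and links the given lists [sP] and [sQ] to the ends of the chosen chain [lst]. *)
have close (F1 F2 : {poly C}) (c1 c2 : C) s1 s2 (t1 t2 : R) : F1 = Pt t1 -> F2 = Pt t2 ->
    F1 = c1 *: \prod_(z <- s1) ('X - z%:P) -> F2 = c2 *: \prod_(z <- s2) ('X - z%:P) ->
    0 <= t1 <= 1 -> 0 <= t2 <= 1 -> `|t1 - t2| <= n%:R^-1 ->
    count (fun z => cabs z < r) s1 = count (fun z => cabs z < r) s2.
  move=> F1t F2t E1 E2 t1P t2P t12.
  have [|c10 s10] := fac _ _ _ E1; first by rewrite F1t; exact: Ptnz.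
  have [|c20 s20] := fac _ _ _ E2; first by rewrite F2t; exact: Ptnz.
  apply: (count_roots_close r0 c10 c20 E1 E2 s10 s20) => w hw.
  have z1 := Ptnz _ t1P w hw; have z2 := Ptnz _ t2P w hw.
  have -> : w * (F1^`().[w] / F1.[w] - F2^`().[w] / F2.[w]) =
    w * ((t1 - t2)%:C * (D^`() * P - P^`() * D).[w]) / ((Pt t1).[w] * (Pt t2).[w]).
    have PtE t : (Pt t).[w] = P.[w] + t%:C * D.[w] by rewrite /Pt hornerD hornerZ.
    have PtD t : (Pt t)^`().[w] = P^`().[w] + t%:C * D^`().[w].
      by rewrite /Pt derivD derivZ hornerD hornerZ.
    have z1' := z1; have z2' := z2; rewrite PtE in z1'; rewrite PtE in z2'.
    by rewrite F1t F2t !PtD !PtE alg// (hornerD (D^`() * P)) hornerN !hornerM rmorphB.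
  have o1 := onc _ _ t1P hw; have o2 := onc _ _ t2P hw; have mw := hm w hw.
  have den : m ^+ 2 / 4 <= cabs ((Pt t1).[w] * (Pt t2).[w]).
    rewrite cabsM (_ : m ^+ 2 / 4 = m / 2 * (m / 2)); last by field.
    by rewrite ler_pM//; lra.
  have m2 : 0 < m ^+ 2 by rewrite exprn_gt0.
  rewrite cabsM cabsV ler_pdivrMr; last by apply: lt_le_trans den; lra.
  have num : cabs (w * ((t1 - t2)%:C * (D^`() * P - P^`() * D).[w])) <= r * (n%:R^-1 * M).
    rewrite !cabsM hw cabs_real ler_wpM2l ?(ltW r0)// ler_pM ?cabs_ge0//.
    by rewrite hM// hw.
  apply: (le_trans num); apply: (@le_trans _ _ (1 / 4 * (m ^+ 2 / 4))); last by rewrite ler_wpM2l//; lra.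
  have : 16 * r * M <= n%:R * m ^+ 2 by rewrite -ler_pdivrMr// ltW.
  rewrite (_ : r * (n%:R^-1 * M) = (r * M) / n%:R); last by field; rewrite gt_eqF.
  rewrite ler_pdivrMr//; lra.
have rng i : (i <= n)%N -> 0 <= (i%:R / n%:R : R) <= 1.
  by move=> hi; rewrite divr_ge0//= ler_pdivrMr// mul1r ler_nat.
have chain i : (i <= n)%N -> count (fun z => cabs z < r) sP = count (fun z => cabs z < r) (lst i).
  elim: i => [|i IH] hi.
    apply: (close _ _ _ _ _ _ 0 (0%:R / n%:R) _ erefl PE (hlst 0%N)).
    - by rewrite /Pt scale0r addr0.
    - by rewrite lexx ler01.
    - exact: rng.
    - by rewrite mul0r subrr normr0 invr_ge0.
  rewrite IH; last exact: ltnW.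
  apply: (close _ _ _ _ _ _ (i%:R / n%:R) (i.+1%:R / n%:R) erefl erefl (hlst i) (hlst i.+1)); rewrite ?rng//.
    exact: ltnW.
  rewrite -mulrBl -addn1 natrD opprD addNKr normrM normrN normr1 mul1r normfV gtr0_norm//.
rewrite (chain n)//; apply: (close _ _ _ _ _ _ (n%:R / n%:R) (n%:R / n%:R) erefl _ (hlst n) QE).
- by rewrite /Pt /D divff ?gt_eqF// scale1r addrC subrK.
- exact: rng.
- exact: rng.
- by rewrite subrr normr0 invr_ge0.
Qed.

(** Only the zero-free cofactors are replaced by polynomials; their error is below the minimum of
    the cofactor, so the new roots lie outside the disc and the lists s and s' keep their counts.
    The margin 1/4, against 1/2 for polynomials, absorbs the error. *)
Lemma entire_rouche (f h g g' : C -> C) (s s' : seq C) (c : C) (r : R) : 0 < r ->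
  entire g -> entire g' ->
  (forall w, f w = prodX s w * g w) -> (forall w, h w = prodX s' w * g' w) ->
  (forall w, cabs (w - c) <= r -> g w != 0 /\ g' w != 0) ->
  (forall w, cabs (w - c) = r -> f w != 0 /\ cabs (f w - h w) <= cabs (f w) / 4) ->
  count (fun z => cabs (z - c) < r) s = count (fun z => cabs (z - c) < r) s'.
Proof.
move=> r0 hg hg' fE hE nz hc.
have sh (k : C -> C) : entire k -> entire (fun w => k (w + c)).
  by move=> hk; apply: entire_ext (entire_affine 1 c hk) => w; rewrite mul1r.
have [|m1 m10 hm1] := entire_min (sh _ hg) (r := r).
  by move=> w hw; have [] := nz (w + c); rewrite ?addrK.
have [|m2 m20 hm2] := entire_min (sh _ hg') (r := r).
  by move=> w hw; have [] := nz (w + c); rewrite ?addrK.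
pose t := [seq b - c | b <- s]; pose t' := [seq b - c | b <- s'].
have pt u w : prodX u (w + c) = prodX [seq b - c | b <- u] w.
  by rewrite /prodX big_map; apply: eq_bigr => b _; ring.
have t0 : {in t, forall z, cabs z != r}.
  move=> z /mapP[b bs ->]; apply/eqP => hb; have [/negP[]] := hc b hb.
  by rewrite fE mulf_eq0 prodX_eq0 bs.
have [m3 m30 hm3] := circle_lower_bound t0.
have [M3 M30 hM3] := entire_bounded r (entire_prodX t).
have [M4 M40 hM4] := entire_bounded r (entire_prodX t').
pose m := m1 * m3; have m0 : 0 < m by rewrite mulr_gt0.
pose e := Num.min (Num.min m1 m2) (m / (32 * (M3 + M4))).
have MM : 0 < 32 * (M3 + M4) by lra.
have e0 : 0 < e by rewrite !lt_min m10 m20 divr_gt0.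
have e1 : e <= m1 by rewrite !ge_min lexx.
have e2 : e <= m2 by rewrite !ge_min lexx orbT.
have e3 : e * (32 * (M3 + M4)) <= m by rewrite -ler_pdivlMr// !ge_min lexx !orbT.
have [p hp] := sh _ hg r e e0; have [p' hp'] := sh _ hg' r e e0.
have [u pu] := closed_field_poly_normal p; have [u' pu'] := closed_field_poly_normal p'.
have big (v : seq C) (q : {poly C}) (k : C -> C) (mm : R) : q = lead_coef q *: \prod_(z <- v) ('X - z%:P) ->
  (forall w, cabs w <= r -> cabs (q.[w] - k w) < e) -> e <= mm -> (forall w, cabs w <= r -> mm <= cabs (k w)) ->
  count (fun z => cabs z < r) v = 0%N.
  move=> qE hq em hk; apply/eqP; rewrite -leqn0 leqNgt -has_count; apply/hasP => -[z zv zr].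
  have := hq z (ltW zr); rewrite qE hornerZ -prodX_horner.
  have /eqP -> : prodX v z == 0 by rewrite prodX_eq0.
  by rewrite mulr0 sub0r cabsN; apply/negP; rewrite -leNgt (le_trans em)// hk// ltW.
have cu := big _ _ _ _ pu hp e1 hm1; have cu' := big _ _ _ _ pu' hp' e2 hm2.
have cnt (x y : seq C) : count (fun z => cabs z < r) y = 0%N ->
   count (fun z => cabs z < r) ([seq b - c | b <- x] ++ y) = count (fun z => cabs (z - c) < r) x.
  by move=> hy; rewrite count_cat hy addn0 count_map.
rewrite -(cnt s u cu) -(cnt s' u' cu').
pose P := (\prod_(z <- t) ('X - z%:P)) * p; pose Q := (\prod_(z <- t') ('X - z%:P)) * p'.
apply: (@poly_rouche P Q (lead_coef p) (lead_coef p') (t ++ u) (t' ++ u') r) => //.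
- by rewrite big_cat /= /P {1}pu -scalerAr.
- by rewrite big_cat /= /Q {1}pu' -scalerAr.
move=> w hw; have wr : cabs w <= r by rewrite hw.
have PE : P.[w] = prodX t w * p.[w] by rewrite hornerM -prodX_horner.
have QE : Q.[w] = prodX t' w * p'.[w] by rewrite hornerM -prodX_horner.
have [f0 hfh] := hc (w + c) (ltac:(by rewrite addrK)).
have fm : m <= cabs (f (w + c)) by rewrite fE cabsM pt mulrC ler_pM ?hm1 ?hm3// ltW.
have d1 : cabs (P.[w] - f (w + c)) <= m / 32.
  rewrite PE fE pt -mulrBr cabsM; apply: (@le_trans _ _ (M3 * e)).
    by rewrite ler_pM ?cabs_ge0 ?hM3// ltW// hp.
  have : M4 * e > 0 by rewrite mulr_gt0.
  lra.
have d2 : cabs (Q.[w] - h (w + c)) <= m / 32.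
  rewrite QE hE pt -mulrBr cabsM; apply: (@le_trans _ _ (M4 * e)).
    by rewrite ler_pM ?cabs_ge0 ?hM4// ltW// hp'.
  have : M3 * e > 0 by rewrite mulr_gt0.
  lra.
set fw := f (w + c) in f0 hfh fm d1 *; set hw' := h (w + c) in hfh d2 *.
have k1 := cabs_sub fw P.[w]; rewrite cabs_dist in k1.
split; first by rewrite -cabs_gt0; lra.
have -> : P.[w] - Q.[w] = (P.[w] - fw) + (fw - hw') - (Q.[w] - hw') by ring.
apply: le_trans (cabsB _ _) _; apply: le_trans (lerD (cabsD _ _) (lexx _)) _; lra.
Qed.

End RoucheTheorem.

(** * Absolutely continuous functions on [0, l] *)

Section RealIntegral.
Variables (R : realType) (l : R).
Local Notation mu := (@lebesgue_measure R).
Implicit Types (f g F G : R -> R).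

Definition rI f : Prop := mu.-integrable (seg l) (EFin \o f).
Definition ri f (a b : R) : R := Rintegral mu `[a, b]%classic f.

Lemma ae_mono (P P' : R -> Prop) : ae_on l P -> (forall x, seg l x -> P x -> P' x) -> ae_on l P'.
Proof. by rewrite /ae_on => h hP; apply: (@filterS _ _ (ae_filter_ringOfSetsType mu) _ _ _ h) => x {}h xl; apply: hP => //; exact: h. Qed.

Lemma ae_and (P P' : R -> Prop) : ae_on l P -> ae_on l P' -> ae_on l (fun x => P x /\ P' x).
Proof. by rewrite /ae_on => h h'; apply: (@filterS2 _ _ (ae_filter_ringOfSetsType mu) _ _ _ _ h h') => x {}h {}h' xl; split; [exact: h|exact: h']. Qed.

Lemma ae_all (P : R -> Prop) : (forall x, seg l x -> P x) -> ae_on l P.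
Proof. by move=> h; apply: aeW. Qed.

Lemma mI (a b : R) : measurable (`[a, b]%classic : set (measurableTypeR R)).
Proof. exact: measurable_itv. Qed.

(* Measurability on [0, l], stated on the copy of R on which the Lebesgue measure lives. *)
Definition rM f : Prop := measurable_fun (seg l : set (measurableTypeR R)) f.

Lemma subseg a b : 0 <= a -> b <= l -> `[a, b]%classic `<=` seg l.
Proof.
move=> a0 bl x /=; rewrite /seg /= !in_itv /= => /andP[ax xb].
by rewrite (le_trans a0 ax) (le_trans xb bl).
Qed.

Lemma rI_sub f a b : rI f -> 0 <= a -> b <= l -> mu.-integrable `[a, b]%classic (EFin \o f).
Proof. move=> hf a0 bl; apply: integrableS hf; [exact: mI|exact: mI|exact: subseg]. Qed.

Lemma rI_meas f : rI f -> rM f.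
Proof. by move=> /integrableP[/measurable_EFinP]. Qed.

Lemma rID f g : rI f -> rI g -> rI (fun x => f x + g x).
Proof. by move=> hf hg; have := integrableD (mI _ _) hf hg. Qed.

Lemma rIZ (k : R) f : rI f -> rI (fun x => k * f x).
Proof. by move=> hf; have := integrableZl (mI _ _) k hf. Qed.

Lemma rIN f : rI f -> rI (fun x => - f x).
Proof.
by move=> /(rIZ (-1)); rewrite (_ : (fun x => -1 * f x) = (fun x => - f x))//; apply/funext => x; rewrite mulN1r.
Qed.

Lemma rIB f g : rI f -> rI g -> rI (fun x => f x - g x).
Proof. by move=> hf /rIN; exact: rID. Qed.

Lemma rI0 : rI (fun _ => 0).
Proof. exact: integrable0. Qed.

Lemma rI_abs f : rI f -> rI (fun x => `|f x|).
Proof. by move=> hf; have := integrable_norm hf. Qed.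

Lemma rI_sum (I : Type) (s : seq I) (F : I -> R -> R) :
  (forall i, rI (F i)) -> rI (fun x => \sum_(i <- s) F i x).
Proof.
move=> hF; elim: s => [|i s IH].
  by rewrite (_ : (fun x => _) = (fun=> 0)); [exact: rI0|apply/funext => x; rewrite big_nil].
rewrite (_ : (fun x => _) = (fun x => F i x + \sum_(i <- s) F i x)); first exact: rID.
by apply/funext => x; rewrite big_cons.
Qed.

Lemma rI_mulb f g (M : R) : rI f -> rM g ->
  (forall x, seg l x -> `|g x| <= M) -> rI (fun x => f x * g x).
Proof.
move=> hf mg hM; have := integrableMl (mI _ _) hf mg; apply.
by exists M; split => [|N MN x xl]; rewrite ?num_real//; apply: le_trans (hM x xl) (ltW MN).
Qed.

Lemma rI_le f g : rM f -> rI g -> (forall x, seg l x -> `|f x| <= `|g x|) -> rI f.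
Proof.
move=> mf hg h; apply: (le_integrable (mI 0 l) _ _ hg); first exact/measurable_EFinP.
by move=> x xl /=; rewrite lee_fin h.
Qed.

Lemma rI_ae f g : rM f -> rI g -> ae_on l (fun x => `|f x| <= g x) -> rI f.
Proof.
move=> mf hg h; apply/integrableP; split; first exact/measurable_EFinP.
have hg' := rI_abs hg.
apply: (@le_lt_trans _ _ (\int[mu]_(x in seg l) `|(g x)%:E|)%E); last by case/integrableP: hg.
apply: ae_ge0_le_integral => //.
- exact: mI.
- by apply: measurableT_comp => //; exact/measurable_EFinP.
- by apply: measurableT_comp => //; apply/measurable_EFinP; exact: rI_meas.
- apply: (ae_mono h) => x _ {}h /=; rewrite lee_fin; apply: le_trans h _; exact: ler_norm.
Qed.

Lemma rI_cst (k : R) : rI (fun _ => k).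
Proof.
have fin : (mu (seg l) < +oo)%E.
  by rewrite /seg lebesgue_measure_itv /=; case: ifP => _; rewrite ?ltry// -EFinD ltry.
apply: (@measurable_bounded_integrable _ _ _ mu (fun _ => k) _ (mI 0 l) fin).
  exact: measurable_cst.
by exists `|k|; split => [|N kN x _]; rewrite ?num_real//= ltW.
Qed.

Lemma riD f g a b : rI f -> rI g -> 0 <= a -> b <= l ->
  ri (fun x => f x + g x) a b = ri f a b + ri g a b.
Proof. by move=> hf hg a0 bl; exact: (RintegralD (mI a b) (rI_sub hf a0 bl) (rI_sub hg a0 bl)). Qed.

Lemma riZ (k : R) f a b : rI f -> 0 <= a -> b <= l -> ri (fun x => k * f x) a b = k * ri f a b.
Proof. by move=> hf a0 bl; exact: (RintegralZl k (mI a b) (rI_sub hf a0 bl)). Qed.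

Lemma riN f a b : rI f -> 0 <= a -> b <= l -> ri (fun x => - f x) a b = - ri f a b.
Proof.
move=> hf a0 bl; rewrite -mulN1r -riZ//; congr (ri _ a b); apply/funext => x; by rewrite mulN1r.
Qed.

Lemma riB f g a b : rI f -> rI g -> 0 <= a -> b <= l ->
  ri (fun x => f x - g x) a b = ri f a b - ri g a b.
Proof. by move=> hf hg a0 bl; rewrite riD ?riN//; exact: rIN. Qed.

Lemma ri0 a b : ri (fun _ => 0) a b = 0.
Proof. by rewrite /ri /Rintegral integral0. Qed.

Lemma ri_eq f g a b : (forall x, a <= x <= b -> f x = g x) -> ri f a b = ri g a b.
Proof. by move=> h; apply: eq_Rintegral => x /set_mem /=; rewrite in_itv /=; exact: h. Qed.

Lemma ri_sum (I : Type) (s : seq I) (F : I -> R -> R) a b :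
  (forall i, rI (F i)) -> 0 <= a -> b <= l ->
  ri (fun x => \sum_(i <- s) F i x) a b = \sum_(i <- s) ri (F i) a b.
Proof.
move=> hF a0 bl; elim: s => [|i s IH].
  rewrite big_nil; apply: etrans (ri0 a b); apply: ri_eq => x _; exact: big_nil.
rewrite big_cons -IH -riD//; last exact: rI_sum.
by apply: ri_eq => x _; exact: big_cons.
Qed.

Lemma ri_le f g a b : rI f -> rI g -> 0 <= a -> b <= l ->
  (forall x, a <= x <= b -> f x <= g x) -> ri f a b <= ri g a b.
Proof.
move=> hf hg a0 bl h; apply: (le_Rintegral (mI a b) (rI_sub hf a0 bl) (rI_sub hg a0 bl)).
by move=> x /=; rewrite in_itv /=; exact: h.
Qed.

Lemma ri_ge0 f a b : (forall x, a <= x <= b -> 0 <= f x) -> 0 <= ri f a b.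
Proof. by move=> h; apply: Rintegral_ge0 => x /=; rewrite in_itv /=; exact: h. Qed.

Lemma ri_abs f a b : rI f -> 0 <= a -> b <= l -> `|ri f a b| <= ri (fun x => `|f x|) a b.
Proof. by move=> hf a0 bl; exact: (le_normr_Rintegral (mI a b) (rI_sub hf a0 bl)). Qed.

Lemma ri_ae f g a b : rI f -> rI g -> 0 <= a -> b <= l -> ae_on l (fun x => f x = g x) -> ri f a b = ri g a b.
Proof.
move=> hf hg a0 bl h; rewrite /ri /Rintegral; congr fine; apply: ae_eq_integral.
- exact: mI.
- by apply: (measurable_int mu); exact: rI_sub.
- by apply: (measurable_int mu); exact: rI_sub.
- apply: (@filterS _ _ (ae_filter_ringOfSetsType mu) _ _ _ h) => x {}h xab /=; rewrite h//; exact: subseg xab.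
Qed.

Lemma ri_ge0_ae f a b : rI f -> 0 <= a -> b <= l -> ae_on l (fun x => 0 <= f x) -> 0 <= ri f a b.
Proof.
move=> hf a0 bl h; rewrite (@ri_ae f (fun x => `|f x|))//; [|exact: rI_abs|].
  by apply: ri_ge0.
by apply: (ae_mono h) => x _ /ger0_norm.
Qed.

Lemma ri_le_ae f g a b : rI f -> rI g -> 0 <= a -> b <= l ->
  ae_on l (fun x => f x <= g x) -> ri f a b <= ri g a b.
Proof.
move=> hf hg a0 bl h; rewrite -subr_ge0 -riB//; apply: ri_ge0_ae => //; first exact: rIB.
by apply: (ae_mono h) => x _; rewrite subr_ge0.
Qed.

Lemma ri_xx f a : ri f a a = 0.
Proof. by rewrite /ri set_itv1 Rintegral_set1. Qed.

Lemma ri_chasles f a b c : rI f -> 0 <= a -> a <= b -> b <= c -> c <= l ->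
  ri f a b + ri f b c = ri f a c.
Proof.
move=> hf a0 ab bc cl; have hac := rI_sub hf a0 cl.
have := @Rintegral_itvB R f (BLeft a) (BRight c) b hac; rewrite !bnd_simp => /(_ ab bc).
rewrite Rintegral_itv_obnd_cbnd; first by rewrite /ri => <-; rewrite addrC subrK.
by apply: integrableS hac; [exact: measurable_itv|exact: measurable_itv|apply: subset_itvr; rewrite bnd_simp].
Qed.

Lemma ri_mono f a b c d : rI f -> (forall x, 0 <= f x) -> 0 <= a -> a <= b -> b <= c -> c <= d -> d <= l ->
  ri f b c <= ri f a d.
Proof.
move=> hf f0 a0 ab bc cd dl.
rewrite -(@ri_chasles f a b d) ?(le_trans bc)//.
rewrite -(@ri_chasles f b c d) ?(le_trans a0)//.
have h1 : 0 <= ri f a b by exact: ri_ge0.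
have h2 : 0 <= ri f c d by exact: ri_ge0.
lra.
Qed.

Lemma ri_small f (e : R) : rI f -> 0 < e -> exists2 d : R, 0 < d &
  forall a b, 0 <= a -> a <= b -> b <= l -> b - a < d -> ri (fun x => `|f x|) a b < e.
Proof.
move=> hf e0; pose g := f \_ (seg l).
have hg : mu.-integrable setT (EFin \o g).
  rewrite /g -restrict_EFin; apply/integrable_restrict => //; first exact: mI.
  by rewrite setTI.
have [d [d0 hd]] := integral_normr_continuous hg e0.
exists d => // a b a0 ab bl bad.
have hm : (mu `[a, b]%classic < d%:E)%E.
  by rewrite lebesgue_measure_itv /=; case: ifP => _; rewrite ?lte_fin// -EFinD lte_fin.
have := hd _ (mI a b) hm; congr (_ < e); apply: eq_Rintegral => x /set_mem xab.
by rewrite /g patchE ifT//; apply/mem_set; exact: subseg xab.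
Qed.

(** Cutting [0, x] into pieces shorter than d and telescoping gives |H x - H 0| <= w (a x - a 0) for
    every w > 0. It replaces the theorem that an absolutely continuous function with zero derivative
    is constant, so nothing has to be differentiated almost everywhere. *)
Lemma osc_const (H a : R -> R) : 0 <= l ->
  (forall w : R, 0 < w -> exists2 d : R, 0 < d & forall x y, 0 <= x -> x <= y -> y <= l -> y - x < d ->
     `|H y - H x| <= w * (a y - a x)) ->
  forall x, 0 <= x <= l -> H x = H 0.
Proof.
move=> l0 h x /andP[x0 xl].
have key w : 0 < w -> `|H x - H 0| <= w * (a x - a 0).
  move=> w0; have [d d0 hd] := h w w0.
  pose n := (Num.Def.archi_bound (x / d)).+1.
  have hn : x / d < n%:R.
    apply: lt_le_trans (archi_boundP _) _; first by rewrite divr_ge0// ltW.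
    by rewrite ler_nat.
  have n0 : 0 < n%:R :> R by rewrite ltr0n.
  have xn : x / n%:R < d by rewrite ltr_pdivrMr// mulrC -ltr_pdivrMr.
  have step i : (i <= n)%N -> `|H (i%:R * (x / n%:R)) - H 0| <= w * (a (i%:R * (x / n%:R)) - a 0).
    elim: i => [|i IH] hi; first by rewrite mul0r !subrr normr0 mulr0.
    have := IH (ltnW hi).
    have xn0 : 0 <= x / n%:R by rewrite divr_ge0// ltW.
    have xi : i.+1%:R * (x / n%:R) <= x.
      by rewrite mulrA ler_pdivrMr// mulrC ler_wpM2l// ler_nat.
    have := hd (i%:R * (x / n%:R)) (i.+1%:R * (x / n%:R)).
    rewrite -mulrBl -addn1 natrD addrAC subrr add0r mul1r -natrD addn1.
    move=> /(_ (mulr_ge0 (ler0n _ _) xn0)).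
    rewrite ler_wpM2r ?ler_nat// => /(_ isT (le_trans xi xl) xn).
    set u := H (i.+1%:R * _); set v := H (i%:R * _) => h1 h2.
    have -> : u - H 0 = (u - v) + (v - H 0) by ring.
    by apply: le_trans (ler_normD _ _) _; lra.
  by have := step n (leqnn n); rewrite mulrC divfK// gt_eqF.
apply/eqP; rewrite -subr_eq0 -normr_le0 leNgt; apply/negP => h0.
have D0 : 0 < 2 * (`|a x - a 0| + 1) by rewrite mulr_gt0// ltr_wpDl.
have := key (`|H x - H 0| / (2 * (`|a x - a 0| + 1))); rewrite divr_gt0// => /(_ isT).
rewrite mulrAC ler_pdivlMr//; apply/negP; rewrite -ltNge.
rewrite ltr_pM2l//; have := ler_norm (a x - a 0); have := normr_ge0 (a x - a 0); lra.
Qed.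

End RealIntegral.

(** * Product and chain rules for absolutely continuous functions *)

Section RealAC.
Variables (R : realType) (l : R).
Hypothesis l0 : 0 <= l.
Local Notation mu := (@lebesgue_measure R).
Implicit Types (f g F G : R -> R).

(* F is absolutely continuous on [0, l] with derivative f. *)
Definition rAC F f : Prop := rI l f /\ forall x, 0 <= x <= l -> F x = F 0 + ri f 0 x.

Lemma segP x : seg l x <-> 0 <= x <= l.
Proof. by rewrite /seg /= in_itv. Qed.

Lemma rAC_diff F f x y : rAC F f -> 0 <= x -> x <= y -> y <= l -> F y - F x = ri f x y.
Proof.
move=> [hf hF] x0 xy yl; rewrite (hF y) ?(le_trans x0)// (hF x) ?x0 ?(le_trans xy)//.
by rewrite -(@ri_chasles R l f 0 x y)//; ring.
Qed.

Lemma rAC_diff_le F f x y : rAC F f -> 0 <= x -> x <= y -> y <= l ->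
  `|F y - F x| <= ri (fun t => `|f t|) x y.
Proof. by move=> hF x0 xy yl; rewrite (rAC_diff hF)//; apply: (ri_abs (l := l)) => //; case: hF. Qed.

Lemma rAC_osc F f e : rAC F f -> 0 < e -> exists2 d : R, 0 < d &
  forall x y, 0 <= x -> x <= y -> y <= l -> y - x < d -> `|F y - F x| <= e.
Proof.
move=> hF e0; have [d d0 hd] := ri_small hF.1 e0; exists d => // x y x0 xy yl xyd.
by apply: le_trans (rAC_diff_le hF x0 xy yl) (ltW _); exact: hd.
Qed.

Lemma rAC_bounded F f : rAC F f -> exists2 M : R, 0 <= M & forall x, 0 <= x <= l -> `|F x| <= M.
Proof.
move=> hF; exists (`|F 0| + ri (fun t => `|f t|) 0 l); first by rewrite addr_ge0// ri_ge0.
move=> x /andP[x0 xl]; have -> : F x = F 0 + (F x - F 0) by ring.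
apply: le_trans (ler_normD _ _) _; rewrite lerD2l; apply: le_trans (rAC_diff_le hF _ x0 xl) _ => //.
by apply: (ri_mono (l := l)) => //; apply: rI_abs; case: hF.
Qed.

Lemma rAC_meas F f : rAC F f -> rM l F.
Proof.
move=> [hf hF]; have hc := parameterized_integral_continuous l0 hf.
have hm : rM l (fun x => ri f 0 x).
  by apply: subspace_continuous_measurable_fun hc; exact: measurable_itv.
have : rM l (fun x => F 0 + ri f 0 x) by apply: measurable_funD => //; exact: measurable_cst.
by apply: eq_measurable_fun => x /set_mem/segP xl; rewrite -hF.
Qed.

Lemma rAC_cst (k : R) : rAC (fun _ => k) (fun _ => 0).
Proof. by split=> [|x _]; [exact: rI0|rewrite ri0 addr0]. Qed.

Lemma rACD F f G g : rAC F f -> rAC G g -> rAC (fun x => F x + G x) (fun x => f x + g x).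
Proof.
move=> [hf hF] [hg hG]; split; first exact: rID.
by move=> x /[dup] xl /andP[x0 xl']; rewrite hF// hG// (riD (l := l))//; ring.
Qed.

Lemma rACZ (k : R) F f : rAC F f -> rAC (fun x => k * F x) (fun x => k * f x).
Proof.
move=> [hf hF]; split; first exact: rIZ.
by move=> x /[dup] xl /andP[x0 xl']; rewrite hF// (riZ (l := l))//; ring.
Qed.

Lemma rAC_ext F f G g : (forall x, 0 <= x <= l -> F x = G x) -> (forall x, 0 <= x <= l -> f x = g x) ->
  rAC F f -> rAC G g.
Proof.
move=> FG fg [hf hF]; split.
  by apply: (eq_integrable (mI 0 l) (EFin \o f)) => // x /set_mem/segP xl /=; rewrite fg.
move=> x /[dup] xl /andP[x0 xl']; rewrite -!FG ?lexx// hF//; congr (_ + _).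
by apply: ri_eq => y /andP[y0 yx]; apply: fg; rewrite y0 (le_trans yx).
Qed.

Lemma rACN F f : rAC F f -> rAC (fun x => - F x) (fun x => - f x).
Proof. by move=> /(rACZ (-1)); apply: rAC_ext => x _; rewrite mulN1r. Qed.

Lemma rACB F f G g : rAC F f -> rAC G g -> rAC (fun x => F x - G x) (fun x => f x - g x).
Proof. by move=> hF /rACN; exact: rACD. Qed.

Lemma rI_mulAC f G g : rI l f -> rAC G g -> rI l (fun x => f x * G x).
Proof.
move=> hf hG; have [M _ hM] := rAC_bounded hG.
by apply: (rI_mulb (M := M) hf (rAC_meas hG)) => x /segP; exact: hM.
Qed.

(** The increment over [x, y] of F G minus the claimed primitive equals the integral of f(t) (G y -
    G t) + g(t) (F x - F t); the brackets are small on short intervals, so [osc_const] applies with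
    the integral of |f| + |g| as majorant. *)
Lemma rACM F f G g : rAC F f -> rAC G g -> rAC (fun x => F x * G x) (fun x => f x * G x + g x * F x).
Proof.
move=> hF hG; have If := hF.1; have Ig := hG.1; have hfG := rI_mulAC hF.1 hG; have hgF := rI_mulAC hG.1 hF.
have hI := rID hfG hgF; split => //.
pose q t := `|f t| + `|g t|; have hq : rI l q by apply: rID; apply: rI_abs; [exact: hF.1|exact: hG.1].
pose H x := F x * G x - ri (fun t => f t * G t + g t * F t) 0 x.
suff hH : forall x, 0 <= x <= l -> H x = H 0.
  by move=> x /hH; rewrite /H ri_xx subr0 => /eqP; rewrite subr_eq => /eqP ->.
apply: (@osc_const _ l H (fun x => ri q 0 x)) => // w w0.
have [d1 d10 h1] := rAC_osc hF w0; have [d2 d20 h2] := rAC_osc hG w0.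
exists (Num.min d1 d2); first by rewrite lt_min d10.
move=> x y x0 xy yl; rewrite lt_min => /andP[y1 y2].
have xl : x <= l by exact: le_trans yl.
have y0 : 0 <= y by exact: le_trans xy.
have -> : ri q 0 y - ri q 0 x = ri q x y by rewrite -(@ri_chasles R l q 0 x y)//; ring.
have e1 : H y - H x = ri (fun t => f t * (G y - G t) + g t * (F x - F t)) x y.
  have -> : H y - H x = (F y - F x) * G y + (G y - G x) * F x - (ri (fun t => f t * G t + g t * F t) 0 y - ri (fun t => f t * G t + g t * F t) 0 x).
    by rewrite /H; ring.
  rewrite -(@ri_chasles R l (fun t => f t * G t + g t * F t) 0 x y)// [X in _ - X]addrAC subrr add0r.
  rewrite (rAC_diff hF)// (rAC_diff hG)//.
  rewrite -[ri f x y * _]mulrC -[ri g x y * _]mulrC -!(riZ (l := l))//.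
  have J1 : rI l (fun t => G y * f t) by exact: rIZ.
  have J2 : rI l (fun t => F x * g t) by exact: rIZ.
  have J3 := rID J1 J2.
  rewrite -(riD (l := l))// -(riB (l := l))//.
  by apply: ri_eq => t _; ring.
have hd : rI l (fun t => f t * (G y - G t) + g t * (F x - F t)).
  apply: rID; apply: rI_mulAC.
  - by [].
  - exact: (rACB (rAC_cst (G y)) hG).
  - by [].
  - exact: (rACB (rAC_cst (F x)) hF).
rewrite e1; apply: le_trans (ri_abs hd x0 yl) _.
rewrite -(riZ (l := l))//; apply: (ri_le (l := l) (rI_abs hd) (rIZ _ hq) x0 yl).
move=> t /andP[xt ty]; apply: le_trans (ler_normD _ _) _; rewrite !normrM /q mulrDr.
have t0 : 0 <= t by exact: le_trans xt.
have tl : t <= l by exact: le_trans yl.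
have k1 : `|G y - G t| <= w by apply: h2 => //; lra.
have k2 : `|F x - F t| <= w by rewrite distrC; apply: h1 => //; lra.
by rewrite lerD// mulrC ler_wpM2r.
Qed.

(** Same scheme as for products: a local bound on phi'' makes phi' Lipschitz on the range of F and
    the first-order Taylor remainder quadratic. The intended instances are exp, cos and sin. *)
Lemma rAC_chain (phi phi' phi'' : R -> R) F f :
  (forall x : R, is_derive x (1 : R) phi (phi' x)) -> (forall x : R, is_derive x (1 : R) phi' (phi'' x)) ->
  (forall B, exists K, forall x, `|x| <= B -> `|phi'' x| <= K) ->
  rAC F f -> rAC (fun x => phi (F x)) (fun x => f x * phi' (F x)).
Proof.
move=> d1 d2 bd hF; have [B B0 hB] := rAC_bounded hF; have [K hK] := bd B; have If := hF.1.
have cont (p p' : R -> R) : (forall x : R, is_derive x (1 : R) p (p' x)) -> continuous p.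
  by move=> hp x; apply/differentiable_continuous/derivable1_diffP; case: (hp x).
have mvt (p p' : R -> R) u v : (forall x : R, is_derive x (1 : R) p (p' x)) -> `|u| <= B -> `|v| <= B ->
    exists2 c, `|c| <= B /\ `|c - u| <= `|v - u| & p v - p u = p' c * (v - u).
  move=> hp uB vB; have [uv|/ltW vu] := leP u v.
    have [|c] := @MVT_segment R p p' u v uv (fun x _ => hp x); first exact/continuous_subspaceT/(cont p p').
    rewrite in_itv /= => /andP[uc cv] E; exists c => //.
    rewrite !ler_norml (ger0_norm (_ : 0 <= v - u)) ?subr_ge0//.
    by move: uB vB; rewrite !ler_norml => /andP[? ?] /andP[? ?]; split; apply/andP; split; lra.
  have [|c] := @MVT_segment R p p' v u vu (fun x _ => hp x); first exact/continuous_subspaceT/(cont p p').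
  rewrite in_itv /= => /andP[uc cv] E; exists c; last by rewrite -opprB E; ring.
  rewrite !ler_norml (ler0_norm (_ : v - u <= 0)) ?subr_le0//.
  by move: uB vB; rewrite !ler_norml => /andP[? ?] /andP[? ?]; split; apply/andP; split; lra.
have K0 : 0 <= K by apply: le_trans (hK 0 _); rewrite ?normr0.
have lip u v : `|u| <= B -> `|v| <= B -> `|phi' v - phi' u| <= K * `|v - u|.
  move=> uB vB; have [c [cB _] ->] := mvt _ _ u v d2 uB vB.
  by rewrite normrM ler_wpM2r// hK.
have quad u v : `|u| <= B -> `|v| <= B -> `|phi v - phi u - phi' u * (v - u)| <= K * `|v - u| * `|v - u|.
  move=> uB vB; have [c [cB cu] ->] := mvt _ _ u v d1 uB vB.
  rewrite -mulrBl normrM ler_wpM2r//; apply: le_trans (lip _ _ uB cB) _.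
  by rewrite ler_wpM2l.
have mphi : rM l (fun x => phi' (F x)).
  apply: measurableT_comp; last exact: rAC_meas hF.
  by apply: continuous_measurable_fun; exact: cont d2.
have bphi x : 0 <= x <= l -> `|phi' (F x)| <= `|phi' 0| + K * B.
  move=> xl; have -> : phi' (F x) = phi' 0 + (phi' (F x) - phi' 0) by ring.
  apply: le_trans (ler_normD _ _) _; rewrite lerD2l; apply: le_trans (lip _ _ _ (hB x xl)) _; rewrite ?normr0//.
  by rewrite ler_wpM2l// subr0 hB.
have hI : rI l (fun x => f x * phi' (F x)).
  by apply: (rI_mulb (M := `|phi' 0| + K * B) hF.1 mphi) => x /segP/bphi.
split => //.
pose q t := `|f t|; have hq : rI l q by apply: rI_abs; exact: hF.1.
pose H x := phi (F x) - ri (fun t => f t * phi' (F t)) 0 x.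
suff hH : forall x, 0 <= x <= l -> H x = H 0.
  by move=> x /hH; rewrite /H ri_xx subr0 => /eqP; rewrite subr_eq => /eqP ->.
apply: (@osc_const _ l H (fun x => ri q 0 x)) => // w w0.
have e0 : 0 < w / (2 * (K + 1)) by rewrite divr_gt0// mulr_gt0// ltr_wpDl.
have [d d0 h1] := rAC_osc hF e0.
exists d => // x y x0 xy yl yd.
have xl : x <= l by exact: le_trans yl.
have y0 : 0 <= y by exact: le_trans xy.
have xB := hB x; rewrite x0 xl in xB; have {}xB := xB isT.
have yB := hB y; rewrite y0 yl in yB; have {}yB := yB isT.
have eK : K * (w / (2 * (K + 1))) <= w / 2.
  rewrite mulrA ler_pdivrMr; last by rewrite mulr_gt0// ltr_wpDl.
  by rewrite (_ : w / 2 * (2 * (K + 1)) = w * (K + 1)); [rewrite mulrDr mulr1 mulrC lerDl ltW|field].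
have -> : ri q 0 y - ri q 0 x = ri q x y by rewrite -(@ri_chasles R l q 0 x y)//; ring.
have hJ : rI l (fun t => f t * (phi' (F x) - phi' (F t))).
  have := rIB (rIZ (phi' (F x)) hF.1) hI; congr (rI l _); apply/funext => t; ring.
have -> : H y - H x = (phi (F y) - phi (F x) - phi' (F x) * (F y - F x)) + ri (fun t => f t * (phi' (F x) - phi' (F t))) x y.
  have -> : ri (fun t => f t * (phi' (F x) - phi' (F t))) x y = phi' (F x) * ri f x y - ri (fun t => f t * phi' (F t)) x y.
    have J1 : rI l (fun t => phi' (F x) * f t) by exact: rIZ.
    rewrite -(riZ (l := l))// -(riB (l := l))//.
    by apply: ri_eq => t _; ring.
  rewrite (rAC_diff hF)// /H -(@ri_chasles R l (fun t => f t * phi' (F t)) 0 x y)//; ring.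
have Q0 : 0 <= ri q x y by apply: ri_ge0 => t _; exact: normr_ge0.
apply: le_trans (ler_normD _ _) _; rewrite [X in _ <= X](_ : _ = w / 2 * ri q x y + w / 2 * ri q x y); last by field.
apply: lerD.
  apply: le_trans (quad _ _ xB yB) _; apply: ler_pM => //; first by rewrite mulr_ge0.
    by apply: le_trans eK; rewrite ler_wpM2l// h1.
  exact: rAC_diff_le hF x0 xy yl.
apply: le_trans (ri_abs hJ x0 yl) _; rewrite -(riZ (l := l))//.
apply: (ri_le (l := l) (rI_abs hJ) (rIZ _ hq) x0 yl).
move=> t /andP[xt ty]; rewrite normrM mulrC ler_wpM2r//.
have t0 : 0 <= t by exact: le_trans xt.
have tl : t <= l by exact: le_trans yl.
have tB := hB t; rewrite t0 tl in tB; have {}tB := tB isT.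
apply: le_trans (lip _ _ tB xB) _; apply: le_trans eK; rewrite ler_wpM2l// distrC h1//; lra.
Qed.

End RealAC.

Section L1Norm.
Variable R : realType.
Implicit Types z w : R[i].

(* The norm |Re z| + |Im z|: submultiplicative, and compatible with integration without constants. *)
Definition cn1 z : R := `|complex.Re z| + `|complex.Im z|.

Lemma cReD z w : complex.Re (z + w) = complex.Re z + complex.Re w. Proof. by case: z w => ? ? []. Qed.
Lemma cImD z w : complex.Im (z + w) = complex.Im z + complex.Im w. Proof. by case: z w => ? ? []. Qed.
Lemma cReN z : complex.Re (- z) = - complex.Re z. Proof. by case: z. Qed.
Lemma cImN z : complex.Im (- z) = - complex.Im z. Proof. by case: z. Qed.
Lemma cReM z w : complex.Re (z * w) = complex.Re z * complex.Re w - complex.Im z * complex.Im w.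
Proof. by case: z w => ? ? []. Qed.
Lemma cImM z w : complex.Im (z * w) = complex.Re z * complex.Im w + complex.Im z * complex.Re w.
Proof. by case: z w => ? ? []. Qed.
Lemma cRe_sum (I : Type) (s : seq I) (F : I -> R[i]) : complex.Re (\sum_(i <- s) F i) = \sum_(i <- s) complex.Re (F i).
Proof. by apply: (big_morph _ cReD). Qed.
Lemma cIm_sum (I : Type) (s : seq I) (F : I -> R[i]) : complex.Im (\sum_(i <- s) F i) = \sum_(i <- s) complex.Im (F i).
Proof. by apply: (big_morph _ cImD). Qed.

Lemma cplxP z w : complex.Re z = complex.Re w -> complex.Im z = complex.Im w -> z = w.
Proof. by case: z w => a b [c d] /= -> ->. Qed.

Lemma cn1_ge0 z : 0 <= cn1 z. Proof. exact: addr_ge0. Qed.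
Lemma cn1_0 : cn1 0 = 0. Proof. by rewrite /cn1 /= normr0 addr0. Qed.
Lemma cn1N z : cn1 (- z) = cn1 z. Proof. by rewrite /cn1 cReN cImN !normrN. Qed.
Lemma cn1D z w : cn1 (z + w) <= cn1 z + cn1 w.
Proof. by rewrite /cn1 cReD cImD addrACA lerD// ler_normD. Qed.
Lemma cn1B z w : cn1 (z - w) <= cn1 z + cn1 w.
Proof. by rewrite -(cn1N w) cn1D. Qed.
Lemma cn1M z w : cn1 (z * w) <= cn1 z * cn1 w.
Proof.
rewrite /cn1 cReM cImM; apply: le_trans (lerD (ler_normB _ _) (ler_normD _ _)) _.
rewrite !normrM; lra.
Qed.
Lemma cn1_sum (I : Type) (s : seq I) (F : I -> R[i]) : cn1 (\sum_(i <- s) F i) <= \sum_(i <- s) cn1 (F i).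
Proof.
elim/big_ind2 : _ => [|x1 x2 y1 y2 h1 h2|//]; first by rewrite cn1_0.
by rewrite (le_trans (cn1D _ _))// lerD.
Qed.
Lemma cabs_le_cn1 z : cabs z <= cn1 z. Proof. exact: cabs_le_ReIm. Qed.
Lemma cn1_le_cabs z : cn1 z <= 2 * cabs z.
Proof. by rewrite /cn1 mulr_natl mulr2n lerD ?Re_le_cabs ?Im_le_cabs. Qed.
Lemma cn1_real (x : R) : cn1 x%:C = `|x|. Proof. by rewrite /cn1 /= normr0 addr0. Qed.
Lemma cn1_eq0 z : cn1 z <= 0 -> z = 0.
Proof.
move=> h; apply/eqP; rewrite -cabs_eq0 eq_le cabs_ge0 andbT.
exact: le_trans (cabs_le_cn1 _) h.
Qed.

Lemma cexp0 : cexp (0 : R[i]) = 1.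
Proof. by apply: cplxP => /=; rewrite expR0 ?cos0 ?sin0 ?mulr1 ?mulr0. Qed.

Lemma cexpD z w : cexp (z + w) = cexp z * cexp w.
Proof.
apply: cplxP; rewrite ?cReM ?cImM /cexp /= cReD cImD expRD ?cosD ?sinD; ring.
Qed.

Lemma cexpN z : cexp z * cexp (- z) = 1.
Proof. by rewrite -cexpD subrr cexp0. Qed.

Lemma cexp_neq0 z : cexp z != 0.
Proof. by apply/eqP => h; have := cexpN z; rewrite h mul0r => /eqP; rewrite eq_sym oner_eq0. Qed.

Lemma cabs_cexp z : cabs (cexp z) = expR (complex.Re z).
Proof.
rewrite /cabs /cexp /= !exprMn -mulrDr cos2Dsin2 mulr1 sqrtr_sqr ger0_norm//.
Qed.

Lemma cexp_sum (I : Type) (s : seq I) (F : I -> R[i]) :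
  cexp (\sum_(i <- s) F i) = \prod_(i <- s) cexp (F i).
Proof. by apply: (big_morph _ cexpD cexp0). Qed.

End L1Norm.

Section ComplexIntegral.
Variables (R : realType) (l : R).
Hypothesis l0 : 0 <= l.
Local Notation C := R[i].
Implicit Types (f g F G : R -> C).

Lemma cintegrableE f : cintegrable l f <-> rI l (fun x => complex.Re (f x)) /\ rI l (fun x => complex.Im (f x)).
Proof. by []. Qed.

Lemma cintE f a b : cint f a b = ri (fun x => complex.Re (f x)) a b +i* ri (fun x => complex.Im (f x)) a b.
Proof. by []. Qed.

Lemma rI_eq (f g : R -> R) : (forall x, f x = g x) -> rI l f -> rI l g.
Proof. by move=> h; rewrite (_ : f = g)//; apply/funext. Qed.

Lemma cIrc f1 (f : R -> R) (g : R -> R) : (forall x, complex.Re (f1 x) = f x) -> (forall x, complex.Im (f1 x) = g x) ->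
  rI l f -> rI l g -> cintegrable l f1.
Proof. by move=> h1 h2 hf hg; split; [apply: rI_eq hf|apply: rI_eq hg] => x; rewrite ?h1 ?h2. Qed.

Lemma cI_real (f : R -> R) : rI l f -> cintegrable l (fun x => (f x)%:C).
Proof. by move=> hf; apply: (cIrc (f := f) (g := fun=> 0)) => //; exact: rI0. Qed.

Lemma cID f g : cintegrable l f -> cintegrable l g -> cintegrable l (fun x => f x + g x).
Proof. by move=> [f1 f2] [g1 g2]; apply: (cIrc _ _ (rID f1 g1) (rID f2 g2)) => x; rewrite ?cReD ?cImD. Qed.

Lemma cIN f : cintegrable l f -> cintegrable l (fun x => - f x).
Proof. by move=> [f1 f2]; apply: (cIrc _ _ (rIN f1) (rIN f2)) => x; rewrite ?cReN ?cImN. Qed.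

Lemma cIB f g : cintegrable l f -> cintegrable l g -> cintegrable l (fun x => f x - g x).
Proof. by move=> hf /cIN; exact: cID. Qed.

Lemma cIZ (k : C) f : cintegrable l f -> cintegrable l (fun x => k * f x).
Proof.
move=> [f1 f2].
apply: (cIrc _ _ (rIB (rIZ (complex.Re k) f1) (rIZ (complex.Im k) f2)) (rID (rIZ (complex.Re k) f2) (rIZ (complex.Im k) f1))) => x.
  exact: cReM.
exact: cImM.
Qed.

Lemma cI0 : cintegrable l (fun _ => 0 : C).
Proof. by split; exact: rI0. Qed.

Lemma cI_eq f g : (forall x, f x = g x) -> cintegrable l f -> cintegrable l g.
Proof. by move=> h; rewrite (_ : f = g)//; apply/funext. Qed.

Lemma cI_sum (I : Type) (s : seq I) (F : I -> R -> C) :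
  (forall i, cintegrable l (F i)) -> cintegrable l (fun x => \sum_(i <- s) F i x).
Proof.
move=> hF; elim: s => [|i s IH]; first by apply: cI_eq cI0 => x; rewrite big_nil.
by apply: cI_eq (cID (hF i) IH) => x; rewrite big_cons.
Qed.

Lemma cI_cn1 f : cintegrable l f -> rI l (fun x => cn1 (f x)).
Proof. by move=> [f1 f2]; apply: rID; exact: rI_abs. Qed.

Lemma cint_eq f g a b : (forall x, a <= x <= b -> f x = g x) -> cint f a b = cint g a b.
Proof. by move=> h; rewrite !cintE; congr (_ +i* _); apply: ri_eq => x /h ->. Qed.

Lemma cint_ae f g a b : cintegrable l f -> cintegrable l g -> 0 <= a -> b <= l ->
  ae_on l (fun x => f x = g x) -> cint f a b = cint g a b.
Proof.
move=> [f1 f2] [g1 g2] a0 bl h; rewrite !cintE; congr (_ +i* _); apply: (ri_ae (l := l)) => //.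
  by apply: ae_mono h _ => x _ ->.
by apply: ae_mono h _ => x _ ->.
Qed.

Lemma cint0 a b : cint (fun _ => 0 : C) a b = 0.
Proof. by rewrite cintE /= !ri0. Qed.

Lemma cint_xx f a : cint f a a = 0.
Proof. by rewrite cintE !ri_xx. Qed.

Lemma cintD f g a b : cintegrable l f -> cintegrable l g -> 0 <= a -> b <= l ->
  cint (fun x => f x + g x) a b = cint f a b + cint g a b.
Proof.
move=> [f1 f2] [g1 g2] a0 bl; rewrite !cintE; apply: cplxP => /=.
  by rewrite -(riD (l := l))//; apply: ri_eq => x _; rewrite cReD.
by rewrite -(riD (l := l))//; apply: ri_eq => x _; rewrite cImD.
Qed.

Lemma cintZ (k : C) f a b : cintegrable l f -> 0 <= a -> b <= l -> cint (fun x => k * f x) a b = k * cint f a b.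
Proof.
move=> [f1 f2] a0 bl; rewrite !cintE; apply: cplxP => /=.
  rewrite cReM -!(riZ (l := l))// -(riB (l := l))//; [|exact: rIZ|exact: rIZ].
  by apply: ri_eq => x _; rewrite cReM.
rewrite cImM -!(riZ (l := l))// -(riD (l := l))//; [|exact: rIZ|exact: rIZ].
by apply: ri_eq => x _; rewrite cImM.
Qed.

Lemma cintN f a b : cintegrable l f -> 0 <= a -> b <= l -> cint (fun x => - f x) a b = - cint f a b.
Proof. by move=> hf a0 bl; rewrite -mulN1r -cintZ//; apply: cint_eq => x _; rewrite mulN1r. Qed.

Lemma cintB f g a b : cintegrable l f -> cintegrable l g -> 0 <= a -> b <= l ->
  cint (fun x => f x - g x) a b = cint f a b - cint g a b.
Proof. by move=> hf hg a0 bl; rewrite cintD ?cintN//; exact: cIN. Qed.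

Lemma cint_sum (I : Type) (s : seq I) (F : I -> R -> C) a b :
  (forall i, cintegrable l (F i)) -> 0 <= a -> b <= l ->
  cint (fun x => \sum_(i <- s) F i x) a b = \sum_(i <- s) cint (F i) a b.
Proof.
move=> hF a0 bl; elim: s => [|i s IH].
  by rewrite big_nil -[RHS](cint0 a b); apply: cint_eq => x _; exact: big_nil.
rewrite big_cons -IH -cintD//; last exact: cI_sum.
by apply: cint_eq => x _; exact: big_cons.
Qed.

Lemma cint_chasles f a b c : cintegrable l f -> 0 <= a -> a <= b -> b <= c -> c <= l ->
  cint f a b + cint f b c = cint f a c.
Proof.
move=> [f1 f2] a0 ab bc cl; rewrite !cintE; apply: cplxP => /=; exact: (ri_chasles (l := l)).
Qed.

Lemma cn1_cint f a b : cintegrable l f -> 0 <= a -> b <= l -> cn1 (cint f a b) <= ri (fun x => cn1 (f x)) a b.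
Proof.
move=> [f1 f2] a0 bl; rewrite (riD (l := l))//; [|exact: rI_abs|exact: rI_abs].
by rewrite /cn1 /=; apply: lerD; exact: (ri_abs (l := l)).
Qed.

Definition cAC F f : Prop :=
  rAC l (fun x => complex.Re (F x)) (fun x => complex.Re (f x)) /\
  rAC l (fun x => complex.Im (F x)) (fun x => complex.Im (f x)).

Lemma cACP F f : cAC F f <-> cintegrable l f /\ forall x, 0 <= x <= l -> F x = F 0 + cint f 0 x.
Proof.
split=> [[[f1 h1] [f2 h2]]|[[f1 f2] h]].
  split => // x xl; apply: cplxP; first by rewrite cReD /=; exact: h1.
  by rewrite cImD /=; exact: h2.
split; split => // x xl; rewrite {1}(h x xl) ?cReD ?cImD//.
Qed.

Lemma cAC_I F f : cAC F f -> cintegrable l f. Proof. by case/cACP. Qed.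

Lemma cAC_ext F f G g : (forall x, 0 <= x <= l -> F x = G x) -> (forall x, 0 <= x <= l -> f x = g x) ->
  cAC F f -> cAC G g.
Proof.
move=> FG fg [h1 h2]; split; [apply: rAC_ext h1|apply: rAC_ext h2] => // x xl; by rewrite ?FG ?fg.
Qed.

Lemma cAC_rc F f (F1 F2 f1 f2 : R -> R) :
  (forall x, complex.Re (F x) = F1 x) -> (forall x, complex.Im (F x) = F2 x) ->
  (forall x, complex.Re (f x) = f1 x) -> (forall x, complex.Im (f x) = f2 x) ->
  rAC l F1 f1 -> rAC l F2 f2 -> cAC F f.
Proof.
by move=> a b c d h1 h2; split; [apply: rAC_ext h1|apply: rAC_ext h2] => // x _; rewrite ?a ?b ?c ?d.
Qed.

Lemma cAC_cst (k : C) : cAC (fun _ => k) (fun _ => 0).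
Proof. by split; exact: rAC_cst. Qed.

Lemma cACD F f G g : cAC F f -> cAC G g -> cAC (fun x => F x + G x) (fun x => f x + g x).
Proof.
move=> [h1 h2] [h3 h4]; apply: (cAC_rc _ _ _ _ (rACD h1 h3) (rACD h2 h4)) => x;
  by rewrite ?cReD ?cImD.
Qed.

Lemma cACM F f G g : cAC F f -> cAC G g -> cAC (fun x => F x * G x) (fun x => f x * G x + g x * F x).
Proof.
move=> [h1 h2] [h3 h4].
apply: (cAC_rc _ _ _ _ (rACB l0 (rACM l0 h1 h3) (rACM l0 h2 h4)) (rACD (rACM l0 h1 h4) (rACM l0 h2 h3))) => x;
  rewrite ?cReD ?cImD ?cReM ?cImM //; ring.
Qed.

Lemma cACZ (k : C) F f : cAC F f -> cAC (fun x => k * F x) (fun x => k * f x).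
Proof.
by move=> h; apply: cAC_ext (cACM (cAC_cst k) h) => // x _; ring.
Qed.

Lemma cACB F f G g : cAC F f -> cAC G g -> cAC (fun x => F x - G x) (fun x => f x - g x).
Proof. by move=> hF /(cACZ (-1)) hG; apply: cAC_ext (cACD hF hG) => x _; ring. Qed.

Lemma cAC_sum (I : Type) (s : seq I) (F f : I -> R -> C) : (forall i, cAC (F i) (f i)) ->
  cAC (fun x => \sum_(i <- s) F i x) (fun x => \sum_(i <- s) f i x).
Proof.
move=> h; elim: s => [|i s IH].
  by apply: cAC_ext (cAC_cst 0) => x _; rewrite big_nil.
by apply: cAC_ext (cACD (h i) IH) => x _; rewrite big_cons.
Qed.

Lemma cAC_bounded F f : cAC F f -> exists2 M : R, 0 <= M & forall x, 0 <= x <= l -> cn1 (F x) <= M.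
Proof.
move=> [/rAC_bounded[M M0 hM] /rAC_bounded[N N0 hN]]; exists (M + N); first exact: addr_ge0.
by move=> x xl; apply: lerD; [exact: hM|exact: hN].
Qed.

Lemma cAC_diff F f x y : cAC F f -> 0 <= x -> x <= y -> y <= l -> F y - F x = cint f x y.
Proof.
move=> /cACP[hf hF] x0 xy yl; rewrite (hF y) ?(le_trans x0)// (hF x) ?x0 ?(le_trans xy)//.
by rewrite -(@cint_chasles f 0 x y)//; ring.
Qed.

Lemma cI_mulAC f G g : cintegrable l f -> cAC G g -> cintegrable l (fun x => f x * G x).
Proof.
move=> [f1 f2] [h1 h2].
apply: (cIrc _ _ (rIB (rI_mulAC l0 f1 h1) (rI_mulAC l0 f2 h2)) (rID (rI_mulAC l0 f1 h2) (rI_mulAC l0 f2 h1))) => x;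
  by rewrite ?cReM ?cImM.
Qed.

Lemma cAC_primitive f : cintegrable l f -> cAC (fun x => cint f 0 x) f.
Proof. by move=> hf; apply/cACP; split => // x _; rewrite cint_xx add0r. Qed.

Lemma cAC_cexp (z : C) (a al : R -> R) : rAC l a al ->
  cAC (fun x => cexp (z * (a x)%:C)) (fun x => z * (al x)%:C * cexp (z * (a x)%:C)).
Proof.
move=> ha; pose p := complex.Re z; pose q := complex.Im z.
have bnd1 (phi : R -> R) : (forall x, `|phi x| <= 1) -> forall B : R, exists K, forall x, `|x| <= B -> `|phi x| <= K.
  by move=> h B; exists 1 => x _.
have bexp (B : R) : exists K, forall x : R, `|x| <= B -> `|expR x| <= K.
  by exists (expR B) => x hx; rewrite ger0_norm ?expR_ge0// ler_expR (le_trans (ler_norm _) hx).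
have he := rAC_chain l0 (fun x => is_derive_expR x) (fun x => is_derive_expR x) bexp (rACZ p ha).
have dNsin (x : R) : is_derive x 1 (fun x => - sin x) (- cos x) by exact: is_deriveN.
have dNcos (x : R) : is_derive x 1 (fun x => - cos x) (sin x).
  by rewrite -[sin x]opprK; exact: is_deriveN.
have bsin x : `|- sin x : R| <= 1 by rewrite normrN ler_norml sin_geN1 sin_le1.
have bcos x : `|- cos x : R| <= 1 by rewrite normrN ler_norml cos_geN1 cos_le1.
have hc := rAC_chain l0 (fun x => is_derive_cos x) dNsin (bnd1 _ bcos) (rACZ q ha).
have hs := rAC_chain l0 (fun x => is_derive_sin x) (fun x => is_derive_cos x) (bnd1 _ bsin) (rACZ q ha).
have Rez x : complex.Re (z * (a x)%:C) = p * a x by rewrite cReM /= mulr0 subr0.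
have Imz x : complex.Im (z * (a x)%:C) = q * a x by rewrite cImM /= mulr0 add0r.
apply: (cAC_rc _ _ _ _ (rACM l0 he hc) (rACM l0 he hs)) => x;
  cbv beta; rewrite ?(cReM, cImM) /cexp /= ?Rez ?Imz -/p -/q; ring.
Qed.

End ComplexIntegral.

(** * Linear systems with integrable coefficients *)

Section Weight.
Variables (R : realType) (l : R).
Hypothesis l0 : 0 <= l.
Variable al : R -> R.
Hypotheses (Ial : rI l al) (al0 : forall x, 0 <= al x).

(* The Bielecki weight turns the Volterra operator with kernel [al] into a 1/2-contraction. *)
Definition wexp (x : R) : R := expR (2 * ri al 0 x).

Lemma wexp_AC : rAC l wexp (fun x => 2 * al x * wexp x).
Proof.
have ha : rAC l (fun x => 2 * ri al 0 x) (fun x => 2 * al x).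
  by apply: rACZ; split => // x _; rewrite ri_xx add0r.
have bexp (B : R) : exists K, forall x : R, `|x| <= B -> `|expR x| <= K.
  by exists (expR B) => x hx; rewrite ger0_norm ?expR_ge0// ler_expR (le_trans (ler_norm _) hx).
exact: (rAC_chain l0 (fun x => is_derive_expR x) (fun x => is_derive_expR x) bexp ha).
Qed.

Lemma wexp_ge1 x : 1 <= wexp x.
Proof. by rewrite /wexp -expR0 ler_expR mulr_ge0// ri_ge0. Qed.

Lemma wexp_ge0 x : 0 <= wexp x. Proof. exact: expR_ge0. Qed.

Lemma wexp_le x : 0 <= x <= l -> wexp x <= wexp l.
Proof.
by move=> /andP[x0 xl]; rewrite /wexp ler_expR ler_wpM2l//; apply: (ri_mono (l := l)).
Qed.

Lemma wexp_I : rI l (fun x => al x * wexp x).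
Proof. exact: rI_mulAC wexp_AC. Qed.

Lemma wexp_int x : 0 <= x <= l -> ri (fun t => al t * wexp t) 0 x <= (wexp x - 1) / 2.
Proof.
move=> /[dup] xl /andP[x0 xl']; have [_ h] := wexp_AC.
have := h x xl; have -> : wexp 0 = 1 by rewrite /wexp ri_xx mulr0 expR0.
have -> : ri (fun x0 => 2 * al x0 * wexp x0) 0 x = 2 * ri (fun t => al t * wexp t) 0 x.
  rewrite -(riZ (l := l))//; last exact: wexp_I.
  by apply: ri_eq => t _; ring.
lra.
Qed.

(** Inserting the bound (c + K 2^-n) [wexp] into the inequality halves the excess K 2^-n, because
    the integral of [al] times [wexp] is at most ([wexp] - 1) / 2. The a priori bound K only starts
    the iteration. *)
Lemma gronwall (u : R -> R) (c K : R) : 0 <= c -> 0 <= K -> rI l (fun x => al x * u x) ->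
  (forall x, 0 <= x <= l -> u x <= K) ->
  (forall x, 0 <= x <= l -> u x <= c + ri (fun t => al t * u t) 0 x) ->
  forall x, 0 <= x <= l -> u x <= c * wexp x.
Proof.
move=> c0 K0 Iu uK hu.
have step n : forall x, 0 <= x <= l -> u x <= (c + K * 2^-1 ^+ n) * wexp x.
  elim: n => [|n IH] x xl.
    apply: le_trans (uK x xl) _; rewrite expr0 mulr1.
    apply: (@le_trans _ _ ((c + K) * 1)); first by rewrite mulr1 lerDr.
    by rewrite ler_wpM2l ?addr_ge0// wexp_ge1.
  have [x0 xl'] := andP xl.
  have Kn : 0 <= K * 2^-1 ^+ n by rewrite mulr_ge0.
  have h1 : ri (fun t => al t * u t) 0 x <= (c + K * 2^-1 ^+ n) * ri (fun t => al t * wexp t) 0 x.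
    rewrite -(riZ (l := l))//; last exact: wexp_I.
    apply: (ri_le (l := l)) => //; first by apply: rIZ; exact: wexp_I.
    move=> t /andP[t0 tx]; rewrite mulrCA ler_wpM2l// IH// t0 (le_trans tx)//.
  have h2 := wexp_int xl; have w1 := wexp_ge1 x.
  have h3 : (c + K * 2^-1 ^+ n) * ri (fun t => al t * wexp t) 0 x <= (c + K * 2^-1 ^+ n) * ((wexp x - 1) / 2).
    by rewrite ler_wpM2l// addr_ge0.
  have h4 := hu x xl; rewrite exprS.
  have h5 : 0 <= c * (wexp x - 1) by rewrite mulr_ge0// subr_ge0.
  lra.
move=> x xl; rewrite -subr_le0; apply: (@le0_of_geo _ _ (K * wexp x) 0) => n _.
by have := step n x xl; lra.
Qed.

End Weight.

Section MatrixNorm.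
Variable R : realType.
Local Notation C := R[i].

(** The sum over all entries is submultiplicative and dominates the integral of a matrix entrywise,
    both with constant 1. *)
Definition mn m p (U : 'M[C]_(m, p)) : R := \sum_i \sum_j cn1 (U i j).

Lemma mn_ge0 m p (U : 'M[C]_(m, p)) : 0 <= mn U.
Proof. by apply: sumr_ge0 => i _; apply: sumr_ge0 => j _; exact: cn1_ge0. Qed.

Lemma mn_entry m p (U : 'M[C]_(m, p)) i j : cn1 (U i j) <= mn U.
Proof.
rewrite /mn (bigD1 i)//= (bigD1 j)//= -addrA lerDl addr_ge0//.
  by apply: sumr_ge0 => ? _; exact: cn1_ge0.
by apply: sumr_ge0 => ? _; apply: sumr_ge0 => ? _; exact: cn1_ge0.
Qed.

Lemma mn0 m p : mn (0 : 'M[C]_(m, p)) = 0.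
Proof. by rewrite /mn big1// => i _; rewrite big1// => j _; rewrite mxE cn1_0. Qed.

Lemma mnN m p (U : 'M[C]_(m, p)) : mn (- U) = mn U.
Proof. by apply: eq_bigr => i _; apply: eq_bigr => j _; rewrite mxE cn1N. Qed.

Lemma mnD m p (U V : 'M[C]_(m, p)) : mn (U + V) <= mn U + mn V.
Proof.
rewrite /mn -big_split; apply: ler_sum => i _; rewrite -big_split; apply: ler_sum => j _.
by rewrite mxE cn1D.
Qed.

Lemma mnB m p (U V : 'M[C]_(m, p)) : mn (U - V) <= mn U + mn V.
Proof. by rewrite -(mnN V) mnD. Qed.

Lemma mnM m p q (U : 'M[C]_(m, p)) (V : 'M[C]_(p, q)) : mn (U *m V) <= mn U * mn V.
Proof.
rewrite /mn mulr_suml; apply: ler_sum => i _.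
apply: (@le_trans _ _ (\sum_j \sum_k cn1 (U i k) * cn1 (V k j))).
  apply: ler_sum => j _; rewrite mxE; apply: le_trans (cn1_sum _ _) _.
  by apply: ler_sum => k _; exact: cn1M.
rewrite exchange_big /= mulr_suml; apply: ler_sum => k _; rewrite -mulr_sumr ler_wpM2l ?cn1_ge0//.
rewrite (bigD1 k)//= lerDl; apply: sumr_ge0 => ? _; apply: sumr_ge0 => ? _; exact: cn1_ge0.
Qed.

Lemma mnZ m p (z : C) (U : 'M[C]_(m, p)) : mn (z *: U) <= cn1 z * mn U.
Proof.
rewrite /mn mulr_sumr; apply: ler_sum => i _; rewrite mulr_sumr; apply: ler_sum => j _.
by rewrite mxE cn1M.
Qed.

Lemma mn_eq0 m p (U : 'M[C]_(m, p)) : mn U <= 0 -> U = 0.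
Proof.
move=> h; apply/matrixP => i j; rewrite mxE; apply: cn1_eq0.
exact: le_trans (mn_entry _ _ _) h.
Qed.

End MatrixNorm.

Section BoundedMultiplier.
Variables (R : realType) (l : R).

Lemma cI_mulb (f g : R -> R[i]) (M : R) : cintegrable l f -> cmeasurable l g ->
  (forall x, seg l x -> cn1 (g x) <= M) -> cintegrable l (fun x => f x * g x).
Proof.
move=> [f1 f2] [g1 g2] hM.
have b1 x : seg l x -> `|complex.Re (g x)| <= M by move=> /hM; apply: le_trans; rewrite lerDl.
have b2 x : seg l x -> `|complex.Im (g x)| <= M by move=> /hM; apply: le_trans; rewrite lerDr.
apply: (cIrc _ _ (rIB (rI_mulb f1 g1 b1) (rI_mulb f2 g2 b2)) (rID (rI_mulb f1 g2 b2) (rI_mulb f2 g1 b1))).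
  by move=> x; rewrite cReM.
by move=> x; rewrite cImM.
Qed.

End BoundedMultiplier.

Section LinearODE.
Variables (R : realType) (l : R).
Hypothesis l0 : 0 <= l.
Local Notation C := R[i].

Definition mAC m p (F f : R -> 'M[C]_(m, p)) : Prop :=
  forall i j, cAC l (fun x => F x i j) (fun x => f x i j).

Lemma mACP m p (F f : R -> 'M[C]_(m, p)) : mAC F f <->
  mxintegrable l f /\ forall x, seg l x -> F x = F 0 + mxint f 0 x.
Proof.
split=> [h|[h1 h2] i j].
  split=> [i j|x xl]; first exact: cAC_I (h i j).
  apply/matrixP => i j; rewrite !mxE; have /cACP[_] := h i j; apply; exact/segP.
apply/cACP; split; first exact: h1.
by move=> x /segP/h2 {1}->; rewrite !mxE.
Qed.

Lemma mAC_I m p (F f : R -> 'M[C]_(m, p)) : mAC F f -> mxintegrable l f.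
Proof. by case/mACP. Qed.

Lemma mAC_eq m p (F f : R -> 'M[C]_(m, p)) x : mAC F f -> 0 <= x <= l -> F x = F 0 + mxint f 0 x.
Proof. by move=> /mACP[_ h] /segP; exact: h. Qed.

Lemma mAC_ext m p (F f G g : R -> 'M[C]_(m, p)) : (forall x, 0 <= x <= l -> F x = G x) ->
  (forall x, 0 <= x <= l -> f x = g x) -> mAC F f -> mAC G g.
Proof. by move=> FG fg h i j; apply: (cAC_ext l0 _ _ (h i j)) => // x xl; rewrite ?FG ?fg. Qed.

Lemma mACD m p (F f G g : R -> 'M[C]_(m, p)) : mAC F f -> mAC G g ->
  mAC (fun x => F x + G x) (fun x => f x + g x).
Proof. by move=> h1 h2 i j; apply: (cAC_ext l0 _ _ (cACD l0 (h1 i j) (h2 i j))) => // x _; rewrite mxE. Qed.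

Lemma mACB m p (F f G g : R -> 'M[C]_(m, p)) : mAC F f -> mAC G g ->
  mAC (fun x => F x - G x) (fun x => f x - g x).
Proof. by move=> h1 h2 i j; apply: (cAC_ext l0 _ _ (cACB l0 (h1 i j) (h2 i j))) => // x _; rewrite !mxE. Qed.

Lemma mACZ m p (z : C) (F f : R -> 'M[C]_(m, p)) : mAC F f -> mAC (fun x => z *: F x) (fun x => z *: f x).
Proof. by move=> h i j; apply: (cAC_ext l0 _ _ (cACZ l0 z (h i j))) => // x _; rewrite !mxE. Qed.

Lemma mAC_cst m p (U : 'M[C]_(m, p)) : mAC (fun _ => U) (fun _ => 0).
Proof. by move=> i j; apply: (cAC_ext l0 _ _ (cAC_cst l (U i j))) => // x _; rewrite mxE. Qed.

Lemma mACMr m p q (F f : R -> 'M[C]_(m, p)) (V : 'M[C]_(p, q)) : mAC F f ->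
  mAC (fun x => F x *m V) (fun x => f x *m V).
Proof.
move=> h i j.
have := cAC_sum l0 (index_enum 'I_p) (fun k => cACZ l0 (V k j) (h i k)).
by apply: cAC_ext => // x _; rewrite mxE; apply: eq_bigr => k _; rewrite mulrC.
Qed.

Lemma mAC_sum m p (I : Type) (s : seq I) (F f : I -> R -> 'M[C]_(m, p)) : (forall i, mAC (F i) (f i)) ->
  mAC (fun x => \sum_(i <- s) F i x) (fun x => \sum_(i <- s) f i x).
Proof.
by move=> h i j; apply: (cAC_ext l0 _ _ (cAC_sum l0 s (fun k => h k i j))) => // x _; rewrite summxE.
Qed.

Lemma mxI_mul m p q (A : R -> 'M[C]_(m, p)) (U u : R -> 'M[C]_(p, q)) : mxintegrable l A -> mAC U u ->
  mxintegrable l (fun x => A x *m U x).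
Proof.
move=> hA hU i j; apply: cI_eq (cI_sum (index_enum 'I_p) (fun k => cI_mulAC l0 (hA i k) (hU k j))) => x.
by rewrite mxE.
Qed.

Lemma mxID m p (f g : R -> 'M[C]_(m, p)) : mxintegrable l f -> mxintegrable l g -> mxintegrable l (fun x => f x + g x).
Proof. by move=> hf hg i j; apply: cI_eq (cID (hf i j) (hg i j)) => x; rewrite mxE. Qed.

Lemma mxIZ m p (z : C) (f : R -> 'M[C]_(m, p)) : mxintegrable l f -> mxintegrable l (fun x => z *: f x).
Proof. by move=> hf i j; apply: cI_eq (cIZ z (hf i j)) => x; rewrite mxE. Qed.

Lemma mxIB m p (f g : R -> 'M[C]_(m, p)) : mxintegrable l f -> mxintegrable l g -> mxintegrable l (fun x => f x - g x).
Proof. by move=> hf hg i j; apply: cI_eq (cIB (hf i j) (hg i j)) => x; rewrite !mxE. Qed.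

Lemma mxI_eq m p (f g : R -> 'M[C]_(m, p)) : (forall x, f x = g x) -> mxintegrable l f -> mxintegrable l g.
Proof. by move=> h; rewrite (_ : f = g)//; apply/funext. Qed.

Lemma mxI0 m p : mxintegrable l (fun _ => 0 : 'M[C]_(m, p)).
Proof. by move=> i j; apply: cI_eq (cI0 l) => x; rewrite mxE. Qed.

Lemma mxI_mn m p (f : R -> 'M[C]_(m, p)) : mxintegrable l f -> rI l (fun x => mn (f x)).
Proof. by move=> h; apply: rI_sum => i; apply: rI_sum => j; apply: cI_cn1. Qed.

Lemma mn_mxint m p (f : R -> 'M[C]_(m, p)) a b : mxintegrable l f -> 0 <= a -> b <= l ->
  mn (mxint f a b) <= ri (fun x => mn (f x)) a b.
Proof.
move=> h a0 bl; rewrite /mn (ri_sum (l := l))//; last by move=> i; apply: rI_sum => j; exact: cI_cn1.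
apply: ler_sum => i _; rewrite (ri_sum (l := l))//; last by move=> j; exact: cI_cn1.
by apply: ler_sum => j _; rewrite mxE; exact: (cn1_cint (l := l)).
Qed.

Lemma mAC_primitive m p (f : R -> 'M[C]_(m, p)) : mxintegrable l f -> mAC (fun x => mxint f 0 x) f.
Proof. by move=> h i j; apply: (cAC_ext l0 _ _ (cAC_primitive (h i j))) => // x _; rewrite mxE. Qed.

Lemma mAC_bounded m p (F f : R -> 'M[C]_(m, p)) : mAC F f ->
  exists2 M : R, 0 <= M & forall x, 0 <= x <= l -> mn (F x) <= M.
Proof.
move=> h; exists (mn (F 0) + ri (fun x => mn (f x)) 0 l).
  by rewrite addr_ge0 ?mn_ge0// ri_ge0// => x _; exact: mn_ge0.
move=> x /[dup] xl /andP[x0 xl']; rewrite (mAC_eq h xl); apply: le_trans (mnD _ _) _.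
rewrite lerD2l; have hI := mAC_I h; apply: le_trans (mn_mxint hI _ xl') _ => //.
by apply: (ri_mono (l := l)) => //; [exact: mxI_mn|move=> t; exact: mn_ge0].
Qed.

Lemma mxint0r m p (f : R -> 'M[C]_(m, p)) a : mxint f a a = 0.
Proof. by apply/matrixP => i j; rewrite !mxE cint_xx. Qed.

Lemma ode_bound n p (A : R -> 'M[C]_n) (g U : R -> 'M[C]_(n, p)) (al : R -> R) :
  mxintegrable l A -> mxintegrable l g -> rI l al -> (forall x, mn (A x) <= al x) ->
  mAC U (fun x => A x *m U x + g x) ->
  forall x, 0 <= x <= l -> mn (U x) <= (mn (U 0) + ri (fun t => mn (g t)) 0 l) * wexp al l.
Proof.
move=> hA hg hal hAal hU x xl; have al0 t : 0 <= al t by apply: le_trans (hAal t); exact: mn_ge0.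
have [M M0 hM] := mAC_bounded hU.
have hgn := mxI_mn hg; have hAU := mxI_mul hA hU.
have mU : rM l (fun t => mn (U t)).
  rewrite /mn; apply: measurable_sum => i; apply: measurable_sum => j; have [h1 h2] := hU i j.
  by apply: measurable_funD; apply: measurableT_comp => //; [exact: (rAC_meas l0 h1)|exact: (rAC_meas l0 h2)].
have hau : rI l (fun t => al t * mn (U t)).
  apply: (rI_mulb (M := M)) => // t /segP tl; rewrite ger0_norm ?mn_ge0//; exact: hM.
set c := mn (U 0) + _; have c0 : 0 <= c.
  by rewrite /c addr_ge0 ?mn_ge0// ri_ge0// => t _; exact: mn_ge0.
apply: le_trans (_ : c * wexp al x <= _); last by rewrite ler_wpM2l// wexp_le.
apply: (gronwall l0 hal al0 (u := fun t => mn (U t)) c0 M0 hau hM) xl => {}x /[dup] xl /andP[x0 xl'].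
rewrite (mAC_eq hU xl); apply: le_trans (mnD _ _) _; rewrite /c -addrA lerD2l.
apply: le_trans (mn_mxint (mxID hAU hg) _ xl') _ => //.
apply: (@le_trans _ _ (ri (fun t => al t * mn (U t) + mn (g t)) 0 x)).
  apply: (ri_le (l := l)) => //; [exact/mxI_mn/mxID|exact: rID|].
  move=> t _; apply: le_trans (mnD _ _) _; rewrite lerD2r; apply: le_trans (mnM _ _) _.
  by rewrite ler_wpM2r ?mn_ge0.
rewrite (riD hau hgn (lexx 0) xl') [X in _ <= X]addrC; apply: lerD => //; apply: (ri_mono (l := l)) => // t; exact: mn_ge0.
Qed.

Lemma ode_unique n p (A : R -> 'M[C]_n) (g U V : R -> 'M[C]_(n, p)) :
  mxintegrable l A -> mAC U (fun x => A x *m U x + g x) -> mAC V (fun x => A x *m V x + g x) ->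
  U 0 = V 0 -> forall x, 0 <= x <= l -> U x = V x.
Proof.
move=> hA hU hV h0 x xl.
have hD : mAC (fun x => U x - V x) (fun x => A x *m (U x - V x) + 0).
  by apply: mAC_ext (mACB hU hV) => // t _; rewrite addr0 mulmxBr opprD addrACA subrr addr0.
have := ode_bound hA (@mxI0 n p) (mxI_mn hA) (fun=> lexx _) hD xl.
have -> : ri (fun t => mn (0 : 'M[C]_(n, p))) 0 l = 0.
  by rewrite -[RHS](ri0 0 l); apply: ri_eq => t _; rewrite mn0.
rewrite h0 subrr mn0 addr0 mul0r => /mn_eq0 /eqP; rewrite subr_eq0 => /eqP //.
Qed.

Fixpoint picard n p (A : R -> 'M[C]_n) (g : R -> 'M[C]_(n, p)) (U0 : 'M[C]_(n, p)) (k : nat) : R -> 'M[C]_(n, p) :=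
  match k with
  | 0%N => fun _ => U0
  | k'.+1 => fun x => U0 + mxint (fun t => A t *m picard A g U0 k' t + g t) 0 x
  end.

Lemma picard_AC n p (A : R -> 'M[C]_n) (g : R -> 'M[C]_(n, p)) U0 k : mxintegrable l A -> mxintegrable l g ->
  exists f, mAC (picard A g U0 k) f.
Proof.
move=> hA hg; elim: k => [|k [f hf]] /=; first by exists (fun=> 0); exact: mAC_cst.
exists (fun t => 0 + (A t *m picard A g U0 k t + g t)).
apply: mACD; first exact: mAC_cst.
by apply: mAC_primitive; apply: mxID => //; exact: mxI_mul hf.
Qed.

(** The rate 2^-k has a constant depending on A only through the majorant [al]. For the system with
    parameter lambda, one majorant serves a whole disc, so convergence is uniform in lambda
    there. *)
Lemma picard_cvg n p (A : R -> 'M[C]_n) (g : R -> 'M[C]_(n, p)) U0 (al : R -> R) :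
  mxintegrable l A -> mxintegrable l g -> rI l al -> (forall x, mn (A x) <= al x) ->
  exists U, [/\ mAC U (fun x => A x *m U x + g x), U 0 = U0 &
    forall k x, 0 <= x <= l -> mn (U x - picard A g U0 k x) <=
      8 * (n * p)%:R * (mn U0 * ri al 0 l + ri (fun t => mn (g t)) 0 l) * wexp al l * 2^-1 ^+ k].
Proof.
move=> hA hg hal hAal; have al0 t : 0 <= al t by apply: le_trans (hAal t); exact: mn_ge0.
pose P := picard A g U0; pose w := wexp al.
have hgn := mxI_mn hg; have hAn := mxI_mn hA.
have hAP k : mxintegrable l (fun t => A t *m P k t + g t).
  by have [f hf] := picard_AC U0 k hA hg; apply: mxID => //; exact: mxI_mul hf.
set c := mn U0 * ri al 0 l + ri (fun t => mn (g t)) 0 l.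
have c0 : 0 <= c.
  by rewrite /c addr_ge0 ?mulr_ge0 ?mn_ge0 ?ri_ge0// => t _; exact: mn_ge0.
have w0 x : 0 <= w x by exact: wexp_ge0.
have Iw := wexp_I l0 hal.
have dif k x : 0 <= x <= l -> mn (P k.+1 x - P k x) <= c * 2^-1 ^+ k * w x.
  elim: k x => [|k IH] x /[dup] xl /andP[x0 xl'].
    rewrite /P /= addrAC subrr add0r expr0 mulr1.
    apply: (@le_trans _ _ c); last by rewrite ler_peMr// wexp_ge1.
    apply: le_trans (mn_mxint (hAP 0%N) _ xl') _ => //.
    apply: (@le_trans _ _ (ri (fun t => mn U0 * al t + mn (g t)) 0 x)).
      apply: (ri_le (l := l)) => //; [exact/mxI_mn/(hAP 0%N)|by apply: rID => //; exact: rIZ|].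
      move=> t _; apply: le_trans (mnD _ _) _; rewrite lerD2r; apply: le_trans (mnM _ _) _.
      by rewrite mulrC ler_wpM2l ?mn_ge0.
    have Iz : rI l (fun t => mn U0 * al t) by exact: rIZ.
    rewrite (riD Iz hgn (lexx 0) xl') (riZ _ hal (lexx 0) xl') /c lerD// ?ler_wpM2l ?mn_ge0//.
      exact: (ri_mono (l := l)).
    by apply: (ri_mono (l := l)) => // t; exact: mn_ge0.
  have E : P k.+2 x - P k.+1 x = mxint (fun t => A t *m (P k.+1 t - P k t)) 0 x.
    have PS m y : P m.+1 y = U0 + mxint (fun t => A t *m P m t + g t) 0 y by [].
    rewrite (PS k.+1) (PS k x) opprD addrACA subrr add0r.
    apply/matrixP => i j; rewrite !mxE -(cintB (l := l))//; [|exact: hAP|exact: hAP].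
    apply: cint_eq => t _; have := mulmxBr (A t) (P k.+1 t) (P k t) => /matrixP/(_ i j).
    by rewrite !mxE => ->; ring.
  have [f hf] := picard_AC U0 k hA hg; have [f' hf'] := picard_AC U0 k.+1 hA hg.
  have hI : mxintegrable l (fun t => A t *m (P k.+1 t - P k t)) by exact: mxI_mul (mACB hf' hf).
  rewrite E; apply: le_trans (mn_mxint hI _ xl') _ => //.
  apply: (@le_trans _ _ (ri (fun t => c * 2^-1 ^+ k * (al t * w t)) 0 x)).
    apply: (ri_le (l := l)) => //; [exact: mxI_mn|exact: rIZ|].
    move=> t /andP[t0 tx]; apply: le_trans (mnM _ _) _; rewrite mulrCA.
    by apply: ler_pM; rewrite ?mn_ge0// IH// t0 (le_trans tx).
  rewrite (riZ (l := l))//; have := wexp_int l0 hal xl.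
  have ck : 0 <= c * 2^-1 ^+ k by rewrite mulr_ge0.
  rewrite exprS => h; apply: le_trans (ler_wpM2l ck h) _; rewrite -/w.
  rewrite (_ : c * (2^-1 * 2^-1 ^+ k) * w x = c * 2^-1 ^+ k * (w x / 2)); last by field.
  by rewrite ler_wpM2l//; lra.
have cau x : 0 <= x <= l -> forall k m, (k <= m)%N -> mn (P k x - P m x) <= 2 * c * w l * 2^-1 ^+ k.
  move=> xl k m km; suff : mn (P k x - P m x) <= 2 * c * w l * (2^-1 ^+ k - 2^-1 ^+ m).
    move/le_trans; apply; rewrite ler_wpM2l ?mulr_ge0// gerBl.
    by rewrite exprn_ge0.
  rewrite -(subnKC km); elim: (m - k)%N => [|j IH].
    by rewrite addn0 !subrr mn0 mulr0.
  rewrite addnS; have -> : P k x - P (k + j).+1 x = (P k x - P (k + j)%N x) - (P (k + j).+1 x - P (k + j)%N x).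
    by rewrite opprB addrA subrK.
  apply: le_trans (mnB _ _) _; have h := dif (k + j)%N x xl.
  have h' : c * 2^-1 ^+ (k + j) * w x <= c * 2^-1 ^+ (k + j) * w l.
    by rewrite ler_wpM2l ?mulr_ge0// wexp_le.
  rewrite exprS; move: IH h h'; move: (2^-1 ^+ k) (2^-1 ^+ (k + j)) => u v; lra.
have lim0 (x : R) i j : exists z : C, 0 <= x <= l -> forall k, cabs (P k x i j - z) <= 2 * (2 * c * w l * 2^-1 ^+ k).
  have [xl|nxl] := pselect (0 <= x <= l); last by exists 0 => /nxl.
  have [|z hz] := @climit R (fun k => P k x i j) (fun k => 2 * c * w l * 2^-1 ^+ k) 0.
    move=> k m _ km; apply: le_trans (cau x xl k m km); apply: le_trans (cabs_le_cn1 _) _.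
    by apply: le_trans (mn_entry _ i j); rewrite !mxE.
  by exists z => _ k; exact: hz.
have [Uf hUf] : exists Uf : R -> 'I_n -> 'I_p -> C, forall x i j, 0 <= x <= l -> forall k,
    cabs (P k x i j - Uf x i j) <= 2 * (2 * c * w l * 2^-1 ^+ k).
  exists (fun x i j => projT1 (cid (lim0 x i j))) => x i j; exact: (projT2 (cid (lim0 x i j))).
(* The entries of [Uf] are chosen pointwise and are arbitrary off [0, l]; the value at 0 is set
   explicitly so that the initial condition holds by definition. *)
pose U x : 'M[C]_(n, p) := if x == 0 then U0 else \matrix_(i, j) Uf x i j.
have W0 : 0 <= c * w l by rewrite mulr_ge0.
(* The 8 is a product of three twos: the geometric tail, the loss in [climit], and [cn1] being at
   most twice the modulus. *)
have near k x : 0 <= x <= l -> mn (U x - P k x) <= 8 * (n * p)%:R * c * w l * 2^-1 ^+ k.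
  move=> xl; rewrite /U; case: eqP => [x0|_].
    have -> : P k x = U0 by rewrite x0 /P; case: k => //= k; rewrite mxint0r addr0.
    by rewrite subrr mn0 !mulr_ge0.
  rewrite /mn; apply: (@le_trans _ _ (\sum_(i < n) \sum_(j < p) (8 * (c * w l * 2^-1 ^+ k)))).
    apply: ler_sum => i _; apply: ler_sum => j _; rewrite !mxE.
    apply: le_trans (cn1_le_cabs _) _; have := hUf x i j xl k; rewrite cabs_dist; lra.
  rewrite !sumr_const !card_ord -mulrnA -mulr_natr mulnC; lra.
(* Measurability of the pointwise limit makes A U integrable, which the integral equation for U
   presupposes. *)
have mU i j : cmeasurable l (fun x => U x i j).
  have Pm k : cmeasurable l (fun x => P k x i j).
    by have [f hf] := picard_AC U0 k hA hg; have [h1 h2] := hf i j; split; [exact: (rAC_meas l0 h1)|exact: (rAC_meas l0 h2)].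
  have cv (pr : C -> R) : (forall z z', `|pr z - pr z'| <= cabs (z - z')) -> forall x, seg l x ->
      (fun k => pr (P k x i j)) @ \oo --> pr (U x i j).
    move=> hpr x /segP xl; apply/cvgrPdist_lt => e e0.
    have [N hN] := geo_half_lt (8 * (n * p)%:R * c * w l) e0.
    exists N => // k /= Nk; apply: le_lt_trans hN; apply: le_trans (hpr _ _) _.
    apply: le_trans (cabs_le_cn1 _) _; apply: (@le_trans _ _ (mn (U x - P k x))).
      by apply: le_trans (mn_entry _ i j); rewrite !mxE.
    apply: le_trans (near k x xl) _; rewrite ler_wpM2l ?mulr_ge0//.
    by rewrite -(subnK Nk) exprD ler_piMl ?exprn_ge0// exprn_ile1// invf_le1// ler1n.
  split.
    apply: (@measurable_fun_cvg _ _ _ (seg l) (fun k x => complex.Re (P k x i j))) => [k|].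
      by have [] := Pm k.
    by apply: cv => z z'; rewrite -cReN -cReD Re_le_cabs.
  apply: (@measurable_fun_cvg _ _ _ (seg l) (fun k x => complex.Im (P k x i j))) => [k|].
    by have [] := Pm k.
  by apply: cv => z z'; rewrite -cImN -cImD Im_le_cabs.
have [M M0 hM] : exists2 M : R, 0 <= M & forall x, 0 <= x <= l -> mn (U x) <= M.
  exists (mn U0 + 8 * (n * p)%:R * c * w l); first by rewrite addr_ge0 ?mn_ge0 ?mulr_ge0.
  move=> x xl; have -> : U x = P 0%N x + (U x - P 0%N x) by rewrite addrC subrK.
  apply: le_trans (mnD _ _) _; rewrite lerD2l; apply: le_trans (near 0%N x xl) _.
  by rewrite expr0 mulr1.
have hAU : mxintegrable l (fun x => A x *m U x).
  have bU k j x : seg l x -> cn1 (U x k j) <= M.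
    by move=> /segP xl; apply: le_trans (hM x xl); exact: mn_entry.
  move=> i j; apply: cI_eq (cI_sum (index_enum 'I_n) (fun k => cI_mulb (hA i k) (mU k j) (bU k j))) => x.
  by rewrite mxE.
have hAUg := mxID hAU hg.
exists U; split.
- apply/mACP; split => // x /segP /[dup] xl /andP[x0 xl'].
  have -> : U 0 = U0 by rewrite /U eqxx.
  apply/eqP; rewrite -subr_eq0; apply/eqP/mn_eq0.
  pose K := 8 * (n * p)%:R * c * w l.
  apply: (@le0_of_geo _ _ (K + K * ri al 0 x) 0) => k _.
  have hI : mxintegrable l (fun t => A t *m (U t - P k t)).
    have [f hf] := picard_AC U0 k hA hg.
    by apply: mxI_eq (mxIB hAU (mxI_mul hA hf)) => t; rewrite mulmxBr.
  have -> : U x - (U0 + mxint (fun t => A t *m U t + g t) 0 x) =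
      (U x - P k.+1 x) - mxint (fun t => A t *m (U t - P k t)) 0 x.
    have PS m y : P m.+1 y = U0 + mxint (fun t => A t *m P m t + g t) 0 y by [].
    have -> : mxint (fun t => A t *m (U t - P k t)) 0 x =
        mxint (fun t => A t *m U t + g t) 0 x - mxint (fun t => A t *m P k t + g t) 0 x.
      apply/matrixP => i j; rewrite !mxE -(cintB (hAUg i j) (hAP k i j) (lexx 0) xl').
      apply: cint_eq => t _; have := mulmxBr (A t) (U t) (P k t) => /matrixP/(_ i j).
      by rewrite !mxE => ->; ring.
    rewrite PS; apply/matrixP => i j; rewrite !mxE; ring.
  apply: le_trans (mnB _ _) _; rewrite mulrDl; apply: lerD.
    apply: le_trans (near k.+1 x xl) _; rewrite -/K ler_wpM2l ?mulr_ge0// exprS.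
    by rewrite ler_piMl ?exprn_ge0// invf_le1// ler1n.
  apply: le_trans (mn_mxint hI _ xl') _ => //.
  apply: (@le_trans _ _ (ri (fun t => K * 2^-1 ^+ k * al t) 0 x)).
    apply: (ri_le (l := l)) => //; [exact: mxI_mn|exact: rIZ|].
    move=> t /andP[t0 tx]; apply: le_trans (mnM _ _) _; rewrite mulrC.
    by apply: ler_pM; rewrite ?mn_ge0// near// t0 (le_trans tx).
  by rewrite (riZ _ hal (lexx 0) xl') mulrAC.
- by rewrite /U eqxx.
- by move=> k x xl; apply: le_trans (near k x xl) _; rewrite /c /w -!mulrA.
Qed.

End LinearODE.

Section MatrixIntegral.
Variables (R : realType) (l : R).
Local Notation C := R[i].

Lemma mxintD m p (f g : R -> 'M[C]_(m, p)) x : mxintegrable l f -> mxintegrable l g -> 0 <= x <= l ->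
  mxint (fun t => f t + g t) 0 x = mxint f 0 x + mxint g 0 x.
Proof.
move=> hf hg /andP[x0 xl]; apply/matrixP => i j; rewrite !mxE -(cintD (hf i j) (hg i j) (lexx 0) xl).
by apply: cint_eq => t _; rewrite mxE.
Qed.

Lemma mxintB m p (f g : R -> 'M[C]_(m, p)) x : mxintegrable l f -> mxintegrable l g -> 0 <= x <= l ->
  mxint (fun t => f t - g t) 0 x = mxint f 0 x - mxint g 0 x.
Proof.
move=> hf hg /andP[x0 xl]; apply/matrixP => i j; rewrite !mxE -(cintB (hf i j) (hg i j) (lexx 0) xl).
by apply: cint_eq => t _; rewrite !mxE.
Qed.

Lemma mxintZ m p (z : C) (f : R -> 'M[C]_(m, p)) x : mxintegrable l f -> 0 <= x <= l ->
  mxint (fun t => z *: f t) 0 x = z *: mxint f 0 x.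
Proof.
move=> hf /andP[x0 xl]; apply/matrixP => i j; rewrite !mxE -(cintZ z (hf i j) (lexx 0) xl).
by apply: cint_eq => t _; rewrite mxE.
Qed.

Lemma mxI_sum m p (I : Type) (s : seq I) (F : I -> R -> 'M[C]_(m, p)) : (forall i, mxintegrable l (F i)) ->
  mxintegrable l (fun x => \sum_(i <- s) F i x).
Proof. by move=> h i j; apply: cI_eq (cI_sum s (fun k => h k i j)) => x; rewrite summxE. Qed.

Lemma mxint_sum m p (I : Type) (s : seq I) (F : I -> R -> 'M[C]_(m, p)) x : (forall i, mxintegrable l (F i)) ->
  0 <= x <= l -> mxint (fun t => \sum_(i <- s) F i t) 0 x = \sum_(i <- s) mxint (F i) 0 x.
Proof.
move=> h xl; elim: s => [|i s IH].
  rewrite big_nil; apply/matrixP => i j; rewrite !mxE -[RHS](cint0 0 x); apply: cint_eq => t _.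
  by rewrite big_nil mxE.
rewrite big_cons -IH -mxintD//; last exact: mxI_sum.
by apply/matrixP => a b; rewrite !mxE; apply: cint_eq => t _; rewrite big_cons.
Qed.

Lemma mxint_eq m p (f g : R -> 'M[C]_(m, p)) x : (forall t, 0 <= t <= x -> f t = g t) ->
  mxint f 0 x = mxint g 0 x.
Proof. by move=> h; apply/matrixP => i j; rewrite !mxE; apply: cint_eq => t /h ->. Qed.

End MatrixIntegral.

(** * The fundamental matrix and its dependence on lambda *)

Section Fundamental.
Variables (R : realType) (l : R) (n : nat).
Hypothesis l0 : 0 <= l.
Variables (beta : 'I_n -> R -> R) (Q : R -> 'M[R[i]]_n).
Hypotheses (Ib : forall k, rI l (beta k)) (IQ : mxintegrable l Q).
Local Notation C := R[i].

Definition Amx (lam : C) (t : R) : 'M[C]_n := ('i * lam) *: Bmx beta t - Q t.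

Lemma mxI_B : mxintegrable l (Bmx beta).
Proof.
move=> j k; case: (boolP (j == k)) => jk.
  by apply: cI_eq (cI_real (Ib j)) => x; rewrite mxE jk.
by apply: cI_eq (cI0 l) => x; rewrite mxE (negbTE jk).
Qed.

Lemma mxI_A lam : mxintegrable l (Amx lam).
Proof. by apply: mxIB => //; apply: mxIZ; exact: mxI_B. Qed.

Definition Abound (r : R) (t : R) : R := r * mn (Bmx beta t) + mn (Q t).

Lemma rI_Abound r : rI l (Abound r).
Proof. by apply: rID; [apply: rIZ; apply: mxI_mn; exact: mxI_B|exact: mxI_mn]. Qed.

Lemma cn1_i (z : C) : cn1 ('i * z) = cn1 z.
Proof. by case: z => a b; rewrite /cn1 /= !mul0r !mul1r sub0r add0r normrN addrC. Qed.

Lemma Abound_le lam r t : cn1 lam <= r -> mn (Amx lam t) <= Abound r t.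
Proof.
move=> h; apply: le_trans (mnB _ _) _; rewrite lerD2r; apply: le_trans (mnZ _ _) _.
by rewrite cn1_i ler_wpM2r ?mn_ge0.
Qed.

Lemma fundamentalP lam (Phi : R -> 'M[C]_n) : is_fundamental beta Q l lam Phi <->
  mAC l Phi (fun t => Amx lam t *m Phi t) /\ Phi 0 = 1%:M.
Proof.
have s0 : seg l 0 by apply/segP; rewrite lexx.
split=> [[h1 h2]|[/mACP[h1 h2] h0]].
  have h0 : Phi 0 = 1%:M by rewrite (h2 0 s0) mxint0r addr0.
  split => //; apply/mACP; split => // x xl; by rewrite {1}h2// h0.
by split => // x xl; rewrite -h0; exact: h2.
Qed.

Lemma ivp_exists p lam (g : R -> 'M[C]_(n, p)) (U0 : 'M[C]_(n, p)) : mxintegrable l g ->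
  exists U, mAC l U (fun t => Amx lam t *m U t + g t) /\ U 0 = U0.
Proof.
move=> hg; have [U [h1 h2 _]] := picard_cvg l0 U0 (mxI_A lam) hg (rI_Abound (cn1 lam)) (fun t => Abound_le t (lexx _)).
by exists U.
Qed.

Lemma PhiQ_fundamental lam : is_fundamental beta Q l lam (PhiQ beta Q l lam).
Proof.
apply: ClassicalEpsilon.epsilon_spec.
have [U [h1 h2]] := ivp_exists lam (1%:M : 'M[C]_n) (@mxI0 R l n n).
exists U; apply/fundamentalP; split => //.
by apply: (mAC_ext l0 _ _ h1) => // x _; rewrite addr0.
Qed.

Lemma PhiQ_AC lam : mAC l (PhiQ beta Q l lam) (fun t => Amx lam t *m PhiQ beta Q l lam t).
Proof. by have /fundamentalP[] := PhiQ_fundamental lam. Qed.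

Lemma PhiQ_0 lam : PhiQ beta Q l lam 0 = 1%:M.
Proof. by have /fundamentalP[] := PhiQ_fundamental lam. Qed.

Lemma PhiQ_unique lam (U : R -> 'M[C]_n) x : mAC l U (fun t => Amx lam t *m U t) -> U 0 = 1%:M ->
  0 <= x <= l -> PhiQ beta Q l lam x = U x.
Proof.
move=> hU U0 xl; apply: (ode_unique l0 (g := fun=> 0) (mxI_A lam)) xl; rewrite ?PhiQ_0//.
  by apply: (mAC_ext l0 _ _ (PhiQ_AC lam)) => // t _; rewrite addr0.
by apply: (mAC_ext l0 _ _ hU) => // t _; rewrite addr0.
Qed.

(** One Picard step applies i lambda B, which raises the degree in lambda by one, and -Q, which
    keeps it; the coefficients c m are functions of x alone. Carrying an infinite family that
    vanishes beyond k spares index bookkeeping. *)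
Lemma picard_poly k : exists c : nat -> R -> 'M[C]_n,
  [/\ forall m, exists f, mAC l (c m) f, forall m x, (k < m)%N -> c m x = 0 &
   forall lam x, 0 <= x <= l -> picard (Amx lam) (fun=> 0) 1%:M k x = \sum_(m < k.+1) lam ^+ m *: c m x].
Proof.
elim: k => [|k [c [cAC c0 cE]]].
  exists (fun m _ => if m is 0%N then 1%:M else 0); split => [[|m]|[]//|lam x xl].
  - by exists (fun=> 0); exact: mAC_cst.
  - by exists (fun=> 0); exact: mAC_cst.
  - by rewrite /= big_ord_recl big_ord0 addr0 expr0 scale1r.
have IBc m : mxintegrable l (fun t => 'i *: (Bmx beta t *m c m t)).
  by have [f hf] := cAC m; apply: mxIZ; exact: mxI_mul mxI_B hf.
have IQc m : mxintegrable l (fun t => Q t *m c m t).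
  by have [f hf] := cAC m; exact: mxI_mul IQ hf.
pose c1 m x := if m is m'.+1 then mxint (fun t => 'i *: (Bmx beta t *m c m' t)) 0 x else 1%:M.
pose c2 m x := mxint (fun t => Q t *m c m t) 0 x.
exists (fun m x => c1 m x - c2 m x); split.
- move=> m; have h2 : mAC l (c2 m) _ := mAC_primitive l0 (IQc m).
  case: m h2 => [|m] h2.
    by exists (fun t => 0 - Q t *m c 0%N t); apply: mACB => //; exact: mAC_cst.
  exists (fun t => 'i *: (Bmx beta t *m c m t) - Q t *m c m.+1 t).
  by apply: mACB => //; exact: mAC_primitive.
- move=> [|m] x //= km; rewrite /c2.
  rewrite [X in X - _](_ : _ = 0) ?[X in _ - X](_ : _ = 0) ?subr0//.
    apply/matrixP => i j; rewrite !mxE -[RHS](cint0 0 x); apply: cint_eq => t _.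
    by rewrite c0 ?mulmx0 ?mxE// ltnW.
  apply/matrixP => i j; rewrite !mxE -[RHS](cint0 0 x); apply: cint_eq => t _.
  by rewrite c0 ?mulmx0 ?scaler0 ?mxE.
move=> lam x /[dup] xl /andP[x0 xl'].
rewrite [LHS]/=; have -> : mxint (fun t => Amx lam t *m picard (Amx lam) (fun=> 0) 1%:M k t + 0) 0 x =
    mxint (fun t => \sum_(m < k.+1) (lam ^+ m.+1 *: ('i *: (Bmx beta t *m c m t)) - lam ^+ m *: (Q t *m c m t))) 0 x.
  apply: mxint_eq => t /andP[t0 tx]; rewrite addr0 cE ?t0 ?(le_trans tx)// mulmx_sumr.
  apply: eq_bigr => m _; rewrite /Amx -scalemxAr mulmxBl scalerBr -!scalemxAl !scalerA.
  by congr (_ - _); congr (_ *: _); rewrite exprS; ring.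
rewrite (mxint_sum (l := l))//; last by move=> m; apply: mxIB; exact: mxIZ.
rewrite (eq_bigr (fun m : 'I_k.+1 => lam ^+ m.+1 *: c1 m.+1 x - lam ^+ m *: c2 m x)); last first.
  move=> m _; rewrite (mxintB (l := l))//; [|exact: mxIZ|exact: mxIZ].
  by rewrite (mxintZ _ (IBc m) xl) (mxintZ _ (IQc m) xl).
rewrite sumrB [RHS](eq_bigr (fun m : 'I_k.+2 => lam ^+ m *: c1 m x - lam ^+ m *: c2 m x)); last first.
  by move=> m _; rewrite scalerBr.
rewrite sumrB addrA; congr (_ - _).
  by rewrite [RHS]big_ord_recl /= expr0 scale1r; congr (_ + _); apply: eq_bigr => m _.
rewrite [RHS]big_ord_recr /=; rewrite [X in _ = _ + X](_ : _ = 0) ?addr0//.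
rewrite [c2 _ _](_ : _ = 0) ?scaler0//.
apply/matrixP => i j; rewrite !mxE -[RHS](cint0 0 x); apply: cint_eq => t _.
by rewrite c0 ?mulmx0 ?mxE.
Qed.

Lemma PhiQ_entire x i j : 0 <= x <= l -> entire (fun lam => PhiQ beta Q l lam x i j).
Proof.
(* [Abound] is stated for [cn1], which is at most twice the modulus; hence the radius 2 r. *)
move=> xl r e e0; pose al := Abound (2 * r).
pose K := 8 * (n * n)%:R * (mn (1%:M : 'M[C]_n) * ri al 0 l + ri (fun t => mn (0 : 'M[C]_n)) 0 l) * wexp al l.
have [k hk] := geo_half_lt K e0; have [c [cAC c0 cE]] := picard_poly k.
exists (\poly_(m < k.+1) c m x i j) => lam hlam.
have hl : cn1 lam <= 2 * r by apply: le_trans (cn1_le_cabs _) _; rewrite ler_wpM2l.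
have [U [hU U0 hUk]] := picard_cvg l0 1%:M (mxI_A lam) (@mxI0 R l n n) (rI_Abound (2 * r)) (fun t => Abound_le t hl).
have hU' : mAC l U (fun t => Amx lam t *m U t).
  by apply: (mAC_ext l0 _ _ hU) => // t _; rewrite addr0.
rewrite (PhiQ_unique hU' U0 xl); apply: le_lt_trans hk; apply: le_trans (hUk k x xl).
rewrite cabs_dist; apply: le_trans (cabs_le_cn1 _) _; apply: le_trans (mn_entry _ i j).
have -> // : (U x - picard (Amx lam) (fun=> 0) 1%:M k x) i j = U x i j - (\poly_(m < k.+1) c m x i j).[lam].
rewrite !mxE cE// summxE horner_poly; congr (_ - _).
by apply: eq_bigr => m _; rewrite mxE mulrC.
Qed.

Lemma DeltaQ_entire (CC D : 'M[C]_n) : entire (DeltaQ beta Q l CC D).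
Proof.
apply: (@entire_ext _ (fun lam => \det (\matrix_(i, j) (CC i j + \sum_k D i k * PhiQ beta Q l lam l k j)))).
  by move=> lam; congr (\det _); apply/matrixP => i j; rewrite !mxE.
apply: entire_det => i j; apply: entireD; first exact: entire_cst.
by apply: entire_sum => k; apply: entireM; [exact: entire_cst|apply: PhiQ_entire; rewrite l0 lexx].
Qed.

End Fundamental.

Section FreeSystem.
Variables (R : realType) (l : R) (n : nat).
Hypothesis l0 : 0 <= l.
Variables (beta : 'I_n -> R -> R).
Hypotheses (Ib : forall k, rI l (beta k)).
Local Notation C := R[i].

Lemma PhiQ_free lam : PhiQ beta (fun=> 0) l lam l = Phi0l beta l lam.
Proof.
pose U x : 'M[C]_n := \matrix_(j, k) (if j == k then cexp ('i * lam * (ri (beta k) 0 x)%:C) else 0).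
have -> : Phi0l beta l lam = U l by [].
apply: (PhiQ_unique l0 Ib (@mxI0 R l n n)); last by rewrite l0 lexx.
  move=> j k; case: (eqVneq j k) => [->|jk].
    have hr : rAC l (fun x => ri (beta k) 0 x) (beta k) by split => // x _; rewrite ri_xx add0r.
    apply: (cAC_ext l0 _ _ (cAC_cexp l0 ('i * lam) hr)) => x _; first by rewrite mxE eqxx.
    rewrite mxE (bigD1 k)//= big1 ?addr0 => [|m mk].
      by rewrite !mxE eqxx subr0.
    by rewrite !mxE (negbTE mk) mulr0.
  apply: (cAC_ext l0 _ _ (cAC_cst l 0)) => x _; first by rewrite mxE (negbTE jk).
  rewrite mxE big1// => m _; rewrite !mxE; case: (eqVneq j m) => [<-|_]; last by rewrite mulr0 subrr mul0r.
  by rewrite (negbTE jk) mulr0.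
apply/matrixP => j k; rewrite !mxE ri_xx mulr0 cexp0; by case: eqP.
Qed.

Lemma Delta0E (CC D : 'M[C]_n) : Delta0 beta l CC D =1 DeltaQ beta (fun=> 0) l CC D.
Proof. by move=> lam; rewrite /Delta0 /DeltaQ PhiQ_free. Qed.

Lemma Delta0_entire (CC D : 'M[C]_n) : entire (Delta0 beta l CC D).
Proof.
apply: entire_ext (DeltaQ_entire l0 Ib (@mxI0 R l n n) CC D) => lam.
by rewrite Delta0E.
Qed.

End FreeSystem.

(** The exponential is the fundamental solution of the scalar free system on [0, 1] with constant
    beta equal to b, so [PhiQ_entire] already contains the claim. *)
Lemma entire_cexp (R : realType) (b : R) : entire (fun lam : R[i] => cexp ('i * lam * b%:C)).
Proof.
pose beta (k : 'I_1) (x : R) := b.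
have Ib k : rI 1 (beta k) by exact: rI_cst.
apply: entire_ext (PhiQ_entire ler01 Ib (@mxI0 R 1 1 1) ord0 ord0 (x := 1) _) => [lam|]; last by rewrite ler01 lexx.
rewrite (PhiQ_free ler01 Ib) mxE eqxx; congr (cexp (_ * _%:C)).
by rewrite /bk /Rintegral /beta integral_cst//= lebesgue_measure_itv /= lte_fin ltr01 oppr0 adde0 mule1.
Qed.

(** * Asymptotics of fundamental solutions in the half-plane *)

Section StepApproximation.
Variables (R : realType) (l : R).
Hypothesis l0 : 0 < l.
Local Notation mu := (@lebesgue_measure R).

Lemma unif_cont (h : R -> R) (B e : R) : continuous h -> 0 < e ->
  exists2 d : R, 0 < d & forall x y, `|x| <= B -> `|y - x| < d -> `|h y - h x| < e.
Proof.
move=> hc e0.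
have [||d d0 hd] := @box_cover R 1 B (fun v d => forall y, `|y - v 0 0| < d -> `|h y - h (v 0 0)| < e).
- by move=> v m m' mm hv y hy; apply: hv; exact: lt_le_trans mm.
- move=> v _; have e2 : 0 < e / 2 by rewrite divr_gt0.
  have /cvgrPdist_lt/(_ _ e2)/nbhs_ballP[d /= d0 hd] := hc (v 0 0).
  exists (d / 2); first by rewrite divr_gt0.
  exists (d / 2); first by rewrite divr_gt0.
  move=> v' hv' _ y hy; have h1 := hv' 0.
  have k1 : `|h (v 0 0) - h y| < e / 2.
    apply: hd; rewrite /ball /= distrC; have -> : y - v 0 0 = (y - v' 0 0) + (v' 0 0 - v 0 0) by ring.
    by apply: le_lt_trans (ler_normD _ _) _; lra.
  have k2 : `|h (v 0 0) - h (v' 0 0)| < e / 2.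
    by apply: hd; rewrite /ball /= distrC; lra.
  have -> : h y - h (v' 0 0) = (h (v 0 0) - h (v' 0 0)) - (h (v 0 0) - h y) by ring.
  by apply: le_lt_trans (ler_normB _ _) _; lra.
exists d => // x y xB hy; pose v : 'rV[R]_1 := \row_i x.
have hv i : `|v 0 i| <= B by rewrite mxE.
by have := hd v hv y; rewrite mxE; exact.
Qed.

Definition node (N i : nat) : R := i%:R * (l / N%:R).

Lemma nodeP N i : (i < N)%N -> [/\ 0 <= node N i, node N i <= node N i.+1, node N i.+1 <= l & node N i.+1 - node N i = l / N%:R].
Proof.
move=> iN; have N0 : 0 < N%:R :> R by rewrite ltr0n; case: N iN.
have lN : 0 <= l / N%:R by rewrite divr_ge0 ?ltW.
split.
- by rewrite mulr_ge0.
- by rewrite ler_wpM2r// ler_nat.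
- by rewrite /node mulrA ler_pdivrMr// mulrC ler_wpM2l ?(ltW l0)// ler_nat.
- by rewrite /node -mulrBl -natrB// subSnn mul1r.
Qed.

Lemma node0 N : node N 0 = 0. Proof. by rewrite /node mul0r. Qed.
Lemma nodeN N : (0 < N)%N -> node N N = l.
Proof. by move=> N0; rewrite /node mulrC divfK// pnatr_eq0 -lt0n. Qed.

Lemma ri_nodes (f : R -> R) N : (0 < N)%N -> rI l f ->
  \sum_(i < N) ri f (node N i) (node N i.+1) = ri f 0 l.
Proof.
move=> N0 hf; suff H m : (m <= N)%N -> \sum_(i < m) ri f (node N i) (node N i.+1) = ri f 0 (node N m).
  by rewrite H// nodeN.
elim: m => [|m IH] hm; first by rewrite big_ord0 node0 ri_xx.
rewrite big_ord_recr /= IH ?(ltnW hm)//; have [a b c _] := nodeP hm.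
exact: (ri_chasles hf (lexx 0) a b c).
Qed.

Lemma cint_nodes (f : R -> R[i]) N : (0 < N)%N -> cintegrable l f ->
  \sum_(i < N) cint f (node N i) (node N i.+1) = cint f 0 l.
Proof.
move=> N0 [f1 f2]; rewrite cintE -!(ri_nodes N0)//.
by apply: cplxP; rewrite ?cRe_sum ?cIm_sum.
Qed.

Lemma continuous_approx (f : R -> R) (e : R) : rI l f -> 0 < e -> exists h : R -> R,
  [/\ continuous h, rI l h & ri (fun x => `|f x - h x|) 0 l < e].
Proof.
move=> hf e0.
have fin : (mu (seg l) < +oo)%E.
  by rewrite /seg lebesgue_measure_itv /=; case: ifP => _; rewrite ?ltry// -EFinD ltry.
have [g [gc gi /cvg_ballP hg]] := approximation_continuous_integrable (mI 0 l) fin hf.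

have /fine_cvgP[/= fin0 /cvgrPdist_lt/(_ e e0) h2] : (\int[mu]_(z in seg l) `|(f z - g n z)%:E|)%E @[n --> \oo] --> (0 : R)%:E.
  by apply/cvg_ballP.
have [N _ hN] := h2.
exists (g N); split; [exact: gc|exact: gi|].
have := hN N (leqnn N); rewrite /= sub0r normrN ger0_norm//; first last.
  by apply: fine_ge0; apply: integral_ge0.
Qed.

(** Real and imaginary parts are first replaced by continuous functions in the integral norm, at
    cost e/4 each; uniform continuity then allows sampling at the nodes, at cost e/2. *)
Lemma step_approx (g : R -> R[i]) (e : R) : cintegrable l g -> 0 < e ->
  exists N (c : nat -> R[i]), (0 < N)%N /\
    \sum_(i < N) ri (fun t => cn1 (g t - c i)) (node N i) (node N i.+1) <= e.
Proof.
move=> [g1 g2] e0; have e4 : 0 < e / 4 by rewrite divr_gt0.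
have [h [hc hI h1]] := continuous_approx g1 e4.
have [k [kc kI k1]] := continuous_approx g2 e4.
have el : 0 < e / (4 * l) by rewrite divr_gt0// mulr_gt0.
have [d d0 hd] := unif_cont l hc el; have [d' d'0 hd'] := unif_cont l kc el.
pose m := Num.min d d'; have m0 : 0 < m by rewrite lt_min d0.
pose N := (Num.Def.archi_bound (l / m)).+1.
have N0 : 0 < N%:R :> R by rewrite ltr0n.
have lm : 0 <= l / m by rewrite divr_ge0 ?ltW.
have hN : l / N%:R < m.
  rewrite ltr_pdivrMr// mulrC -ltr_pdivrMr//; apply: lt_le_trans (archi_boundP lm) _.
  by rewrite ler_nat.
exists N, (fun i => h (node N i) +i* k (node N i)); split => //.
pose F t := `|complex.Re (g t) - h t| + `|complex.Im (g t) - k t| + e / (2 * l).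
have I1 : rI l (fun t => `|complex.Re (g t) - h t|) by apply: rI_abs; exact: rIB.
have I2 : rI l (fun t => `|complex.Im (g t) - k t|) by apply: rI_abs; exact: rIB.
have IF : rI l F by apply: rID; [exact: rID|exact: rI_cst].
have -> : e = e / 4 + e / 4 + e / 2 by field.
apply: (@le_trans _ _ (ri F 0 l)); last first.
  rewrite (riD (rID I1 I2) (rI_cst l _) (lexx 0) (lexx l)) (riD I1 I2 (lexx 0) (lexx l)).
  apply: lerD; first by apply: lerD; exact: ltW.
  rewrite /ri Rintegral_cst//= lebesgue_measure_itv /= lte_fin l0 -EFinD subr0 /=.
  by rewrite le_eqVlt; apply/orP; left; apply/eqP; field; rewrite gt_eqF.
rewrite -(ri_nodes (ltn0Sn _ : 0 < N)%N IF); apply: ler_sum => i _.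
have [a b c dd] := nodeP (ltn_ord i).
have Ic : rI l (fun t => cn1 (g t - (h (node N i) +i* k (node N i)))).
  apply: cI_cn1; apply: cIB; first by split.
  by split; exact: rI_cst.
apply: (ri_le Ic IF a c) => t /andP[ta tb].
rewrite /cn1 /F cReD cImD cReN cImN /=.
have nB : `|node N i| <= l by rewrite ger0_norm//; lra.
have dt : `|t - node N i| < m.
  by rewrite ger0_norm ?subr_ge0//; apply: le_lt_trans hN; rewrite -dd lerB.
have md : m <= d by rewrite /m ge_min lexx.
have md' : m <= d' by rewrite /m ge_min lexx orbT.
have k3 := hd _ _ nB (lt_le_trans dt md).
have k4 := hd' _ _ nB (lt_le_trans dt md').
have tri (x y z : R) : `|x - z| <= `|x - y| + `|y - z|.
  by rewrite (_ : x - z = (x - y) + (y - z)) ?ler_normD//; ring.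
have t1 := tri (complex.Re (g t)) (h t) (h (node N i)).
have t2 := tri (complex.Im (g t)) (k t) (k (node N i)).
have -> : e / (2 * l) = e / (4 * l) + e / (4 * l) by field; rewrite gt_eqF.
lra.
Qed.

End StepApproximation.

(** * Systems with nonnegative phases, uniformly in the upper half-plane *)

Section ForwardSystem.
Variables (R : realType) (l : R).
Hypothesis l0 : 0 < l.
Local Notation C := R[i].
Variables (I : finType) (th : I -> R -> R) (q : I -> I -> R -> C).
Hypotheses (Ith : forall f, rI l (th f)) (th0 : forall f, ae_on l (fun x => 0 <= th f x)).
Hypothesis Iq : forall f g, cintegrable l (q f g).
Let l0' : 0 <= l := ltW l0.

Definition rho f (x : R) : R := ri (th f) 0 x.
Definition qsum (t : R) : R := \sum_f \sum_g cn1 (q f g t).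
(** A Gronwall bound for all solutions with initial entries at most 1, independent of lambda: each
    of the |I| propagators contributes a factor 2, because [cn1] is at most twice the modulus. *)
Definition Vbound : R := 2 * #|I|%:R * wexp (fun t => 2 * qsum t) l.

Lemma qsum_ge0 t : 0 <= qsum t.
Proof. by apply: sumr_ge0 => f _; apply: sumr_ge0 => g _; exact: cn1_ge0. Qed.

Lemma rI_qsum : rI l qsum.
Proof. by apply: rI_sum => f; apply: rI_sum => g; exact: cI_cn1. Qed.

Lemma Vbound_ge0 : 0 <= Vbound.
Proof. by rewrite !mulr_ge0// wexp_ge0. Qed.

Section Solution.
Variables (lam : C) (w : I -> R -> C).
Hypothesis hlam : 0 <= complex.Im lam.
Hypothesis hw : forall f, cAC l (w f) (fun t => 'i * lam * (th f t)%:C * w f t - \sum_g q f g t * w g t).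
Hypothesis w0 : forall f, cn1 (w f 0) <= 1.

(** The propagator of the f-th scalar equation from t to x. For t <= x and Im lambda >= 0 its
    modulus is at most 1, precisely because the phase density [th f] is nonnegative. *)
Definition KK f (x t : R) : C := cexp ('i * lam * (rho f x - rho f t)%:C).

Lemma KK_le f x t : 0 <= t -> t <= x -> x <= l -> cn1 (KK f x t) <= 2.
Proof.
move=> t0 tx xl; apply: le_trans (cn1_le_cabs _) _; rewrite cabs_cexp.
have -> : complex.Re ('i * lam * (rho f x - rho f t)%:C) = - (complex.Im lam * (rho f x - rho f t)).
  by case: lam => a b /=; ring.
have h : 0 <= rho f x - rho f t.
  have := @ri_chasles _ l (th f) 0 t x (Ith f) (lexx 0) t0 tx xl.
  rewrite /rho => <-; rewrite addrAC subrr add0r; exact: (ri_ge0_ae (l := l)).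
have : expR (- (complex.Im lam * (rho f x - rho f t))) <= 1.
  by rewrite -[X in _ <= X]expR0 ler_expR oppr_le0 mulr_ge0.
lra.
Qed.

Lemma KK_AC f x : cAC l (KK f x) (fun t => - ('i * lam * (th f t)%:C) * KK f x t).
Proof.
have hr : rAC l (rho f) (th f) by split => // y _; rewrite /rho ri_xx add0r.
have hr' := rACB l0' (rAC_cst l (rho f x)) hr.
apply: (cAC_ext l0' _ _ (cAC_cexp l0' ('i * lam) hr')) => // t _.
by rewrite /KK sub0r rmorphN mulrN.
Qed.

Lemma Kw_AC f g x : cAC l (fun t => KK f x t * w g t)
  (fun t => 'i * lam * (th g t - th f t)%:C * (KK f x t * w g t) - KK f x t * \sum_m q g m t * w m t).
Proof.
apply: (cAC_ext l0' _ _ (cACM l0' (KK_AC f x) (hw g))) => // t _.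
by rewrite rmorphB /=; ring.
Qed.

Lemma qw_I g : cintegrable l (fun t => \sum_m q g m t * w m t).
Proof. by apply: cI_sum => m; exact: (cI_mulAC l0' (Iq g m) (hw m)). Qed.

Lemma Kqw_I f g x : cintegrable l (fun t => KK f x t * \sum_m q g m t * w m t).
Proof. by apply: cI_eq (cI_mulAC l0' (qw_I g) (KK_AC f x)) => t; rewrite mulrC. Qed.

Lemma duhamel f x : 0 <= x <= l ->
  w f x = KK f x 0 * w f 0 - cint (fun t => KK f x t * \sum_m q f m t * w m t) 0 x.
Proof.
move=> /[dup] xl /andP[x0 xl']; have := cAC_diff (Kw_AC f f x) (lexx 0) x0 xl'.
rewrite {1}/KK subrr mulr0 cexp0 mul1r => /eqP; rewrite subr_eq => /eqP ->.
rewrite addrC; congr (_ + _); rewrite -(cintN (l := l))//; last exact: Kqw_I.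
by apply: cint_eq => t _; rewrite subrr mulr0 mul0r sub0r.
Qed.

Lemma w_bound x : 0 <= x <= l -> \sum_f cn1 (w f x) <= Vbound.
Proof.
pose al t := 2 * qsum t; have hal : rI l al by apply: rIZ; exact: rI_qsum.
have al0 t : 0 <= al t by rewrite mulr_ge0// qsum_ge0.
pose v t := \sum_f cn1 (w f t).
have [M [M0 hM]] : exists M : R, 0 <= M /\ forall f x, 0 <= x <= l -> cn1 (w f x) <= M.
  have hb f : exists M : R, 0 <= M /\ forall x, 0 <= x <= l -> cn1 (w f x) <= M.
    by have [M M0 hM] := cAC_bounded (hw f); exists M.
  have [Mf hMf] := choice hb; exists (\sum_f Mf f); split; first by apply: sumr_ge0 => f _; case: (hMf f).
  move=> f y yl; apply: le_trans ((hMf f).2 y yl) _; rewrite (bigD1 f)//= lerDl; apply: sumr_ge0 => g _; by case: (hMf g).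
have vM y : 0 <= y <= l -> v y <= #|I|%:R * M.
  move=> yl; apply: (@le_trans _ _ (\sum_(f : I) M)); first by apply: ler_sum => f _; exact: hM.
  by rewrite sumr_const mulr_natl.
have v0 y : 0 <= v y by apply: sumr_ge0 => f _; exact: cn1_ge0.
have mv : rM l v.
  apply: measurable_sum => f; have [h1 h2] := hw f.
  by apply: measurable_funD; apply: measurableT_comp => //; [exact: (rAC_meas l0' h1)|exact: (rAC_meas l0' h2)].
have Iav : rI l (fun t => al t * v t).
  by apply: (rI_mulb (M := #|I|%:R * M)) => // t /segP tl; rewrite ger0_norm//; exact: vM.
have KM0 : 0 <= #|I|%:R * M by rewrite mulr_ge0.
move=> xl; apply: (@le_trans _ _ (2 * #|I|%:R * wexp al x)); last first.
  by rewrite ler_wpM2l//; exact: wexp_le.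
apply: (gronwall l0' hal al0 (u := v) _ KM0 Iav vM) xl => // {}x /[dup] xl /andP[x0 xl'].
apply: (@le_trans _ _ (\sum_f (2 + ri (fun t => 2 * (\sum_m cn1 (q f m t)) * v t) 0 x))).
  apply: ler_sum => f _; rewrite (duhamel f xl); apply: le_trans (cn1B _ _) _; apply: lerD.
    by apply: le_trans (cn1M _ _) _; rewrite -[X in _ <= X]mulr1 ler_pM ?cn1_ge0// KK_le.
  apply: le_trans (cn1_cint (Kqw_I f f x) (lexx 0) xl') _.
  have Ir : rI l (fun t => 2 * (\sum_m cn1 (q f m t)) * v t).
    apply: (rI_mulb (M := #|I|%:R * M)) => //; last by move=> t /segP tl; rewrite ger0_norm//; exact: vM.
    by apply: rIZ; apply: rI_sum => m; exact: cI_cn1.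
  apply: (ri_le (l := l)) => //; first exact: cI_cn1 (Kqw_I f f x).
  move=> t /andP[t0 tx]; apply: le_trans (cn1M _ _) _; rewrite -mulrA; apply: ler_pM; rewrite ?cn1_ge0 ?KK_le//.
  apply: le_trans (cn1_sum _ _) _; rewrite mulr_suml; apply: ler_sum => m _.
  apply: le_trans (cn1M _ _) _; rewrite ler_wpM2l ?cn1_ge0//.
  by rewrite /v (bigD1 m)//= lerDl; apply: sumr_ge0 => ? _; exact: cn1_ge0.
rewrite big_split /= sumr_const -[2 *+ _]mulr_natr lerD2l.
have Ir f : rI l (fun t => 2 * (\sum_m cn1 (q f m t)) * v t).
  apply: (rI_mulb (M := #|I|%:R * M)) => //; last by move=> t /segP tl; rewrite ger0_norm//; exact: vM.
  by apply: rIZ; apply: rI_sum => m; exact: cI_cn1.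
rewrite -(ri_sum _ Ir (lexx 0) xl'); apply: (ri_le (l := l)) => //; first exact: rI_sum.
by move=> t _; rewrite -mulr_suml -mulr_sumr.
Qed.

Lemma w_bound1 f x : 0 <= x <= l -> cn1 (w f x) <= Vbound.
Proof.
move=> /w_bound; apply: le_trans; rewrite (bigD1 f)//= lerDl.
by apply: sumr_ge0 => ? _; exact: cn1_ge0.
Qed.

Lemma Kqw_bound f g a b : 0 <= a -> a <= b -> b <= l ->
  cn1 (cint (fun t => KK f l t * \sum_m q g m t * w m t) a b) <= 2 * Vbound * ri qsum 0 l.
Proof.
move=> a0 ab bl; apply: le_trans (cn1_cint (Kqw_I f g l) a0 bl) _.
have hq := rI_qsum; have V0 := Vbound_ge0.
apply: (@le_trans _ _ (ri (fun t => 2 * Vbound * qsum t) a b)).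
  apply: (ri_le (l := l)) => //; [exact: cI_cn1 (Kqw_I f g l)|exact: rIZ|].
  move=> t /andP[ta tb]; have t0 : 0 <= t by exact: le_trans ta.
  have tl : t <= l by exact: le_trans tb bl.
  apply: le_trans (cn1M _ _) _; rewrite -mulrA; apply: ler_pM; rewrite ?cn1_ge0 ?KK_le//.
  apply: le_trans (cn1_sum _ _) _.
  apply: (@le_trans _ _ (\sum_m (Vbound * cn1 (q g m t)))).
    apply: ler_sum => m _; apply: le_trans (cn1M _ _) _; rewrite mulrC ler_wpM2r ?cn1_ge0//.
    by apply: w_bound1; rewrite t0.
  rewrite -mulr_sumr ler_wpM2l// /qsum [X in _ <= X](bigD1 g)//= lerDl.
  by apply: sumr_ge0 => ? _; apply: sumr_ge0 => ? _; exact: cn1_ge0.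
rewrite (riZ _ hq a0 bl); apply: ler_wpM2l; first exact: (mulr_ge0 (ler0n _ 2) V0).
exact: (ri_mono hq qsum_ge0 (lexx 0) a0 ab bl (lexx l)).
Qed.

(* Integration by parts: the phases of the f-th and g-th components differ. *)
Lemma osc_int f g a b : 0 <= a -> a <= b -> b <= l ->
  cabs lam * cabs (cint (fun t => 'i * (th f t - th g t)%:C * (KK f l t * w g t)) a b) <=
  4 * Vbound + 2 * Vbound * ri qsum 0 l.
Proof.
move=> a0 ab bl; rewrite -cabsM; have hK := Kw_AC f g l; have hd := cAC_diff hK a0 ab bl; cbv beta in hd.
have Iq' := Kqw_I f g l; have Ih := cAC_I hK.
have Ir : cintegrable l (fun t => 'i * lam * (th g t - th f t)%:C * (KK f l t * w g t)).
  by apply: cI_eq (cID Ih Iq') => t; rewrite subrK.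
have hI : cintegrable l (fun t => 'i * (th f t - th g t)%:C * (KK f l t * w g t)).
  apply: cI_eq (cI_mulAC l0' (cIZ 'i (cI_real (rIB (Ith f) (Ith g)))) hK) => t; by [].
have E : lam * cint (fun t => 'i * (th f t - th g t)%:C * (KK f l t * w g t)) a b =
   (KK f l a * w g a - KK f l b * w g b) - cint (fun t => KK f l t * \sum_m q g m t * w m t) a b.
  rewrite -(opprB (KK f l b * w g b)) hd (cintB Ir Iq' a0 bl) opprB addrAC subrr add0r.
  rewrite -(cintZ lam hI a0 bl) -(cintN Ir a0 bl); apply: cint_eq => t _.
  rewrite !rmorphB /=; ring.
rewrite E; apply: le_trans (cabs_le_cn1 _) _; apply: le_trans (cn1B _ _) _; apply: lerD; last exact: Kqw_bound.
have V0 := Vbound_ge0.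
have pt t : 0 <= t <= l -> cn1 (KK f l t * w g t) <= 2 * Vbound.
  move=> /[dup] tl /andP[t0 tl']; apply: le_trans (cn1M _ _) _.
  by apply: ler_pM; rewrite ?cn1_ge0 ?KK_le// w_bound1.
have h1 : 0 <= a <= l by rewrite a0 (le_trans ab).
have h2 : 0 <= b <= l by rewrite (le_trans a0 ab).
by apply: le_trans (cn1B _ _) _; have := pt a h1; have := pt b h2; lra.
Qed.

End Solution.

Hypothesis (Mth : R) (hMth : forall f, ae_on l (fun x => `|th f x| <= Mth)).
Hypothesis hsep : forall f g, ae_on l (fun x => q f g x = 0) \/
  exists2 c : R, 0 < c & ae_on l (fun x => c <= `|th f x - th g x|).

(** G stands for q / (i (th f - th g)). Writing r for the phase difference, r / max(r^2, c^2) equals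
    1 / r where |r| >= c and is bounded by 1 / c everywhere, so the exceptional null set needs no
    care. *)
Lemma sep_divisor f g (c : R) : 0 < c -> ae_on l (fun x => c <= `|th f x - th g x|) ->
  exists2 G, cintegrable l G & ae_on l (fun t => q f g t = 'i * (th f t - th g t)%:C * G t).
Proof.
move=> c0 hc; pose r t := th f t - th g t.
(* On positive numbers the power with exponent -1 is the inverse; this form gives measurability by
   composition. *)
pose s t := r t * (Num.max (r t ^+ 2) (c ^+ 2)) `^ (-1).
have c2 : 0 < c ^+ 2 by rewrite exprn_gt0.
have mx0 t : 0 < Num.max (r t ^+ 2) (c ^+ 2) by rewrite lt_max c2 orbT.
have sE t : s t = r t / Num.max (r t ^+ 2) (c ^+ 2) by rewrite /s powR_inv1// ltW.
have mr : rM l r by apply: rI_meas; exact: rIB.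
have ms : rM l s.
  have mm : rM l (fun t => Num.max (r t ^+ 2) (c ^+ 2)).
    by apply: measurable_maxr; [exact: measurable_funX|exact: measurable_cst].
  by apply: measurable_funM => //; exact: (measurableT_comp (measurable_powR (-1)) mm).
have sb t : `|s t| <= c^-1.
  rewrite sE normrM normfV (gtr0_norm (mx0 t)) ler_pdivrMr// mulrC ler_pdivlMr//.
  have [rc|rc] := leP `|r t| c.
    rewrite le_max; apply/orP; right; rewrite expr2 ler_wpM2r// ltW//.
  rewrite le_max; apply/orP; left; rewrite -real_normK ?num_real// expr2 ler_wpM2l//; exact: ltW.
have IG : cintegrable l (fun t => q f g t * (- 'i * (s t)%:C)).
  apply: (cI_mulb (M := c^-1)) => //; last first.
    move=> t _; apply: le_trans (_ : cn1 (- 'i * (s t)%:C) <= _) (sb t).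
    by rewrite mulNr cn1N cn1_i cn1_real.
  have Z1 : (fun x => complex.Re (- 'i * (s x)%:C)) = (fun=> 0) by apply/funext => x; rewrite /=; ring.
  have Z2 : (fun x => complex.Im (- 'i * (s x)%:C)) = (fun x => - s x) by apply/funext => x; rewrite /=; ring.
  split; first by rewrite Z1; exact: measurable_cst.
  by rewrite Z2; exact: measurable_funN.
exists (fun t => q f g t * (- 'i * (s t)%:C)) => //.
apply: ae_mono hc _ => t _ hct.
have r2 : c ^+ 2 <= r t ^+ 2.
  by rewrite -[X in _ <= X]real_normK ?num_real//; apply: lerXn2r => //; rewrite nnegrE// ltW.
have rs : r t * s t = 1.
  rewrite sE; have -> : Num.max (r t ^+ 2) (c ^+ 2) = r t ^+ 2 by apply/max_idPl.
  have r0 : r t != 0 by rewrite -normr_gt0 (lt_le_trans c0).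
  by field.
have i2 : 'i * 'i = -1 :> C by rewrite -expr2 sqr_i.
have rsC : (r t)%:C * (s t)%:C = 1 :> C by rewrite -(rmorphM (real_complex R)) /= rs.
have E (a u k v : C) : a * u * (k * (- a * v)) = - (a * a) * (u * v) * k by ring.
by rewrite -/(r t) E i2 rsC opprK !mul1r.
Qed.

(** A Riemann-Lebesgue argument uniform in the solution w: on each step of an approximation of G the
    constant comes out of the integral and [osc_int] gives O(1 / |lambda|), while the approximation
    error is paid with the uniform bound on w. *)
Lemma offdiag_small f g (e : R) : 0 < e -> exists L : R, forall lam w,
  0 <= complex.Im lam -> L <= cabs lam ->
  (forall f, cAC l (w f) (fun t => 'i * lam * (th f t)%:C * w f t - \sum_g q f g t * w g t)) ->
  (forall f, cn1 (w f 0) <= 1) ->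
  cn1 (cint (fun t => KK lam f l t * (q f g t * w g t)) 0 l) <= e.
Proof.
move=> e0; have V0 := Vbound_ge0.
have [q0|[c c0 hc]] := hsep f g.
  exists 0 => lam w hlam _ hw w0; have hK := KK_AC lam f l.
  have h1 : cintegrable l (fun t => KK lam f l t * (q f g t * w g t)).
    by apply: cI_eq (cI_mulAC l0' (cI_mulAC l0' (Iq f g) (hw g)) hK) => t; rewrite mulrC.
  rewrite (cint_ae h1 (cI0 l) (lexx 0) (lexx l)) ?cint0 ?cn1_0 ?ltW//.
  by apply: ae_mono q0 _ => t _ ->; rewrite mul0r mulr0.
have [G IG qG] := sep_divisor c0 hc.
have M0 : 0 <= 2 * `|Mth| + 1 by rewrite addr_ge0 ?mulr_ge0.
(* B dominates the factor multiplying G, since |th f - th g| <= 2 |Mth| and the propagated solution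
   is at most 2 [Vbound]; the added ones keep B positive. *)
pose B := 2 * (2 * `|Mth| + 1) * Vbound + 1.
have B0 : 0 < B by rewrite /B ltr_wpDl// mulr_ge0// mulr_ge0.
have eB : 0 < e / (2 * B) by rewrite divr_gt0// mulr_gt0.
have [N [cc [N0 hN]]] := step_approx l0 IG eB.
pose A := (\sum_(i < N) 2 * cn1 (cc i)) * (4 * Vbound + 2 * Vbound * ri qsum 0 l).
have Q0 : 0 <= ri qsum 0 l by apply: ri_ge0 => t _; exact: qsum_ge0.
have A0 : 0 <= A.
  rewrite mulr_ge0//; first by apply: sumr_ge0 => i _; rewrite mulr_ge0// cn1_ge0.
  by rewrite addr_ge0 ?(mulr_ge0 (mulr_ge0 _ V0))// mulr_ge0.
(* The step functions cost e/2 in total, and this threshold makes the oscillating part A / |lambda|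
   at most e/4. *)
exists (4 * A / e + 1) => lam w hlam lamL hw w0; have hK := KK_AC lam f l.
have lam0 : 0 < cabs lam.
  apply: lt_le_trans lamL; apply: ltr_wpDl => //.
  by apply: divr_ge0; [exact: (mulr_ge0 (ler0n _ 4) A0)|exact: ltW].
have hKw := Kw_AC hw f g l.
pose p t := 'i * (th f t - th g t)%:C * (KK lam f l t * w g t).
have Ip0 : cintegrable l (fun t => 'i * (th f t - th g t)%:C) by apply: cIZ; apply: cI_real; exact: rIB.
have Ip : cintegrable l p by exact: (cI_mulAC l0' Ip0 hKw).
have h1 : cintegrable l (fun t => KK lam f l t * (q f g t * w g t)).
  by apply: cI_eq (cI_mulAC l0' (cI_mulAC l0' (Iq f g) (hw g)) hK) => t; rewrite mulrC.
rewrite -(cint_nodes l0 N0 h1).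
have piece (i : 'I_N) : cn1 (cint (fun t => KK lam f l t * (q f g t * w g t)) (node l N i) (node l N i.+1)) <=
   B * ri (fun t => cn1 (G t - cc i)) (node l N i) (node l N i.+1) +
   2 * cn1 (cc i) * (4 * Vbound + 2 * Vbound * ri qsum 0 l) / cabs lam.
  have [a b d _] := nodeP l0 (ltn_ord i).
  have Icp : cintegrable l (fun t => cc i * p t) by exact: cIZ.
  have Irest := cIB h1 Icp.
  have -> : cint (fun t => KK lam f l t * (q f g t * w g t)) (node l N i) (node l N i.+1) =
     cint (fun t => KK lam f l t * (q f g t * w g t) - cc i * p t) (node l N i) (node l N i.+1) +
     cc i * cint p (node l N i) (node l N i.+1).
    by rewrite (cintB h1 Icp a d) (cintZ _ Ip a d) subrK.
  apply: le_trans (cn1D _ _) _; apply: lerD.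
    apply: le_trans (cn1_cint Irest a d) _.
    have IGc : cintegrable l (fun t => G t - cc i) by apply: cIB => //; split; exact: rI_cst.
    rewrite -(riZ B (cI_cn1 IGc) a d); apply: (ri_le_ae (cI_cn1 Irest) (rIZ _ (cI_cn1 IGc)) a d).
    apply: (ae_mono (ae_and qG (ae_and (hMth f) (hMth g)))) => t tl [qGt [m1 m2]]; have /segP/andP[t0 tl'] := tl.
    rewrite qGt; rewrite (_ : _ - _ = 'i * (th f t - th g t)%:C * (KK lam f l t * w g t) * (G t - cc i)); last by rewrite /p; ring.
    apply: le_trans (cn1M _ _) _; rewrite ler_wpM2r ?cn1_ge0//.
    apply: le_trans (cn1M _ _) _; apply: (@le_trans _ _ (2 * `|Mth| * (2 * Vbound))); last by rewrite /B; nra.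
    apply: ler_pM; rewrite ?cn1_ge0//.
      rewrite cn1_i cn1_real; apply: le_trans (ler_normB _ _) _; have := ler_norm Mth; lra.
    apply: le_trans (cn1M _ _) _; apply: ler_pM; rewrite ?cn1_ge0 ?KK_le//.
    by apply: (w_bound1 hlam hw w0); rewrite t0 tl'.
  apply: le_trans (cn1M _ _) _; rewrite [X in _ <= X](_ : _ = cn1 (cc i) * (2 * (4 * Vbound + 2 * Vbound * ri qsum 0 l) / cabs lam)); last by ring.
  rewrite ler_wpM2l ?cn1_ge0//; apply: le_trans (cn1_le_cabs _) _.
  rewrite -mulrA ler_wpM2l// ler_pdivlMr// mulrC.
  exact: osc_int.
apply: le_trans (cn1_sum _ _) _; apply: le_trans (ler_sum _ (fun i _ => piece i)) _.
rewrite big_split /= -mulr_sumr -!mulr_suml -/A.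
apply: (@le_trans _ _ (B * (e / (2 * B)) + A / cabs lam)).
  by rewrite lerD2r ler_wpM2l// ltW.
have -> : B * (e / (2 * B)) = e / 2 by field; rewrite gt_eqF.
have : A / cabs lam <= e / 4.
  rewrite ler_pdivrMr//; apply: (@le_trans _ _ (e / 4 * (4 * A / e + 1))).
    by rewrite (_ : e / 4 * (4 * A / e + 1) = A + e / 4); [rewrite lerDl divr_ge0// ltW|field; rewrite gt_eqF].
  by rewrite ler_wpM2l// divr_ge0// ltW.
lra.
Qed.

(** By Duhamel's formula the difference is a finite sum of the integrals of [offdiag_small]. The
    threshold L is fixed before lambda and w, so it holds for all solutions at once. *)
Theorem forward_asymp (e : R) : 0 < e -> exists L : R, forall lam w,
  0 <= complex.Im lam -> L <= cabs lam ->
  (forall f, cAC l (w f) (fun t => 'i * lam * (th f t)%:C * w f t - \sum_g q f g t * w g t)) ->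
  (forall f, cn1 (w f 0) <= 1) ->
  forall f, cn1 (w f l - cexp ('i * lam * (ri (th f) 0 l)%:C) * w f 0) <= e.
Proof.
move=> e0; have D0 : 0 < #|I|%:R + 1 :> R by rewrite ltr_wpDl.
have e1 : 0 < e / (#|I|%:R + 1) by rewrite divr_gt0.
have [L1 hL1] := choice (fun fg : I * I => offdiag_small fg.1 fg.2 e1).
exists (\sum_fg `|L1 fg|) => lam w hlam lamL hw w0 f.
have ll : 0 <= l <= l by rewrite lexx ltW.
rewrite (duhamel hw f ll) /KK /rho ri_xx subr0 addrAC subrr add0r cn1N.
have hK := KK_AC lam f l.
have h1 g : cintegrable l (fun t => KK lam f l t * (q f g t * w g t)).
  by apply: cI_eq (cI_mulAC l0' (cI_mulAC l0' (Iq f g) (hw g)) hK) => t; rewrite mulrC.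
have -> : cint (fun t => cexp ('i * lam * (ri (th f) 0 l - ri (th f) 0 t)%:C) * \sum_m q f m t * w m t) 0 l =
    \sum_g cint (fun t => KK lam f l t * (q f g t * w g t)) 0 l.
  by rewrite -(cint_sum _ h1 (lexx 0) (lexx l)); apply: cint_eq => t _; rewrite mulr_sumr.
apply: le_trans (cn1_sum _ _) _; apply: (@le_trans _ _ (\sum_(g : I) (e / (#|I|%:R + 1)))).
  apply: ler_sum => g _; apply: (hL1 (f, g) lam w) => //.
  apply: le_trans lamL; apply: le_trans (ler_norm _) _; rewrite (bigD1 (f, g))//= lerDl.
  by apply: sumr_ge0.
rewrite sumr_const -[_ *+ _]mulr_natl mulrA ler_pdivrMr// mulrC ler_wpM2l//; first exact: ltW.
by rewrite lerDl.
Qed.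

End ForwardSystem.

Section DeterminantDerivative.
Variables (R : realType) (l : R).
Hypothesis l0 : 0 <= l.
Local Notation C := R[i].

Lemma cAC_prod (I : eqType) (s : seq I) (F f : I -> R -> C) : uniq s -> (forall i, cAC l (F i) (f i)) ->
  cAC l (fun x => \prod_(i <- s) F i x) (fun x => \sum_(i <- s) \prod_(j <- s) (if j == i then f j x else F j x)).
Proof.
move=> us h; elim: s us => [_|a s IH /= /andP[nas us]].
  by apply: (cAC_ext l0 _ _ (cAC_cst l 1)) => x _; rewrite big_nil.
apply: (cAC_ext l0 _ _ (cACM l0 (h a) (IH us))) => x _; first by rewrite big_cons.
rewrite big_cons big_cons eqxx; congr (_ * _ + _).
  by apply: eq_big_seq => j js; case: eqP => // ja; rewrite -ja js in nas.
rewrite mulr_suml; apply: eq_big_seq => i is'; rewrite big_cons mulrC.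
by case: eqP => // ai; rewrite ai is' in nas.
Qed.

Lemma cAC_det n (F f : 'I_n -> 'I_n -> R -> C) : (forall i j, cAC l (F i j) (f i j)) ->
  cAC l (fun x => \det (\matrix_(i, j) F i j x))
    (fun x => \sum_i \det (\matrix_(k, j) (if k == i then f k j x else F k j x))).
Proof.
move=> h.
have hs (s : 'S_n) := cACZ l0 ((-1) ^+ s) (cAC_prod (index_enum_uniq 'I_n) (fun i => h i (s i))).
apply: (cAC_ext l0 _ _ (cAC_sum l0 (index_enum 'S_n) hs)) => x _.
  by apply: eq_bigr => s _; congr (_ * _); apply: eq_bigr => i _; rewrite mxE.
rewrite exchange_big /=; apply: eq_bigr => s _; rewrite mulr_sumr; apply: eq_bigr => i _.
by congr (_ * _); apply: eq_bigr => k _; rewrite mxE; case: eqP.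
Qed.

Lemma det_replace_row n (M : 'M[C]_n) (i : 'I_n) (r : 'I_n -> C) :
  \det (\matrix_(k, j) (if k == i then r j else M k j)) = \sum_j r j * cofactor M i j.
Proof.
rewrite (expand_det_row _ i); apply: eq_bigr => j _; rewrite mxE eqxx; congr (_ * _).
rewrite /cofactor; congr (_ * \det _); apply/matrixP => a b; rewrite !mxE.
by rewrite eq_sym (negbTE (neq_lift _ _)).
Qed.

End DeterminantDerivative.

Lemma ae_fin (R : realType) (l : R) (I : finType) (P : I -> R -> Prop) :
  (forall i, ae_on l (P i)) -> ae_on l (fun x => forall i, P i x).
Proof.
move=> h; suff H (s : seq I) : ae_on l (fun x => forall i, i \in s -> P i x).
  by apply: ae_mono (H (enum I)) _ => x _ hx i; apply: hx; rewrite mem_enum.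
elim: s => [|a s IH]; first by apply: ae_all => x _ i; rewrite in_nil.
apply: ae_mono (ae_and (h a) IH) _ => x _ [ha hs] i; rewrite in_cons => /orP[/eqP->//|].
exact: hs.
Qed.

(** * The compound system satisfied by the minors *)

Section Minors.
Variables (R : realType) (l : R) (n : nat).
Hypothesis l0 : 0 < l.
Local Notation C := R[i].
Variables (beta : 'I_n -> R -> R) (Q : R -> 'M[C]_n) (Mb : R).
Hypotheses (Ib : forall k, rI l (beta k)) (IQ : mxintegrable l Q).
Hypothesis hMb : forall k, ae_on l (fun x => `|beta k x| <= Mb).
Hypothesis hsgn : forall k, ae_on l (fun x => if bk beta l k < 0 then beta k x < 0 else 0 < beta k x).
Hypothesis hsep : forall j k, ae_on l (fun x => Q x j k = 0) \/
  exists2 c : R, 0 < c & ae_on l (fun x => c <= `|beta j x - beta k x|).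
Hypothesis hdiag : forall j, ae_on l (fun x => Q x j j = 0).
Variables (CC D : 'M[C]_n).
Let l0' : 0 <= l := ltW l0.

(* Rows of the 2n x n matrix (I, Phi): [inl k] is the k-th unit row, [inr k] the k-th row of Phi.
   det (C + D Phi) is a fixed linear combination of its maximal minors, indexed by f. *)
Definition J : finType := ('I_n + 'I_n)%type.

Definition Xrow (P : 'M[C]_n) (s : J) (j : 'I_n) : C :=
  match s with inl k => (k == j)%:R | inr k => P k j end.

Definition minor (P : 'M[C]_n) (f : {ffun 'I_n -> J}) : C := \det (\matrix_(i, j) Xrow P (f i) j).

Definition coefCD (f : {ffun 'I_n -> J}) : C :=
  \prod_i match f i with inl k => CC i k | inr k => D i k end.

Lemma det_minors P : \det (CC + D *m P) = \sum_(f : {ffun 'I_n -> J}) coefCD f * minor P f.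
Proof.
pose a i (s : J) := match s with inl k => CC i k | inr k => D i k end.
have E i j : (CC + D *m P) i j = \sum_(s : J) a i s * Xrow P s j.
  rewrite !mxE big_sumType /=; congr (_ + _).
  by rewrite (bigD1 j)//= eqxx mulr1 big1 ?addr0// => k /negbTE->; rewrite mulr0.
rewrite /determinant; under eq_bigr => s _ do (under eq_bigr => i _ do rewrite E; rewrite bigA_distr_bigA /= mulr_sumr).
rewrite exchange_big /=; apply: eq_bigr => f _; rewrite /minor /determinant mulr_sumr.
apply: eq_bigr => s _; rewrite big_split /= mulrCA; congr (_ * (_ * _)).
by apply: eq_bigr => i _; rewrite mxE.
Qed.

Lemma minor_noninj P (f : {ffun 'I_n -> J}) : ~~ injectiveb f -> minor P f = 0.
Proof.
move=> /injectivePn[i [i' ii' E]]; apply: (determinant_alternate ii') => j.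
by rewrite !mxE E.
Qed.

Definition upd (f : {ffun 'I_n -> J}) i s : {ffun 'I_n -> J} := [ffun k => if k == i then s else f k].

Definition bt (s : J) (x : R) : R := match s with inl _ => 0 | inr k => beta k x end.
Definition qt (s s' : J) (x : R) : C :=
  match s, s' with inr k, inr k' => Q x k k' | _, _ => 0 end.

Lemma Xrow_AC lam s j : cAC l (fun x => Xrow (PhiQ beta Q l lam x) s j)
  (fun x => 'i * lam * (bt s x)%:C * Xrow (PhiQ beta Q l lam x) s j -
     \sum_s' qt s s' x * Xrow (PhiQ beta Q l lam x) s' j).
Proof.
case: s => k.
  apply: (cAC_ext l0' _ _ (cAC_cst l ((k == j)%:R : C))) => x _ //.
  by rewrite big1 ?subr0 => [|? _] /=; rewrite ?mul0r// mulr0 mul0r.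
apply: (cAC_ext l0' _ _ (PhiQ_AC l0' Ib IQ lam k j)) => x _ //.
rewrite big_sumType /= [X in _ - (X + _)]big1 => [|i _]; last by rewrite mul0r.
rewrite add0r mxE [RHS](_ : _ = \sum_i (if i == k then 'i * lam * (beta k x)%:C * PhiQ beta Q l lam x k j else 0) -
   \sum_i Q x k i * PhiQ beta Q l lam x i j); last by rewrite -big_mkcond big_pred1_eq.
rewrite -sumrB; apply: eq_bigr => i _; rewrite !mxE eq_sym.
by case: eqP => [->|_]; rewrite ?mulr0 mulrBl ?mul0r.
Qed.

(** Differentiating a minor row by row replaces the row [f i] by a combination of rows s'; this
    collects the coefficients of all replacements that turn f into g. *)
Definition qF (f g : {ffun 'I_n -> J}) (x : R) : C :=
  \sum_i \sum_s' (if upd f i s' == g then qt (f i) s' x else 0).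

Lemma minor_AC lam f : cAC l (fun x => minor (PhiQ beta Q l lam x) f)
  (fun x => 'i * lam * (\sum_i bt (f i) x)%:C * minor (PhiQ beta Q l lam x) f -
     \sum_(g : {ffun 'I_n -> J}) qF f g x * minor (PhiQ beta Q l lam x) g).
Proof.
apply: (cAC_ext l0' _ _ (cAC_det l0' (fun i j => Xrow_AC lam (f i) j))) => x _ //.
set P := PhiQ beta Q l lam x.
have rep i s : minor P (upd f i s) = \sum_j Xrow P s j * cofactor (\matrix_(k, j) Xrow P (f k) j) i j.
  rewrite -det_replace_row; congr (\det _); apply/matrixP => a b; rewrite !mxE ffunE.
  by case: eqP.
have updid i : upd f i (f i) = f by apply/ffunP => k; rewrite ffunE; case: eqP => // ->.
have repf i : minor P f = \sum_j Xrow P (f i) j * cofactor (\matrix_(k, j) Xrow P (f k) j) i j.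
  by have := rep i (f i); rewrite updid.
have repl i : \det (\matrix_(k, j) (if k == i then 'i * lam * (bt (f k) x)%:C * Xrow P (f k) j -
     \sum_s' qt (f k) s' x * Xrow P s' j else Xrow P (f k) j)) =
   'i * lam * (bt (f i) x)%:C * minor P f - \sum_s' qt (f i) s' x * minor P (upd f i s').
  rewrite (repf i); under [X in _ - X]eq_bigr do rewrite rep mulr_sumr.
  rewrite [X in _ - X]exchange_big /= mulr_sumr -sumrB.
  transitivity (\det (\matrix_(k, j) (if k == i then 'i * lam * (bt (f i) x)%:C * Xrow P (f i) j -
     \sum_s' qt (f i) s' x * Xrow P s' j else (\matrix_(k, j) Xrow P (f k) j) k j))).
    by congr (\det _); apply/matrixP => a b; rewrite !mxE; case: eqP => // ->.
  rewrite det_replace_row; apply: eq_bigr => j _; rewrite mulrBl; congr (_ - _); first exact: (esym (mulrA _ _ _)).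
  by rewrite mulr_suml; apply: eq_bigr => s _; exact: (esym (mulrA _ _ _)).
rewrite (eq_bigr _ (fun i _ => repl i)) sumrB -mulr_suml -mulr_sumr; congr (_ - _).
  by congr (_ * _ * _); rewrite rmorph_sum.
rewrite (eq_bigr (fun i => \sum_s' \sum_(g : {ffun 'I_n -> J}) (if upd f i s' == g then qt (f i) s' x * minor P g else 0))); last first.
  by move=> i _; apply: eq_bigr => s _; rewrite -big_mkcond (big_pred1 (upd f i s)) // => g; rewrite eq_sym.
rewrite [RHS](eq_bigr (fun g => \sum_i \sum_s' (if upd f i s' == g then qt (f i) s' x * minor P g else 0))); last first.
  move=> g _; rewrite /qF mulr_suml; apply: eq_bigr => i _; rewrite mulr_suml; apply: eq_bigr => s _.
  by case: ifP => _; rewrite ?mul0r.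
rewrite [RHS]exchange_big /=; apply: eq_bigr => i _; by rewrite exchange_big.
Qed.

Definition bneg (x : R) : R := \sum_k (if bk beta l k < 0 then beta k x else 0).
Definition Rneg : R := \sum_k (if bk beta l k < 0 then bk beta l k else 0).
(** Minors with a repeated row vanish. Dropping them matters: only for distinct rows is each
    negative beta_k counted at most once, as nonnegativity of the shifted phase requires. *)
Definition Iinj : finType := {f : {ffun 'I_n -> J} | injectiveb f}.
Definition thF (f : Iinj) (x : R) : R := \sum_i bt (val f i) x - bneg x.

Lemma rI_bt s : rI l (bt s).
Proof. by case: s => k /=; [exact: rI0|exact: Ib]. Qed.

Lemma rI_bneg : rI l bneg.
Proof. by apply: rI_sum => k; case: (bk beta l k < 0); [exact: Ib|exact: rI0]. Qed.

Lemma rI_thF f : rI l (thF f).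
Proof. by apply: rIB; [apply: rI_sum => i; exact: rI_bt|exact: rI_bneg]. Qed.

(** Replace each phase by its negative part: over distinct rows these sum to at least the sum of all
    negative parts, which [bneg] does not exceed. *)
Lemma thF_ge0 f : ae_on l (fun x => 0 <= thF f x).
Proof.
apply: ae_mono (ae_fin hsgn) _ => x _ hx; rewrite /thF subr_ge0.
pose m (s : J) : R := Num.min (bt s x) 0.
have m0 s : m s <= 0 by rewrite /m ge_min lexx orbT.
apply: (@le_trans _ _ (\sum_s m s)).
  rewrite big_sumType /= /m /bt big1 ?add0r => [|i _]; last by rewrite minxx.
  apply: ler_sum => k _; have := hx k; case: ifP => _ hk; rewrite le_min ?lexx ?ltW//.
apply: (@le_trans _ _ (\sum_i m (val f i))); last by apply: ler_sum => i _; rewrite /m ge_min lexx.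
have -> : \sum_i m (val f i) = \sum_(s in codom (val f)) m s.
  rewrite -(big_uniq _ (valP f : uniq (codom (val f)))) /codom /image_mem big_map big_enum.
  exact: eq_bigl.
rewrite [X in X <= _](bigID (mem (codom (val f)))) /= gerDl.
by apply: sumr_le0 => s _.
Qed.

Lemma thF_bound f : ae_on l (fun x => `|thF f x| <= n%:R * `|Mb| + n%:R * `|Mb|).
Proof.
apply: ae_mono (ae_fin hMb) _ => x _ hx; apply: le_trans (ler_normB _ _) _.
have hM k : `|beta k x| <= `|Mb| by apply: le_trans (hx k) (ler_norm _).
apply: lerD; apply: le_trans (ler_norm_sum _ _ _) _; rewrite -[in X in _ <= X](card_ord n) mulr_natl -sumr_const; apply: ler_sum => i _.
  by rewrite /bt; case: (val f i) => k; rewrite ?normr0.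
by case: ifP => _; rewrite ?normr0.
Qed.

Lemma qt_I s s' : cintegrable l (qt s s').
Proof. by case: s s' => [k|k] [k'|k'] /=; [exact: cI0|exact: cI0|exact: cI0|exact: IQ]. Qed.

Lemma qF_I f g : cintegrable l (qF f g).
Proof. by apply: cI_sum => i; apply: cI_sum => s; case: (upd f i s == g); [exact: qt_I|exact: cI0]. Qed.

(** A nonzero coupling of f and g means that they differ in one position, where both are rows of
    Phi, say k and k'; then the coupling is Q_kk' and the phase difference is beta_k - beta_k'. For
    f = g only diagonal entries of Q occur, and these vanish. *)
Lemma qF_sep (f g : Iinj) : ae_on l (fun x => qF (val f) (val g) x = 0) \/
  exists2 c : R, 0 < c & ae_on l (fun x => c <= `|thF f x - thF g x|).
Proof.
set f' := val f; set g' := val g.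
have dg x : (forall j, Q x j j = 0) -> forall s, qt s s x = 0.
  by move=> h [k|k] /=.
have [|] := boolP [exists i, upd f' i (g' i) == g']; last first.
  move=> /existsPn no; left; apply: ae_all => x _; rewrite /qF big1// => i _; rewrite big1// => s _.
  case: eqP => // E; have /negP[] := no i; have gi : g' i = s by rewrite -E ffunE eqxx.
  by rewrite gi E.
move=> /existsP[i /eqP E]; have [fgi|fgi] := eqVneq (f' i) (g' i).
  left; apply: ae_mono (ae_fin hdiag) _ => x _ /dg d; rewrite /qF big1// => j _; rewrite big1// => s _.
  have fg : f' = g' by rewrite -E; apply/ffunP => k; rewrite ffunE; case: eqP => // ->.
  by case: eqP => // E'; rewrite -[s](_ : f' j = s) ?d// fg -E' ffunE eqxx.
have qE x : qF f' g' x = qt (f' i) (g' i) x.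
  rewrite /qF (bigD1 i)//= [X in _ + X]big1 => [|j ji].
    rewrite addr0 (bigD1 (g' i))//= E eqxx big1 ?addr0// => s sg.
    case: eqP => // E'; case/eqP: sg; by rewrite -E' ffunE eqxx.
  rewrite big1// => s _; case: eqP => // E'; case/eqP: fgi.
  by rewrite -[in RHS]E' ffunE eq_sym (negbTE ji).
have thE x : thF f x - thF g x = bt (f' i) x - bt (g' i) x.
  rewrite /thF opprB addrA subrK -/f' -/g' (bigD1 i)//= [X in _ - X](bigD1 i)//= opprD addrACA.
  rewrite (_ : \sum_(j < n | j != i) bt (f' j) x = \sum_(j < n | j != i) bt (g' j) x) ?subrr ?addr0//.
  by apply: eq_bigr => j ji; rewrite -{1}E ffunE (negbTE ji).
case Ef : (f' i) => [k|k].
  by left; apply: ae_all => x _; rewrite qE Ef.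
case Eg : (g' i) => [k'|k'].
  by left; apply: ae_all => x _; rewrite qE Ef Eg.
have [h|[c c0 h]] := hsep k k'.
  by left; apply: ae_mono h _ => x _ h; rewrite qE Ef Eg.
by right; exists c => //; apply: ae_mono h _ => x _; rewrite thE Ef Eg.
Qed.

Lemma sum_inj (F : {ffun 'I_n -> J} -> C) : (forall f : {ffun 'I_n -> J}, ~~ injectiveb f -> F f = 0) ->
  \sum_f F f = \sum_(f : Iinj) F (val f).
Proof.
move=> F0; rewrite (bigID (fun f : {ffun 'I_n -> J} => injectiveb f)) /= [X in _ + X]big1 ?addr0//.
rewrite (reindex_omap (val : Iinj -> _) insub) /=; last by move=> f hf; rewrite insubT.
by apply: eq_bigl => f; rewrite (valP f) valK eqxx.
Qed.

(** The exponential factor subtracts the least phase [bneg], and the factor 1 / n! brings the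
    initial values, minors of the matrix (I, I), below 1 as [forward_asymp] demands. *)
Definition wF lam (f : Iinj) (x : R) : C :=
  (#|'S_n|%:R^-1)%:C * (cexp (- ('i * lam) * (ri bneg 0 x)%:C) * minor (PhiQ beta Q l lam x) (val f)).

Lemma wF_AC lam f : cAC l (wF lam f) (fun x => 'i * lam * (thF f x)%:C * wF lam f x -
  \sum_(g : Iinj) qF (val f) (val g) x * wF lam g x).
Proof.
have hr : rAC l (fun x => ri bneg 0 x) bneg by split=> [|x _]; [exact: rI_bneg|rewrite ri_xx add0r].
have hE := cAC_cexp l0' (- ('i * lam)) hr.
apply: (cAC_ext l0' _ _ (cACZ l0' _ (cACM l0' hE (minor_AC lam (val f))))) => // x _.
rewrite (sum_inj (F := fun g => qF (val f) g x * minor _ g)); last first.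
  by move=> g hg; rewrite minor_noninj ?mulr0.
rewrite /wF /thF rmorphB /=; set E := cexp _; set K := (_ : R)%:C.
have -> : \sum_(g : Iinj) qF (val f) (val g) x * (K * (E * minor (PhiQ beta Q l lam x) (val g))) =
    K * E * \sum_(g : Iinj) qF (val f) (val g) x * minor (PhiQ beta Q l lam x) (val g).
  by rewrite mulr_sumr; apply: eq_bigr => g _; ring.
ring.
Qed.

Lemma cn1_minor1 f : cn1 (minor 1%:M f) <= #|'S_n|%:R.
Proof.
apply: le_trans (cn1_sum _ _) _; rewrite -sumr_const; apply: ler_sum => s _.
apply: le_trans (cn1M _ _) _; rewrite -[X in _ <= X]mulr1; apply: ler_pM; rewrite ?cn1_ge0//.
  by rewrite -signr_odd; case: odd; rewrite ?expr1 ?expr0 ?cn1N (cn1_real 1) normr1.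
elim/big_ind : _ => [|a b ha hb|i _]; first by rewrite (cn1_real 1) normr1.
  by apply: le_trans (cn1M _ _) _; rewrite -[X in _ <= X]mulr1 ler_pM ?cn1_ge0.
have hb (b : bool) : cn1 (b%:R : C) <= 1 by case: b; rewrite ?(cn1_real 1) ?normr1// (cn1_real 0) normr0.
by rewrite mxE /Xrow; case: (f i) => k; rewrite ?mxE.
Qed.

Lemma wF_0 lam f : wF lam f 0 = (#|'S_n|%:R^-1)%:C * minor 1%:M (val f).
Proof. by rewrite /wF ri_xx mulr0 cexp0 mul1r PhiQ_0. Qed.

Lemma minor_Phi0l lam f : minor (Phi0l beta l lam) f =
  cexp ('i * lam * (\sum_i ri (bt (f i)) 0 l)%:C) * minor 1%:M f.
Proof.
have -> : cexp ('i * lam * (\sum_i ri (bt (f i)) 0 l)%:C) = \prod_i cexp ('i * lam * (ri (bt (f i)) 0 l)%:C).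
  by rewrite -cexp_sum -mulr_sumr; congr (cexp (_ * _)); rewrite (rmorph_sum (real_complex R)).
rewrite /minor /determinant mulr_sumr; apply: eq_bigr => s _.
rewrite mulrCA; congr (_ * _); rewrite -big_split; apply: eq_bigr => i _; rewrite !mxE /Xrow.
case: (f i) => k /=; first by rewrite ri0 mulr0 cexp0 mul1r.
by rewrite !mxE; case: eqVneq => [<-|_]; rewrite ?mulr1n ?mulr0n ?mulr1 ?mulr0.
Qed.

Lemma Rneg_ri : ri bneg 0 l = Rneg.
Proof.
rewrite /bneg (ri_sum (l := l))//; last by move=> k; case: (bk beta l k < 0); [exact: Ib|exact: rI0].
by apply: eq_bigr => k _; case: (bk beta l k < 0) => //; rewrite ri0.
Qed.

Lemma Delta_asymp_upper (e : R) : 0 < e -> exists L : R, forall lam, 0 <= complex.Im lam -> L <= cabs lam ->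
  cabs (DeltaQ beta Q l CC D lam - Delta0 beta l CC D lam) <= e * cabs (cexp ('i * lam * Rneg%:C)).
Proof.
move=> e0; pose A := \sum_(f : Iinj) cabs (coefCD (val f)); pose K : R := #|'S_n|%:R.
have K0 : 0 < K by rewrite ltr0n card_Sn fact_gt0.
have A0 : 0 <= A by apply: sumr_ge0 => f _; exact: cabs_ge0.
have B0 : 0 < K * (A + 1) by rewrite mulr_gt0// ltr_wpDl.
have e1 : 0 < e / (K * (A + 1)) by rewrite divr_gt0.
(* The accuracy e / (K (A + 1)) anticipates two losses: K = n! undoes the normalisation of [wF], and
   A is the total weight of the minors in the expansion of the determinant. *)
have [L hL] := forward_asymp l0 rI_thF thF_ge0 (fun f g => qF_I (val f) (val g)) thF_bound qF_sep e1.
exists L => lam him lamL.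
have w0 f : cn1 (wF lam f 0) <= 1.
  rewrite wF_0; apply: le_trans (cn1M _ _) _; rewrite cn1_real ger0_norm ?invr_ge0//.
  by rewrite mulrC ler_pdivrMr// mul1r cn1_minor1.
have hw := hL lam (wF lam) him lamL (wF_AC lam) w0.
pose T := cexp (- ('i * lam) * Rneg%:C).
have piece (f : Iinj) : cabs (T * (minor (PhiQ beta Q l lam l) (val f) - minor (Phi0l beta l lam) (val f))) <= e / (A + 1).
  have := hw f; rewrite wF_0 /wF Rneg_ri -/T minor_Phi0l.
  have -> : ri (thF f) 0 l = \sum_i ri (bt (val f i)) 0 l - Rneg.
    rewrite /thF (riB _ rI_bneg (lexx 0) (lexx l)) ?Rneg_ri; last by apply: rI_sum => i; exact: rI_bt.
    by rewrite (ri_sum _ (fun i => rI_bt (val f i)) (lexx 0) (lexx l)).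
  set S := \sum_i _; have -> : cexp ('i * lam * (S - Rneg)%:C) = T * cexp ('i * lam * S%:C).
    by rewrite /T -cexpD; congr cexp; rewrite rmorphB /=; ring.
  set m1 := minor (PhiQ _ _ _ _ _) _; set m2 := minor 1%:M _; set E := cexp _.
  have -> : (#|'S_n|%:R^-1)%:C * (T * m1) - T * E * ((#|'S_n|%:R^-1)%:C * m2) = (K^-1)%:C * (T * (m1 - E * m2)).
    by rewrite /K; ring.
  move=> h; have := le_trans (cabs_le_cn1 _) h; rewrite cabsM cabs_real ger0_norm; last by rewrite invr_ge0 ltW.
    rewrite ler_pdivrMl// => /le_trans; apply.
  rewrite le_eqVlt; apply/orP; left; apply/eqP; field.
  by rewrite !gt_eqF// ltr_wpDl.
have -> : DeltaQ beta Q l CC D lam - Delta0 beta l CC D lam =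
   \sum_(f : Iinj) coefCD (val f) * (minor (PhiQ beta Q l lam l) (val f) - minor (Phi0l beta l lam) (val f)).
  rewrite /DeltaQ /Delta0 !det_minors -sumrB -(sum_inj (F := fun f => coefCD f * (minor _ f - minor _ f))); last first.
    by move=> f hf; rewrite !minor_noninj// subrr mulr0.
  by apply: eq_bigr => f _; rewrite mulrBr.
set X := \sum_f _.
have TT : T * cexp ('i * lam * Rneg%:C) = 1 by rewrite /T mulNr -mulrN mulrC mulrN cexpN.
have : cabs (T * X) <= e.
  rewrite /X mulr_sumr; apply: le_trans (cabs_sum _ _ _) _.
  apply: (@le_trans _ _ (\sum_(f : Iinj) cabs (coefCD (val f)) * (e / (A + 1)))).
    by apply: ler_sum => f _; rewrite mulrCA cabsM ler_wpM2l ?cabs_ge0// piece.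
  rewrite -mulr_suml -/A mulrA ler_pdivrMr; last by rewrite ltr_wpDl.
  by rewrite mulrC ler_wpM2l ?lerDl// ltW.
move=> hT; have E : X = T * X * cexp ('i * lam * Rneg%:C) by rewrite mulrAC TT mul1r.
by rewrite E cabsM ler_wpM2r ?cabs_ge0.
Qed.

End Minors.

End ContinuousTime.

(** * Lower bounds for exponential polynomials *)

Section DetContinuity.
Variable R : realType.
Local Notation C := R[i].

Lemma prod_ucont (I : Type) (s : seq I) (M e : R) : 0 < e -> exists2 d : R, 0 < d &
  forall a b : I -> C, (forall i, cabs (a i) <= M) -> (forall i, cabs (b i - a i) <= d) ->
  cabs (\prod_(i <- s) b i - \prod_(i <- s) a i) <= e.
Proof.
elim: s e => [|x s IH] e e0.
  by exists 1 => // a b _ _; rewrite !big_nil subrr cabs0 ltW.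
have N0 : 0 < 2 * (`|M| + 1) by rewrite mulr_gt0// ltr_wpDl.
have e1 : 0 < Num.min 1 (e / (2 * (`|M| + 1))) by rewrite lt_min ltr01 divr_gt0.
have [d d0 hd] := IH _ e1.
pose B := \prod_(i <- s) (`|M| + 1) + 1.
have P0 : 0 <= \prod_(i <- s) (`|M| + 1) by apply: prodr_ge0 => i _; rewrite addr_ge0.
have B0 : 0 < B by rewrite /B ltr_wpDl.
exists (Num.min d (Num.min 1 (e / (2 * B)))); first by rewrite !lt_min d0 ltr01 divr_gt0// mulr_gt0.
move=> a b ha hb; rewrite !big_cons; set p := \prod_(i <- s) b i; set p0 := \prod_(i <- s) a i.
have hbd i : cabs (b i - a i) <= d by apply: le_trans (hb i) _; rewrite ge_min lexx.
have hbe : cabs (b x - a x) <= e / (2 * B) by apply: le_trans (hb x) _; rewrite !ge_min lexx !orbT.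
have hp := hd a b ha hbd; rewrite -/p -/p0 in hp.
have hp1 : cabs (p - p0) <= e / (2 * (`|M| + 1)) by apply: le_trans hp _; rewrite ge_min lexx orbT.
have hp2 : cabs (p - p0) <= 1 by apply: le_trans hp _; rewrite ge_min lexx.
have hax : cabs (a x) <= `|M| + 1 by apply: le_trans (ha x) (le_trans (ler_norm M) _); rewrite lerDl.
have hp0 : cabs p0 <= \prod_(i <- s) (`|M| + 1).
  rewrite /p0 cabs_prod; apply: ler_prod => i _; rewrite cabs_ge0 /=.
  by apply: le_trans (ha i) (le_trans (ler_norm M) _); rewrite lerDl.
have hpB : cabs p <= B.
  have -> : p = p0 + (p - p0) by rewrite addrC subrK.
  by apply: le_trans (cabsD _ _) _; rewrite /B lerD.
have -> : b x * p - a x * p0 = (b x - a x) * p + a x * (p - p0) by ring.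
apply: le_trans (cabsD _ _) _; rewrite !cabsM [X in _ <= X](_ : e = e / (2 * B) * B + (`|M| + 1) * (e / (2 * (`|M| + 1)))).
  by apply: lerD; apply: ler_pM; rewrite ?cabs_ge0.
have M1 : `|M| + 1 != 0 by rewrite gt_eqF// ltr_wpDl.
by field; rewrite M1 gt_eqF.
Qed.

Lemma det_ucont n (M e : R) : 0 < e -> exists2 d : R, 0 < d &
  forall A B : 'M[C]_n, (forall i j, cabs (A i j) <= M) -> (forall i j, cabs (B i j - A i j) <= d) ->
  cabs (\det B - \det A) <= e.
Proof.
move=> e0; have N0 : 0 < #|'S_n|%:R :> R by rewrite ltr0n card_Sn fact_gt0.
have e1 : 0 < e / #|'S_n|%:R by rewrite divr_gt0.
have [d d0 hd] := prod_ucont (index_enum 'I_n) M e1.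
exists d => // A B hA hB; rewrite /determinant -sumrB; apply: le_trans (cabs_sum _ _ _) _.
rewrite [X in _ <= X](_ : e = \sum_(s : 'S_n) (e / #|'S_n|%:R)); last first.
  by rewrite sumr_const -[_ *+ _]mulr_natr divfK// gt_eqF.
apply: ler_sum => s _; rewrite -mulrBr cabsM cabsX cabsN cabs1 expr1n mul1r.
by apply: hd => i.
Qed.

Lemma det_bounded n (M : R) : exists2 K : R, 0 < K & forall A : 'M[C]_n, (forall i j, cabs (A i j) <= M) -> cabs (\det A) <= K.
Proof.
exists (1 + \sum_(s : 'S_n) \prod_(i < n) `|M|).
  by rewrite ltr_pwDl// sumr_ge0// => s _; apply: prodr_ge0.
move=> A hA; apply: ler_wpDl => //; apply: le_trans (cabs_sum _ _ _) _; apply: ler_sum => s _.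
rewrite cabsM cabsX cabsN cabs1 expr1n mul1r cabs_prod; apply: ler_prod => i _; rewrite cabs_ge0 /=.
by apply: le_trans (hA _ _) (ler_norm _).
Qed.

End DetContinuity.

Section ExponentialPolynomial.
Variables (R : realType) (n : nat).
Local Notation C := R[i].
Variables (CC D : 'M[C]_n).

Definition dgm (a : 'I_n -> C) : 'M[C]_n := \matrix_(j, k) (if j == k then a j else 0).

Lemma mul_dgm (A : 'M[C]_n) a i j : (A *m dgm a) i j = A i j * a j.
Proof.
rewrite mxE (bigD1 j)//= mxE eqxx big1 ?addr0// => k kj.
by rewrite mxE (negbTE kj) mulr0.
Qed.

Lemma det_dgm a : \det (dgm a) = \prod_k a k.
Proof.
have -> : dgm a = diag_mx (\row_k a k).
  by apply/matrixP => i j; rewrite !mxE; case: eqVneq => [->|_]; rewrite ?mulr1n ?mulr0n.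
by rewrite det_diag; apply: eq_bigr => k _; rewrite mxE.
Qed.

(* For |u k| = 1 these are the translates of Delta_0 along the real axis and their limits. *)
Definition Fu (b : 'I_n -> R) (u : 'I_n -> C) (lam : C) : C :=
  \det (CC + D *m dgm (fun k => u k * cexp ('i * lam * (b k)%:C))).

Lemma cabs_cexpi lam (x : R) : cabs (cexp ('i * lam * x%:C)) = expR (- (complex.Im lam * x)).
Proof. by rewrite cabs_cexp; congr expR; case: lam => p q /=; ring. Qed.

Lemma Fu_entire b u : entire (Fu b u).
Proof.
apply: (@entire_ext _ (fun lam => \det (\matrix_(i, j) (CC i j + D i j * (u j * cexp ('i * lam * (b j)%:C)))))).
  by move=> lam; congr (\det _); apply/matrixP => i j; rewrite mxE [RHS]mxE mul_dgm.
apply: entire_det => i j; apply: entireD; first exact: entire_cst.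
apply: entireM; first exact: entire_cst.
by apply: entireM; [exact: entire_cst|exact: entire_cexp].
Qed.

Definition mxmax (A : 'M[C]_n) : R := \sum_i \sum_j cabs (A i j).
Lemma mxmax_le (A : 'M[C]_n) i j : cabs (A i j) <= mxmax A.
Proof.
rewrite /mxmax (bigD1 i)//= (bigD1 j)//= -addrA lerDl addr_ge0//.
  by apply: sumr_ge0 => ? _; exact: cabs_ge0.
by apply: sumr_ge0 => ? _; apply: sumr_ge0 => ? _; exact: cabs_ge0.
Qed.
Lemma mxmax_ge0 (A : 'M[C]_n) : 0 <= mxmax A.
Proof. by apply: sumr_ge0 => ? _; apply: sumr_ge0 => ? _; exact: cabs_ge0. Qed.

Variable b : 'I_n -> R.

Definition bsum : R := \sum_k `|b k|.
Lemma bsum_le k : `|b k| <= bsum. Proof. by rewrite /bsum (bigD1 k)//= lerDl sumr_ge0. Qed.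

Lemma cexp_strip lam k (r : R) : `|complex.Im lam| <= r -> cabs (cexp ('i * lam * (b k)%:C)) <= expR (r * bsum).
Proof.
move=> h; rewrite cabs_cexpi ler_expR; apply: le_trans (ler_norm _) _; rewrite normrN normrM.
by rewrite ler_pM// bsum_le.
Qed.

Lemma Fu_bounded (r : R) : exists2 M : R, 0 < M & forall u lam, (forall k, cabs (u k) <= 1) ->
  `|complex.Im lam| <= r -> cabs (Fu b u lam) <= M.
Proof.
have [K K0 hK] := det_bounded n (mxmax CC + mxmax D * expR (r * bsum)).
exists K => // u lam hu hl; apply: hK => i j; rewrite mxE mul_dgm; apply: le_trans (cabsD _ _) _.
apply: lerD; first exact: mxmax_le.
rewrite cabsM; apply: ler_pM; rewrite ?cabs_ge0 ?mxmax_le// cabsM -[X in _ <= X]mul1r.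
by apply: ler_pM; rewrite ?cabs_ge0// cexp_strip.
Qed.

Lemma Fu_close (r e : R) : 0 < e -> exists2 d : R, 0 < d & forall u u0 lam, (forall k, cabs (u0 k) <= 1) ->
  (forall k, cabs (u k - u0 k) <= d) -> `|complex.Im lam| <= r -> cabs (Fu b u lam - Fu b u0 lam) <= e.
Proof.
move=> e0; have [d d0 hd] := det_ucont n (mxmax CC + mxmax D * expR (r * bsum)) e0.
pose B := mxmax D * expR (r * bsum) + 1.
have B0 : 0 < B by rewrite /B ltr_wpDl// mulr_ge0 ?mxmax_ge0 ?expR_ge0.
exists (d / B); first by rewrite divr_gt0.
move=> u u0 lam h0 hu hl; apply: hd => i j.
  rewrite mxE mul_dgm; apply: le_trans (cabsD _ _) _; apply: lerD; first exact: mxmax_le.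
  rewrite cabsM; apply: ler_pM; rewrite ?cabs_ge0 ?mxmax_le// cabsM -[X in _ <= X]mul1r.
  by apply: ler_pM; rewrite ?cabs_ge0// cexp_strip.
rewrite [X in cabs (X - _)]mxE [X in cabs (_ - X)]mxE !mul_dgm.
have -> : CC i j + D i j * (u j * cexp ('i * lam * (b j)%:C)) - (CC i j + D i j * (u0 j * cexp ('i * lam * (b j)%:C))) =
   (u j - u0 j) * (D i j * cexp ('i * lam * (b j)%:C)) by ring.
rewrite cabsM; apply: (@le_trans _ _ (d / B * (mxmax D * expR (r * bsum)))).
  by apply: ler_pM; rewrite ?cabs_ge0// cabsM ler_pM ?cabs_ge0 ?mxmax_le// cexp_strip.
rewrite mulrAC ler_pdivrMr// ler_wpM2l ?(ltW d0)//; by rewrite /B lerDl.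
Qed.

Lemma exp_small (d : R) k : 0 < d -> b k != 0 -> exists2 h : R, 0 < h & forall y : R, h <= y -> expR (- (y * `|b k|)) <= d.
Proof.
move=> d0 bk0; have B0 : 0 < `|b k| by rewrite normr_gt0.
exists (d^-1 / `|b k|); first by rewrite divr_gt0// invr_gt0.
move=> y hy; rewrite expRN -[X in _ <= X]invrK lef_pV2 ?posrE ?expR_gt0 ?invr_gt0//.
have : d^-1 <= y * `|b k| by rewrite -ler_pdivrMr.
have := @expR_ge1Dx R (y * `|b k|); lra.
Qed.

(* High in the upper half-plane the term carrying all the growing exponentials dominates. *)
Lemma Fu_upper : (forall k, b k != 0) ->
  \det (CC *m dgm (fun k => (0 < b k)%R%:R) + D *m dgm (fun k => (b k < 0)%R%:R)) != 0 ->
  exists h c : R, [/\ 0 < h, 0 < c & forall u lam, (forall k, cabs (u k) = 1) -> h <= complex.Im lam ->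
    c * cabs (cexp ('i * lam * (\sum_k (if b k < 0 then b k else 0))%:C)) <= cabs (Fu b u lam)].
Proof.
move=> b0; move EM: (CC *m _ + _) => M0 dM0.
have dM : 0 < cabs (\det M0) by rewrite cabs_gt0.
have e0 : 0 < cabs (\det M0) / 2 by rewrite divr_gt0.
have [d d0 hd] := det_ucont n (mxmax M0) e0.
pose B := mxmax CC + mxmax D + 1.
have B0 : 0 < B by rewrite /B ltr_wpDl// addr_ge0 ?mxmax_ge0.
have dB : 0 < d / B by rewrite divr_gt0.
have hk k : exists h : R, 0 < h /\ forall y, h <= y -> expR (- (y * `|b k|)) <= d / B.
  by have [h h0 hh] := exp_small dB (b0 k); exists h.
have [hs hhs] := choice hk.
exists (1 + \sum_k hs k), (cabs (\det M0) / 2); split; [|exact: e0|].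
  by rewrite ltr_pwDl// sumr_ge0// => k _; case: (hhs k) => /ltW.
move=> u lam hu him.
pose ex k := u k * cexp ('i * lam * (b k)%:C).
have ex0 k : ex k != 0 by rewrite mulf_neq0 ?cexp_neq0// -cabs_gt0 hu.
(* In the upper half-plane exp(i lambda b_k) grows exactly when b_k < 0. Multiplying column k by
   [e1 k] divides out the growing exponentials, and the matrix becomes close to [M0]. *)
pose e1 k := if b k < 0 then (ex k)^-1 else 1.
pose e2 k := if b k < 0 then 1 else ex k.
have e12 k : ex k * e1 k = e2 k by rewrite /e1 /e2; case: ifP => _; rewrite ?mulfV ?mulr1.
have sm k : cabs (if b k < 0 then (ex k)^-1 else ex k) <= d / B.
  apply: le_trans ((hhs k).2 (complex.Im lam) _); last first.
    apply: le_trans him; apply: ler_wpDl => //; rewrite (bigD1 k)//= lerDl.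
    by apply: sumr_ge0 => j _; case: (hhs j) => /ltW.
  have cex : cabs (ex k) = expR (- (complex.Im lam * b k)) by rewrite cabsM hu mul1r cabs_cexpi.
  case: ifP => bn.
    by rewrite cabsV cex -expRN opprK ler_expR (ltr0_norm bn) mulrN opprK.
  by rewrite cex ler_expR ger0_norm// leNgt bn.
have key : \det (CC + D *m dgm ex) * \prod_k e1 k = \det (CC *m dgm e1 + D *m dgm e2).
  rewrite -det_dgm -det_mulmx mulmxDl -mulmxA; congr (\det (_ + _ *m _)).
  by apply/matrixP => i j; rewrite mul_dgm !mxE; case: eqVneq => [->|_]; rewrite ?mul0r ?e12.
have near : cabs (\det (CC *m dgm e1 + D *m dgm e2) - \det M0) <= cabs (\det M0) / 2.
  apply: hd => i j; [exact: mxmax_le|].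
  rewrite -EM [X in cabs (X - _)]mxE [X in cabs (_ - X)]mxE !mul_dgm /e1 /e2.
  have := sm j; have := b0 j; case: (ltgtP (b j) 0) => [bj|bj|bj] bj0 smj.
  - rewrite mulr0 mulr1 add0r addrK cabsM; apply: (@le_trans _ _ (mxmax CC * (d / B))).
      by rewrite ler_pM ?cabs_ge0 ?mxmax_le.
    rewrite mulrCA ler_piMr ?(ltW d0)// ler_pdivrMr// mul1r /B -addrA lerDl.
    by rewrite addr_ge0 ?mxmax_ge0.
  - rewrite mulr0 mulr1 addr0 addrAC subrr add0r cabsM; apply: (@le_trans _ _ (mxmax D * (d / B))).
      by rewrite ler_pM ?cabs_ge0 ?mxmax_le.
    rewrite mulrCA ler_piMr ?(ltW d0)// ler_pdivrMr// mul1r /B addrAC lerDr.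
    by rewrite addr_ge0 ?mxmax_ge0.
  - by [].
have low : cabs (\det M0) / 2 <= cabs (Fu b u lam * \prod_k e1 k).
  rewrite -/ex in key *; rewrite /Fu key.
  have := cabs_sub (\det M0) (\det (CC *m dgm e1 + D *m dgm e2)); rewrite cabs_dist; lra.
have prd : cabs (\prod_k e1 k) * cabs (cexp ('i * lam * (\sum_k (if b k < 0 then b k else 0))%:C)) = 1.
  have -> : 'i * lam * (\sum_k (if b k < 0 then b k else 0))%:C = \sum_k 'i * lam * (if b k < 0 then b k else 0)%:C.
    by rewrite (rmorph_sum (real_complex R)) mulr_sumr.
  rewrite cexp_sum !cabs_prod -big_split /= big1// => k _; rewrite /e1 /ex.
  case: ifP => _; last by rewrite mulr0 cexp0 cabs1 mul1r.
  by rewrite cabsV cabsM hu mul1r mulVf// cabs_eq0 cexp_neq0.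
rewrite cabsM in low.
apply: le_trans (ler_wpM2r (cabs_ge0 _) low) _; rewrite -(mulrA (cabs (Fu b u lam))) prd mulr1; exact: lexx.
Qed.

End ExponentialPolynomial.

(** Among the size s + 1 distinct candidates d / (i + 2), one is missing from s. *)
Lemma avoid_radius (R : realType) (s : seq R) (d : R) : 0 < d -> exists2 r : R, 0 < r < d & r \notin s.
Proof.
move=> d0; pose t := [seq d / (i.+2)%:R | i <- iota 0 (size s).+1].
have ut : uniq t.
  rewrite map_inj_uniq ?iota_uniq// => i j /(mulfI (lt0r_neq0 d0))/invr_inj/eqP.
  by rewrite eqr_nat => /eqP[].
have [/allP h|/allPn[r rt rs]] := boolP (all (mem s) t).
  by have := uniq_leq_size ut h; rewrite size_map size_iota ltnn.
exists r => //; have /mapP[i _ ->] := rt; rewrite divr_gt0//= ltr_pdivrMr// ltr_pMr//.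
by rewrite ltr1n.
Qed.

(** * A compact family of exponential polynomials *)

Section UnimodularFamily.
Variables (R : realType) (n : nat).
Local Notation C := R[i].
Variable F : ('I_n -> C) -> C -> C.
Hypothesis F_entire : forall u, entire (F u).
Hypothesis F_close : forall r e : R, 0 < e -> exists2 d : R, 0 < d & forall u u0 lam, (forall k, cabs (u0 k) <= 1) ->
  (forall k, cabs (u k - u0 k) <= d) -> `|complex.Im lam| <= r -> cabs (F u lam - F u0 lam) <= e.
Hypothesis F_neq0 : forall u, (forall k, cabs (u k) = 1) -> exists z, F u z != 0.

(* Compactness in (u, y) together with Rouche: near a zero of a limit function every
   nearby function has a zero. *)
Lemma unimodular_dichotomy (d h : R) : 0 < d -> 0 < h -> exists2 c : R, 0 < c & forall u y, (forall k, cabs (u k) = 1) -> `|y| <= h ->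
  (exists2 z, cabs (z - (0 +i* y)) < d & F u z = 0) \/ c <= cabs (F u (0 +i* y)).
Proof.
move=> d0 h0.
(* The torus and the segment are read off a single real vector: real parts, imaginary parts, then y
   / h, so every coordinate lies in [-1, 1]. Vectors off the torus are disposed of by a
   neighbourhood on which the claim is vacuous. *)
pose u (v : 'rV[R]_(n + n + 1)) k : C := v 0 (lshift 1 (lshift n k)) +i* v 0 (lshift 1 (rshift n k)).
pose y (v : 'rV[R]_(n + n + 1)) : R := h * v 0 (rshift (n + n) ord0).
pose pt (v : 'rV[R]_(n + n + 1)) : C := 0 +i* y v.
have ucl (v v' : 'rV[R]_(n + n + 1)) e : (forall i, `|v' 0 i - v 0 i| < e / 2) -> forall k, cabs (u v' k - u v k) < e.
  move=> hv k; apply: le_lt_trans (cabs_le_ReIm _) _ => /=.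
  by have := hv (lshift 1 (lshift n k)); have := hv (lshift 1 (rshift n k)); lra.
have ycl (v v' : 'rV[R]_(n + n + 1)) e : (forall i, `|v' 0 i - v 0 i| < e / h) -> cabs (pt v' - pt v) < e.
  move=> hv; apply: le_lt_trans (cabs_le_ReIm _) _ => /=; rewrite subr0 normr0 add0r -mulrBr normrM gtr0_norm//.
  by have := hv (rshift (n + n) ord0); rewrite ltr_pdivlMr// mulrC.
pose Pr (v : 'rV[R]_(n + n + 1)) (m : R) := (forall k, cabs (u v k) = 1) ->
  (exists2 z, cabs (z - pt v) < d & F (u v) z = 0) \/ m <= cabs (F (u v) (pt v)).
have yB (v : 'rV[R]_(n + n + 1)) : (forall i, `|v 0 i| <= 1) -> `|y v| <= h.
  by move=> hv; rewrite normrM gtr0_norm// ler_piMr// ltW.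
have [||c c0 hc] := @box_cover R (n + n + 1) 1 Pr.
- by move=> v m m' mm hv hu; have [hz|hm] := hv hu; [left|right; exact: le_trans hm].
- move=> v hv; have [uni|nuni] := pselect (forall k, cabs (u v k) = 1); last first.
    have [k /eqP hk] : exists k, cabs (u v k) <> 1 by apply/existsNP.
    have e0 : 0 < `|cabs (u v k) - 1| by rewrite normr_gt0 subr_eq0.
    exists (`|cabs (u v k) - 1| / 2); first by rewrite divr_gt0.
    exists 1 => // v' hv' _ /(_ k) E; have := ucl _ _ _ hv' k.
    have := cabs_sub (u v k) (u v' k); have := cabs_sub (u v' k) (u v k).
    rewrite (cabs_dist (u v k)) E => a1 a2 a3; exfalso; move: a3; apply/negP; rewrite -leNgt ler_norml; lra.
  have unile k : cabs (u v k) <= 1 by rewrite uni.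
  have [F0|Fn0] := eqVneq (F (u v) (pt v)) 0; last first.
    have m0 : 0 < cabs (F (u v) (pt v)) / 4 by rewrite divr_gt0// cabs_gt0.
    have [d1 d10 h1] := F_close h m0.
    have [d2 [d20 h2]] := entire_cont (pt v) (F_entire (u v)) m0.
    exists (Num.min (d1 / 2) (d2 / h)); first by rewrite lt_min !divr_gt0.
    exists (cabs (F (u v) (pt v)) / 4) => // v' hv' hv'1 _; right.
    have k1 : cabs (F (u v') (pt v') - F (u v) (pt v')) <= cabs (F (u v) (pt v)) / 4.
      apply: h1 => // [k|]; last exact: yB.
      by apply/ltW/ucl => i; apply: lt_le_trans (hv' i) _; rewrite ge_min lexx.
    have k2 : cabs (F (u v) (pt v') - F (u v) (pt v)) < cabs (F (u v) (pt v)) / 4.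
      by apply: h2; apply: ycl => i; apply: lt_le_trans (hv' i) _; rewrite ge_min lexx orbT.
    have := cabs_sub (F (u v) (pt v)) (F (u v') (pt v')); rewrite cabs_dist.
    have := cabs_tri (F (u v') (pt v')) (F (u v) (pt v')) (F (u v) (pt v)); lra.
  (* Here the function vanishes at [pt v]. A circle of radius [rho] < d/2 free of its zeros carries
     Rouche to all nearby parameters; the zero obtained is within [rho] of [pt v], hence within d of
     the perturbed point. The radius h + d contains this disc. *)
  have [z0 Fz0] := F_neq0 uni; pose r := h + d.
  have r0 : 0 < r by rewrite addr_gt0.
  have [s [g [hg FE hs gn0]]] := entire_factor r (F_entire (u v)) Fz0.
  have d2 : 0 < d / 2 by rewrite divr_gt0.
  have [rho /andP[rho0 rhod] rhos] := avoid_radius [seq cabs (z - pt v) | z <- s] d2.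
  have ptr : cabs (pt v) <= h.
    by apply: le_trans (cabs_le_ReIm _) _; rewrite /= normr0 add0r yB.
  have inr w : cabs (w - pt v) <= rho -> cabs w <= r.
    by move=> hw; have := cabs_sub w (pt v); rewrite /r; lra.
  have [m1 m10 hm1] := @circle_lower_bound R [seq z - pt v | z <- s] rho (fun z => ltac:(move=> /mapP[w ws ->]; apply: contraNneq rhos => <-; exact: map_f)).
  have [m2 m20 hm2] := entire_min hg gn0.
  have m0 : 0 < m1 * m2 / 4 by rewrite divr_gt0// mulr_gt0.
  have Flow w : cabs (w - pt v) = rho -> m1 * m2 <= cabs (F (u v) w).
    move=> hw; rewrite FE cabsM; apply: ler_pM; [exact: ltW|exact: ltW| |by apply: hm2; apply: inr; rewrite hw].
    have := hm1 (w - pt v) hw; rewrite /prodX big_map.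
    by under eq_bigr do rewrite opprB addrA subrK.
  have [d1 d10 h1] := F_close r m0.
  exists (Num.min (d1 / 2) (d / 2 / h)); first by rewrite lt_min !divr_gt0.
  exists 1 => // v' hv' hv'1 uni'; left.
  have close w : cabs w <= r -> cabs (F (u v') w - F (u v) w) <= m1 * m2 / 4.
    move=> hw; apply: h1 => // [k|].
      by apply/ltW/ucl => i; apply: lt_le_trans (hv' i) _; rewrite ge_min lexx.
    exact: le_trans (Im_le_cabs _) hw.
  have [z0' Fz0'] := F_neq0 uni'.
  have [s' [g' [hg' FE' hs' gn0']]] := entire_factor r (F_entire (u v')) Fz0'.
  have := @entire_rouche R (F (u v)) (F (u v')) g g' s s' (pt v) rho rho0 hg hg' FE FE'.
  have H1 w : cabs (w - pt v) <= rho -> g w != 0 /\ g' w != 0.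
    by move=> /inr hw; rewrite gn0// gn0'.
  have H2 w : cabs (w - pt v) = rho -> F (u v) w != 0 /\ cabs (F (u v) w - F (u v') w) <= cabs (F (u v) w) / 4.
    move=> hw; have lw := Flow w hw; split; first by rewrite -cabs_gt0 (lt_le_trans _ lw)// mulr_gt0.
    rewrite cabs_dist; apply: le_trans (close w (inr w _)) _; first by rewrite hw.
    by rewrite ler_pM2r// invr_gt0.
  move=> /(_ H1 H2) cnt.
  have pts : pt v \in s by rewrite -prodX_eq0; move: F0; rewrite FE => /eqP; rewrite mulf_eq0 (negbTE (gn0 _ _)) ?orbF// inr// subrr cabs0 ltW.
  have : has (fun z => cabs (z - pt v) < rho) s'.
    rewrite has_count -cnt -has_count; apply/hasP; exists (pt v) => //.
    by rewrite subrr cabs0.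
  move=> /hasP[z zs zr]; exists z; last by apply/eqP; rewrite FE' mulf_eq0 prodX_eq0 zs.
  have := cabs_tri z (pt v) (pt v'); have : cabs (pt v' - pt v) < d / 2.
    by apply: ycl => i; apply: lt_le_trans (hv' i) _; rewrite ge_min lexx orbT.
  rewrite (cabs_dist (pt v)); lra.
exists c => // u1 y1 hu hy.
pose v : 'rV[R]_(n + n + 1) := row_mx (row_mx (\row_k complex.Re (u1 k)) (\row_k complex.Im (u1 k))) (\row_k (y1 / h)).
have vu : u v = u1.
  by apply/funext => k; rewrite /u /v !row_mxEl row_mxEr !mxE; case: (u1 k).
have vy : pt v = 0 +i* y1 by rewrite /pt /y /v row_mxEr mxE mulrC divfK// gt_eqF.
have := hc v; rewrite /Pr vu vy; apply => //.
move=> i; case: (splitP i) => [j ij|j ij].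
  have -> : i = lshift 1 j by apply: val_inj.
  rewrite /v row_mxEl; case: (splitP j) => [k jk|k jk].
    have -> : j = lshift n k by apply: val_inj.
    by rewrite row_mxEl mxE; apply: le_trans (Re_le_cabs _) _; rewrite hu.
  have -> : j = rshift n k by apply: val_inj.
  by rewrite row_mxEr mxE; apply: le_trans (Im_le_cabs _) _; rewrite hu.
have -> : i = rshift (n + n) j by apply: val_inj.
by rewrite /v row_mxEr mxE normrM normfV (gtr0_norm h0) ler_pdivrMr// mul1r.
Qed.

End UnimodularFamily.

Section LowerBounds.
Variables (R : realType) (n : nat).
Local Notation C := R[i].
Variables (CC D : 'M[C]_n) (b : 'I_n -> R).
Hypothesis b0 : forall k, b k != 0.
Hypothesis dup : \det (CC *m dgm (fun k => (0 < b k)%R%:R) + D *m dgm (fun k => (b k < 0)%R%:R)) != 0.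
Hypothesis ddn : \det (CC *m dgm (fun k => (b k < 0)%R%:R) + D *m dgm (fun k => (0 < b k)%R%:R)) != 0.
Local Notation F := (Fu CC D b).

Definition Rp : R := \sum_k (if 0 < b k then b k else 0).

Lemma iNN (lam : C) (x : R) : 'i * - lam * (- x)%:C = 'i * lam * x%:C.
Proof. by rewrite rmorphN !mulrN mulNr opprK. Qed.

Lemma Fu_lower : exists h c : R, [/\ 0 < h, 0 < c & forall u lam, (forall k, cabs (u k) = 1) -> complex.Im lam <= - h ->
    c * cabs (cexp ('i * lam * Rp%:C)) <= cabs (F u lam)].
Proof.
have bN k : - b k != 0 by rewrite oppr_eq0.
have [|h [c [h0 c0 hc]]] := @Fu_upper R n CC D (fun k => - b k) bN.
  rewrite (_ : dgm (fun k => (0 < - b k)%R%:R) = dgm (fun k => (b k < 0)%R%:R)); last first.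
    by apply/matrixP => i j; rewrite !mxE oppr_gt0.
  rewrite (_ : dgm (fun k => (- b k < 0)%R%:R) = dgm (fun k => (0 < b k)%R%:R)) //.
  by apply/matrixP => i j; rewrite !mxE oppr_lt0.
exists h, c; split => // u lam hu him; have := hc u (- lam) hu.
have -> : complex.Im (- lam) = - complex.Im lam by case: (lam).
rewrite lerNr => /(_ him).
have -> : Fu CC D (fun k => - b k) u (- lam) = F u lam.
  congr (\det (_ + _ *m _)); apply/matrixP => i j; rewrite !mxE.
  by rewrite iNN.
have -> // : 'i * - lam * (\sum_k (if - b k < 0 then - b k else 0))%:C = 'i * lam * Rp%:C.
have -> : \sum_k (if - b k < 0 then - b k else 0) = - Rp.
  by rewrite /Rp -sumrN; apply: eq_bigr => k _; rewrite oppr_lt0; case: ifP; rewrite ?oppr0.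
by rewrite iNN.
Qed.

Lemma Fu_neq0 u : (forall k, cabs (u k) = 1) -> exists z, F u z != 0.
Proof.
move=> hu; have [h [c [h0 c0 hc]]] := Fu_upper b0 dup; exists (0 +i* h).
rewrite -cabs_gt0; apply: lt_le_trans (hc u _ hu _) => //.
by rewrite mulr_gt0// cabs_gt0 cexp_neq0.
Qed.

Lemma Fu_middle (d h : R) : 0 < d -> 0 < h -> exists2 c : R, 0 < c & forall u y, (forall k, cabs (u k) = 1) -> `|y| <= h ->
  (exists2 z, cabs (z - (0 +i* y)) < d & F u z = 0) \/ c <= cabs (F u (0 +i* y)).
Proof. exact: (unimodular_dichotomy (Fu_entire CC D b) (Fu_close CC D b) Fu_neq0). Qed.

End LowerBounds.

Lemma cplx_split (R : realType) (z : R[i]) : z = (0 +i* complex.Im z) + (complex.Re z)%:C.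
Proof. by case: z => x y; apply/eqP; rewrite eq_complex /= add0r addr0 !eqxx. Qed.

(** * Lower bounds for Delta_0 and location of its zeros *)

Section ZeroDistribution.
Variables (R : realType) (n : nat).
Local Notation C := R[i].
Variables (F : ('I_n -> C) -> C -> C) (D0 : C -> C) (ux : R -> 'I_n -> C) (rn rp : R).
Local Notation uni u := (forall k, cabs (u k) = 1).
Hypothesis ux1 : forall x k, cabs (ux x k) = 1.
Hypothesis F_shift : forall x z, D0 (z + x%:C) = F (ux x) z.
Hypothesis F_upper : exists h c : R, [/\ 0 < h, 0 < c & forall u lam, uni u -> h <= complex.Im lam ->
  c * cabs (cexp ('i * lam * rn%:C)) <= cabs (F u lam)].
Hypothesis F_lower : exists h c : R, [/\ 0 < h, 0 < c & forall u lam, uni u -> complex.Im lam <= - h ->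
  c * cabs (cexp ('i * lam * rp%:C)) <= cabs (F u lam)].
Hypothesis F_middle : forall d h : R, 0 < d -> 0 < h -> exists2 c : R, 0 < c & forall u y, uni u -> `|y| <= h ->
  (exists2 z, cabs (z - (0 +i* y)) < d & F u z = 0) \/ c <= cabs (F u (0 +i* y)).
Hypothesis F_bounded : forall r : R, exists2 M : R, 0 < M & forall u lam, (forall k, cabs (u k) <= 1) ->
  `|complex.Im lam| <= r -> cabs (F u lam) <= M.

Lemma shift_Re z : D0 z = F (ux (complex.Re z)) (0 +i* complex.Im z).
Proof. by rewrite {1}(cplx_split z) F_shift. Qed.

Lemma cexp_strip1 (lam : C) (r h : R) : `|complex.Im lam| <= h -> cabs (cexp ('i * lam * r%:C)) <= expR (h * `|r|).
Proof.
move=> hl; rewrite cabs_cexpi ler_expR; apply: le_trans (ler_norm _) _.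
by rewrite normrN normrM ler_wpM2r.
Qed.

(** A real translation brings lambda to the imaginary axis at the price of changing u. In the strip
    the dichotomy excludes its first branch, and exponentials are bounded there; outside the strip
    the half-plane bounds apply directly. *)
Lemma zero_free_lower (d : R) : 0 < d -> exists2 c : R, 0 < c & forall lam, (forall z, D0 z = 0 -> d <= cabs (z - lam)) ->
  (0 <= complex.Im lam -> c * cabs (cexp ('i * lam * rn%:C)) <= cabs (D0 lam)) /\
  (complex.Im lam <= 0 -> c * cabs (cexp ('i * lam * rp%:C)) <= cabs (D0 lam)).
Proof.
move=> d0; have [h1 [c1 [h10 c10 up]]] := F_upper; have [h2 [c2 [h20 c20 dn]]] := F_lower.
have h0 : 0 < h1 + h2 by rewrite addr_gt0.
have [cm cm0 mid] := F_middle d0 h0.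
pose E (r : R) := expR ((h1 + h2) * `|r|).
have E0 r : 0 < E r by exact: expR_gt0.
exists (Num.min (Num.min c1 c2) (Num.min (cm / E rn) (cm / E rp))).
  by rewrite !lt_min c10 c20 !divr_gt0.
move=> lam far.
have strip r : `|complex.Im lam| <= h1 + h2 -> cm / E r * cabs (cexp ('i * lam * r%:C)) <= cabs (D0 lam).
  move=> hl; apply: (@le_trans _ _ cm).
    by rewrite mulrAC ler_pdivrMr// ler_pM2l// cexp_strip1.
  have [[z zl Fz]|] := mid (ux (complex.Re lam)) (complex.Im lam) (ux1 _) hl; last by rewrite -shift_Re.
  have /far : D0 (z + (complex.Re lam)%:C) = 0 by rewrite F_shift.
  rewrite {2}(cplx_split lam).
  have -> : z + (complex.Re lam)%:C - ((0 +i* complex.Im lam) + (complex.Re lam)%:C) = z - (0 +i* complex.Im lam) by ring.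
  by rewrite leNgt zl.
have low c c' t r : c <= c' -> c' * cabs t <= r -> c * cabs t <= r :> R.
  by move=> cc; apply: le_trans; rewrite ler_wpM2r ?cabs_ge0.
split=> him; have [hs|hs] := leP `|complex.Im lam| (h1 + h2).
- by apply: low (strip _ hs); rewrite !ge_min lexx !orbT.
- apply: (low _ c1); first by rewrite !ge_min lexx.
  have -> : D0 lam = F (ux (complex.Re lam)) (0 +i* complex.Im lam) by exact: shift_Re.
  have := up (ux (complex.Re lam)) (0 +i* complex.Im lam) (ux1 _).
  rewrite !cabs_cexpi; apply => /=; rewrite ger0_norm// in hs.
  by apply: le_trans (ltW hs); rewrite lerDl ltW.
- by apply: low (strip _ hs); rewrite !ge_min lexx !orbT.
- apply: (low _ c2); first by rewrite !ge_min lexx !orbT.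
  have -> : D0 lam = F (ux (complex.Re lam)) (0 +i* complex.Im lam) by exact: shift_Re.
  have := dn (ux (complex.Re lam)) (0 +i* complex.Im lam) (ux1 _).
  rewrite !cabs_cexpi; apply => /=; rewrite ler0_norm// in hs.
  by rewrite lerNr; apply: le_trans (ltW hs); rewrite lerDr ltW.
Qed.

Lemma zeros_strip : exists2 h : R, 0 < h & forall z, D0 z = 0 -> `|complex.Im z| < h.
Proof.
have [h1 [c1 [h10 c10 up]]] := F_upper; have [h2 [c2 [h20 c20 dn]]] := F_lower.
have pos (c : R) t : 0 < c -> c * cabs (cexp t) <= 0 -> False.
  by move=> c0; rewrite leNgt mulr_gt0// cabs_gt0 cexp_neq0.
exists (h1 + h2); first by rewrite addr_gt0.
move=> z Dz; rewrite ltNge; apply/negP => hz; have Fz : F (ux (complex.Re z)) (0 +i* complex.Im z) = 0 by rewrite -shift_Re.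
have [z0|z0] := leP 0 (complex.Im z).
  have := up (ux (complex.Re z)) (0 +i* complex.Im z) (ux1 _); rewrite Fz cabs0 => /= H; apply: (pos _ _ c10) (H _).
  by rewrite ger0_norm// in hz; apply: le_trans hz; rewrite lerDl ltW.
have := dn (ux (complex.Re z)) (0 +i* complex.Im z) (ux1 _); rewrite Fz cabs0 => /= H; apply: (pos _ _ c20) (H _).
by rewrite ltr0_norm// in hz; rewrite lerNr; apply: le_trans hz; rewrite lerDr ltW.
Qed.

(** At height h the upper half-plane bound is a lower bound independent of x, so a Jensen count
    about x + i h gives a bound K that does not depend on the horizontal position. *)
Lemma zero_count_disc : exists2 h : R, 0 < h & forall rho : R, 0 < rho -> exists K : nat, forall (x : R) s g, entire g ->
  (forall w, D0 w = prodX s w * g w) -> {in s, forall z, cabs (z - (x +i* h)) <= rho} -> (size s <= K)%N.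
Proof.
have [h [c [h0 c0 up]]] := F_upper; exists h => // rho rho0.
have [M M0 hM] := F_bounded (h + 4 * rho).
have m0 : 0 < c * expR (- (h * rn)) by rewrite mulr_gt0 ?expR_gt0.
have [K hK] := geo_half_lt (2 * M) m0; exists K => x s g hg DE hs; rewrite leqNgt; apply/negP => Ks.
have low : c * expR (- (h * rn)) <= cabs (D0 (x +i* h)).
  by have := up (ux x) (0 +i* h) (ux1 x) (lexx _); rewrite cabs_cexpi shift_Re.
have hi w : cabs (w - (x +i* h)) = 4 * rho -> cabs (D0 w) <= M.
  move=> hw; rewrite shift_Re; apply: hM => [k|]; first by rewrite ux1.
  have := Im_le_cabs (w - (x +i* h)); rewrite hw; case: w {hw} => p q /=.
  by move=> hq; rewrite -(subrK h q); apply: le_trans (ler_normD _ _) _; rewrite addrC (gtr0_norm h0) lerD2l.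
have := entire_zeros_bound hg rho0 DE hs hi.
apply/negP; rewrite -ltNge; apply: lt_le_trans low; apply: le_lt_trans hK.
apply: ler_wpM2l; first by apply: mulr_ge0 => //; exact: ltW.
by apply: ler_wiXn2l; rewrite ?invr_ge0 ?invf_le1 ?ler1n//; exact: ltnW.
Qed.

(** The zeros lie in a horizontal strip, which an annulus meets in two pieces of bounded size, near
    j and near -j; each fits in a disc about one of the points j + i h and -j + i h. Width 2 is what
    a ring between radii taken in [j, j + 1) and [j + 1, j + 2) occupies. *)
Lemma zero_count_annulus : exists K : nat, forall (j : nat) s g, entire g -> (forall w, D0 w = prodX s w * g w) ->
  {in s, forall z, j%:R <= cabs z <= j%:R + 2} -> (size s <= K)%N.
Proof.
have [h h0 hh] := zero_count_disc; have [h1 h10 hz] := zeros_strip.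
pose rho := 2 * h1 + 2 + h.
have rho0 : 0 < rho by rewrite /rho; lra.
have [K hK] := hh _ rho0; exists (K + K)%N => j s g hg DE hs.
have strip z : z \in s -> `|complex.Im z| < h1.
  by move=> zs; apply: hz; rewrite DE; apply/eqP; rewrite mulf_eq0 prodX_eq0 zs.
pose p (z : C) := 0 <= complex.Re z.
have bnd z : z \in s -> [/\ j%:R - h1 <= `|complex.Re z|, `|complex.Re z| <= j%:R + 2 & `|complex.Im z| < h1].
  move=> zs; have /andP[a1 a2] := hs z zs; split; last exact: strip.
    by rewrite lerBlDr; apply: le_trans a1 (le_trans (cabs_le_ReIm _) _); rewrite lerD2l ltW// strip.
  exact: le_trans (Re_le_cabs _) a2.
rewrite -(count_predC p) -!size_filter; apply: leq_add.
  apply: (hK j%:R _ (fun w => prodX [seq z <- s | ~~ p z] w * g w)).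
  - by apply: entireM => //; exact: entire_prodX.
  - by move=> w; rewrite mulrA -prodX_split.
  move=> z; rewrite mem_filter => /andP[pz zs]; apply: le_trans (cabs_le_ReIm _) _.
  have [a1 a2 a3] := bnd z zs; move: pz a1 a2 a3; rewrite /p; case: z {zs} => x y /= x0.
  rewrite (ger0_norm x0) ltr_norml => a1 a2 /andP[a3 a4].
  apply: (@le_trans _ _ ((h1 + 2) + (h1 + h))); last by rewrite /rho; lra.
  by apply: lerD; rewrite ler_norml; apply/andP; split; lra.
apply: (hK (- j%:R) _ (fun w => prodX [seq z <- s | p z] w * g w)).
- by apply: entireM => //; exact: entire_prodX.
- by move=> w; rewrite mulrA -[X in _ = X * _]mulrC -prodX_split.
move=> z; rewrite mem_filter => /andP[pz zs]; apply: le_trans (cabs_le_ReIm _) _.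
have [a1 a2 a3] := bnd z zs; move: pz a1 a2 a3; rewrite /p; case: z {zs} => x y /=; rewrite -ltNge => x0.
rewrite (ltr0_norm x0) ltr_norml => a1 a2 /andP[a3 a4].
apply: (@le_trans _ _ ((h1 + 2) + (h1 + h))); last by rewrite /rho; lra.
by apply: lerD; rewrite ler_norml; apply/andP; split; lra.
Qed.

End ZeroDistribution.

(** * Comparison of the two characteristic determinants *)

Section Translates.
Variables (R : realType) (n : nat).
Local Notation C := R[i].
Variables (CC D : 'M[C]_n) (b : 'I_n -> R).

Definition ux (x : R) (k : 'I_n) : C := cexp ('i * x%:C * (b k)%:C).

Lemma cabs_ux x k : cabs (ux x k) = 1.
Proof. by rewrite /ux cabs_cexpi /= mul0r oppr0 expR0. Qed.

Lemma Fu_shift x z : Fu CC D b (fun=> 1) (z + x%:C) = Fu CC D b (ux x) z.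
Proof.
congr (\det (_ + _ *m _)); apply/matrixP => i j; rewrite !mxE; case: eqVneq => // _.
by rewrite mul1r mulrDr mulrDl cexpD mulrC.
Qed.

End Translates.

Section Reflection.
Variables (R : realType) (l : R) (n : nat).
Local Notation C := R[i].
Variables (beta : 'I_n -> R -> R) (Q : R -> 'M[C]_n) (CC D : 'M[C]_n).
Hypothesis l0 : 0 < l.
Hypothesis Ib : forall k, rI l (beta k).
Let nbeta k x := - beta k x.

Lemma bk_opp k : bk nbeta l k = - bk beta l k.
Proof. by rewrite /bk -[LHS]/(ri _ 0 l) (riN (Ib k)). Qed.

(** Both sides solve literally the same equation, so the predicates passed to [epsilon] are equal
    and so are the chosen solutions. *)
Lemma PhiQ_opp lam : PhiQ nbeta Q l (- lam) = PhiQ beta Q l lam.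
Proof.
have EA : (fun t => ('i * - lam) *: Bmx nbeta t - Q t) = (fun t => ('i * lam) *: Bmx beta t - Q t).
  apply/funext => t; congr (_ - _); apply/matrixP => i j; rewrite !mxE.
  by case: eqVneq => _; rewrite ?mulr0// rmorphN !mulrN mulNr opprK.
have E : is_fundamental nbeta Q l (- lam) = is_fundamental beta Q l lam.
  pose G (A : R -> 'M[C]_n) (Phi : R -> 'M[C]_n) := mxintegrable l (fun t => A t *m Phi t) /\
    forall x, seg l x -> Phi x = 1%:M + mxint (fun t => A t *m Phi t) 0 x.
  by rewrite -[LHS]/(G _) -[RHS]/(G _) EA.
by rewrite /PhiQ E.
Qed.

Lemma DeltaQ_opp lam : DeltaQ nbeta Q l CC D (- lam) = DeltaQ beta Q l CC D lam.
Proof. by rewrite /DeltaQ PhiQ_opp. Qed.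

Lemma Delta0_Fu lam : Delta0 beta l CC D lam = Fu CC D (bk beta l) (fun=> 1) lam.
Proof.
congr (\det (_ + _ *m _)); apply/matrixP => i j; rewrite !mxE mul1r.
by case: eqVneq => [->|].
Qed.

Lemma Delta0_opp lam : Delta0 nbeta l CC D (- lam) = Delta0 beta l CC D lam.
Proof.
congr (\det (_ + _ *m _)); apply/matrixP => i j; rewrite !mxE.
by case: eqVneq => // _; rewrite bk_opp iNN.
Qed.

End Reflection.

Section Comparison.
Variables (R : realType) (l : R) (n : nat).
Hypothesis l0 : 0 < l.
Local Notation C := R[i].
Variables (beta : 'I_n -> R -> R) (Q : R -> 'M[C]_n) (Mb : R).
Hypothesis (Ib : forall k, rI l (beta k)) (IQ : mxintegrable l Q).
Hypothesis hMb : forall k, ae_on l (fun x => `|beta k x| <= Mb).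
Hypothesis hsgn : forall k, ae_on l (fun x => if bk beta l k < 0 then beta k x < 0 else 0 < beta k x).
Hypothesis hsep : forall j k, ae_on l (fun x => Q x j k = 0) \/
  exists2 c : R, 0 < c & ae_on l (fun x => c <= `|beta j x - beta k x|).
Hypothesis hdiag : forall j, ae_on l (fun x => Q x j j = 0).
Variables (CC D : 'M[C]_n).
Local Notation b := (bk beta l).
Hypothesis b0 : forall k, b k != 0.
Hypothesis dup : \det (CC *m dgm (fun k => (0 < b k)%R%:R) + D *m dgm (fun k => (b k < 0)%R%:R)) != 0.
Hypothesis ddn : \det (CC *m dgm (fun k => (b k < 0)%R%:R) + D *m dgm (fun k => (0 < b k)%R%:R)) != 0.
Local Notation D0 := (Delta0 beta l CC D).
Local Notation DQ := (DeltaQ beta Q l CC D).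

Lemma Delta_asymp_lower (e : R) : 0 < e -> exists L : R, forall lam, complex.Im lam <= 0 -> L <= cabs lam ->
  cabs (DQ lam - D0 lam) <= e * cabs (cexp ('i * lam * (Rp b)%:C)).
Proof.
move=> e0; have [|||L hL] := @Delta_asymp_upper R l n l0 (fun k x => - beta k x) Q Mb
  (fun k => rIN (Ib k)) IQ _ _ _ hdiag CC D e e0.
- by move=> k; apply: ae_mono (hMb k) _ => x _; rewrite normrN.
- move=> k; rewrite (bk_opp Ib) oppr_lt0; apply: ae_mono (hsgn k) _ => x _.
  by have := b0 k; case: (ltgtP (b k) 0) => // _ _; rewrite ?oppr_gt0 ?oppr_lt0.
- move=> j k; have [H|[c c0 H]] := hsep j k; [by left|right].
  by exists c => //; apply: ae_mono H _ => x _; rewrite -opprD normrN.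
exists L => lam him hl; have := hL (- lam); rewrite DeltaQ_opp (Delta0_opp _ _ Ib).
have -> : complex.Im (- lam) = - complex.Im lam by case: (lam).
rewrite oppr_ge0 cabsN => /(_ him hl).
have -> : Rneg l (fun k x => - beta k x) = - Rp b.
  rewrite /Rp -sumrN; apply: eq_bigr => k _.
  by rewrite (bk_opp Ib) oppr_lt0; case: ifP; rewrite ?oppr0.
by rewrite iNN.
Qed.

Lemma D0_neq0 : exists z, D0 z != 0.
Proof. by have [z hz] := Fu_neq0 b0 dup (u := fun=> 1) (fun=> cabs1 R); exists z; rewrite Delta0_Fu. Qed.

Lemma D0_shift x z : D0 (z + x%:C) = Fu CC D b (ux b x) z.
Proof. by rewrite Delta0_Fu Fu_shift. Qed.

Lemma Delta0_count_annulus : exists K : nat, forall (j : nat) s g, entire g -> (forall w, D0 w = prodX s w * g w) ->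
  {in s, forall z, j%:R <= cabs z <= j%:R + 2} -> (size s <= K)%N.
Proof.
exact: (zero_count_annulus (@cabs_ux R n b) D0_shift (Fu_upper b0 dup) (Fu_lower b0 ddn) (Fu_bounded CC D b)).
Qed.

Lemma Delta_comparison (d : R) : 0 < d -> exists L : R, forall lam, L <= cabs lam ->
  (forall z, D0 z = 0 -> d <= cabs (z - lam)) -> D0 lam != 0 /\ cabs (D0 lam - DQ lam) <= cabs (D0 lam) / 4.
Proof.
move=> d0; have [c c0 low] := zero_free_lower (@cabs_ux R n b) D0_shift (Fu_upper b0 dup) (Fu_lower b0 ddn) (Fu_middle b0 dup) d0.
(* Accuracy c/4 against the lower bound c |exp| produces the ratio 1/4 that [entire_rouche] asks
   for. *)
have c4 : 0 < c / 4 by rewrite divr_gt0.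
have [L1 h1] := Delta_asymp_upper l0 Ib IQ hMb hsgn hsep hdiag CC D c4.
have [L2 h2] := Delta_asymp_lower c4.
exists (Num.max L1 L2) => lam; rewrite ge_max => /andP[hl1 hl2] far.
split; first by apply/eqP => D00; have := far _ D00; rewrite subrr cabs0 leNgt d0.
have [up dn] := low lam far; rewrite cabs_dist.
have fin r t : r <= c / 4 * t -> c * t <= cabs (D0 lam) -> r <= cabs (D0 lam) / 4.
  move=> a1 a2; apply: le_trans a1 _; rewrite mulrAC; exact: ler_wpM2r.
have [him|him] := leP 0 (complex.Im lam); first by apply: fin (h1 _ him hl1) (up him).
by apply: fin (h2 _ (ltW him) hl2) (dn (ltW him)).
Qed.

End Comparison.

(** * Matching of zeros *)

Section Multiplicity.
Variable R : realType.
Local Notation C := R[i].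

Lemma ccont_prod (f g : C -> C) z : ccont_at f z -> ccont_at g z -> ccont_at (fun w => f w * g w) z.
Proof.
move=> hf hg e e0; have [d1 [d10 h1]] := hf 1 ltr01.
have A0 : 0 < cabs (f z) + 1 by have := cabs_ge0 (f z); lra.
have B0 : 0 < cabs (g z) + 1 by have := cabs_ge0 (g z); lra.
have [d2 [d20 h2]] := hf (e / (2 * (cabs (g z) + 1))) (divr_gt0 e0 (mulr_gt0 (ltr0n _ 2) B0)).
have [d3 [d30 h3]] := hg (e / (2 * (cabs (f z) + 1))) (divr_gt0 e0 (mulr_gt0 (ltr0n _ 2) A0)).
exists (Num.min d1 (Num.min d2 d3)); split; first by rewrite !lt_min d10 d20.
move=> w; rewrite !lt_min => /and3P[w1 w2 w3].
have -> : f w * g w - f z * g z = f w * (g w - g z) + (f w - f z) * g z by ring.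
apply: le_lt_trans (cabsD _ _) _; rewrite !cabsM.
have fw : cabs (f w) <= cabs (f z) + 1.
  by have := cabs_sub (f w) (f z); have := h1 w w1; lra.
have -> : e = (cabs (f z) + 1) * (e / (2 * (cabs (f z) + 1))) + e / (2 * (cabs (g z) + 1)) * (cabs (g z) + 1).
  by field; rewrite !gt_eqF.
apply: ler_ltD.
  by apply: ler_pM; rewrite ?cabs_ge0//; apply/ltW/h3.
apply: (@le_lt_trans _ _ (cabs (f w - f z) * (cabs (g z) + 1))); first by rewrite ler_wpM2l ?cabs_ge0// lerDl.
by rewrite ltr_pM2r//; exact: h2.
Qed.

(** If k < k', the cofactor g coincides off z with (w - z)^(k' - k) g', which is continuous and
    vanishes at z, although g is continuous and does not. *)
Lemma zero_mult_lt (F : C -> C) z k k' : zero_mult F z k -> zero_mult F z k' -> (k' <= k)%N.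
Proof.
move=> [g [Fg [cg gz]]] [g' [Fg' [cg' gz']]]; rewrite leqNgt; apply/negP => kk.
pose q w := (w - z) ^+ (k' - k) * g' w.
have cq : ccont_at q z.
  apply: ccont_prod cg'; apply: entire_cont.
  apply: entire_ext (entire_poly (('X - z%:P) ^+ (k' - k))) => w.
  by rewrite !hornerE.
have qz : q z = 0.
  have kS : (k' - k)%N = (k' - k).-1.+1 by rewrite prednK// subn_gt0.
  by rewrite /q subrr kS expr0n mul0r.
have qg w : w != z -> q w = g w.
  move=> wz; have nz : (w - z) ^+ k != 0 by rewrite expf_neq0// subr_eq0.
  apply: (mulfI nz); rewrite -Fg Fg' /q mulrA -exprD subnKC//; exact: ltnW.
have g0 : 0 < cabs (g z) / 2 by rewrite divr_gt0// cabs_gt0.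
have [d1 [d10 h1]] := cg _ g0; have [d2 [d20 h2]] := cq _ g0.
pose d := Num.min d1 d2 / 2; have d0 : 0 < d by rewrite divr_gt0// lt_min d10.
have dm : 0 < Num.min d1 d2 by rewrite lt_min d10.
have E : cabs (z + d%:C - z) = d by rewrite addrC addKr cabs_real ger0_norm// ltW.
have dd : d < Num.min d1 d2 by rewrite /d; lra.
have wz : z + d%:C != z by rewrite -subr_eq0 -cabs_gt0 E.
have := h1 (z + d%:C); rewrite E (lt_le_trans dd) ?ge_min ?lexx// => /(_ isT).
have := h2 (z + d%:C); rewrite E (lt_le_trans dd) ?ge_min ?lexx ?orbT// => /(_ isT).
rewrite qz subr0 qg// => a1 a2.
by have := cabs_sub (g z) (g (z + d%:C)); rewrite cabs_dist; lra.
Qed.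

Lemma zero_mult_uniq (F : C -> C) z k k' : zero_mult F z k -> zero_mult F z k' -> k = k'.
Proof. by move=> h h'; apply/eqP; rewrite eqn_leq (zero_mult_lt h' h) (zero_mult_lt h h'). Qed.

Lemma zero_mult_factor (F g : C -> C) s z : entire g -> (forall w, F w = prodX s w * g w) -> g z != 0 ->
  zero_mult F z (count_mem z s).
Proof.
move=> hg FE gz; exists (fun w => prodX [seq x <- s | x != z] w * g w); split; [move=> w|split].
- rewrite FE (prodX_split (pred1 z) s w) mulrA; congr (_ * _ * _).
  rewrite /prodX big_filter -size_filter; elim: s {FE} => [|a s IH]; first by rewrite big_nil.
  by rewrite big_cons /=; case: eqVneq => [->|_]; rewrite ?IH ?exprS.
- by apply: entire_cont; apply: entireM => //; exact: entire_prodX.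
- by rewrite mulf_neq0// prodX_eq0 mem_filter eqxx.
Qed.

End Multiplicity.

(** Used to list the pairs of a matching in the order in which the enumeration visits their first
    components. *)
Lemma perm_map_lift (T U : eqType) (f : T -> U) (p : seq T) (s : seq U) :
  perm_eq (map f p) s -> exists2 p', perm_eq p' p & map f p' = s.
Proof.
elim: s p => [|x s IH] p ps.
  by exists [::] => //; have := perm_size ps; rewrite size_map; case: p {ps}.
have /mapP[y yp xy] : x \in map f p by rewrite (perm_mem ps) mem_head.
have := perm_map f (perm_to_rem yp); rewrite /= -xy perm_sym => /perm_trans/(_ ps).
rewrite perm_cons => /IH[p' pp' E]; exists (y :: p'); last by rewrite /= E xy.
by rewrite perm_sym; apply: perm_trans (perm_to_rem yp) _; rewrite perm_cons perm_sym.
Qed.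

(** Pigeonhole: the N + 1 intervals (e / 10^(a+1), e / 10^a] with a <= N are disjoint, and at most N
    numbers cannot meet all of them. *)
Lemma scale_gap (R : realType) (D : seq R) (e : R) (N : nat) : 0 < e -> (size D <= N)%N ->
  exists2 a : nat, (a <= N)%N & forall x, x \in D -> x <= e / 10 ^+ a.+1 \/ e / 10 ^+ a < x.
Proof.
move=> e0 sD; apply: contrapT => H.
have K a : (a <= N)%N -> exists x, x \in D /\ e / 10 ^+ a.+1 < x <= e / 10 ^+ a.
  move=> aN; apply: contrapT => H'; apply: H; exists a => // x xD.
  have [h|h] := leP x (e / 10 ^+ a.+1); [by left|right; rewrite ltNge; apply/negP => h'].
  by apply: H'; exists x; rewrite xD h h'.
have /choice[t ht] a : exists x, (a <= N)%N -> x \in D /\ e / 10 ^+ a.+1 < x <= e / 10 ^+ a.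
  by have [/K[x hx]|aN] := leqP a N; [exists x|exists 0].
have dec a b : (a < b)%N -> (b <= N)%N -> t b < t a.
  move=> ab bN; have [_ /andP[_ hb]] := ht b bN; have [_ /andP[ha _]] := ht a (ltnW (leq_trans ab bN)).
  apply: le_lt_trans hb _; apply: le_lt_trans ha; rewrite ler_pM2l// lef_pV2 ?posrE ?exprn_gt0//.
  by apply: ler_weXn2l => //; rewrite ler1n.
have ut : uniq (map t (iota 0 N.+1)).
  rewrite map_inj_in_uniq ?iota_uniq// => a b; rewrite !mem_iota !add0n !ltnS /= => aN bN E.
  by case: (ltngtP a b) => // ab; [have := dec _ _ ab bN|have := dec _ _ ab aN]; rewrite E ltxx.
have sub : {subset map t (iota 0 N.+1) <= D}.
  by move=> x /mapP[a]; rewrite mem_iota add0n ltnS /= => aN ->; case: (ht a aN).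
by have := leq_trans (uniq_leq_size ut sub) sD; rewrite size_map size_iota ltnn.
Qed.

(* The discs of radius d/4 about points of s split s into clusters of diameter at most d/10. *)
Lemma cluster_pairing (R : realType) (d : R) (s t : seq R[i]) : 0 < d ->
  {in s &, forall z z', cabs (z - z') <= d / 10 \/ d < cabs (z - z')} ->
  {in s, forall c, count (fun z => cabs (z - c) < d / 4) s = count (fun z => cabs (z - c) < d / 4) t} ->
  size s = size t ->
  exists p : seq (R[i] * R[i]), [/\ perm_eq (unzip1 p) s, perm_eq (unzip2 p) t & {in p, forall q, cabs (q.2 - q.1) < d}].
Proof.
move=> d0; have [m] := ubnP (size s); elim: m s t => // m IH s t sm gap cnt st.
case: s => [|c s'] in sm gap cnt st *.
  by exists [::]; rewrite perm_sym; move/esym/size0nil: st => ->.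
set s := c :: s' in sm gap cnt st *.
pose P z := cabs (z - c) < d / 4.
have cs : c \in s by rewrite mem_head.
have Pc : P c by rewrite /P subrr cabs0 divr_gt0.
have gapN : {in [seq z <- s | ~~ P z] &, forall z z', cabs (z - z') <= d / 10 \/ d < cabs (z - z')}.
  by move=> z z'; rewrite !mem_filter => /andP[_ zs] /andP[_ zs']; exact: gap.
have cP u : (size [seq z <- u | P z] + size [seq z <- u | ~~ P z])%N = size u.
  by rewrite !size_filter; exact: count_predC.
have ss : size [seq z <- s | P z] = size [seq z <- t | P z] by rewrite !size_filter cnt.
(* Discs about points outside the cluster of c do not reach into it: such a c' is not within d/10 of
   c, so it is farther than d, which exceeds twice the radius d/4. Removing the cluster thus leaves
   the other counts unchanged. *)
have disj c' z : c' \in [seq z <- s | ~~ P z] -> cabs (z - c') < d / 4 -> ~~ P z.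
  rewrite mem_filter => /andP[nP c's] h; apply/negP => Pz.
  have [h1|h1] := gap _ _ c's cs.
    by move: nP; rewrite /P -leNgt; lra.
  by have := cabs_tri c' z c; rewrite (cabs_dist c' z); move: Pz; rewrite /P; lra.
have cntf u c' : c' \in [seq z <- s | ~~ P z] ->
   count (fun z => cabs (z - c') < d / 4) [seq z <- u | ~~ P z] = count (fun z => cabs (z - c') < d / 4) u.
  move=> c's; rewrite count_filter; apply: eq_count => z /=.
  by case h : (cabs _ < _) => //=; rewrite (disj c' z).
have [|||p [p1 p2 p3]] := IH [seq z <- s | ~~ P z] [seq z <- t | ~~ P z] _ gapN.
- have : (0 < size [seq z <- s | P z])%N by rewrite size_filter -has_count; apply/hasP; exists c.
  move=> h; move: sm; rewrite -(cP s) ltnS; apply: leq_trans.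
  by rewrite -[X in (X < _)%N]add0n ltn_add2r.
- move=> c' c's; rewrite !cntf//; apply: cnt.
  by move: c's; rewrite mem_filter => /andP[].
- by apply/eqP; rewrite -(eqn_add2l (size [seq z <- s | P z])) cP ss cP st.
exists (zip [seq z <- s | P z] [seq z <- t | P z] ++ p).
rewrite /unzip1 /unzip2 !map_cat -!/unzip1 -!/unzip2 -/(unzip1 _) -/(unzip2 _) -/(unzip1 p) -/(unzip2 p).
split.
- rewrite unzip1_zip ?ss//; apply: perm_trans (perm_cat (perm_refl _) p1) _.
  exact: (permEl (perm_filterC P s)).
- rewrite unzip2_zip ?ss//; apply: perm_trans (perm_cat (perm_refl _) p2) _.
  exact: (permEl (perm_filterC P t)).
move=> q; rewrite mem_cat => /orP[qz|]; last exact: p3.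
have : q.1 \in [seq z <- s | P z] by rewrite -(@unzip1_zip _ _ [seq z <- s | P z] [seq z <- t | P z]) ?ss// map_f.
have : q.2 \in [seq z <- t | P z] by rewrite -(@unzip2_zip _ _ [seq z <- s | P z] [seq z <- t | P z]) ?ss// map_f.
rewrite !mem_filter /P => /andP[h2 _] /andP[h1 _].
by have := cabs_tri q.2 c q.1; rewrite (cabs_dist c); lra.
Qed.

(** For each i, take a witness satisfying the strongest attainable condition [W k] among k < i. This
    merges the separate statements for each accuracy into one sequence of matchings. *)
Lemma diagonal_choice (T : Type) (V : nat -> T -> Prop) (W : nat -> T -> Prop) :
  (forall i, exists p, V i p) -> (forall k p, W k.+1 p -> W k p) ->
  (forall k, exists i0, forall i, (i0 <= i)%N -> exists2 p, V i p & W k p) ->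
  exists p : nat -> T, (forall i, V i (p i)) /\ forall k, exists i0, forall i, (i0 <= i)%N -> W k (p i).
Proof.
move=> hV Wd hW.
have Wle k m p : (k <= m)%N -> W m p -> W k p.
  by move=> km; rewrite -(subnK km); elim: (m - k)%N => // r IH /Wd; exact: IH.
have step i n : exists p, V i p /\ forall k, (k < n)%N -> (exists2 q, V i q & W k q) -> W k p.
  elim: n => [|n [p [Vp hp]]]; first by have [p Vp] := hV i; exists p.
  have [[q Vq Wq]|nq] := pselect (exists2 q, V i q & W n q).
    by exists q; split => // k kn _; exact: Wle Wq.
  by exists p; split => // k; rewrite ltnS leq_eqVlt => /orP[/eqP-> /nq//|]; exact: hp.
have [p hp] := choice (fun i => step i i); exists p; split=> [i|k]; first by case: (hp i).
have [i0 h0] := hW k; exists (maxn i0 k.+1) => i; rewrite geq_max => /andP[i0i ki].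
by case: (hp i) => _ /(_ k ki); apply; exact: h0.
Qed.

(** * From matchings in rings to one enumeration *)

Section Assembly.
Variable R : realType.
Local Notation C := R[i].
Variables (f h : C -> C) (lam0 : int -> C) (ring : nat -> C -> bool) (S T : nat -> seq C).
Hypothesis ring_cover : forall z, exists i, ring i z.
Hypothesis ring_disj : forall z i j, ring i z -> ring j z -> i = j.
Hypothesis ringS : forall i, {in S i, forall z, ring i z}.
Hypothesis ringT : forall i, {in T i, forall z, ring i z}.
Hypothesis multS : forall i z, ring i z -> zero_mult f z (count_mem z (S i)).
Hypothesis multT : forall i z, ring i z -> zero_mult h z (count_mem z (T i)).
Hypothesis enum0 : enum_zeros f lam0.
Variable p : nat -> seq (C * C).
Hypothesis p1 : forall i, perm_eq (unzip1 (p i)) (S i).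
Hypothesis p2 : forall i, perm_eq (unzip2 (p i)) (T i).
Hypothesis p_close : forall e : R, 0 < e -> exists i0, forall i, (i0 <= i)%N -> {in p i, forall q, cabs (q.2 - q.1) < e}.

(** Each zero has finitely many indices, as many as its multiplicity, and a ring contains finitely
    many zeros; hence the indices falling in a ring form a finite list whose values are [S i] with
    multiplicities. *)
Lemma ring_indices i : exists I : seq int, [/\ uniq I, (forall m, (m \in I) = ring i (lam0 m)) & perm_eq (map lam0 I) (S i)].
Proof.
have /choice[sq hsq] z : exists s : seq int, [/\ uniq s, zero_mult f z (size s) & forall m, lam0 m = z <-> m \in s].
  by have [k [hk [s [us [ss hs]]]]] := enum0 z; exists s; rewrite ss.
pose I := undup (flatten [seq sq z | z <- S i]).
have memS m : ring i (lam0 m) -> lam0 m \in S i.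
  move=> rm; have [_ sm hm] := hsq (lam0 m); have := zero_mult_uniq sm (multS rm).
  move=> E; rewrite -has_pred1 has_count -E; have : m \in sq (lam0 m) by apply/hm.
  by case: (sq _).
have memI m : (m \in I) = ring i (lam0 m).
  rewrite mem_undup; apply/flattenP/idP => [[_ /mapP[z zS ->] mz]|rm].
    by have [_ _ /(_ m)[_ /(_ mz)->]] := hsq z; exact: ringS.
  exists (sq (lam0 m)); first by rewrite map_f// memS.
  by have [_ _ /(_ m)[+ _]] := hsq (lam0 m); apply.
exists I; split => //; first exact: undup_uniq.
apply/allP => z _ /=; rewrite count_map; apply/eqP.
have [rz|nrz] := boolP (ring i z); last first.
  have -> : count_mem z (S i) = 0%N by apply/count_memPn; apply: contra nrz; exact: ringS.
  rewrite (eq_in_count (a2 := pred0)) ?count_pred0// => m mI /=.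
  by apply: contraNF nrz => /eqP <-; rewrite -memI.
have [uz mz hz] := hsq z; rewrite -(zero_mult_uniq mz (multS rz)) -size_filter; apply: perm_size.
apply: uniq_perm => //; first by rewrite filter_uniq// undup_uniq.
move=> m; rewrite mem_filter /= memI; apply/andP/idP => [[/eqP/hz]//|/hz E].
by rewrite E eqxx rz.
Qed.

(** [lam m] is the partner of [lam0 m] in the pairing of its ring. Every index belongs to exactly
    one ring, so the new sequence enumerates each [T i] exactly once. *)
Lemma matching_assembly : exists lam : int -> C, enum_zeros h lam /\
  forall e : R, 0 < e -> exists N : nat, forall m : int, (N < `|m|)%N -> cabs (lam m - lam0 m) < e.
Proof.
have [I hI] := choice ring_indices.
have /choice[q hq] i : exists q, perm_eq q (p i) /\ unzip1 q = map lam0 (I i).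
  have [_ _ hp] := hI i; have [q qp E] := @perm_map_lift _ _ fst (p i) (map lam0 (I i)) (perm_trans (p1 i) (etrans (perm_sym _ _) hp)).
  by exists q.
have [idx hidx] := choice ring_cover.
pose lam m := nth 0 (unzip2 (q (idx (lam0 m)))) (index m (I (idx (lam0 m)))).
have szq i : size (q i) = size (I i) by rewrite -(size_map fst) -/(unzip1 _) (hq i).2 size_map.
have lamE i m : m \in I i -> lam m = nth 0 (unzip2 (q i)) (index m (I i)).
  move=> mI; rewrite /lam (_ : idx (lam0 m) = i)//; apply: ring_disj (hidx _) _.
  by have [_ <- _] := hI i.
have mapE i : map lam (I i) = unzip2 (q i).
  apply: (@eq_from_nth _ 0) => [|k]; first by rewrite !size_map szq.
  rewrite size_map => kI; rewrite (nth_map 0)// (lamE i) ?mem_nth//.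
  by rewrite index_uniq//; case: (hI i).
have permT i : perm_eq (map lam (I i)) (T i).
  by rewrite mapE; apply: perm_trans (p2 i); apply: perm_map; case: (hq i).
have memI m : m \in I (idx (lam0 m)) by have [_ -> _] := hI (idx (lam0 m)); exact: hidx.
have ring_lam i m : (m \in I i) = ring i (lam m).
  have rl j : m \in I j -> ring j (lam m).
    by move=> mj; apply: ringT; rewrite -(perm_mem (permT j)) map_f.
  apply/idP/idP => [|rm]; first exact: rl.
  by rewrite -(ring_disj (rl _ (memI m)) rm).
exists lam; split.
  move=> z; exists (count_mem z (T (idx z))); split; first exact: multT (hidx z).
  exists [seq m <- I (idx z) | lam m == z]; split; [|split].
  - by rewrite filter_uniq//; case: (hI (idx z)).
  - by have /seq.permP<- := permT (idx z); rewrite size_filter count_map.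
  move=> m; rewrite mem_filter ring_lam; split=> [->|/andP[/eqP]//].
  by rewrite eqxx hidx.
move=> e e0; have [i0 hi0] := p_close e0.
(* Only the finitely many indices in the rings before [i0] are excluded, and this is the largest of
   their absolute values. *)
exists (\max_(m <- flatten [seq I i | i <- iota 0 i0]) `|m|%N) => m mN.
set i := idx (lam0 m); have mi : m \in I i by exact: memI.
have ii : (i0 <= i)%N.
  rewrite leqNgt; apply/negP => il; move: mN; apply/negP; rewrite -leqNgt.
  apply: (@leq_bigmax_seq _ _ xpredT (fun m : int => `|m|%N)) => //.
  by apply/flattenP; exists (I i) => //; rewrite map_f// mem_iota.
have im : (index m (I i) < size (q i))%N by rewrite szq index_mem.
set k := index m (I i) in im *.
have E1 : (nth (0, 0) (q i) k).1 = lam0 m.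
  by rewrite -(nth_map (0, 0) 0 fst)// -/(unzip1 (q i)) (hq i).2 (nth_map m) ?index_mem// nth_index.
have E2 : (nth (0, 0) (q i) k).2 = lam m by rewrite (lamE i)// -(nth_map (0, 0) 0 snd).
have := hi0 i ii (nth (0, 0) (q i) k).
by rewrite -(perm_mem (hq i).1) mem_nth// E1 E2; apply.
Qed.

End Assembly.

Section Matching.
Variable R : realType.
Local Notation C := R[i].
Variables (f h : C -> C) (lam0 : int -> C).
Hypotheses (hf : entire f) (hh : entire h).
Hypothesis f_nz : exists z, f z != 0.
Hypothesis count_bound : exists K : nat, forall (j : nat) s g, entire g -> (forall w, f w = prodX s w * g w) ->
  {in s, forall z, j%:R <= cabs z <= j%:R + 2} -> (size s <= K)%N.
Hypothesis compare : forall d : R, 0 < d -> exists L : R, forall w, L <= cabs w ->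
  (forall z, f z = 0 -> d <= cabs (z - w)) -> f w != 0 /\ cabs (f w - h w) <= cabs (f w) / 4.

Lemma factor_root F g s z : (forall w : C, F w = prodX s w * g w) -> g z != 0 -> (F z == 0) = (z \in s).
Proof. by move=> FE gz; rewrite FE mulf_eq0 (negbTE gz) orbF prodX_eq0. Qed.

(** The zeros not selected are moved into the entire cofactor, so the bound applies to any part of a
    factorisation lying in the annulus. *)
Lemma count_sub K (j : nat) s g (P : pred C) : (forall (j : nat) s g, entire g -> (forall w, f w = prodX s w * g w) ->
  {in s, forall z, j%:R <= cabs z <= j%:R + 2} -> (size s <= K)%N) ->
  entire g -> (forall w, f w = prodX s w * g w) -> (forall z, z \in s -> P z -> j%:R <= cabs z <= j%:R + 2) ->
  (size [seq z <- s | P z] <= K)%N.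
Proof.
move=> hK hg fE hP; apply: (hK j _ (fun w => prodX [seq z <- s | ~~ P z] w * g w)).
- by apply: entireM => //; exact: entire_prodX.
- by move=> w; rewrite mulrA -prodX_split.
by move=> z; rewrite mem_filter => /andP[Pz zs]; exact: hP.
Qed.

(** The K + 1 radii j + (2 a + 1) d with 2 (K + 1) d = 1 have disjoint d-neighbourhoods inside
    [j, j + 1]. If each had a zero of f within d, the annulus would contain K + 1 distinct zeros. *)
Lemma good_radii : exists2 d : R, 0 < d & exists r : nat -> R, forall j, j%:R <= r j < j%:R + 1 /\
  forall z, f z = 0 -> d <= `|cabs z - r j|.
Proof.
have [K hK] := count_bound; have [z0 fz0] := f_nz.
pose d : R := (2 * K.+1%:R)^-1.
have d0 : 0 < d by rewrite invr_gt0 mulr_gt0// ltr0n.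
exists d => //.
suff /choice[r hr] : forall j : nat, exists x, j%:R <= x < j%:R + 1 /\ forall z, f z = 0 -> d <= `|cabs z - x| by exists r.
move=> j; apply: contrapT => H.
pose r (a : nat) := j%:R + (2 * a%:R + 1) * d.
have dK : 2 * K.+1%:R * d = 1 by rewrite mulfV// mulf_neq0// pnatr_eq0.
have rj a : (a < K.+1)%N -> j%:R <= r a < j%:R + 1 /\ r a + d <= j%:R + 1 /\ j%:R <= r a - d.
  move=> aK; have a1 : a%:R + 1 <= K.+1%:R :> R by rewrite -natr1 -[_ + 1](natrD R a 1) ?addn1 natr1 ler_nat.
  have a0 : 0 <= a%:R :> R by rewrite ler0n.
  have a2 : (2 * a%:R + 2) * d <= 1 by rewrite -[X in _ <= X]dK ler_pM2r//; lra.
  have a3 : 0 <= 2 * a%:R * d by apply: mulr_ge0; [apply: mulr_ge0|exact: ltW].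
  by rewrite /r mulrDl mul1r; rewrite mulrDl in a2; split; [apply/andP; split|split]; lra.
have /choice[t ht] a : exists z, (a < K.+1)%N -> f z = 0 /\ `|cabs z - r a| < d.
  have [aK|_] := ltnP a K.+1; last by exists 0.
  apply: contrapT => H'; apply: H; exists (r a); split; first by case: (rj a aK).
  by move=> z fz; rewrite leNgt; apply/negP => hz; apply: H'; exists z.
have [s [g [hg fE _ gn0]]] := entire_factor (j%:R + 2) hf fz0.
have tb a : (a < K.+1)%N -> j%:R <= cabs (t a) <= j%:R + 2.
  by move=> aK; have [_ []] := rj a aK; have [_] := ht a aK; rewrite ltr_norml => /andP[? ?] ? ?; apply/andP; split; lra.
pose P (z : C) := j%:R <= cabs z <= j%:R + 2.
have := @count_sub K j s g P hK hg fE (fun z _ => id).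
have ut : uniq (map t (iota 0 K.+1)).
  have lt a b : (a < b)%N -> (b < K.+1)%N -> t a != t b.
    move=> ab bK; apply/eqP => E; have [_] := ht a (ltn_trans ab bK); have [_] := ht b bK.
    rewrite E !ltr_norml /r => /andP[b1 b2] /andP[b3 b4].
    have b5 : (2 * b%:R) * d < (2 * a%:R + 2) * d by rewrite mulrDl; lra.
    move: b5; rewrite ltr_pM2r// => b5.
    have : a%:R + 1 <= b%:R :> R by rewrite natr1 ler_nat.
    lra.
  rewrite map_inj_in_uniq ?iota_uniq// => a b; rewrite !mem_iota !add0n /= => aN bN E.
  by case: (ltngtP a b) => // ab; [have := lt _ _ ab bN|have := lt _ _ ab aN]; rewrite E eqxx.
have sub : {subset map t (iota 0 K.+1) <= [seq z <- s | P z]}.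
  move=> x /mapP[a]; rewrite mem_iota add0n /= => aK ->; rewrite mem_filter /P tb//=.
  rewrite -(factor_root fE) ?(ht a aK).1//; apply: gn0; by case/andP: (tb a aK).
by move=> sz; have := leq_trans (uniq_leq_size ut sub) sz; rewrite size_map size_iota ltnn.
Qed.

Lemma nat_above (x : R) : exists N : nat, x <= N%:R.
Proof. by exists (Num.bound `|x|); apply: le_trans (ler_norm x) (ltW (archi_boundP (normr_ge0 x))). Qed.

Lemma cabs_norm_sub (z w : C) : `|cabs z - cabs w| <= cabs (z - w).
Proof. by rewrite ler_norml; have := cabs_sub z w; have := cabs_sub w z; rewrite (cabs_dist w); lra. Qed.

Lemma count_shell (s : seq C) (a b : R) : a <= b ->
  count (fun z => cabs z < b) s = addn (count (fun z => cabs z < a) s) (count (fun z => a <= cabs z < b) s).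
Proof.
move=> ab; elim: s => //= z s ->; rewrite addnACA; congr (_ + _)%N.
by have [za|za] := ltP (cabs z) a; rewrite ?(lt_le_trans za ab).
Qed.

Lemma zeros_matching : enum_zeros f lam0 -> exists lam : int -> C, enum_zeros h lam /\
  forall e : R, 0 < e -> exists N : nat, forall m : int, (N < `|m|)%N -> cabs (lam m - lam0 m) < e.
Proof.
move=> enum0; have [d0 d00 [r hr]] := good_radii; have [L0 hL0] := compare d00.
have [J0 hJ0] := nat_above L0; have [K hK] := count_bound; have [z0 fz0] := f_nz.
have r_ge j : j%:R <= r j by case: (hr j) => /andP[].
have r_lt j : r j < j%:R + 1 by case: (hr j) => /andP[].
have r_ge0 j : 0 <= r j by apply: le_trans (r_ge j).
have circle j w : (J0 <= j)%N -> cabs w = r j -> f w != 0 /\ cabs (f w - h w) <= cabs (f w) / 4.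
  move=> Jj hw; apply: hL0 => [|z fz].
    by rewrite hw; apply: le_trans hJ0 (le_trans _ (r_ge j)); rewrite ler_nat.
  by apply: le_trans (cabs_norm_sub _ _); rewrite hw; exact: (hr j).2.
have [z1 hz1] : exists z, h z != 0.
  have [|f1 fh] := circle J0 (r J0)%:C (leqnn _); first by rewrite cabs_real ger0_norm.
  exists (r J0)%:C; apply/eqP => h0; move: fh; rewrite h0 subr0.
  by rewrite -cabs_gt0 in f1; lra.
(* Ring 0 is the whole disc inside the first circle on which the comparison is valid. Its zeros are
   finitely many but not bounded by K, so they are paired arbitrarily; closeness is claimed for
   later rings only. *)
pose rr i := if i is i'.+1 then r (J0 + i')%N else 0.
have rrS i : rr i <= rr i.+1.
  case: i => [|i] /=; first exact: r_ge0.
  by apply: ltW (lt_le_trans (r_lt _) (le_trans _ (r_ge _))); rewrite natr1 ler_nat addnS.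
have rr0 i : 0 <= rr i by case: i => [|i] /=.
have rr_mono i j : (i <= j)%N -> rr i <= rr j.
  by move=> ij; rewrite -(subnK ij); elim: (j - i)%N => // k IH; exact: le_trans IH (rrS _).
pose ring i (z : C) := rr i <= cabs z < rr i.+1.
have ring_cover z : exists i, ring i z.
  have [N hN] := nat_above (cabs z + 1).
  have : cabs z < rr N.+1.
    apply: (@lt_le_trans _ _ N%:R); first by lra.
    by apply: le_trans (r_ge _); rewrite ler_nat leq_addl.
  elim: N.+1 => [|k IH] hk; first by move: hk; rewrite ltNge cabs_ge0.
  by have [h1|/IH//] := leP (rr k) (cabs z); exists k; rewrite /ring h1.
have ring_disj z i j : ring i z -> ring j z -> i = j.
  move=> /andP[i1 i2] /andP[j1 j2]; case: (ltngtP i j) => // ij.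
    by have := lt_le_trans i2 (le_trans (rr_mono _ _ ij) j1); rewrite ltxx.
  by have := lt_le_trans j2 (le_trans (rr_mono _ _ ij) i1); rewrite ltxx.
have fac F z : entire F -> F z != 0 -> exists sg : nat -> seq C * (C -> C), forall i,
    [/\ entire (sg i).2, forall w, F w = prodX (sg i).1 w * (sg i).2 w & forall w, cabs w <= rr i.+1 -> (sg i).2 w != 0].
  move=> hF Fz; have /choice[sg hsg] i : exists sg : seq C * (C -> C), [/\ entire sg.2,
      forall w, F w = prodX sg.1 w * sg.2 w & forall w, cabs w <= rr i.+1 -> sg.2 w != 0].
    by have [s [g [h1 h2 _ h3]]] := entire_factor (rr i.+1) hF Fz; exists (s, g).
  by exists sg.
have [sf hsf] := fac f z0 hf fz0; have [sh hsh] := fac h z1 hh hz1.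
pose S i := [seq z <- (sf i).1 | ring i z]; pose T i := [seq z <- (sh i).1 | ring i z].
have mult F (sg : nat -> seq C * (C -> C)) i z : [/\ entire (sg i).2, forall w, F w = prodX (sg i).1 w * (sg i).2 w
    & forall w, cabs w <= rr i.+1 -> (sg i).2 w != 0] -> ring i z -> zero_mult F z (count_mem z [seq z <- (sg i).1 | ring i z]).
  move=> [h1 h2 h3] rz; rewrite count_filter (@eq_count _ _ (pred1 z)).
    by apply: (zero_mult_factor h1 h2); apply: h3; case/andP: rz => _ /ltW.
  by move=> x /=; case: eqVneq => // ->; rewrite rz.
have rouche_rr i k : (k <= i.+1)%N -> count (fun z => cabs z < rr k) (sf i).1 = count (fun z => cabs z < rr k) (sh i).1.
  case: k => [_|k ki].
    by rewrite !(@eq_count _ _ pred0) ?count_pred0// => z /=; apply/negbTE; rewrite -leNgt cabs_ge0.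
  have [rk|rk] := eqVneq (rr k.+1) 0.
    by rewrite !(@eq_count _ _ pred0) ?count_pred0// => z; apply/negbTE; rewrite rk -leNgt cabs_ge0.
  have [f1 f2 f3] := hsf i; have [h1 h2 h3] := hsh i.
  have rk0 : 0 < rr k.+1 by rewrite lt_neqAle eq_sym rk rr0.
  have := @entire_rouche R f h _ _ _ _ 0 (rr k.+1) rk0 f1 h1 f2 h2.
  have E (s : seq C) : count (fun z => cabs (z - 0) < rr k.+1) s = count (fun z => cabs z < rr k.+1) s.
    by apply: eq_count => z; rewrite subr0.
  rewrite !E; apply.
    by move=> w; rewrite subr0 => hw; have hw' := le_trans hw (rr_mono _ _ ki); rewrite f3// h3.
  by move=> w; rewrite subr0; apply: circle; exact: leq_addr.
have size_ST i : size (S i) = size (T i).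
  apply/eqP; rewrite !size_filter -(eqn_add2l (count (fun z => cabs z < rr i) (sf i).1)) -count_shell//.
  by rewrite [X in (X + _)%N](rouche_rr i i)// -count_shell// rouche_rr.
have rootS i z : ring i z -> f z = 0 -> z \in S i.
  move=> rz fz; rewrite mem_filter rz /=; have [f1 f2 f3] := hsf i.
  by rewrite -(factor_root f2) ?fz//; apply: f3; case/andP: rz => _ /ltW.
have Sroot i z : z \in S i -> f z = 0.
  rewrite mem_filter => /andP[_ zs]; have [f1 f2 f3] := hsf i.
  by apply/eqP; rewrite f2 mulf_eq0 prodX_eq0 zs.
pose V i (p : seq (C * C)) := perm_eq (unzip1 p) (S i) /\ perm_eq (unzip2 p) (T i).
pose W k (p : seq (C * C)) := {in p, forall q, cabs (q.2 - q.1) < 2^-1 ^+ k :> R}.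
have pair_close e : 0 < e -> exists i0, forall i, (i0 <= i)%N -> exists2 p, V i p & {in p, forall q, cabs (q.2 - q.1) < e}.
  move=> e0; pose e1 := Num.min e d0; have e10 : 0 < e1 by rewrite lt_min e0.
  have e1e : e1 <= e by rewrite ge_min lexx.
  have e1d : e1 <= d0 by rewrite ge_min lexx orbT.
  (* At most K zeros give at most K^2 distances. The clustering scale d depends on the ring but
     never falls below [dm], so a threshold L obtained for [dm] / 10 works for every ring. *)
  pose N := (K * K)%N; pose dm := e1 / 10 ^+ N.
  have T0 k : 0 < 10 ^+ k :> R by rewrite exprn_gt0.
  have dm0 : 0 < dm by rewrite divr_gt0.
  have dm1 : 0 < dm / 10 by rewrite divr_gt0.
  have [L hL] := compare dm1; have [i0 hi0] := nat_above (L + d0).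
  exists i0.+1 => -[//|i]; rewrite ltnS => i0i; set j := (J0 + i)%N.
  have Lj : L + d0 <= r j.
    by apply: le_trans hi0 (le_trans _ (r_ge _)); rewrite ler_nat (leq_trans i0i)// leq_addl.
  have sS : (size (S i.+1) <= K)%N.
    have [f1 f2 f3] := hsf i.+1; apply: (@count_sub K j _ _ _ hK f1 f2) => z _ /andP[] /=.
    rewrite addnS -/j => z1l z2; apply/andP; split; first exact: le_trans (r_ge _) z1l.
    by apply/ltW/(lt_le_trans z2)/ltW/(lt_le_trans (r_lt _)); rewrite -natr1; lra.
  pose Ds := [seq cabs (z - z') | z <- S i.+1, z' <- S i.+1].
  have sD : (size Ds <= N)%N by rewrite size_allpairs leq_mul.
  have [a aN gap] := scale_gap e10 sD.
  set d := e1 / 10 ^+ a; have dpos : 0 < d by rewrite divr_gt0.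
  have d_e1 : d <= e1 by rewrite ler_pdivrMr// ler_peMr ?(ltW e10)// exprn_ege1// ler1n.
  have dm_d : dm <= d by rewrite ler_pM2l// lef_pV2 ?posrE// ler_weXn2l// ler1n.
  have d10 : e1 / 10 ^+ a.+1 = d / 10 by rewrite exprS invfM mulrCA mulrC.
  have gapS : {in S i.+1 &, forall z z', cabs (z - z') <= d / 10 \/ d < cabs (z - z')}.
    by move=> z z' zs zs'; rewrite -d10; apply: gap; exact: allpairs_f.
  (* Zeros keep distance [d0] from the bounding circles and d <= [d0], so the discs of radius d/4
     stay inside the ring and counting in the ring or in the whole list is the same. *)
  have inner c : c \in S i.+1 -> rr i.+1 + d0 <= cabs c /\ cabs c + d0 <= rr i.+2.
    move=> cS; have fc := Sroot _ _ cS; move: cS; rewrite mem_filter => /andP[/andP[c1 c2] _].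
    have := (hr (J0 + i)%N).2 c fc; have := (hr (J0 + i.+1)%N).2 c fc; move: c1 c2; rewrite /rr.
    by move=> c1 c2; rewrite ltr0_norm ?subr_lt0// ger0_norm ?subr_ge0//; lra.
  have cntE c (s : seq C) : c \in S i.+1 ->
     count (fun z => cabs (z - c) < d / 4) [seq z <- s | ring i.+1 z] = count (fun z => cabs (z - c) < d / 4) s.
    move=> cS; rewrite count_filter; apply: eq_count => z /=.
    case zc : (_ < _) => //=; have [c1 c2] := inner c cS; rewrite /ring.
    have := cabs_sub z c; have := cabs_sub c z; rewrite (cabs_dist c) => a1 a2.
    by apply/andP; split; lra.
  have [|p [p1 p2 p3]] := cluster_pairing dpos gapS _ (size_ST i.+1); last first.
    exists p => // q /p3 hq; apply: lt_le_trans hq _; lra.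
  move=> c cS; rewrite !cntE//; have [c1 c2] := inner c cS.
  have [f1 f2 f3] := hsf i.+1; have [h1 h2 h3] := hsh i.+1.
  have d4 : 0 < d / 4 by rewrite divr_gt0.
  apply: (@entire_rouche R f h _ _ _ _ c (d / 4) d4 f1 h1 f2 h2) => w hw.
    have hw' : cabs w <= rr i.+2 by have := cabs_sub w c; lra.
    by rewrite f3// h3.
  apply: hL => [|z fz].
    by move: c1; rewrite /= -/j => c1; have := cabs_sub c w; rewrite (cabs_dist c); lra.
  (* Every zero is at least d/10 away from the circle of radius d/4 about c: those within d/10 of c
     stay 3d/20 inside it, and all others, in the ring or not, are at distance at least d from c. *)
  apply: (@le_trans _ _ (d / 10)); first by lra.
  have tri := cabs_tri z w c.
  have [rz|] := boolP (ring i.+1 z).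
    by have [h4|h4] := gapS _ _ cS (rootS _ _ rz fz); rewrite (cabs_dist c) in h4; have := cabs_tri w z c; rewrite (cabs_dist w z); lra.
  have a1 := cabs_sub z c; have := cabs_sub c z; rewrite (cabs_dist c) => a2.
  by rewrite /ring negb_and -ltNge -leNgt => /orP[rz|rz]; lra.
have [|||p [pV pW]] := @diagonal_choice _ V W.
- move=> i; exists (zip (S i) (T i)); split; first by rewrite unzip1_zip// size_ST.
  by rewrite unzip2_zip// size_ST.
- move=> k p hW q /hW hq; apply: lt_le_trans hq _; rewrite exprS ler_piMl ?exprn_ge0 ?invr_ge0//.
  by rewrite invf_le1// ler1n.
- by move=> k; apply: pair_close; rewrite exprn_gt0// invr_gt0.
apply: (@matching_assembly R f h lam0 ring S T ring_cover ring_disj _ _ _ _ enum0 p (fun i => (pV i).1) (fun i => (pV i).2)).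
- by move=> i z; rewrite mem_filter => /andP[].
- by move=> i z; rewrite mem_filter => /andP[].
- by move=> i z; exact: mult (hsf i).
- by move=> i z; exact: mult (hsh i).
move=> e e0; have [k hk] := geo_half_lt 1 e0; have [i0 hi0] := pW k.
by exists i0 => i ii q qp; apply: lt_trans (hi0 i ii q qp) _; rewrite mul1r in hk.
Qed.

End Matching.

(** * Toeplitz systems over a local ring *)

Section LocalSmith.
Variables (F : fieldType) (n : nat).
Implicit Types (p q : {poly F}) (M : 'M[{poly F}]_n) (c e : 'cV[{poly F}]_n).

Lemma dvdXnP k p : reflect (forall j, (j < k)%N -> p`_j = 0) ('X^k %| p).
Proof.
apply: (iffP idP) => [/dvdpP[q ->] j jk|h]; first by rewrite coefMXn jk.
rewrite -(poly_take_drop k p) (_ : take_poly k p = 0) ?add0r ?dvdp_mull//.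
by apply/polyP => j; rewrite coef_take_poly coef0; case: ifP => // /h.
Qed.

(** The congruence c = 0 modulo X^k, with polynomials standing for truncated power series. *)
Definition lowv k c := forall i, 'X^k %| c i 0.

Lemma lowvD k c e : lowv k c -> lowv k e -> lowv k (c + e).
Proof. by move=> hc he i; rewrite mxE dvdp_addr. Qed.
Lemma lowvN k c : lowv k c -> lowv k (- c).
Proof. by move=> hc i; rewrite mxE dvdpNr. Qed.
Lemma lowvB k c e : lowv k c -> lowv k e -> lowv k (c - e).
Proof. by move=> hc he; apply: lowvD => //; exact: lowvN. Qed.
Lemma lowvM k M c : lowv k c -> lowv k (M *m c).
Proof. by move=> hc i; rewrite mxE; elim/big_rec: _ => [|j x _ hx]; rewrite ?dvdp0// dvdp_addr// dvdp_mull. Qed.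

(** Multiplying by the adjugate gives X^d u c = 0 modulo X^k; cancel X^d, then u, which is prime to
    X. *)
Lemma lowv_det k d M u c : \det M = 'X^d * u -> ~~ root u 0 -> (d <= k)%N -> lowv k (M *m c) -> lowv (k - d) c.
Proof.
move=> dM u0 dk h i; have := lowvM (\adj M) h i; rewrite mulmxA mul_adj_mx mul_scalar_mx mxE dM.
rewrite -{1}(subnKC dk) exprD -mulrA dvdp_mul2l ?expf_neq0 ?polyX_eq0// Gauss_dvdpr//.
by rewrite coprimep_expl// coprimep_sym coprimepX.
Qed.

Definition polyCmx (V : 'M[F]_n) : 'M[{poly F}]_n := map_mx polyC V.

Lemma polyCmxM V W : polyCmx V *m polyCmx W = polyCmx (V *m W). Proof. by rewrite /polyCmx map_mxM. Qed.
Lemma polyCmx1 : polyCmx 1%:M = 1%:M. Proof. by rewrite /polyCmx map_mx1. Qed.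

Definition dg (j : 'I_n) : 'M[{poly F}]_n := diag_mx (\row_k (if k == j then 'X else 1)).

Lemma dg_mulE j c i : (dg j *m c) i 0 = (if i == j then 'X else 1) * c i 0.
Proof. by rewrite mul_diag_mx !mxE. Qed.

(* If M(0) kills v, a constant change of basis makes one column of M divisible by X. *)
Lemma split_column M : (\det M).[0] = 0 -> exists (V : 'M[F]_n) (j : 'I_n) N,
  V \in unitmx /\ M *m polyCmx V = N *m dg j.
Proof.
move=> dM0; pose M0 := map_mx (horner_eval 0) M : 'M[F]_n.
have /eqP : \det M0 = 0 by rewrite /M0 det_map_mx /horner_eval.
rewrite -det_tr; move/det0P => [v vn0 vM].
have /existsP[j vj] : [exists j, v 0 j != 0].
  apply: contraNT vn0; rewrite negb_exists => /forallP h; apply/eqP/rowP => j; rewrite mxE.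
  by apply/eqP; have := h j; rewrite negbK.
pose V : 'M[F]_n := \matrix_(a, b) (if b == j then v 0 a else (a == b)%:R).
have uV : V \in unitmx.
  rewrite -row_free_unit; apply: inj_row_free => u uV; apply/rowP => b; rewrite mxE.
  have ub i : i != j -> u 0 i = 0.
    move=> ij; have /rowP/(_ i) := uV; rewrite !mxE (bigD1 i)//= mxE (negbTE ij) eqxx mulr1 big1 ?addr0// => a ai.
    by rewrite mxE (negbTE ij) (negbTE ai) mulr0.
  have [->|bj] := eqVneq b j; last exact: ub.
  have /rowP/(_ j) := uV; rewrite !mxE (bigD1 j)//= mxE eqxx big1 ?addr0 => [/eqP|a aj].
    by rewrite mulf_eq0 (negbTE vj) orbF => /eqP.
  by rewrite ub// mul0r.
pose MV := M *m polyCmx V.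
have col0 i : 'X %| MV i j.
  rewrite -['X]expr1; apply/dvdXnP => -[|//] _; rewrite mxE coef_sum.
  have /rowP/(_ i) := vM; rewrite !mxE => E; rewrite -[RHS]E; apply: eq_bigr => k _.
  by rewrite !mxE coefMC eqxx /horner_eval horner_coef0 mulrC.
exists V, j, (\matrix_(a, b) (if b == j then MV a b %/ 'X else MV a b)); split => //.
apply/matrixP => a b; rewrite mul_mx_diag -/MV [RHS]mxE [X in X * _]mxE [X in _ * X]mxE.
by case: eqVneq => [->|_]; rewrite ?mulr1// divpK.
Qed.

(** The solutions modulo X^k have dimension equal to the order d of the determinant. Each factor
    diag(X, 1, ..., 1) adds one dimension: old solutions are divided by X in one coordinate, and one
    new solution, X^(k-1) in that coordinate, appears. *)
Lemma local_solutions d : forall M u k, \det M = 'X^d * u -> ~~ root u 0 -> (d <= k)%N ->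
  exists c : 'I_d -> 'cV[{poly F}]_n, [/\ forall i, lowv k (M *m c i),
    forall a : 'I_d -> F, lowv k (\sum_i (a i)%:P *: c i) -> forall i, a i = 0 &
    forall e, lowv k (M *m e) -> exists a : 'I_d -> F, lowv k (e - \sum_i (a i)%:P *: c i)].
Proof.
elim: d => [|d IH] M u k dM u0 dk.
  exists (fun=> 0); split => [[]//|a _ []//|e he]; exists (fun=> 0).
  by rewrite big_ord0 subr0; have := lowv_det dM u0 dk he; rewrite subn0.
have dM0 : (\det M).[0] = 0 by rewrite dM hornerM exprS hornerM hornerX !mul0r.
have [V [j [N [uV MN]]]] := split_column dM0.
pose v := \det V; have v0 : v != 0 by rewrite -unitfE -unitmxE.
have dN : \det N = 'X^d * (v%:P * u).
  have X0 : 'X != 0 :> {poly F} by rewrite polyX_eq0.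
  apply: (mulfI X0); have := congr1 determinant MN; rewrite !det_mulmx dM.
  rewrite /dg det_diag (bigD1 j)//= mxE eqxx big1 => [|k' kj]; last by rewrite mxE (negbTE kj).
  rewrite mulr1 (_ : \det (polyCmx V) = v%:P) => [E|]; last by rewrite /polyCmx det_map_mx.
  by rewrite [LHS]mulrC -E exprS; ring.
have u0' : ~~ root (v%:P * u) 0 by rewrite rootM negb_or u0 rootC v0.
have k0 : (0 < k)%N by exact: leq_ltn_trans dk.
have [e [eN ei es]] := IH N (v%:P * u) k dN u0' (ltnW dk).
(* A solution for N vanishes modulo X^(k-d), and k - d >= 1 because the determinant of M has order d
   + 1 <= k; so its j-th coordinate can be divided by X. *)
have eX c : lowv k (N *m c) -> 'X %| c j 0.
  move=> h; have := lowv_det dN u0' (ltnW dk) h j; apply: dvdp_trans.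
  by rewrite -{1}['X]expr1 dvdp_exp2l// subn_gt0.
pose down c : 'cV[{poly F}]_n := \col_i (if i == j then c i 0 %/ 'X else c i 0).
have dgdown c : lowv k (N *m c) -> dg j *m down c = c.
  move=> h; apply/colP => i; rewrite dg_mulE mxE; case: eqVneq => [->|_]; last by rewrite mul1r.
  by rewrite mulrC divpK// eX.
pose W := polyCmx (invmx V).
have VW : polyCmx V *m W = 1%:M by rewrite polyCmxM mulmxV// polyCmx1.
have WV : W *m polyCmx V = 1%:M by rewrite polyCmxM mulVmx// polyCmx1.
pose z : 'cV[{poly F}]_n := \col_i (if i == j then 'X^(k.-1) else 0).
have dgz : lowv k (dg j *m z).
  by move=> i; rewrite dg_mulE mxE; case: eqVneq => _; rewrite ?mulr0 ?dvdp0// -exprS prednK.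
pose c (i : 'I_d.+1) := polyCmx V *m (if unlift ord0 i is Some i' then down (e i') else z).
have cS i : c (lift ord0 i) = polyCmx V *m down (e i) by rewrite /c liftK.
have c0 : c ord0 = polyCmx V *m z by rewrite /c unlift_none.
have MVd x : M *m (polyCmx V *m x) = N *m (dg j *m x) by rewrite !mulmxA MN.
have sumE (a : 'I_d.+1 -> F) : \sum_i (a i)%:P *: c i =
    polyCmx V *m ((a ord0)%:P *: z + \sum_i (a (lift ord0 i))%:P *: down (e i)).
  rewrite big_ord_recl c0 mulmxDr -scalemxAr mulmx_sumr; congr (_ + _).
  by apply: eq_bigr => i _; rewrite cS scalemxAr.
have dgs (a : 'I_d -> F) : dg j *m (\sum_i (a i)%:P *: down (e i)) = \sum_i (a i)%:P *: e i.
  by rewrite mulmx_sumr; apply: eq_bigr => i _; rewrite -scalemxAr dgdown.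
exists c; split => [i|a ha|b hb].
- case: (unliftP ord0 i) => [i' ->|->]; first by rewrite cS MVd dgdown.
  by rewrite c0 MVd; apply: lowvM.
- have h1 : lowv k ((a ord0)%:P *: z + \sum_i (a (lift ord0 i))%:P *: down (e i)).
    by have := lowvM W ha; rewrite sumE mulmxA WV mul1mx.
  have h2 : lowv k (\sum_i (a (lift ord0 i))%:P *: e i).
    have := lowvM (dg j) h1; rewrite mulmxDr dgs -scalemxAr => h3.
    have h4 : lowv k ((a ord0)%:P *: (dg j *m z)) by move=> i; rewrite mxE dvdp_mull.
    by have := lowvB h3 h4; rewrite addrAC subrr add0r.
  have aS i : a (lift ord0 i) = 0 by exact: ei h2 i.
  move=> i; case: (unliftP ord0 i) => [i' ->//|->].
  have := h1 j; rewrite mxE big1 ?mxE => [|i' _]; last by rewrite aS scale0r.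
  by rewrite addr0 eqxx => /dvdXnP/(_ k.-1); rewrite coefCM coefXn eqxx mulr1; apply; rewrite prednK.
have h1 : lowv k (N *m (dg j *m (W *m b))) by rewrite -MVd (mulmxA (polyCmx V)) VW mul1mx.
have [a ha] := es _ h1.
have [r rdef] : exists r, r = W *m b - \sum_i (a i)%:P *: down (e i) by eexists.
have rE : lowv k (dg j *m r) by rewrite rdef mulmxBr dgs.
(* After the old solutions are subtracted, [r] is 0 modulo X^k except in coordinate j, where only
   the coefficient of X^(k-1) may survive; it is the coefficient of the new solution. *)
pose A (i : 'I_d.+1) : F := if unlift ord0 i is Some i' then a i' else (r j 0)`_k.-1.
exists A.
have -> : b - \sum_i (A i)%:P *: c i = polyCmx V *m (r - (A ord0)%:P *: z).
  rewrite sumE {1}(_ : b = polyCmx V *m (W *m b)); last by rewrite (mulmxA (polyCmx V)) VW mul1mx.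
  rewrite -mulmxBr; congr (_ *m _); rewrite rdef addrAC -addrA opprD; congr (_ + (_ + _)).
  by congr (- _); apply: eq_bigr => i _; rewrite /A liftK.
apply: lowvM => i; apply/dvdXnP => m mk; have := rE i; rewrite dg_mulE !mxE coefB coefCM.
case: eqVneq => [->|_] /dvdXnP hr; last by rewrite coef0 mulr0 subr0 -[RHS](hr m mk) mul1r.
rewrite coefXn /A unlift_none; have [->|mk1] := eqVneq m k.-1; first by rewrite mulr1 subrr.
rewrite mulr0 subr0; have := hr m.+1; rewrite coefXM /=; apply.
by rewrite -(prednK k0) ltnS ltn_neqAle mk1 -ltnS prednK.
Qed.

Definition mser (M : nat -> 'M[F]_n) N : 'M[{poly F}]_n := \matrix_(i, j) \poly_(m < N) M m i j.
(** The vanishing, for j < k, of the coefficient of X^j in the product of the series of M and c. *)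
Definition toep (M : nat -> 'M[F]_n) k (c : nat -> 'cV[F]_n) :=
  forall j, (j < k)%N -> \sum_(i < j.+1) M i *m c (j - i)%N = 0.
Definition colc (p : 'cV[{poly F}]_n) m : 'cV[F]_n := \col_i (p i 0)`_m.

Lemma mser_coef (M : nat -> 'M[F]_n) N (p : 'cV[{poly F}]_n) i j : (j < N)%N ->
  ((mser M N *m p) i 0)`_j = (\sum_(m < j.+1) M m *m colc p (j - m)) i 0.
Proof.
move=> jN; rewrite mxE coef_sum summxE.
under eq_bigr do rewrite coefM.
rewrite exchange_big; apply: eq_bigr => m _; rewrite mxE; apply: eq_bigr => b _.
by rewrite !mxE coef_poly (leq_ltn_trans _ jN)// -ltnS.
Qed.

Lemma toep_low (M : nat -> 'M[F]_n) N k (p : 'cV[{poly F}]_n) : (k <= N)%N -> lowv k (mser M N *m p) <-> toep M k (colc p).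
Proof.
move=> kN; split=> [h j jk|h i].
  apply/colP => i; rewrite -(@mser_coef M N) ?(leq_trans jk)// [RHS]mxE.
  by have /dvdXnP := h i; apply.
by apply/dvdXnP => j jk; rewrite mser_coef ?(leq_trans jk)// h// mxE.
Qed.

Lemma toep_eq (M : nat -> 'M[F]_n) k (c e : nat -> 'cV[F]_n) : (forall m, (m < k)%N -> c m = e m) -> toep M k c -> toep M k e.
Proof.
move=> ce h j jk; rewrite -[RHS](h j jk); apply: eq_bigr => i _; rewrite ce//.
exact: leq_ltn_trans (leq_subr _ _) jk.
Qed.

Definition seqv (c : nat -> 'cV[F]_n) k : 'cV[{poly F}]_n := \col_i \poly_(m < k) c m i 0.

Lemma colc_seqv (c : nat -> 'cV[F]_n) k m : (m < k)%N -> colc (seqv c k) m = c m.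
Proof. by move=> mk; apply/colP => i; rewrite !mxE coef_poly mk. Qed.

Lemma colc_lowv k (p : 'cV[{poly F}]_n) m : lowv k p -> (m < k)%N -> colc p m = 0.
Proof. by move=> h mk; apply/colP => i; rewrite !mxE; have /dvdXnP := h i; apply. Qed.

Lemma colc_comb d (a : 'I_d -> F) (c : 'I_d -> 'cV[{poly F}]_n) m :
  colc (\sum_i (a i)%:P *: c i) m = \sum_i a i *: colc (c i) m.
Proof.
apply/colP => i; rewrite mxE !summxE coef_sum; apply: eq_bigr => j _.
by rewrite !mxE coefCM.
Qed.

(** The last clause says that longer systems yield nothing new: a solution of length k starts with k
    - d zeros and then continues as a solution of length d. This is the stabilisation of the kernels
    of the powers. *)
Lemma toeplitz_basis (M : nat -> 'M[F]_n) d :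
  (forall N, (d < N)%N -> exists2 u, \det (mser M N) = 'X^d * u & ~~ root u 0) ->
  exists c : 'I_d -> nat -> 'cV[F]_n, [/\ forall i, toep M d (c i),
    forall a : 'I_d -> F, (forall m, (m < d)%N -> \sum_i a i *: c i m = 0) -> forall i, a i = 0 &
    forall k (e : nat -> 'cV[F]_n), (d <= k)%N -> toep M k e -> (forall m, (m < k - d)%N -> e m = 0) /\
      exists a : 'I_d -> F, forall m, (m < d)%N -> e (k - d + m)%N = \sum_i a i *: c i m].
Proof.
move=> dM; have [u du u0] := dM d.+1 (ltnSn d).
have [c [hc ci cs]] := local_solutions du u0 (leqnn d).
exists (fun i => colc (c i)); split => [i|a ha|k e dk he].
- by apply/(toep_low M _ (leqnSn d)).
- apply: ci => i; apply/dvdXnP => m md.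
  by have /colP/(_ i) := ha m md; rewrite -colc_comb !mxE.
have e0 m : (m < k - d)%N -> e m = 0.
  move=> mk; have [w dw w0] := dM k.+1 dk.
  have h : lowv k (mser M k.+1 *m seqv e k).
    by apply/(toep_low _ _ (leqnSn k)); apply: toep_eq he => r rk; rewrite colc_seqv.
  by rewrite -(@colc_seqv e k) ?(leq_trans mk) ?leq_subr//; apply: colc_lowv (lowv_det dw w0 dk h) mk.
split => //; pose e' m := e (k - d + m)%N.
have he' : toep M d e'.
  move=> j jd; have jk : (k - d + j < k)%N by rewrite -[X in (_ < X)%N](subnK dk) ltn_add2l.
  rewrite -[RHS](he _ jk) (big_ord_widen (k - d + j).+1 (fun i => M i *m e' (j - i)%N)) ?ltnS ?leq_addl//.
  rewrite big_mkcond; apply: eq_bigr => i _; rewrite ltnS; case: leqP => ij; first by rewrite /e' addnBA.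
  rewrite e0 ?mulmx0// ltn_subLR; last exact: (ltn_ord i).
  by move: (nat_of_ord i) ij => r jr; rewrite addnC ltn_add2r.
have [|a ha] := cs (seqv e' d).
  by apply/(toep_low _ _ (leqnSn d)); apply: toep_eq he' => m md; rewrite colc_seqv.
exists a => m md; rewrite -[LHS]/(e' m) -(colc_seqv e' md) -colc_comb.
have := colc_lowv ha md; move: (\sum_i _) => s E; apply/colP => i.
by move/colP/(_ i): E; rewrite !mxE coefB => /eqP; rewrite subr_eq0 => /eqP.
Qed.

End LocalSmith.

(** * Root subspaces *)

Section Chains.
Import numFieldNormedType.Exports.
Local Open Scope classical_set_scope.

Section Cancellation.
Variables (R : realType) (l : R).
Hypothesis l0 : 0 < l.
Local Notation mu := (@lebesgue_measure R).

Lemma ri_abs_eq0 (f : R -> R) : rI l f -> ri (fun x => `|f x|) 0 l = 0 -> ae_on l (fun x => f x = 0).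
Proof.
move=> hf h; have mf : measurable_fun (seg l : set (measurableTypeR R)) (EFin \o f) by apply/measurable_EFinP; exact: rI_meas.
have [+ _] := @ae_eq_integral_abs _ (measurableTypeR R) R mu (seg l) (mI 0 l) (EFin \o f) mf.
have hI : (\int[mu]_(x in seg l) `|(EFin \o f) x| = 0)%E.
  have /integrableP[_ fin] := hf.
  have := h; rewrite /ri /Rintegral => h'.
  rewrite -[LHS]fineK; first by congr (_%:E).
  by rewrite ge0_fin_numE// integral_ge0.
move=> /(_ hI) ae; apply: (@filterS _ _ (ae_filter_ringOfSetsType mu) _ _ _ ae) => x H xl.
by have := H xl; rewrite /= => -[].
Qed.

Lemma ri_nonneg_eq0 (f : R -> R) : rI l f -> ae_on l (fun x => 0 <= f x) -> ri f 0 l = 0 -> ae_on l (fun x => f x = 0).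
Proof.
move=> hf f0 h; apply: ri_abs_eq0 => //; rewrite -[RHS]h; apply: ri_ae (lexx _) (lexx _) _ => //; first exact: rI_abs.
by apply: ae_mono f0 _ => x _ /ger0_norm.
Qed.

Lemma ri_cst (k : R) : ri (fun _ => k) 0 l = k * l.
Proof.
rewrite /ri /Rintegral integral_cst; last exact: mI.
by rewrite /= lebesgue_measure_itv /= lte_fin l0 /= subr0.
Qed.

(** The square of F is constant, since its derivative 2 f F vanishes almost everywhere, and a
    constant that is almost everywhere 0 on an interval of positive length is 0. *)
Lemma rAC_ae0 F f : rAC l F f -> ae_on l (fun x => F x = 0) -> forall x, 0 <= x <= l -> F x = 0.
Proof.
move=> hF h; have hFF := rACM (ltW l0) hF hF.
have c x : 0 <= x <= l -> F x * F x = F 0 * F 0.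
  move=> /andP[x0 xl]; rewrite (hFF.2 x) ?x0// (@ri_ae _ l _ (fun=> 0)) ?ri0 ?addr0//; first exact: hFF.1.
    exact: rI0.
  by apply: ae_mono h _ => t _ ->; rewrite !mulr0 addr0.
have : ri (fun _ => F 0 * F 0) 0 l = 0.
  rewrite (@ri_ae _ l _ (fun=> 0)) ?ri0//; [exact: rI_cst|exact: rI0|].
  by apply: ae_mono h _ => t /segP tl Ft; rewrite -(c t tl) Ft mulr0.
rewrite ri_cst => /eqP; rewrite mulf_eq0 (gt_eqF l0) orbF => /eqP F0 x xl.
by apply/eqP; have /eqP := c x xl; rewrite F0 mulf_eq0 orbb.
Qed.

(* With P x = int_0^x b w identically 0, integrating P w by parts gives int b w^2 = 0. *)
Lemma rAC_cancel (b w w' : R -> R) : rI l b -> ae_on l (fun x => 0 < b x) \/ ae_on l (fun x => b x < 0) ->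
  rAC l w w' -> (forall x, 0 <= x <= l -> ri (fun t => b t * w t) 0 x = 0) -> ae_on l (fun x => w x = 0).
Proof.
move=> hb sg hw h; have hbw : rI l (fun t => b t * w t) by exact: (rI_mulAC (ltW l0) hb hw).
have hP : rAC l (fun=> 0) (fun t => b t * w t) by split=> // x xl; rewrite h// addr0.
have hPw := rACM (ltW l0) hP hw.
have hbww : rI l (fun t => b t * w t * w t) by exact: (rI_mulAC (ltW l0) hbw hw).
have ll : 0 <= l <= l by rewrite lexx ltW.
have I0 : ri (fun t => b t * w t * w t) 0 l = 0.
  have := hPw.2 l ll; rewrite !mul0r add0r => E; rewrite [RHS]E; apply: ri_eq => t _.
  by rewrite mulr0 addr0.
have fin (sgn : R) : ae_on l (fun x => 0 < sgn * b x) -> ae_on l (fun x => w x = 0).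
  move=> sb; have E : ri (fun t => sgn * (b t * w t * w t)) 0 l = 0 by rewrite (riZ _ hbww)// I0 mulr0.
  have bww0 : ae_on l (fun x => 0 <= sgn * (b x * w x * w x)).
    apply: ae_mono sb _ => x _ bx; rewrite !mulrA -mulrA -expr2.
    by rewrite mulr_ge0 ?sqr_ge0 ?ltW.
  have H := ri_nonneg_eq0 (rIZ sgn hbww) bww0 E; apply: ae_mono (ae_and sb H) _ => x _ [bx]; rewrite !mulrA => /eqP.
  by rewrite !mulf_eq0 -mulf_eq0 (gt_eqF bx) /= orbb => /eqP.
case: sg => sg; [apply: (fin 1)|apply: (fin (-1))]; apply: ae_mono sg _ => x _.
  by rewrite mul1r.
by rewrite mulN1r oppr_gt0.
Qed.

End Cancellation.

Section MatrixAE.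
Variables (R : realType) (l : R).
Hypothesis l0 : 0 < l.
Local Notation C := R[i].

Lemma mAC_ae m p (F f g : R -> 'M[C]_(m, p)) : mAC l F f -> mxintegrable l g -> ae_on l (fun x => f x = g x) -> mAC l F g.
Proof.
move=> hF hg h i j; have /cACP[fI FE] := hF i j; apply/cACP; split; first exact: hg.
move=> x /andP[x0 xl]; rewrite FE ?x0//; congr (_ + _); apply: (cint_ae fI (hg i j) (lexx _) xl).
by apply: ae_mono h _ => t _ ->.
Qed.

Lemma mAC_ae0 m p (F f : R -> 'M[C]_(m, p)) : mAC l F f -> ae_on l (fun x => F x = 0) -> forall x, 0 <= x <= l -> F x = 0.
Proof.
move=> hF h x xl; apply/matrixP => i j; rewrite [RHS]mxE; have [h1 h2] := hF i j.
apply: cplxP; [apply: (rAC_ae0 l0 h1)|apply: (rAC_ae0 l0 h2)] => //.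
  by apply: ae_mono h _ => t _ ->; rewrite mxE.
by apply: ae_mono h _ => t _ ->; rewrite mxE.
Qed.

Lemma Bmx_mulE n (beta : 'I_n -> R -> R) t p (U : 'M[C]_(n, p)) i j : (Bmx beta t *m U) i j = (beta i t)%:C * U i j.
Proof.
rewrite mxE (bigD1 i)//= mxE eqxx big1 ?addr0// => k ki.
by rewrite mxE eq_sym (negbTE ki) mul0r.
Qed.

Lemma Bmx_cancel n (beta : 'I_n -> R -> R) (w w' : R -> 'cV[C]_n) : (forall k, rI l (beta k)) ->
  (forall k, ae_on l (fun x => 0 < beta k x) \/ ae_on l (fun x => beta k x < 0)) -> mAC l w w' ->
  (forall x, 0 <= x <= l -> mxint (fun t => 'i *: (Bmx beta t *m w t)) 0 x = 0) -> ae_on l (fun x => w x = 0).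
Proof.
move=> Ib sg hw h.
have comp k : ae_on l (fun x => w x k 0 = 0).
  have [h1 h2] := hw k 0.
  have e x : 0 <= x <= l -> cint (fun t => 'i * ((beta k t)%:C * w t k 0)) 0 x = 0.
    move=> xl; have /matrixP/(_ k 0) := h x xl; rewrite !mxE => E; rewrite -[RHS]E.
    by apply: cint_eq => t _; rewrite [RHS]mxE Bmx_mulE.
  have a1 : ae_on l (fun x => complex.Re (w x k 0) = 0).
    apply: (rAC_cancel l0 (Ib k) (sg k) h1) => x xl; have := congr1 (@complex.Im R) (e x xl).
    rewrite cintE /= => E; rewrite -[RHS]E; apply: ri_eq => t _.
    by case: (w t k 0) => p q /=; ring.
  have a2 : ae_on l (fun x => complex.Im (w x k 0) = 0).
    apply: (rAC_cancel l0 (Ib k) (sg k) h2) => x xl; have /andP[x0 xle] := xl; have := congr1 (@complex.Re R) (e x xl).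
    rewrite cintE /= => E; apply/eqP; rewrite -oppr_eq0 -(riN (l := l))//; last exact: (rI_mulAC (ltW l0) (Ib k) h2).
    rewrite -[X in _ == X]E; apply/eqP; apply: ri_eq => t _.
    by case: (w t k 0) => p q /=; ring.
  by apply: ae_mono (ae_and a1 a2) _ => x _ [b1 b2]; exact: cplxP.
apply: ae_mono (ae_fin comp) _ => x _ hx; apply/colP => k; by rewrite hx mxE.
Qed.

End MatrixAE.

Section WeightedSpace.
Variables (R : realType) (l : R) (n : nat).
Hypothesis l0 : 0 < l.
Local Notation C := R[i].
Local Notation mu := (@lebesgue_measure R).
Variables (beta : 'I_n -> R -> R).
Hypothesis Ib : forall k, rI l (beta k).

Definition wH (f : vec R n) (x : R) : R :=
  \sum_k `|beta k x| * (complex.Re (f x k 0) ^+ 2 + complex.Im (f x k 0) ^+ 2).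

Lemma wH_ge0 (f : vec R n) x : 0 <= wH f x.
Proof. by apply: sumr_ge0 => k _; rewrite mulr_ge0// addr_ge0 ?sqr_ge0. Qed.

Lemma normH2E (f : vec R n) : rI l (wH f) -> normH2 beta l f = (ri (wH f) 0 l)%:E.
Proof.
move=> /integrableP[_ fin]; rewrite /ri /Rintegral fineK//.
rewrite ge0_fin_numE; last by apply: integral_ge0 => x _; rewrite lee_fin wH_ge0.
apply: le_lt_trans fin; rewrite le_eqVlt; apply/orP; left; apply/eqP; apply: eq_integral => x _ /=.
by rewrite ger0_norm// wH_ge0.
Qed.

Lemma rM_wH (f : vec R n) : (forall k, cmeasurable l (fun x => f x k 0)) -> rM l (wH f).
Proof.
move=> hf; apply: measurable_sum => k; apply: measurable_funM.
  by apply: measurableT_comp => //; exact: rI_meas.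
by apply: measurable_funD; apply: measurable_funX; case: (hf k).
Qed.

Lemma inHP (f : vec R n) : inH beta l f <-> (forall k, cmeasurable l (fun x => f x k 0)) /\ rI l (wH f).
Proof.
split=> -[mf h]; split => //; last by rewrite normH2E// ltry.
apply/integrableP; split; first by apply/measurable_EFinP; exact: rM_wH.
apply: le_lt_trans h; rewrite le_eqVlt; apply/orP; left; apply/eqP; apply: eq_integral => x _ /=.
by rewrite ger0_norm// wH_ge0.
Qed.

Lemma inH_AC (y y' : vec R n) : mAC l y y' -> inH beta l y.
Proof.
move=> hy; apply/inHP; split => [k|]; first by have [h1 h2] := hy k 0; split; [exact: (rAC_meas (ltW l0) h1)|exact: (rAC_meas (ltW l0) h2)].
apply: rI_sum => k; have [h1 h2] := hy k 0.
have [M M0 hM] := rAC_bounded (rACM (ltW l0) h1 h1); have [N N0 hN] := rAC_bounded (rACM (ltW l0) h2 h2).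
have := rAC_meas (ltW l0) (rACD (rACM (ltW l0) h1 h1) (rACM (ltW l0) h2 h2)) => mm.
apply: (@rI_mulb _ l (fun x => `|beta k x|) (fun x => complex.Re (y x k 0) ^+ 2 + complex.Im (y x k 0) ^+ 2) (M + N)).
- exact: rI_abs.
- by move: mm; congr (rM _ _); apply/funext => x; rewrite !expr2.
move=> x /segP xl; apply: le_trans (ler_normD _ _) _.
by rewrite !expr2 lerD ?hM ?hN.
Qed.

Lemma inH_add (f y y' : vec R n) (z : C) : inH beta l f -> mAC l y y' -> inH beta l (fun x => f x + z *: y x).
Proof.
move=> /inHP[mf hf] hy0; have hy := mACZ (ltW l0) z hy0; have /inHP[my hy2] := inH_AC hy.
apply/inHP; have mfy k : cmeasurable l (fun x => (f x + z *: y x) k 0).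
  split.
    rewrite (_ : (fun x => _) = (fun x => complex.Re (f x k 0) + complex.Re ((z *: y x) k 0))); last by apply/funext => x; rewrite mxE cReD.
    by apply: measurable_funD; [case: (mf k)|case: (my k)].
  rewrite (_ : (fun x => _) = (fun x => complex.Im (f x k 0) + complex.Im ((z *: y x) k 0))); last by apply/funext => x; rewrite mxE cImD.
  by apply: measurable_funD; [case: (mf k)|case: (my k)].
split => //; apply: (rI_le (g := fun x => 2 * wH f x + 2 * wH (fun x => z *: y x) x)).
- exact: rM_wH.
- by apply: rID; apply: rIZ.
move=> x _; rewrite !ger0_norm ?wH_ge0 ?addr_ge0 ?mulr_ge0 ?wH_ge0// /wH !mulr_sumr -big_split /=.
apply: ler_sum => k _; rewrite mulrCA (mulrCA 2) -mulrDr ler_wpM2l// mxE cReD cImD.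
move: (f x k 0) ((z *: y x) k 0) => [a b] [c d] /=.
have := sqr_ge0 (a - c); have := sqr_ge0 (b - d); nra.
Qed.

End WeightedSpace.

Section Chain.
Variables (R : realType) (l : R) (n : nat).
Hypothesis l0 : 0 < l.
Local Notation C := R[i].
Variables (beta : 'I_n -> R -> R) (Q : R -> 'M[C]_n).
Hypotheses (Ib : forall k, rI l (beta k)) (IQ : mxintegrable l Q).
Hypothesis sg : forall k, ae_on l (fun x => 0 < beta k x) \/ ae_on l (fun x => beta k x < 0).
Variables (CC D : 'M[C]_n) (mu : C).
Local Notation A := (Amx beta Q mu).
Let B t (p : nat) (U : 'M[C]_(n, p)) : 'M[C]_(n, p) := 'i *: (Bmx beta t *m U).

Lemma mxI_iB p (U u : R -> 'M[C]_(n, p)) : mAC l U u -> mxintegrable l (fun t => B t (U t)).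
Proof. by move=> hU; apply: mxIZ; apply: (mxI_mul (ltW l0) (mxI_B Ib) hU). Qed.

(* Phi_i is the i-th Taylor coefficient of Phi_Q(x, lambda) at lambda = mu. *)
Lemma chain_exists : exists Phi : nat -> R -> 'M[C]_n,
  [/\ Phi 0%N = PhiQ beta Q l mu, forall i, mAC l (Phi i.+1) (fun t => A t *m Phi i.+1 t + B t (Phi i t)) &
    forall i, Phi i.+1 0 = 0].
Proof.
have /choice[step hstep] (U : R -> 'M[C]_n) : exists V, (exists u, mAC l U u) -> mAC l V (fun t => A t *m V t + B t (U t)) /\ V 0 = 0.
  have [[u hu]|nu] := pselect (exists u, mAC l U u); last by exists U.
  have [V [h1 h2]] := ivp_exists (ltW l0) Ib IQ mu (0 : 'M[C]_n) (mxI_iB hu).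
  by exists V.
have hP i : exists u, mAC l (iter i step (PhiQ beta Q l mu)) u.
  elim: i => [|i /hstep[h _]]; first by eexists; exact: (PhiQ_AC (ltW l0) Ib IQ mu).
  by eexists; exact: h.
exists (fun i => iter i step (PhiQ beta Q l mu)); split => // i; first by case: (hstep _ (hP i)).
by case: (hstep _ (hP i)).
Qed.

Variable Phi : nat -> R -> 'M[C]_n.
Hypothesis Phi0 : Phi 0%N = PhiQ beta Q l mu.
Hypothesis PhiS : forall i, mAC l (Phi i.+1) (fun t => A t *m Phi i.+1 t + B t (Phi i t)).
Hypothesis PhiS0 : forall i, Phi i.+1 0 = 0.

(** The Taylor coefficients at mu of the matrix C + D Phi_Q(l, .), whose determinant is Delta_Q. *)
Definition Mc (i : nat) : 'M[C]_n := (if i == 0%N then CC else 0) + D *m Phi i l.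
(** The coefficient of X^(k-1) in the product of the series Phi(x, mu + X) and c(X). Subtracting mu
    from the differential expression sends the function of order k + 1 to that of order k. *)
Definition yc (k : nat) (c : nat -> 'cV[C]_n) (x : R) : 'cV[C]_n := \sum_(i < k) Phi i x *m c (k - i.+1)%N.

Lemma Phi0_AC : mAC l (Phi 0%N) (fun t => A t *m Phi 0%N t).
Proof. by rewrite Phi0; exact: (PhiQ_AC (ltW l0) Ib IQ mu). Qed.

Lemma Phi0_0 : Phi 0%N 0 = 1%:M.
Proof. by rewrite Phi0; exact: (PhiQ_0 (ltW l0) Ib IQ mu). Qed.

Lemma yc_rec k c : mAC l (yc k.+1 c) (fun t => A t *m yc k.+1 c t + B t (yc k c t)).
Proof.
have h := mACD (ltW l0) (mACMr (ltW l0) (c k) Phi0_AC)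
  (mAC_sum (ltW l0) (index_enum _) (fun i : 'I_k => mACMr (ltW l0) (c (k - i.+1)%N) (PhiS i))).
apply: (mAC_ext (ltW l0) _ _ h) => x _; first by rewrite /yc big_ord_recl subn1.
rewrite /yc big_ord_recl subn1 mulmxDr mulmxA -addrA; congr (_ + _).
rewrite /B !mulmx_sumr scaler_sumr -big_split /=; apply: eq_bigr => i _.
by rewrite mulmxDl -scalemxAl !mulmxA.
Qed.

Lemma yc_AC k c : exists u, mAC l (yc k c) u.
Proof.
case: k => [|k]; last by eexists; exact: yc_rec.
exists (fun=> 0); apply: (mAC_ext (ltW l0) _ _ (mAC_cst (ltW l0) (0 : 'cV[C]_n))) => // x _.
by rewrite /yc big_ord0.
Qed.

Lemma yc_0 k c : yc k.+1 c 0 = c k.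
Proof.
rewrite /yc big_ord_recl subn1 Phi0_0 mul1mx big1 ?addr0// => i _.
by rewrite PhiS0 mul0mx.
Qed.

Lemma yc_eq k c e x : (forall j, (j < k)%N -> c j = e j) -> yc k c x = yc k e x.
Proof. by move=> h; apply: eq_bigr => i _; rewrite h// -subSn// subSS leq_subr. Qed.

Lemma yc_bc k c : CC *m yc k.+1 c 0 + D *m yc k.+1 c l = \sum_(i < k.+1) Mc i *m c (k - i)%N.
Proof.
rewrite yc_0 /yc mulmx_sumr !big_ord_recl /= subn1 subn0 addrA; congr (_ + _).
  by rewrite /Mc eqxx mulmxDl mulmxA.
by apply: eq_bigr => i _; rewrite /Mc /= add0r mulmxA subSS.
Qed.

Lemma LU_form (y z f : vec R n) x : f x = z x + mu *: y x ->
  'i *: (Bmx beta x *m f x) - Q x *m y x = A x *m y x + B x (z x).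
Proof.
move=> ->; rewrite /Amx /B mulmxBl mulmxDr scalerDr -scalemxAr -scalemxAl scalerA.
by rewrite -addrA addrC.
Qed.

(** If (L - mu) y is represented by c at order k, then y and the function of order k + 1 built from
    c extended by the value y(0) solve one initial value problem, hence agree; the boundary
    condition is the last Toeplitz equation. *)
Lemma kerpow_rep k y : in_kerpow beta Q l CC D mu k y ->
  exists c, toep Mc k c /\ ae_on l (fun x => y x = yc k c x).
Proof.
elim: k y => [|k IH] y.
  by move=> h; exists (fun=> 0); split => //; apply: ae_mono h _ => x _ ->; rewrite /yc big_ord0.
move=> [f [[fH [gI [yE bc]]] [z [zf /IH[c [tc zc]]]]]].
have [u hu] := yc_AC k c.
have hy : mAC l y (fun t => A t *m y t + B t (yc k c t)).
  have hy0 : mAC l y (fun t => 'i *: (Bmx beta t *m f t) - Q t *m y t) by apply/mACP.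
  apply: (mAC_ae hy0).
    by apply: mxID; [apply: (mxI_mul (ltW l0) (mxI_A Ib IQ mu) hy0)|exact: mxI_iB hu].
  apply: ae_mono (ae_and zf zc) _ => x _ [h1 h2]; apply: LU_form.
  by rewrite -h2 h1 subrK.
pose c' j := if (j < k)%N then c j else y 0.
have yV x : 0 <= x <= l -> y x = yc k.+1 c' x.
  move=> xl; apply: (ode_unique (ltW l0) (mxI_A Ib IQ mu) hy _ _ xl); last by rewrite yc_0 /c' ltnn.
  have cc' t : yc k c' t = yc k c t by apply: yc_eq => j jk; rewrite /c' jk.
  by apply: (mAC_ext (ltW l0) _ _ (yc_rec k c')) => t _; rewrite ?cc'.
exists c'; split; last by apply: ae_all => x /segP; exact: yV.
have l00 : (0 : R) <= 0 <= l by rewrite lexx (ltW l0).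
have ll : 0 <= l <= l by rewrite lexx (ltW l0).
move=> j; rewrite ltnS leq_eqVlt => /orP[/eqP->|jk].
  by rewrite -yc_bc -!yV.
rewrite -[RHS](tc j jk); apply: eq_bigr => i _; rewrite /c' (leq_ltn_trans _ jk)//.
exact: leq_subr.
Qed.

Lemma rep_kerpow k c : toep Mc k c -> in_kerpow beta Q l CC D mu k (yc k c).
Proof.
elim: k => [|k IH] tc /=; first by apply: ae_all => x _; rewrite /yc big_ord0.
have tc' : toep Mc k c by move=> j jk; apply: tc; exact: ltnW.
have [u hu] := yc_AC k c; have hy := yc_rec k c.
exists (fun x => yc k c x + mu *: yc k.+1 c x); split; last first.
  by exists (yc k c); split; [apply: ae_all => x _; rewrite addrK|exact: IH].
have /mACP[gI gE] : mAC l (yc k.+1 c) (fun t => 'i *: (Bmx beta t *m (yc k c t + mu *: yc k.+1 c t)) - Q t *m yc k.+1 c t).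
  apply: (mAC_ext (ltW l0) _ _ hy) => x _; [by []|]; exact: (esym (@LU_form (yc k.+1 c) (yc k c) (fun x => yc k c x + mu *: yc k.+1 c x) x erefl)).
split; first exact: (@inH_add R l n l0 beta Ib (yc k c) (yc k.+1 c) _ mu (inH_AC l0 Ib hu) hy).
by split => //; split => //; rewrite yc_bc tc.
Qed.

Lemma rep_shift k c : toep Mc k c -> toep Mc k.+1 (fun j => if j is j'.+1 then c j' else 0) /\
  forall x, yc k.+1 (fun j => if j is j'.+1 then c j' else 0) x = yc k c x.
Proof.
move=> tc; split=> [[_|j]|x].
- by rewrite big_ord_recl big_ord0 subn0 mulmx0 addr0.
- rewrite ltnS => jk; rewrite big_ord_recr /= subnn mulmx0 addr0 -[RHS](tc j jk).
  by apply: eq_bigr => i _; rewrite subSn// -ltnS.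
rewrite /yc big_ord_recr /= subnn mulmx0 addr0; apply: eq_bigr => i _.
by rewrite subSS -[(k - i)%N]prednK ?subn_gt0// subnS.
Qed.

(** Leading zeros do not change the function, so every root vector may be represented at some order
    at least d, as [toeplitz_basis] requires. *)
Lemma rep_pad k c p : toep Mc k c -> exists c', toep Mc (p + k) c' /\ forall x, yc (p + k) c' x = yc k c x.
Proof.
elim: p => [|p IH] tc; first by exists c.
by have [c' [/rep_shift[h1 h2] h3]] := IH tc; eexists; split; [exact: h1|move=> x; rewrite addSn h2].
Qed.

(** The value at 0 gives c k = 0. Once the function of order k + 1 vanishes identically, its
    equation leaves zero integrals of B times the function of order k, and [Bmx_cancel] passes to
    that function. *)
Lemma yc_indep k c : ae_on l (fun x => yc k c x = 0) -> forall j, (j < k)%N -> c j = 0.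
Proof.
elim: k => // k IH h; have hy := yc_rec k c.
have y0 := mAC_ae0 l0 hy h; have l00 : (0 : R) <= 0 <= l by rewrite lexx (ltW l0).
have ck : c k = 0 by rewrite -yc_0 y0.
have [u hu] := yc_AC k c.
have /IH H : ae_on l (fun x => yc k c x = 0).
  apply: (Bmx_cancel l0 Ib sg hu) => x xl.
  have := mAC_eq hy; move=> /(_ x xl); rewrite !y0// add0r => E; rewrite [RHS]E.
  apply: mxint_eq => t /andP[t0 tx]; rewrite y0 ?mulmx0 ?add0r// t0 /=.
  by apply: le_trans tx _; case/andP: xl.
by move=> j; rewrite ltnS leq_eqVlt => /orP[/eqP->//|]; exact: H.
Qed.

Lemma yc_comb d (a : 'I_d -> C) (c : 'I_d -> nat -> 'cV[C]_n) k x :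
  \sum_i a i *: yc k (c i) x = yc k (fun m => \sum_i a i *: c i m) x.
Proof.
rewrite /yc; under eq_bigr do rewrite scaler_sumr.
rewrite exchange_big; apply: eq_bigr => m _; rewrite mulmx_sumr; apply: eq_bigr => i _.
by rewrite scalemxAr.
Qed.

Lemma alg_mult_toeplitz d : (forall N, (d < N)%N -> exists2 u, \det (mser Mc N) = 'X^d * u & ~~ root u 0) ->
  alg_mult beta Q l CC D mu d.
Proof.
move=> dM; have [c [tc ci cs]] := toeplitz_basis dM.
exists (fun i => yc d (c i)); split; [|split].
- by move=> i; exists d; exact: rep_kerpow.
- move=> a ha; apply: ci => m md; apply: (yc_indep (k := d) (c := fun m => \sum_i a i *: c i m)) md.
  by apply: ae_mono ha _ => x _ h; rewrite -yc_comb.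
move=> y [k /kerpow_rep[e [te ye]]]; have [e' [te' ye']] := rep_pad d te.
have [ez [a ea]] := cs _ e' (leq_addr k d) te'; exists a; apply: ae_mono ye _ => x _ ->.
rewrite yc_comb -ye' [RHS](big_ord_widen (d + k) (fun i => Phi i x *m _ (d - i.+1)%N)) ?leq_addr// big_mkcond.
apply: eq_bigr => i _; case: ltnP => id.
  have di : (d - i.+1 < d)%N by rewrite ltn_subrL (leq_ltn_trans (leq0n _) id).
  by rewrite -(ea _ di) addKn addnBA// (addnC k).
rewrite ez ?mulmx0// addKn ltn_subLR; last exact: ltn_ord.
by move: (nat_of_ord i) id => r dr; rewrite ltn_add2r ltnS.
Qed.

End Chain.

End Chains.

(** * The order of the truncated characteristic series *)

Section DetLipschitz.
Variable R : realType.
Local Notation C := R[i].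

(** A linear modulus is essential here: an error of size h^N in the entries has to remain of size
    h^N in the determinant. *)
Lemma prod_lip (I : Type) (s : seq I) (M : R) : 0 <= M -> exists2 K : R, 0 <= K & forall (a b : I -> C) d,
  (forall i, cabs (a i) <= M) -> (forall i, cabs (b i) <= M) -> (forall i, cabs (b i - a i) <= d) ->
  cabs (\prod_(i <- s) b i - \prod_(i <- s) a i) <= K * d.
Proof.
move=> M0; elim: s => [|x s [K K0 hK]].
  by exists 0 => // a b d _ _ _; rewrite !big_nil subrr cabs0 mul0r.
have P0 : 0 <= \prod_(i <- s) M by apply: prodr_ge0.
exists (\prod_(i <- s) M + M * K); first by rewrite addr_ge0 ?mulr_ge0.
move=> a b d ha hb hd; rewrite !big_cons; have h := hK a b d ha hb hd.
have hp : cabs (\prod_(i <- s) b i) <= \prod_(i <- s) M.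
  by rewrite cabs_prod; apply: ler_prod => i _; rewrite cabs_ge0 /=.
move: (\prod_(i <- s) b i) (\prod_(i <- s) a i) h hp => p q h hp.
have -> : b x * p - a x * q = (b x - a x) * p + a x * (p - q) by ring.
apply: le_trans (cabsD _ _) _; rewrite !cabsM mulrDl; apply: lerD.
  by rewrite mulrC; apply: ler_pM; rewrite ?cabs_ge0.
by rewrite -mulrA; apply: ler_pM; rewrite ?cabs_ge0.
Qed.

Lemma det_lip n (M : R) : 0 <= M -> exists2 K : R, 0 <= K & forall (A B : 'M[C]_n) d,
  (forall i j, cabs (A i j) <= M) -> (forall i j, cabs (B i j) <= M) -> (forall i j, cabs (B i j - A i j) <= d) ->
  cabs (\det B - \det A) <= K * d.
Proof.
move=> M0; have [K K0 hK] := prod_lip (index_enum 'I_n) M0.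
exists (\sum_(s : 'S_n) K); first exact: sumr_ge0.
move=> A B d hA hB hd; rewrite /determinant -sumrB; apply: le_trans (cabs_sum _ _ _) _.
rewrite mulr_suml; apply: ler_sum => s _.
rewrite -mulrBr cabsM cabsX cabsN cabs1 expr1n mul1r.
by apply: hK => i.
Qed.

(** As N > d, the error h^N is o(h^d), so P has the same order d at 0 as F at mu; for a polynomial
    this order is the exact power of X dividing it. *)
Lemma zero_mult_taylor (F : C -> C) mu d N (P : {poly C}) (K : R) : (d < N)%N -> 0 <= K -> zero_mult F mu d ->
  (forall h, cabs h <= 1 -> cabs (F (mu + h) - P.[h]) <= K * cabs h ^+ N) ->
  exists2 u, P = 'X^d * u & ~~ root u 0.
Proof.
move=> dN K0 [G [FG [cG G0]]] hP.
have zP : zero_mult (horner P) 0 d.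
  (* The quotient P(h) / h^d is extended at 0 by the cofactor value of F, which is its limit. *)
  exists (fun h => if h == 0 then G mu else P.[h] / h ^+ d); split; [|split].
  - move=> w; rewrite subr0; case: eqVneq => [->|w0]; last by rewrite mulrC divfK// expf_neq0.
    have := hP 0; rewrite cabs0 ler01 addr0 expr0n => /(_ isT).
    rewrite (gtn_eqF (leq_ltn_trans (leq0n d) dN)) mulr0 => h0.
    have /eqP : cabs (F mu - P.[0]) == 0 by rewrite eq_le h0 cabs_ge0.
    by move/eqP; rewrite cabs_eq0 subr_eq0 => /eqP <-; rewrite FG subrr.
  - move=> e e0; have e2 : 0 < e / 2 by rewrite divr_gt0.
    have [d1 [d10 h1]] := cG _ e2; have K1 : 0 < 2 * (K + 1) by rewrite mulr_gt0// ltr_wpDl.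
    exists (Num.min 1 (Num.min d1 (e / (2 * (K + 1))))); split; first by rewrite !lt_min ltr01 d10 divr_gt0.
    move=> w; rewrite subr0 !lt_min eqxx => /and3P[w1 w2 w3].
    case: eqVneq => [_|w0]; first by rewrite subrr cabs0.
    have cw0 : 0 < cabs w by rewrite cabs_gt0.
    have -> : P.[w] / w ^+ d - G mu = (G (mu + w) - G mu) - (F (mu + w) - P.[w]) / w ^+ d.
      rewrite FG; have -> : mu + w - mu = w by ring.
      by field; rewrite expf_neq0.
    apply: le_lt_trans (cabsB _ _) _.
    have a1 : cabs (G (mu + w) - G mu) < e / 2.
      by apply: h1; rewrite (_ : mu + w - mu = w)//; ring.
    have a2 : cabs ((F (mu + w) - P.[w]) / w ^+ d) <= K * cabs w.
      rewrite cabsM cabsV cabsX ler_pdivrMr ?exprn_gt0// -mulrA -exprS.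
      apply: le_trans (hP w (ltW w1)) _; rewrite ler_wpM2l// ler_wiXn2l// ?ltW//.
    have a3 : K * cabs w <= e / 2.
      apply: (@le_trans _ _ ((K + 1) * cabs w)); first by rewrite ler_wpM2r ?cabs_ge0// lerDl.
      by move: w3; rewrite ltr_pdivlMr//; move: (cabs w) => t; lra.
    lra.
  - by rewrite eqxx.
have P0 : P != 0.
  apply/eqP => P0; have [g [Pg [cg g0]]] := zP.
  have e0 : 0 < cabs (g 0) by rewrite cabs_gt0.
  have [d1 [d10 h1]] := cg _ e0; have d2 : 0 < d1 / 2 by rewrite divr_gt0.
  have w0 : (d1 / 2)%:C != 0 :> C by rewrite -cabs_eq0 cabs_real normr_eq0 gt_eqF.
  have gw : g (d1 / 2)%:C = 0.
    by apply/eqP; have /esym/eqP := Pg (d1 / 2)%:C; rewrite P0 horner0 subr0 mulf_eq0 expf_eq0 (negbTE w0) andbF.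
  have := h1 (d1 / 2)%:C; rewrite gw subr0 sub0r cabsN cabs_real ger0_norm ?ltW// ltxx.
  by move=> /(_ _)/negP; apply; lra.
have [m [q q0' PE]] := multiplicity_XsubC P 0; move: PE; rewrite polyC0 subr0 => PE.
have q0 := implyP q0' P0.
have zm : zero_mult (horner P) 0 m.
  exists (horner q); split; [|split]; last by [].
    by move=> w; rewrite PE hornerM horner_exp hornerX subr0 mulrC.
  exact: entire_cont (entire_poly q).
by exists q => //; rewrite PE (zero_mult_uniq zP zm) mulrC.
Qed.

End DetLipschitz.

Section TaylorChain.
Variables (R : realType) (l : R) (n : nat).
Hypothesis l0 : 0 < l.
Local Notation C := R[i].
Variables (beta : 'I_n -> R -> R) (Q : R -> 'M[C]_n).
Hypotheses (Ib : forall k, rI l (beta k)) (IQ : mxintegrable l Q).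
Variables (CC D : 'M[C]_n) (mu : C).
Local Notation A := (Amx beta Q mu).
Local Notation iB t U := ('i *: (Bmx beta t *m U)).
Variable Phi : nat -> R -> 'M[C]_n.
Hypothesis Phi0 : Phi 0%N = PhiQ beta Q l mu.
Hypothesis PhiS : forall i, mAC l (Phi i.+1) (fun t => A t *m Phi i.+1 t + iB t (Phi i t)).
Hypothesis PhiS0 : forall i, Phi i.+1 0 = 0.

Lemma Amx_shift h t (U : 'M[C]_n) : Amx beta Q (mu + h) t *m U = A t *m U + h *: iB t U.
Proof.
rewrite /Amx mulrDr scalerDl addrAC mulmxDl; congr (_ + _).
by rewrite -scalemxAl scalerA [h * _]mulrC.
Qed.

Let src N (t : R) : 'M[C]_n := if N is N'.+1 then iB t (Phi N' t) else 0.

(** If [Psi] is the remainder of order N + 1, then Phi_N + h [Psi] solves the remainder equation of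
    order N; at order 0 this is the fundamental system at mu + h. *)
Lemma taylor_remainder h N Psi : mAC l Psi (fun t => Amx beta Q (mu + h) t *m Psi t + src N t) ->
  Psi 0 = (if N is 0 then 1%:M else 0) ->
  forall x, 0 <= x <= l -> PhiQ beta Q l (mu + h) x = \sum_(i < N) h ^+ i *: Phi i x + h ^+ N *: Psi x.
Proof.
elim: N Psi => [|N IH] Psi hPsi Psi0 x xl.
  rewrite big_ord0 add0r expr0 scale1r; apply: (PhiQ_unique (ltW l0) Ib IQ) => //.
  by apply: (mAC_ext (ltW l0) _ _ hPsi) => // t _; rewrite /src addr0.
pose U t := Phi N t + h *: Psi t.
rewrite (IH U) //; first by rewrite big_ord_recr /= scalerDr addrA scalerA -exprSr.
  have hN : mAC l (Phi N) (fun t => A t *m Phi N t + src N t).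
    case: (N) => [|N']; last exact: PhiS.
    rewrite Phi0; apply: (mAC_ext (ltW l0) _ _ (PhiQ_AC (ltW l0) Ib IQ mu)) => // t _.
    by rewrite /src addr0.
  apply: (mAC_ext (ltW l0) _ _ (mACD (ltW l0) hN (mACZ (ltW l0) h hPsi))) => // t _.
  rewrite /U mulmxDr (Amx_shift h t (Phi N t)) -scalemxAr scalerDr.
  rewrite -[src N.+1 t]/(iB t (Phi N t)).
  move: (A t *m Phi N t) (src N t) (h *: (Amx _ _ _ _ *m _)) (h *: iB _ _) => a b c d.
  by rewrite -!addrA; congr (a + _); rewrite addrC [c + d]addrC -addrA.
by rewrite /U Psi0 scaler0 addr0; case: (N) => [|N']; rewrite ?PhiS0// Phi0 (PhiQ_0 (ltW l0) Ib IQ).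
Qed.

Lemma taylor_bound N : exists2 K : R, 0 <= K & forall h, cabs h <= 1 -> exists Psi : 'M[C]_n,
  PhiQ beta Q l (mu + h) l = \sum_(i < N) h ^+ i *: Phi i l + h ^+ N *: Psi /\ mn Psi <= K.
Proof.
(* This bounds [cn1] of mu + h for all |h| <= 1, so one Gronwall constant covers all remainders. *)
pose r := 2 * (cabs mu + 1); pose al := Abound beta Q r.
have hal : rI l al := rI_Abound Ib IQ r.
have hsrc : mxintegrable l (src N).
  case: N => [|N]; first exact: mxI0.
  case: N => [|N]; last exact: (mxI_iB l0 Ib (PhiS N)).
  by rewrite /src Phi0; exact: (mxI_iB l0 Ib (PhiQ_AC (ltW l0) Ib IQ mu)).
pose U0 : 'M[C]_n := if N is 0 then 1%:M else 0.
exists ((mn U0 + ri (fun t => mn (src N t)) 0 l) * wexp al l).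
  rewrite mulr_ge0 ?wexp_ge0// addr_ge0 ?mn_ge0//; apply: ri_ge0 => t _; exact: mn_ge0.
move=> h h1; have [Psi [hP P0]] := ivp_exists (ltW l0) Ib IQ (mu + h) U0 hsrc.
have ll : 0 <= l <= l by rewrite lexx (ltW l0).
exists (Psi l); split; first exact: taylor_remainder.
rewrite -P0; apply: (ode_bound (ltW l0) (mxI_A Ib IQ (mu + h)) hsrc hal _ hP) => // t.
apply: Abound_le; apply: le_trans (cn1_le_cabs _) _; rewrite ler_pM2l//.
by apply: le_trans (cabsD _ _) _; rewrite lerD2l.
Qed.

Lemma mser_horner N h : map_mx (horner_eval h) (mser (Mc l CC D Phi) N.+1) = CC + D *m \sum_(i < N.+1) h ^+ i *: Phi i l.
Proof.
apply/matrixP => i j; rewrite mxE [X in horner_eval _ X]mxE /horner_eval horner_poly.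
rewrite (eq_bigr (fun m : 'I_N.+1 => (h ^+ m *: Mc l CC D Phi m) i j)); last by move=> m _; rewrite [RHS]mxE mulrC.
rewrite -summxE; congr (fun_of_matrix _ i j).
rewrite mulmx_sumr !big_ord_recl addrA /Mc /= !expr0 !scale1r; congr (_ + _).
by apply: eq_bigr => m _; rewrite add0r scalemxAr.
Qed.

Lemma det_mser_order d N : (d < N)%N -> zero_mult (DeltaQ beta Q l CC D) mu d ->
  exists2 u, \det (mser (Mc l CC D Phi) N) = 'X^d * u & ~~ root u 0.
Proof.
case: N => // N dN zd; have [K K0 hK] := taylor_bound N.+1.
pose S := \sum_(i < N.+1) mn (Phi i l).
have S0 : 0 <= S by apply: sumr_ge0 => i _; exact: mn_ge0.
pose M := mn CC + mn D * (2 ^+ N * S) + mn D * K.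
have mDK : 0 <= mn D * K by rewrite mulr_ge0 ?mn_ge0.
have M0 : 0 <= M by rewrite /M !addr_ge0 ?mulr_ge0 ?mn_ge0 ?exprn_ge0.
have [L L0 hL] := det_lip n M0.
apply: (zero_mult_taylor (K := L * (mn D * K)) dN _ zd); first exact: mulr_ge0.
move=> h h1; have [Psi [PE hPsi]] := hK h h1.
have -> : (\det (mser (Mc l CC D Phi) N.+1)).[h] = \det (CC + D *m \sum_(i < N.+1) h ^+ i *: Phi i l).
  by rewrite -mser_horner det_map_mx.
rewrite /DeltaQ PE -mulrA.
have cX k : cabs h ^+ k <= 1 by rewrite exprn_ile1// cabs_ge0.
have ent (U : 'M[C]_n) i j : cabs (U i j) <= mn U by exact: le_trans (cabs_le_cn1 _) (mn_entry _ _ _).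
have bS i j : cabs ((D *m \sum_(i < N.+1) h ^+ i *: Phi i l) i j) <= mn D * (2 ^+ N * S).
  apply: le_trans (ent _ _ _) _; apply: le_trans (mnM _ _) _; rewrite ler_wpM2l ?mn_ge0//.
  rewrite mulr_sumr; elim/big_ind2: _ => [|x1 x2 y1 y2 a1 a2|k _]; first by rewrite mn0.
    by apply: le_trans (mnD _ _) _; exact: lerD.
  apply: le_trans (mnZ _ _) _; rewrite ler_wpM2r ?mn_ge0//.
  apply: (@le_trans _ _ (2 ^+ k)); last by rewrite ler_weXn2l ?ler1n// -ltnS.
  have c2 : cn1 h <= 2 by apply: le_trans (cn1_le_cabs _) _; rewrite ler_piMr.
  elim: (nat_of_ord k) => [|m IH]; first by rewrite !expr0 (_ : 1 = 1%:C) ?cn1_real ?normr1.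
  rewrite !exprS; apply: le_trans (cn1M _ _) _; apply: ler_pM; rewrite ?cn1_ge0//.
have bP i j : cabs ((D *m Psi) i j) <= mn D * K.
  apply: le_trans (ent _ _ _) _; apply: le_trans (mnM _ _) _; rewrite ler_wpM2l ?mn_ge0//.
have BE i j : (CC + D *m (\sum_(i < N.+1) h ^+ i *: Phi i l + h ^+ N.+1 *: Psi)) i j =
    (CC + D *m \sum_(i < N.+1) h ^+ i *: Phi i l) i j + h ^+ N.+1 * (D *m Psi) i j.
  by rewrite mulmxDr addrA mxE; congr (_ + _); rewrite -scalemxAr mxE.
have bA i j : cabs ((CC + D *m \sum_(i < N.+1) h ^+ i *: Phi i l) i j) <= mn CC + mn D * (2 ^+ N * S).
  by rewrite mxE; apply: le_trans (cabsD _ _) _; apply: lerD.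
have bH i j : cabs (h ^+ N.+1 * (D *m Psi) i j) <= mn D * K * cabs h ^+ N.+1.
  by rewrite cabsM cabsX mulrC ler_wpM2r// exprn_ge0// cabs_ge0.
apply: hL => i j.
- by apply: le_trans (bA i j) _; rewrite lerDl.
- rewrite BE; apply: le_trans (cabsD _ _) _; apply: lerD => //.
  by apply: le_trans (bH i j) _; rewrite ler_piMr.
by rewrite BE addrAC subrr add0r.
Qed.

End TaylorChain.

Lemma zero_mult_alg_mult (R : realType) (l : R) (n : nat) (beta : 'I_n -> R -> R) (Q : R -> 'M[R[i]]_n)
  (CC D : 'M[R[i]]_n) mu d : 0 < l -> (forall k, rI l (beta k)) -> mxintegrable l Q ->
  (forall k, ae_on l (fun x => 0 < beta k x) \/ ae_on l (fun x => beta k x < 0)) ->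
  zero_mult (DeltaQ beta Q l CC D) mu d -> alg_mult beta Q l CC D mu d.
Proof.
move=> l0 Ib IQ sg zd; have [Phi [h0 hS hS0]] := chain_exists l0 Ib IQ mu.
apply: (alg_mult_toeplitz l0 Ib IQ sg h0 hS hS0) => N dN.
exact: (det_mser_order l0 Ib IQ h0 hS hS0).
Qed.

(** * The resolvent *)

Section ResolventEstimate.
Import numFieldNormedType.Exports.
Local Open Scope classical_set_scope.

Section Resolvent.
Variables (R : realType) (l : R) (n : nat).
Hypothesis l0 : 0 < l.
Local Notation C := R[i].
Variables (beta : 'I_n -> R -> R) (Q : R -> 'M[C]_n).
Hypotheses (Ib : forall k, rI l (beta k)) (IQ : mxintegrable l Q).
Variables (CC D : 'M[C]_n) (mu : C).
Local Notation A := (Amx beta Q mu).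
Local Notation iB t U := ('i *: (Bmx beta t *m U)).
Local Notation absB x := (\sum_k `|beta k x|).

(** From |t| <= 1 + t^2 one gets |beta g| <= |beta| + |beta| g^2, both integrable: a function of
    finite weighted norm is integrable against B. *)
Lemma mxI_Bf (f : vec R n) : inH beta l f -> mxintegrable l (fun t => Bmx beta t *m f t).
Proof.
move=> /(inHP Ib)[mf hf] i j; rewrite (ord1 j).
have wi x : `|beta i x| * (complex.Re (f x i 0) ^+ 2 + complex.Im (f x i 0) ^+ 2) <= wH beta f x.
  by rewrite /wH (bigD1 i)//= lerDl sumr_ge0// => k _; rewrite mulr_ge0// addr_ge0 ?sqr_ge0.
have int (g : R -> R) : rM l g -> (forall x, g x ^+ 2 <= complex.Re (f x i 0) ^+ 2 + complex.Im (f x i 0) ^+ 2) ->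
    rI l (fun x => beta i x * g x).
  move=> mg hg; apply: (rI_le (g := fun x => `|beta i x| + wH beta f x)).
  - by apply: measurable_funM mg; exact: rI_meas (Ib i).
  - by apply: rID hf; exact: rI_abs (Ib i).
  move=> x _; rewrite [X in _ <= X]ger0_norm ?addr_ge0 ?wH_ge0// normrM.
  apply: (@le_trans _ _ (`|beta i x| + `|beta i x| * g x ^+ 2)).
    rewrite -[X in _ <= X + _]mulr1 -mulrDr ler_wpM2l// ler_norml.
    by have := sqr_ge0 (g x - 1); have := sqr_ge0 (g x + 1); move: (g x) => t; rewrite -subr_ge0; nra.
  by rewrite lerD2l; apply: le_trans (wi x); rewrite ler_wpM2l.
have [m1 m2] := mf i; apply/cintegrableE; split.
  apply: rI_eq (int _ m1 _) => x; last by rewrite lerDl sqr_ge0.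
  by rewrite Bmx_mulE; case: (f x i 0) => p q /=; ring.
apply: rI_eq (int _ m2 _) => x; last by rewrite lerDr sqr_ge0.
by rewrite Bmx_mulE; case: (f x i 0) => p q /=; ring.
Qed.

Lemma rI_absB : rI l (fun x => absB x).
Proof. by apply: rI_sum => k; exact: rI_abs (Ib k). Qed.

(* Cauchy-Schwarz: 2 |b h| <= s |b| + |b| h^2 / s, at the optimal s. *)
Lemma cauchy_schwarz_B (h : vec R n) : inH beta l h ->
  ri (fun t => mn (iB t (h t))) 0 l ^+ 2 <= 2 * (ri (fun x => absB x) 0 l + 1) * ri (wH beta h) 0 l.
Proof.
move=> hH; have /(inHP Ib)[_ hw] := hH.
set I := ri _ 0 l; set W := ri (fun x => absB x) 0 l; set b := ri (wH beta h) 0 l.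
have W0 : 0 <= W by apply: ri_ge0 => x _; apply: sumr_ge0.
have b0 : 0 <= b by apply: ri_ge0 => x _; exact: wH_ge0.
have IB : rI l (fun t => mn (iB t (h t))) by apply: mxI_mn; apply: mxIZ; exact: mxI_Bf.
have I0 : 0 <= I by apply: ri_ge0 => x _; exact: mn_ge0.
have key s : 0 < s -> I <= s / 2 * W + s^-1 * b.
  move=> s0; rewrite -(riZ _ rI_absB) ?lexx// -(riZ _ hw) ?lexx// -(riD (rIZ _ rI_absB) (rIZ _ hw)) ?lexx//.
  apply: (ri_le IB (rID (rIZ (s / 2) rI_absB) (rIZ s^-1 hw)) (lexx _) (lexx _)).
  move=> x _; rewrite /mn /wH !mulr_sumr -big_split /=; apply: ler_sum => i _.
  rewrite big_ord1 mxE cn1_i Bmx_mulE; apply: le_trans (cn1M _ _) _; rewrite cn1_real.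
  apply: (@le_trans _ _ (`|beta i x| * (s / 2 + s^-1 * (complex.Re (h x i 0) ^+ 2 + complex.Im (h x i 0) ^+ 2)))); last first.
    by rewrite mulrDr [_ * (s / 2)]mulrC mulrCA.
  rewrite ler_wpM2l//; case: (h x i 0) => p q /=; rewrite /cn1 /=.
  have := normr_ge0 p; have := normr_ge0 q; rewrite -(real_normK (num_real p)) -(real_normK (num_real q)).
  move: `|p| `|q| => u v v0 u0.
  have h1 : 0 <= s^-1 * (u + v - s) ^+ 2 by rewrite mulr_ge0 ?invr_ge0 ?sqr_ge0// ltW.
  have h2 : 0 <= s^-1 * (u - v) ^+ 2 by rewrite mulr_ge0 ?invr_ge0 ?sqr_ge0// ltW.
  have E : s^-1 * (u + v - s) ^+ 2 = s^-1 * (u + v) ^+ 2 - 2 * (u + v) + s by field; rewrite gt_eqF.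
  move: h1 h2; rewrite E; move: s^-1 => t; nra.
have [->|In0] := eqVneq I 0; first by rewrite expr0n mulr_ge0// mulr_ge0// addr_ge0.
have Ip : 0 < I by rewrite lt_neqAle eq_sym In0.
have W1 : 0 < W + 1 by rewrite ltr_wpDl.
(* Up to the added 1 this s makes the term s W / 2 absorbable by I / 2; the 1 keeps the quotient
   defined when W = 0. *)
have := key (I / (W + 1)) (divr_gt0 Ip W1); rewrite invf_div => k1.
have k2 : I / (W + 1) / 2 * W <= I / 2.
  rewrite mulrAC ler_wpM2r ?invr_ge0// mulrAC ler_pdivrMr// ler_wpM2l//; by rewrite lerDl.
have k3 : I / 2 <= (W + 1) / I * b by lra.
have := ler_wpM2l (ltW Ip) k3.
have -> : I * ((W + 1) / I * b) = (W + 1) * b by field.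
rewrite expr2; lra.
Qed.

(** Existence: a solution starting at 0 is corrected by Phi c so as to meet the boundary condition.
    Estimate: y - Phi y(0) starts at 0 and is bounded by the data, and the boundary condition then
    recovers y(0) through the inverse of C + D Phi(l). *)
Lemma DeltaQ_resolvent : (forall k, ae_on l (fun x => 0 < beta k x) \/ ae_on l (fun x => beta k x < 0)) ->
  DeltaQ beta Q l CC D mu != 0 -> resolvent_pt beta Q l CC D mu.
Proof.
move=> sg dn0; pose Phi := PhiQ beta Q l mu; pose M := CC + D *m Phi l.
have uM : M \in unitmx by rewrite unitmxE unitfE.
have PA := PhiQ_AC (ltW l0) Ib IQ mu; have P0 := PhiQ_0 (ltW l0) Ib IQ mu.
have ll : 0 <= l <= l by rewrite lexx (ltW l0).
split.
  move=> f hf; have hg : mxintegrable l (fun t => iB t (f t)) by apply: mxIZ; exact: mxI_Bf.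
  have [Y [hY Y0]] := ivp_exists (ltW l0) Ib IQ mu (0 : 'cV[C]_n) hg.
  pose c := - (invmx M *m (D *m Y l)); pose y : vec R n := fun x => Y x + Phi x *m c.
  have hy : mAC l y (fun t => A t *m y t + iB t (f t)).
    apply: (mAC_ext (ltW l0) _ _ (mACD (ltW l0) hY (mACMr (ltW l0) c PA))) => // t _.
    by rewrite /y mulmxDr mulmxA addrAC.
  exists y; have /mACP[gI gE] : mAC l y (fun t => 'i *: (Bmx beta t *m (f t + mu *: y t)) - Q t *m y t).
    apply: (mAC_ext (ltW l0) _ _ hy) => x _; first by [].
    exact: (esym (@LU_form R n beta Q mu y f (fun x => f x + mu *: y x) x erefl)).
  split; first exact: (@inH_add R l n l0 beta Ib f y _ mu hf hy).
  split => //; split => //.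
  rewrite /y Y0 /Phi P0 mul1mx add0r mulmxDr -/Phi addrCA mulmxA -mulmxDl -/M /c mulmxN.
  by rewrite mulKVmx// subrr.
pose al := Abound beta Q (cn1 mu); pose E := wexp al l.
have hal : rI l al := rI_Abound Ib IQ (cn1 mu).
have Aal t : mn (A t) <= al t by exact: Abound_le.
have E0 : 0 <= E by exact: wexp_ge0.
pose W := ri (fun x => absB x) 0 l.
have W0 : 0 <= W by apply: ri_ge0 => x _; apply: sumr_ge0.
pose K := (mn (invmx M) * (mn D * E) + 1) * E.
have K0 : 0 <= K by rewrite mulr_ge0// addr_ge0// !mulr_ge0 ?mn_ge0.
exists (K ^+ 2 * W * (2 * (W + 1))) => y g [gH [gI [yE bc]]].
pose h : vec R n := fun x => g x - mu *: y x; change (normH2 beta l y <= (K ^+ 2 * W * (2 * (W + 1)))%:E * normH2 beta l h)%E.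
have hy0 : mAC l y (fun t => iB t (g t) - Q t *m y t) by apply/mACP.
have hE : h = (fun x => g x + (- mu) *: y x) by apply/funext => x; rewrite /h scaleNr.
have hH : inH beta l h by rewrite hE; exact: (@inH_add R l n l0 beta Ib g y _ (- mu) gH hy0).
have hy : mAC l y (fun t => A t *m y t + iB t (h t)).
  apply: (mAC_ext (ltW l0) _ _ hy0) => x _; first by [].
  by apply: (@LU_form R n beta Q mu y h g x); rewrite /h subrK.
have hg : mxintegrable l (fun t => iB t (h t)) by apply: mxIZ; exact: mxI_Bf.
set I := ri (fun t => mn (iB t (h t))) 0 l.
have I0 : 0 <= I by apply: ri_ge0 => x _; exact: mn_ge0.
have y0b : mn (y 0) <= mn (invmx M) * (mn D * E) * I.
  pose Y x := y x - Phi x *m y 0.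
  have hY : mAC l Y (fun t => A t *m Y t + iB t (h t)).
    apply: (mAC_ext (ltW l0) _ _ (mACB (ltW l0) hy (mACMr (ltW l0) (y 0) PA))) => // t _.
    by rewrite /Y (mulmxBr (A t)) mulmxA addrAC.
  have Y0 : Y 0 = 0 by rewrite /Y /Phi P0 mul1mx subrr.
  have Yb : mn (Y l) <= E * I.
    have := ode_bound (ltW l0) (mxI_A Ib IQ mu) hg hal Aal hY ll.
    by rewrite Y0 mn0 add0r mulrC.
  have Mbc : M *m y 0 + D *m Y l = 0.
    by rewrite /M /Y mulmxDl mulmxBr mulmxA addrACA subrr addr0.
  have My : M *m y 0 = - (D *m Y l) by apply/eqP; rewrite -addr_eq0 Mbc.
  rewrite -(mulKmx uM (y 0)) My mulmxN mnN; apply: le_trans (mnM _ _) _.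
  rewrite -!mulrA ler_wpM2l ?mn_ge0//; apply: le_trans (mnM _ _) _.
  by rewrite ler_wpM2l ?mn_ge0.
have yb x : 0 <= x <= l -> mn (y x) <= K * I.
  move=> xl; apply: le_trans (ode_bound (ltW l0) (mxI_A Ib IQ mu) hg hal Aal hy xl) _.
  rewrite -/I -/E /K mulrAC ler_wpM2r// mulrDl mul1r lerD2r//.
have /(inHP Ib)[_ hwh] := hH; have /(inHP Ib)[_ hwy] := inH_AC l0 Ib hy.
rewrite (normH2E hwh) (normH2E hwy) -EFinM lee_fin.
apply: (@le_trans _ _ ((K * I) ^+ 2 * W)).
  rewrite /W -(riZ _ rI_absB) ?lexx//; apply: (ri_le hwy (rIZ ((K * I) ^+ 2) rI_absB) (lexx _) (lexx _)).
  move=> x xl; rewrite /wH mulr_sumr; apply: ler_sum => k _; rewrite mulrC ler_wpM2r//.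
  apply: (@le_trans _ _ (mn (y x) ^+ 2)); last by apply: lerXn2r; [exact: mn_ge0|exact: mulr_ge0|exact: yb].
  apply: (@le_trans _ _ (cn1 (y x k 0) ^+ 2)); last by apply: lerXn2r; [exact: cn1_ge0|exact: mn_ge0|exact: mn_entry].
  rewrite /cn1 -(real_normK (num_real (complex.Re _))) -(real_normK (num_real (complex.Im _))).
  have := normr_ge0 (complex.Re (y x k 0)); have := normr_ge0 (complex.Im (y x k 0)).
  move: `|complex.Re _| `|complex.Im _| => u v v0 u0; nra.
have cs := cauchy_schwarz_B hH; rewrite -/I -/W in cs.
have -> : K ^+ 2 * W * (2 * (W + 1)) * ri (wH beta h) 0 l = K ^+ 2 * W * (2 * (W + 1) * ri (wH beta h) 0 l) by rewrite !mulrA.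
have -> : (K * I) ^+ 2 * W = K ^+ 2 * W * I ^+ 2 by ring.
by apply: ler_wpM2l cs; rewrite mulr_ge0 ?exprn_ge0.
Qed.

End Resolvent.

Lemma zero_mult_isolated (R : realType) (F : R[i] -> R[i]) z k : zero_mult F z k ->
  exists2 r : R, 0 < r & forall w, 0 < cabs (w - z) < r -> F w != 0.
Proof.
move=> [g [Fg [cg g0]]]; have e0 : 0 < cabs (g z) by rewrite cabs_gt0.
have [d [d0 hd]] := cg _ e0; exists d => // w /andP[w0 wd]; rewrite Fg mulf_neq0//.
  by rewrite expf_neq0// -cabs_gt0.
by apply: contraTneq (hd w wd) => ->; rewrite sub0r cabsN ltxx.
Qed.

End ResolventEstimate.

(** * The spectral theorem *)

Section Coefficients.
Variables (R : realType) (l : R) (n : nat).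
Hypothesis l0 : 0 < l.
Variable beta : 'I_n -> R -> R.

Lemma ae_on_false : ~ ae_on l (fun=> False).
Proof.
move=> h; have := ri_cst l0 1; rewrite (@ri_ae _ l _ (fun=> 0)) ?ri0//.
- by rewrite mul1r => E; have := l0; rewrite -E ltxx.
- exact: rI_cst.
- exact: rI0.
- by apply: ae_mono h _.
Qed.

Lemma ri_pos (f : R -> R) : rI l f -> ae_on l (fun x => 0 < f x) -> 0 < ri f 0 l.
Proof.
move=> hf h; have f0 : ae_on l (fun x => 0 <= f x) by apply: ae_mono h _ => x _ /ltW.
rewrite lt_neqAle (ri_ge0_ae hf) ?lexx// andbT; apply/eqP => /esym E; apply: ae_on_false.
by apply: ae_mono (ae_and h (ri_nonneg_eq0 hf f0 E)) _ => x _ [+ fx]; rewrite fx ltxx.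
Qed.

Lemma bk_sign k : rI l (beta k) -> ae_on l (fun x => 0 < beta k x) \/ ae_on l (fun x => beta k x < 0) ->
  bk beta l k != 0 /\ ae_on l (fun x => if bk beta l k < 0 then beta k x < 0 else 0 < beta k x).
Proof.
move=> Ib [h|h].
  have b0 : 0 < bk beta l k by exact: ri_pos.
  by rewrite gt_eqF// ltNge ltW.
have b0 : bk beta l k < 0.
  rewrite -oppr_gt0 -[X in - X]/(ri (beta k) 0 l) -(riN Ib) ?lexx//; apply: ri_pos; first exact: rIN.
  by apply: ae_mono h _ => x _; rewrite oppr_gt0.
by rewrite lt_eqF// b0.
Qed.

(** The assumption concerns neighbours only. Along a chain of indices equalities compose, and a gap
    of theta, once present, persists because later steps are equalities or increases. *)
Lemma separation (theta : R) : 0 < theta ->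
  (forall k k' : 'I_n, nat_of_ord k' = (nat_of_ord k).+1 ->
     ae_on l (fun x => beta k x = beta k' x) \/ ae_on l (fun x => beta k x + theta < beta k' x)) ->
  forall j k : 'I_n, ae_on l (fun x => beta j x = beta k x) \/ ae_on l (fun x => theta <= `|beta j x - beta k x|).
Proof.
move=> t0 h; have H m (j k : 'I_n) : nat_of_ord k = (j + m)%N ->
    ae_on l (fun x => beta j x = beta k x) \/ ae_on l (fun x => beta j x + theta < beta k x).
  elim: m j k => [|m IH] j k E.
    by left; apply: ae_all => x _; congr (beta _ x); apply: val_inj; rewrite /= E addn0.
  have jn : (j + m < n)%N by apply: ltn_trans (ltn_ord k); rewrite E addnS.
  have [a1|a1] := IH j (Ordinal jn) erefl; have [a2|a2] := h (Ordinal jn) k (etrans E (addnS _ _)).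
  - by left; apply: ae_mono (ae_and a1 a2) _ => x _ [-> ->].
  - by right; apply: ae_mono (ae_and a1 a2) _ => x _ [->].
  - by right; apply: ae_mono (ae_and a1 a2) _ => x _ [+ <-].
  - right; apply: ae_mono (ae_and a1 a2) _ => x _ [b1 b2]; apply: lt_trans b1 (lt_trans _ b2).
    by rewrite ltrDl.
have H' (j k : 'I_n) : (j <= k)%N -> ae_on l (fun x => beta j x = beta k x) \/ ae_on l (fun x => theta <= beta k x - beta j x).
  move=> jk; have [a|a] := H (k - j)%N j k (esym (subnKC jk)); [by left|right].
  by apply: ae_mono a _ => x _; lra.
move=> j k; have [jk|jk] := leqP j k.
  have [a|a] := H' j k jk; [by left|right; apply: ae_mono a _ => x _ a1].
  by rewrite distrC; apply: le_trans a1 (ler_norm _).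
have [a|a] := H' k j (ltnW jk); [left|right]; apply: ae_mono a _ => x _ a1; first by rewrite a1.
exact: le_trans a1 (ler_norm _).
Qed.

Lemma Pplus_dgm : Pplus beta l = dgm (fun k => (0 < bk beta l k)%R%:R).
Proof. by apply/matrixP => j k; rewrite !mxE; case: eqVneq => [->|]//=; case: ifP. Qed.

Lemma Pminus_dgm : (forall k, bk beta l k != 0) -> 1%:M - Pplus beta l = dgm (fun k => (bk beta l k < 0)%R%:R).
Proof.
move=> b0; rewrite Pplus_dgm; apply/matrixP => j k; rewrite !mxE; case: eqVneq => [_|_]; last by rewrite subrr.
by have := b0 j; case: (ltgtP (bk beta l j) 0) => // _ _; rewrite ?subr0 ?subrr.
Qed.

End Coefficients.

Theorem theorem6p6 (R : realType) (n : nat) (l : R)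
  (beta : 'I_n -> R -> R) (Q : R -> 'M[R[i]]_n) (C D : 'M[R[i]]_n)
  (lam0 : int -> R[i]) :
  0 < l ->
  (* beta_k, 1/beta_k in L^infty[0,l] *)
  (forall k, Linf l (beta k) /\ Linf l (fun x => (beta k x)^-1)) ->
  (* each beta_k has constant nonzero sign *)
  (forall k, ae_on l (fun x => 0 < beta k x) \/ ae_on l (fun x => beta k x < 0)) ->
  (* beta_1 <= ... <= beta_{n_-} < 0 < beta_{n_- + 1} <= ... <= beta_n *)
  (exists nm : nat, (nm <= n)%N /\
     forall k : 'I_n, ((k < nm)%N -> ae_on l (fun x => beta k x < 0)) /\
                      ((nm <= k)%N -> ae_on l (fun x => 0 < beta k x))) ->
  (forall k k' : 'I_n, nat_of_ord k' = (nat_of_ord k).+1 ->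
     ae_on l (fun x => beta k x <= beta k' x)) ->
  (* separation condition *)
  (exists theta : R, 0 < theta /\
     forall k k' : 'I_n, nat_of_ord k' = (nat_of_ord k).+1 ->
       ae_on l (fun x => beta k x = beta k' x) \/
       ae_on l (fun x => beta k x + theta < beta k' x)) ->
  (* Q in L^1([0,l]; C^{n x n}) *)
  (forall j k, cintegrable l (fun x => Q x j k)) ->
  (* Q_jk = 0 whenever beta_j = beta_k *)
  (forall j k, ae_on l (fun x => beta j x = beta k x) ->
     ae_on l (fun x => Q x j k = 0)) ->
  (* boundary conditions: rank (C D) = n, regular *)
  \rank (row_mx C D) = n ->
  regular_bc beta l C D ->
  (* Lambda_0 = zeros of Delta_0 counted with multiplicity *)
  enum_zeros (Delta0 beta l C D) lam0 ->
  discrete_spectrum beta Q l C D /\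
  exists lam : int -> R[i],
    enum_eigen beta Q l C D lam /\
    enum_zeros (DeltaQ beta Q l C D) lam /\
    (forall e : R, 0 < e -> exists N : nat, forall m : int,
        (N < `|m|)%N -> cabs (lam m - lam0 m) < e).
Proof.
move=> l0 hbeta sg _ _ [theta [t0 hsep]] IQ hQ _ [reg1 reg2] enum0.
have Ib k : rI l (beta k).
  by have [[mb [M hM]] _] := hbeta k; exact: (rI_ae mb (rI_cst l M) hM).
have /choice[Ms hMs] k : exists M, ae_on l (fun x => `|beta k x| <= M) by have [[_ hM] _] := hbeta k.
have hMb k : ae_on l (fun x => `|beta k x| <= \sum_j `|Ms j|).
  apply: ae_mono (hMs k) _ => x _ h; apply: le_trans h (le_trans (ler_norm _) _).
  by rewrite (bigD1 k)//= lerDl sumr_ge0.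
have b0 k : bk beta l k != 0 by case: (bk_sign l0 (Ib k) (sg k)).
have hsgn k := (bk_sign l0 (Ib k) (sg k)).2.
have sep j k : ae_on l (fun x => Q x j k = 0) \/ exists2 c : R, 0 < c & ae_on l (fun x => c <= `|beta j x - beta k x|).
  by have [/hQ|h] := separation t0 hsep j k; [left|right; exists theta].
have hdiag j : ae_on l (fun x => Q x j j = 0) by apply: hQ; exact: ae_all.
(* The upper half-plane uses det(C P_+ + D P_-): there the exponentials with b_k < 0 grow, so D
   enters through exactly those columns. The other determinant serves the lower half-plane. *)
have dup := reg2; rewrite Pminus_dgm// Pplus_dgm in dup.
have ddn := reg1; rewrite Pminus_dgm// Pplus_dgm in ddn.
have [lam [enumQ close]] := zeros_matching (Delta0_entire (ltW l0) Ib C D) (DeltaQ_entire (ltW l0) Ib IQ C D)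
  (D0_neq0 b0 dup) (Delta0_count_annulus b0 dup ddn) (Delta_comparison l0 Ib IQ hMb hsgn sep hdiag b0 dup ddn) enum0.
split; last first.
  exists lam; split; last by [].
  by move=> z; have [k [zk ck]] := enumQ z; exists k; split=> //; exact: zero_mult_alg_mult.
(* The enumeration of the zeros of Delta_Q provides a finite multiplicity at every mu; so zeros are
   isolated, and d > 0 exactly when Delta_Q(mu) = 0. *)
move=> mu; have [d [zd _]] := enumQ mu.
have [z0|nz] := eqVneq (DeltaQ beta Q l C D mu) 0; last by left; exact: DeltaQ_resolvent.
right; split.
  have [r r0 hr] := zero_mult_isolated zd; exists r; split => // w hw.
  exact: (DeltaQ_resolvent l0 Ib IQ sg (hr w hw)).
exists d; split; last exact: zero_mult_alg_mult.
case: d zd => // -[g [Fg [_ g0]]]; move: z0; rewrite Fg expr0 mul1r => z0.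
by rewrite z0 eqxx in g0.
Qed.
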